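(* Let $n\ge 2$, let $\Omega\subset\mathbb{R}^n$ be a bounded domain with Lipschitz boundary, let $1<p<n$, $p^*=\frac{np}{n-p}$, and let $\nu,q,\kappa_1,\kappa_2$ be real numbers with $0<\nu<1<p<q<\kappa_i+1<p^*$ ($i=1,2$) and $\kappa_1+\kappa_2+2<p^*$. Let $\eta:\overline{\Omega}\to[0,\infty)$ with $\eta\in L^\infty(\Omega)$, and let $a_1,a_2\in L^\infty(\Omega)$ with $a_i(z)>0$ for a.e. $z\in\Omega$. Then there exists a constant $\lambda^*>0$ such that for all $\lambda\in(0,\lambda^* )$ the system $$\begin{cases}-\Delta_p y_1-\mathrm{div}(\eta|\nabla y_1|^{q-2}\nabla y_1)=a_1(z)|y_1|^{-1-\nu}y_1+\lambda(\kappa_1+1)|y_1|^{\kappa_1-1}y_1|y_2|^{\kappa_2+1}, & z\in\Omega,\\ -\Delta_p y_2-\mathrm{div}(\eta|\nabla y_2|^{q-2}\nabla y_2)=a_2(z)|y_2|^{-1-\nu}y_2+\lambda(\kappa_2+1)|y_1|^{\kappa_1+1}|y_2|^{\kappa_2-1}y_2, & z\in\Omega,\\ y_1=y_2=0, & z\in\partial\Omega,\end{cases}$$ has at least two positive weak solutions $(y_1^*,y_2^* ),(y_{1*},y_{2*})\in W_0^{1,\mathcal H}(\Omega)\times W_0^{1,\mathcal H}(\Omega)$ such that $$J(y_1^*,y_2^* )<0<J(y_{1*},y_{2*}).$$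
   Context: $|\cdot|$ is the Euclidean norm on $\mathbb{R}^n$ and $\Delta_p y=\mathrm{div}(|\nabla y|^{p-2}\nabla y)$. Put $\mathcal H(z,t)=t^p+\eta(z)t^q$ and $\rho_{\mathcal H}(u)=\int_\Omega(|u|^p+\eta|u|^q)\,dz$. $L^{\mathcal H}(\Omega)$ is the Musielak-Orlicz space of measurable $u$ with $\rho_{\mathcal H}(u)<\infty$, with Luxemburg norm $\|u\|_{\mathcal H}=\inf\{\tau>0:\rho_{\mathcal H}(u/\tau)\le1\}$. $W^{1,\mathcal H}(\Omega)=\{y\in L^{\mathcal H}(\Omega):|\nabla y|\in L^{\mathcal H}(\Omega)\}$ has norm $\|\nabla y\|_{\mathcal H}+\|y\|_{\mathcal H}$ (where $\|\nabla y\|_{\mathcal H}=\||\nabla y|\|_{\mathcal H}$), and $W_0^{1,\mathcal H}(\Omega)$ is the completion of $C_0^\infty(\Omega)$ in it. The energy functional is $$J(y_1,y_2)=\sum_{i=1}^2\int_\Omega\Big(\tfrac1p|\nabla y_i|^p+\tfrac{\eta}{q}|\nabla y_i|^q\Big)dz-\tfrac{1}{1-\nu}\int_\Omega\big[a_1|y_1|^{1-\nu}+a_2|y_2|^{1-\nu}\big]dz-\lambda\int_\Omega|y_1|^{\kappa_1+1}|y_2|^{\kappa_2+1}dz.$$ A positive weak solution is a pair $(y_1,y_2)\in W_0^{1,\mathcal H}(\Omega)\times W_0^{1,\mathcal H}(\Omega)$ with $y_1,y_2>0$ a.e. in $\Omega$ such that for every $(h,w)\in W_0^{1,\mathcal H}(\Omega)\times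 W_0^{1,\mathcal H}(\Omega)$ one has $a_1y_1^{-\nu}h,\ a_2y_2^{-\nu}w\in L^1(\Omega)$ and $$\int_\Omega(|\nabla y_1|^{p-2}+\eta|\nabla y_1|^{q-2})\nabla y_1\cdot\nabla h\,dz+\int_\Omega(|\nabla y_2|^{p-2}+\eta|\nabla y_2|^{q-2})\nabla y_2\cdot\nabla w\,dz-\int_\Omega a_1y_1^{-\nu}h\,dz-\int_\Omega a_2y_2^{-\nu}w\,dz$$ $$-\lambda(\kappa_1+1)\int_\Omega|y_1|^{\kappa_1}|y_2|^{\kappa_2+1}h\,dz-\lambda(\kappa_2+1)\int_\Omega|y_1|^{\kappa_1+1}|y_2|^{\kappa_2}w\,dz=0.$$ *)

(* Defs.v *)
From HB Require Import structures.
From mathcomp Require Import all_boot all_order all_algebra.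
From mathcomp Require Import all_classical all_reals all_analysis.

Set Implicit Arguments.
Unset Strict Implicit.
Unset Printing Implicit Defensive.

Import Order.TTheory GRing.Theory Num.Theory.
Import numFieldNormedType.Exports.

Local Open Scope classical_set_scope.
Local Open Scope ring_scope.

(* R^n is 'rV[R]_n.  Its library norm `|x| is the sup norm: it is used below
   only for the topology, differentiability, boundedness and the Lipschitz
   property; the Euclidean norm is enorm. *)

Definition dotv {R : realType} {n : nat} (x y : 'rV[R]_n) : R :=
  \sum_(i < n) x 0 i * y 0 i.

Definition enorm {R : realType} {n : nat} (x : 'rV[R]_n) : R :=
  Num.sqrt (dotv x x).

Definition open_box {R : realType} {n : nat} (ab : 'rV[R]_n * 'rV[R]_n) :
    set 'rV[R]_n :=
  [set x | forall i, ab.1 0 i < x 0 i < ab.2 0 i].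

Definition box_volume {R : realType} {n : nat} (ab : 'rV[R]_n * 'rV[R]_n) :
    \bar R :=
  (\prod_(i < n) Num.max (ab.2 0 i - ab.1 0 i) 0)%:E.

(* The index set D makes finite (in particular empty) covers available; this
   only matters for n = 0, where no box is empty. *)
Definition box_cover {R : realType} {n : nat} (A : set 'rV[R]_n) :
    set (set nat * (nat -> 'rV[R]_n * 'rV[R]_n)) :=
  [set DF | A `<=` \bigcup_(k in DF.1) open_box (DF.2 k)].

Definition lebesgue_outer {R : realType} {n : nat} (A : set 'rV[R]_n) :
    \bar R :=
  ereal_inf [set (\esum_(k in DF.1) box_volume (DF.2 k))%E
            | DF in box_cover A].

Section lebesgue_outer_measure.
Context {R : realType} {n : nat}.
Local Open Scope ereal_scope.
Implicit Types A : set 'rV[R]_n.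

Lemma box_volume_ge0 (ab : 'rV[R]_n * 'rV[R]_n) : 0 <= box_volume ab.
Proof. by rewrite lee_fin prodr_ge0// => i _; rewrite le_max lexx orbT. Qed.

Lemma lebesgue_outer_ge0 A : 0 <= lebesgue_outer A.
Proof.
apply: le_ereal_inf_tmp => _ [DF _ <-].
by apply: esum_ge0 => k _; exact: box_volume_ge0.
Qed.

Lemma lebesgue_outer0 : lebesgue_outer (set0 : set 'rV[R]_n) = 0.
Proof.
apply/eqP; rewrite eq_le lebesgue_outer_ge0 andbT.
apply: ereal_inf_lbound; exists (set0, fun=> (0%R, 0%R)) => /=.
  by move=> x [].
exact: esum_set0.
Qed.

Lemma le_lebesgue_outer :
  {homo @lebesgue_outer R n : A B / A `<=` B >-> A <= B}.
Proof.
move=> A B AB; apply/ereal_inf_le_tmp => _ [DF BDF <-].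
by exists DF => //; exact: subset_trans AB BDF.
Qed.

Lemma lebesgue_outer_sigma_subadditive :
  sigma_subadditive (@lebesgue_outer R n).
Proof.
move=> A; have [[i ioo]|] := pselect (exists i, lebesgue_outer (A i) = +oo).
  rewrite (eseries_pinfty _ _ ioo) ?leey// => k _.
  by rewrite -ltNye (lt_le_trans _ (lebesgue_outer_ge0 _)).
rewrite -forallNE => Aoo.
suff add2e (e : {posnum R}) : lebesgue_outer (\bigcup_n A n) <=
    \sum_(i <oo) lebesgue_outer (A i) + e%:num%:E.
  by apply/lee_addgt0Pr => _/posnumP[].
rewrite (le_trans _ (epsilon_trick _ _ _))//; last first.
  by move=> k; exact: lebesgue_outer_ge0.
pose P k (DF : set nat * (nat -> 'rV[R]_n * 'rV[R]_n)) :=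
  box_cover (A k) DF /\ \esum_(j in DF.1) box_volume (DF.2 j) <=
    lebesgue_outer (A k) + (e%:num / (2 ^ k.+1)%:R)%:E.
have [G PG] : {G & forall k, P k (G k)}.
  apply: (@choice _ _ P) => k; rewrite /P /lebesgue_outer.
  set S := (X in ereal_inf X); move infS : (ereal_inf S) => iS.
  case: iS infS => [r Sr|Soo|Soo].
  - have en1 : (0 < e%:num / (2 ^ k.+1)%:R)%R by [].
    have /(lb_ereal_inf_adherent en1) : ereal_inf S \is a fin_num by rewrite Sr.
    move=> [x [B AnB muBx] xS].
    by exists B; split => //; rewrite muBx -Sr; exact/ltW.
  - by have := Aoo k; rewrite /lebesgue_outer Soo.
  - by have := lebesgue_outer_ge0 (A k); rewrite /lebesgue_outer Soo leeNy_eq.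
have /card_esym/ppcard_eqP[f] := card_nat2.
pose K : set (nat * nat) := [set: nat] `*`` (fun i => (G i).1).
pose F k := (G (f k).1).2 (f k).2.
apply: (@le_trans _ _ (\esum_(k in f @^-1` K) box_volume (F k))).
  apply: ereal_inf_lbound; exists (f @^-1` K, F) => //= x [i _ Aix].
  have [j Gj xj] := (PG i).1 _ Aix.
  have fK : f (f^-1%FUN (i, j)) = (i, j) by rewrite invK ?inE.
  by exists (f^-1%FUN (i, j)); rewrite /= /F /K /= fK.
rewrite -(@reindex_esum _ _ _ (f @^-1` K) K f
  (fun k => box_volume ((G k.1).2 k.2))); last first.
  split.
  - by [].
  - by move=> x y _ _; apply: (@inj _ _ _ f); rewrite inE.
  - move=> [i j] Kij; exists (f^-1%FUN (i, j)) => /=.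
      by rewrite invK ?inE.
    by rewrite invK ?inE.
rewrite /K -(@esum_esum _ _ _ [set: nat] (fun i => (G i).1)
   (fun i j => box_volume ((G i).2 j))); last first.
  by move=> i j _ _; exact: box_volume_ge0.
rewrite -nneseries_esumT; last first.
  by move=> i; apply: esum_ge0 => *; exact: box_volume_ge0.
apply: lee_nneseries => [k _ _|k _]; last exact: (PG k).2.
by apply: esum_ge0 => *; exact: box_volume_ge0.
Qed.

HB.instance Definition _ := isOuterMeasure.Build R 'rV[R]_n
  (@lebesgue_outer R n) lebesgue_outer0 lebesgue_outer_ge0
  le_lebesgue_outer lebesgue_outer_sigma_subadditive.

End lebesgue_outer_measure.

(* R^n with the sigma-algebra of its Lebesgue measurable sets. *)
Definition lebT (R : realType) (n : nat) :=
  caratheodory_type (@lebesgue_outer R n).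
HB.instance Definition _ (R : realType) (n : nat) :=
  Measurable.on (lebT R n).

Definition leb {R : realType} {n : nat} : set (lebT R n) -> \bar R :=
  @lebesgue_outer R n.
HB.instance Definition _ (R : realType) (n : nat) :=
  Measure.copy (@leb R n)
    ((@lebesgue_outer R n : {outer_measure set _ -> \bar R})
      : set (caratheodory_type (@lebesgue_outer R n)) -> \bar R).

Definition critical_exponent {R : realType} (n : nat) (p : R) : R :=
  n%:R * p / (n%:R - p).

Section double_phase.
Context {R : realType} {n : nat}.
Implicit Types (Om : set 'rV[R]_n) (p q nu : R).
Implicit Types (eta u y phi : 'rV[R]_n -> R) (g : 'rV[R]_n -> 'rV[R]_n).

Definition leb_measurable_fun Om u :=
  measurable_fun (Om : set (lebT R n)) (u : lebT R n -> R).

Definition ae_on Om (P : 'rV[R]_n -> Prop) :=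
  {ae @leb R n, forall z : lebT R n, Om z -> P z}.

(* u belongs to L^infty(Om). *)
Definition Linfty Om u :=
  leb_measurable_fun Om u /\ exists M : R, ae_on Om (fun z => `|u z| <= M).

Definition loc_integrable Om u :=
  leb_measurable_fun Om u /\
  forall K : set 'rV[R]_n, compact K -> K `<=` Om ->
    (@leb R n).-integrable (K : set (lebT R n)) (EFin \o u).

Definition is_domain Om := [/\ open Om, connected Om & Om !=set0].

(* Near each boundary point, Om is the strict epigraph of a Lipschitz function
   over the hyperplane orthogonal to some unit vector e; x - (x.e)e is the
   orthogonal projection of x on that hyperplane. *)
Definition lipschitz_boundary Om :=
  forall x0, (closure Om `\` interior Om) x0 ->
  exists (e : 'rV[R]_n) (gam : 'rV[R]_n -> R),
    [/\ enorm e = 1, lipschitz gam &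
     \forall x \near x0, Om x <-> gam (x - dotv x e *: e) < dotv x e].

Definition partial (i : 'I_n) (phi : 'rV[R]_n -> R) : 'rV[R]_n -> R :=
  fun x => 'D_(delta_mx 0 i) phi x.

(* C^infty: every iterated partial derivative is differentiable everywhere
   (hence exists and is continuous). *)
Definition smooth phi :=
  forall (s : seq 'I_n) x, differentiable (foldr partial phi s) x.

Definition test_fun Om phi :=
  [/\ smooth phi, compact (closure [set x | phi x != 0]) &
      closure [set x | phi x != 0] `<=` Om].

Definition is_weak_grad Om u g :=
  [/\ loc_integrable Om u, (forall i, loc_integrable Om (fun z => g z 0 i)) &
   forall phi, test_fun Om phi -> forall i,
     \int[@leb R n]_(z in Om) (u z * partial i phi z) =
     - \int[@leb R n]_(z in Om) (g z 0 i * phi z)].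

(* Some weak gradient of u on Om if there is one, and 0 otherwise; it is unique
   up to a null set of Om. *)
Definition wgrad Om u : 'rV[R]_n -> 'rV[R]_n :=
  xget (fun=> 0) [set g | is_weak_grad Om u g].

Definition calH p q eta (z : 'rV[R]_n) (t : R) : R :=
  t `^ p + eta z * t `^ q.

Definition modular Om p q eta u : \bar R :=
  (\int[@leb R n]_(z in Om) (calH p q eta z `|u z|)%:E)%E.

Definition LH Om p q eta : set ('rV[R]_n -> R) :=
  [set u | leb_measurable_fun Om u /\ (modular Om p q eta u < +oo)%E].

Definition normLH Om p q eta u : R :=
  inf [set tau : R | 0 < tau /\
                     (modular Om p q eta (fun z => u z / tau)%R <= 1)%E].

Definition W1H Om p q eta : set ('rV[R]_n -> R) :=
  [set u | [/\ LH Om p q eta u, exists g, is_weak_grad Om u g &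
               LH Om p q eta (enorm \o wgrad Om u)]].

Definition normW1H Om p q eta u : R :=
  normLH Om p q eta (enorm \o wgrad Om u) + normLH Om p q eta u.

(* The completion of the test functions in W^{1,H}, i.e. their closure for the
   norm of W^{1,H}. *)
Definition W01H Om p q eta : set ('rV[R]_n -> R) :=
  [set u | W1H Om p q eta u /\
    forall eps : R, 0 < eps -> exists2 phi, test_fun Om phi &
      normW1H Om p q eta (fun z => u z - phi z) < eps].

Definition energy Om p q eta nu a1 a2 (k1 k2 lam : R) y1 y2 : R :=
  \int[@leb R n]_(z in Om) (p^-1 * enorm (wgrad Om y1 z) `^ p
                            + eta z / q * enorm (wgrad Om y1 z) `^ q)
  + \int[@leb R n]_(z in Om) (p^-1 * enorm (wgrad Om y2 z) `^ p
                              + eta z / q * enorm (wgrad Om y2 z) `^ q)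
  - (1 - nu)^-1 * \int[@leb R n]_(z in Om)
      (a1 z * `|y1 z| `^ (1 - nu) + a2 z * `|y2 z| `^ (1 - nu))
  - lam * \int[@leb R n]_(z in Om)
      (`|y1 z| `^ (k1 + 1) * `|y2 z| `^ (k2 + 1)).

(* The integral of (|grad y|^(p-2) + eta |grad y|^(q-2)) grad y . grad h.  Where
   grad y = 0 the integrand is 0 whatever the value given to the powers. *)
Definition double_phase_form Om p q eta y h : R :=
  \int[@leb R n]_(z in Om)
    ((enorm (wgrad Om y z) `^ (p - 2) + eta z * enorm (wgrad Om y z) `^ (q - 2))
     * dotv (wgrad Om y z) (wgrad Om h z)).

Definition positive_weak_solution Om p q eta nu (a1 a2 : 'rV[R]_n -> R)
    (k1 k2 lam : R) (y1 y2 : 'rV[R]_n -> R) : Prop :=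
  [/\ W01H Om p q eta y1, W01H Om p q eta y2,
      ae_on Om (fun z => 0 < y1 z), ae_on Om (fun z => 0 < y2 z) &
   forall h w, W01H Om p q eta h -> W01H Om p q eta w ->
   [/\ (@leb R n).-integrable (Om : set (lebT R n))
         (fun z => (a1 z * y1 z `^ (- nu) * h z)%:E),
       (@leb R n).-integrable (Om : set (lebT R n))
         (fun z => (a2 z * y2 z `^ (- nu) * w z)%:E) &
       double_phase_form Om p q eta y1 h + double_phase_form Om p q eta y2 w
       - \int[@leb R n]_(z in Om) (a1 z * y1 z `^ (- nu) * h z)
       - \int[@leb R n]_(z in Om) (a2 z * y2 z `^ (- nu) * w z)
       - lam * (k1 + 1) * \int[@leb R n]_(z in Om)
           (`|y1 z| `^ k1 * `|y2 z| `^ (k2 + 1) * h z)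
       - lam * (k2 + 1) * \int[@leb R n]_(z in Om)
           (`|y1 z| `^ (k1 + 1) * `|y2 z| `^ k2 * w z) = 0]].

End double_phase.

(* Main.v *)
(* Write the energy along a ray as [J (t y) = P t^p + Q t^q - S t^(1-nu) - lam C t^(k1+k2+2)].

   For small [lam], [J >= 1] on the level set [P + Q = const], so minimising [J] over the sublevel
   set gives an interior minimiser, with [J < 0].  For the second solution, [M y = max_t J (t y)] is
   minimised over [C y > 0]: after rescaling, a minimising sequence has its maximum at [t = 1], hence is
   bounded, and [C] cannot vanish in the limit because [M >= 1].  The maximiser on each ray is unique, so
   perturbing a minimiser [y] in a direction [h] moves the maximiser continuously and the Euler-Lagrange
   inequality [J (t_m (y + e_m h)) >= J (t_m y)], [t_m -> 1], is available although [J] is not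
   differentiable.  Nonnegative directions and Fatou's lemma give positivity and the integrability of
   [a y^(-nu) h]; arbitrary directions and dominated convergence give the weak equation.

   Functions of [W_0^(1,H)] are handled as limits of test functions, with their gradients; the Sobolev
   inequality and compactness come from comparing a test function with its averages over dyadic cells. *)
From HB Require Import structures.
From mathcomp Require Import all_boot all_order all_algebra.
From mathcomp Require Import all_classical all_reals all_analysis.
From mathcomp Require Import measurable_realfun ring lra zify.
Require Import Defs.

Set Implicit Arguments.
Unset Strict Implicit.
Unset Printing Implicit Defensive.
Import Order.TTheory GRing.Theory Num.Theory.
Import numFieldNormedType.Exports.
Local Open Scope classical_set_scope.
Local Open Scope ring_scope.

(** The derivative [a y^(-nu) h] of the singular term is not known to be integrable beforehand. What
    is available is that the singular and coupling increments have a sign for [h >= 0] and that the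
    energy quotients converge. Each equation comes from varying one component with the other frozen,
    and both minimisers feed the same one-sided inequality [stationary_path]. For the second one,
    the fibre of [y] at [tau] is at most its maximum, which is at most the fibre of the perturbed
    point at that [tau]; the comparison is made at equal [tau], so no Lagrange multiplier arises.
    Convexity takes the place of weak convergence: [sob_weak_closed] minimises the total energy over
    shrinking [L^r] neighbourhoods of the limit, and uniform convexity makes near-minimisers
    converge strongly. It serves the minimising sequences and the passage to [|u|] alike. The
    exponent is [r = k1 + k2 + 2], and subcriticality enters as [n (r - p) < p r], the condition
    that makes increments of dyadic averages decay geometrically in [L^r]. *)

Section sup_norm.
Context {R : realType} {n : nat}.
Implicit Types x : 'rV[R]_n.

Lemma ler_coord_norm x j : `|x 0 j| <= `|x|.
Proof.
by rewrite [leRHS]/Num.norm/= mx_normrE; apply/bigmax_geP; right; exists (0, j).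
Qed.

Lemma normrV_le x M : 0 <= M -> (forall i, `|x 0 i| <= M) -> `|x| <= M.
Proof.
move=> M0 H; rewrite [leLHS]/Num.norm/= mx_normrE; apply/bigmax_leP; split => //.
by move=> [i j] _ /=; rewrite ord1.
Qed.

Lemma normrV_lt x M : 0 < M -> (forall i, `|x 0 i| < M) -> `|x| < M.
Proof.
move=> M0 H; rewrite [ltLHS]/Num.norm/= mx_normrE; apply/bigmax_ltP; split => //.
by move=> [i j] _ /=; rewrite ord1.
Qed.

End sup_norm.

(** * Lebesgue outer measure: affine maps, Borel sets, the unit cube, dyadic cells *)

Section esum_scale.
Local Open Scope ereal_scope.

Lemma esumZl_le (R : realType) (I : choiceType) (D : set I) (a : I -> \bar R)
    (c : R) : (0 <= c)%R -> (forall i, 0 <= a i) ->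
  \esum_(i in D) (c%:E * a i) <= c%:E * \esum_(i in D) a i.
Proof.
move=> c0 a0; apply: ge_ereal_sup => _ [F [finF FD] <-].
rewrite -ge0_mule_fsumr//; apply: lee_wpmul2l; first by rewrite lee_fin.
by apply: ereal_sup_ubound; exists F.
Qed.

End esum_scale.

Section lebesgue_affine.
Context {R : realType} {n : nat}.
Implicit Types (A : set 'rV[R]_n) (b : 'rV[R]_n) (t : R).

Let pull t b (ab : 'rV[R]_n * 'rV[R]_n) : 'rV[R]_n * 'rV[R]_n :=
  (t^-1 *: (ab.1 - b), t^-1 *: (ab.2 - b)).

Let pull_box t b ab : 0 < t ->
  open_box (pull t b ab) = (fun x : 'rV[R]_n => t *: x + b) @^-1` open_box ab.
Proof.
move=> t0; apply/seteqP; split => x /= H i; have := H i; rewrite !mxE.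
  move=> /andP[]; rewrite !ltr_pdivrMl ?ltr_pdivlMl//.
  by move=> ? ?; apply/andP; split; lra.
move=> /andP[? ?]; rewrite ltr_pdivrMl ?ltr_pdivlMl//.
by apply/andP; split; lra.
Qed.

Let pull_volume t b ab : 0 < t ->
  box_volume (pull t b ab) = ((t ^+ n)^-1%:E * box_volume ab)%E.
Proof.
move=> t0; rewrite /box_volume -EFinM; congr EFin.
rewrite -[n in t ^+ n](card_ord n) -prodr_const -prodfV -big_split/=.
apply: eq_bigr => i _; rewrite !mxE maxr_pMr ?invr_ge0 ?(ltW t0)// mulr0.
by congr (Num.max _ _); ring.
Qed.

(** A cover of [A] pulls back box by box to a cover of the preimage, each volume being divided by
    [t^n]. The reverse inequality is the same statement for the inverse affine map. *)
Let lebesgue_outer_affine_le t b A : 0 < t ->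
  ((t ^+ n)%:E * lebesgue_outer ((fun x : 'rV[R]_n => (t *: x + b)%R) @^-1` A)
    <= lebesgue_outer A)%E.
Proof.
move=> t0; have tn0 : 0 < t ^+ n by rewrite exprn_gt0.
apply: le_ereal_inf_tmp => _ [DF ADF <-].
rewrite -lee_pdivlMl//; apply: le_trans (esumZl_le _ _ _) => //; last 2 first.
- by rewrite invr_ge0 ltW.
- by move=> k; exact: box_volume_ge0.
apply: ereal_inf_lbound; exists (DF.1, fun k => pull t b (DF.2 k)) => /=.
  by move=> x /= Ax; have [k Dk xk] := ADF _ Ax; exists k => //=; rewrite pull_box.
by apply: eq_esum => k _; rewrite pull_volume.
Qed.

Lemma lebesgue_outer_affine t b A : 0 < t ->
  (lebesgue_outer A =
   (t ^+ n)%:E * lebesgue_outer ((fun x : 'rV[R]_n => (t *: x + b)%R) @^-1` A))%E.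
Proof.
move=> t0; have tn0 : 0 < t ^+ n by rewrite exprn_gt0.
have ti0 : 0 < t^-1 by rewrite invr_gt0.
apply/eqP; rewrite eq_le lebesgue_outer_affine_le// andbT.
have := lebesgue_outer_affine_le (- (t^-1 *: b)) ((fun x : 'rV[R]_n => (t *: x + b)%R) @^-1` A) ti0.
rewrite exprVn lee_pdivrMl// => h; apply: le_trans h.
rewrite le_eqVlt; apply/orP; left; apply/eqP; congr lebesgue_outer.
apply/seteqP; split => x /=;
  by rewrite scalerDr scalerN !scalerA mulfV ?gt_eqF// !scale1r subrK.
Qed.

Lemma lebesgue_outer_translation b A :
  lebesgue_outer ((fun x : 'rV[R]_n => (x + b)%R) @^-1` A) = lebesgue_outer A.
Proof.
rewrite [RHS](lebesgue_outer_affine b _ ltr01) expr1n mul1e.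
by congr lebesgue_outer; apply/seteqP; split => x /=; rewrite scale1r.
Qed.

End lebesgue_affine.

Section lebesgue_measurable.
Context {R : realType} {n : nat}.
Implicit Types (A : set 'rV[R]_n) (b : 'rV[R]_n) (t c : R).

Let box_capl (i : 'I_n) c (ab : 'rV[R]_n * 'rV[R]_n) : 'rV[R]_n * 'rV[R]_n :=
  (ab.1, \row_j if j == i then Num.min (ab.2 0 j) c else ab.2 0 j).

Let box_capr (i : 'I_n) c (ab : 'rV[R]_n * 'rV[R]_n) : 'rV[R]_n * 'rV[R]_n :=
  (\row_j (if j == i then Num.max (ab.1 0 j) c else ab.1 0 j), ab.2).

(** Cutting a box at the hyperplane [x_i = c] changes only the [i]-th side, whose two truncated
    lengths add up to at most the original one; the other factors are the common product [P]. *)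
Let box_cap_volume i c ab : (box_volume (box_capl i c ab) +
  box_volume (box_capr i c ab) <= box_volume ab)%E.
Proof.
rewrite /box_volume -EFinD lee_fin !(@bigD1 _ _ _ _ i xpredT)//=.
set P := \prod_(j < n | j != i) Num.max (ab.2 0 j - ab.1 0 j) 0.
rewrite (_ : \prod_(_ < n | _) _ = P); last first.
  by apply: eq_bigr => j /negbTE ji; rewrite !mxE ji.
rewrite (_ : \prod_(_ < n | _) _ = P); last first.
  by apply: eq_bigr => j /negbTE ji; rewrite !mxE ji.
rewrite -mulrDl !mxE eqxx ler_wpM2r//.
  by apply: prodr_ge0 => j _; rewrite le_max lexx orbT.
rewrite !maxEle !minEle; repeat case: ifPn; rewrite -?ltNge; lra.
Qed.

Let hyperplane_null (i : 'I_n) c : lebesgue_outer [set x : 'rV[R]_n | x 0 i = c] = 0.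
Proof.
pose H (m : nat) := [set x : 'rV[R]_n | x 0 i = c /\ forall j, `|x 0 j| < m%:R].
suff H0 m : lebesgue_outer (H m) = 0.
  apply/eqP; rewrite eq_le lebesgue_outer_ge0 andbT.
  apply: (@le_trans _ _ (lebesgue_outer (\bigcup_m H m))).
    apply: le_lebesgue_outer => x /= xc; exists (Num.truncn `|x|).+1 => //.
    split=> // j; rewrite (le_lt_trans _ (truncnS_gt _))//.
    exact: ler_coord_norm.
  apply: le_trans (lebesgue_outer_sigma_subadditive _) _.
  by rewrite eseries0// => k _ _; exact: H0.
apply/eqP; rewrite eq_le lebesgue_outer_ge0 andbT.
apply/lee_addgt0Pr => e e0; rewrite add0e.
pose P : R := \prod_(j < n | j != i) (m%:R + m%:R + 1).
have P0 : 0 < P by apply: prodr_gt0 => j _; rewrite ltr_wpDl.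
(* Half the thickness of a slab around the hyperplane, tuned so that the slab over the [m]-th
   truncation has volume [2 d P = e]. *)
pose d := e / (2 * P); have d0 : 0 < d by rewrite divr_gt0// mulr_gt0.
pose ab : 'rV[R]_n * 'rV[R]_n :=
  (\row_j if j == i then c - d else - m%:R, \row_j if j == i then c + d else m%:R + 1).
apply: (@le_trans _ _ (box_volume ab)).
  apply: ereal_inf_lbound; exists ([set 0%N], fun=> ab) => /=.
    move=> x [xc xm]; exists 0%N => // j; rewrite !mxE; case: eqP => [->|_].
      by rewrite xc; apply/andP; split; lra.
    by have := xm j; rewrite ltr_norml => /andP[? ?]; apply/andP; split; lra.
  by rewrite esum_set1// box_volume_ge0.
rewrite lee_fin (@bigD1 _ _ _ _ i xpredT)//= !mxE eqxx.
rewrite (_ : \prod_(_ < n | _) _ = P); last first.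
  apply: eq_bigr => j /negbTE ji; rewrite !mxE ji max_l; first by ring.
  by rewrite opprK addr_ge0// addr_ge0.
rewrite max_l; last by lra.
rewrite (_ : c + d - _ = 2 * d); last by ring.
by rewrite /d le_eqVlt; apply/orP; left; apply/eqP; field; rewrite gt_eqF.
Qed.

(** Caratheodory's criterion: every cover of [X] is cut into a cover of the part left of the
    hyperplane and a cover of the part strictly right of it. The open boxes on the right miss the
    hyperplane itself, which is null. *)
Lemma measurable_lt_coord (i : 'I_n) c :
  measurable ([set x | x 0 i < c] : set (lebT R n)).
Proof.
apply: le_caratheodory_measurable => X.
apply: le_ereal_inf_tmp => _ [DF XDF <-] /=.
apply: (@le_trans _ _ (\esum_(k in DF.1)
    (box_volume (box_capl i c (DF.2 k)) + box_volume (box_capr i c (DF.2 k))))%E);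
  last by apply: le_esum => k _; exact: box_cap_volume.
rewrite esumD; last 2 first.
- by move=> *; exact: box_volume_ge0.
- by move=> *; exact: box_volume_ge0.
apply: leeD.
  apply: ereal_inf_lbound; exists (DF.1, fun k => box_capl i c (DF.2 k)) => //=.
  move=> x [/XDF[k Dk xk] /= xc]; exists k => //= j; rewrite mxE.
  have /andP[-> xb] := xk j; case: eqP => // ji.
  by rewrite lt_min xb ji xc.
apply: (@le_trans _ _ (lebesgue_outer ((X `&` [set x | c < x 0 i]) `|` [set x | x 0 i = c]))).
  apply: le_lebesgue_outer => x [Xx] /= /negP; rewrite -leNgt le_eqVlt.
  by move=> /orP[/eqP <-|?]; [right|left].
apply: le_trans (outer_measureU2 _ _ _) _; rewrite /= hyperplane_null adde0.
apply: ereal_inf_lbound; exists (DF.1, fun k => box_capr i c (DF.2 k)) => //=.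
move=> x [/XDF[k Dk xk] /= xc]; exists k => //= j; rewrite mxE.
have /andP[ax ->] := xk j; case: eqP => // ji; last by rewrite ax.
by rewrite gt_max ax ji xc.
Qed.

End lebesgue_measurable.

Section lebesgue_borel.
Context {R : realType} {n : nat}.
Implicit Types (A : set 'rV[R]_n) (b : 'rV[R]_n) (t c : R).

Lemma measurable_coord (i : 'I_n) (D : set (lebT R n)) :
  measurable_fun D (fun x : lebT R n => (x : 'rV[R]_n) 0 i).
Proof.
move=> mD; apply: (measurability _ (RGenInftyO.measurableE R)); last exact: mD.
move=> _ [_ [c ->] <-]; apply: measurableI; first exact: mD.
by rewrite set_itvE; exact: measurable_lt_coord.
Qed.

Lemma open_open_box (ab : 'rV[R]_n * 'rV[R]_n) : open (open_box ab).
Proof.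
rewrite openE => x Hx; rewrite /interior/=.
apply: (@filter_forall _ _ (fun i (y : 'rV[R]_n) => ab.1 0 i < y 0 i < ab.2 0 i) (nbhs x) _) => i.
have o : open `]ab.1 0 i, ab.2 0 i[%classic by exact: itv_open.
have : nbhs (x 0 i) `]ab.1 0 i, ab.2 0 i[%classic.
  by apply: open_nbhs_nbhs; split => //=; rewrite in_itv; exact: Hx.
move=> /(@coord_continuous _ _ _ 0 i x).
rewrite nbhs_simpl /= => H; near=> y.
have : `]ab.1 0 i, ab.2 0 i[%classic (y 0 i) by near: y; exact: H.
by rewrite /= in_itv.
Unshelve. all: by end_near.
Qed.

Definition closed_box (ab : 'rV[R]_n * 'rV[R]_n) : set 'rV[R]_n :=
  [set x | forall i, ab.1 0 i <= x 0 i <= ab.2 0 i].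

(** Boxes with rational corners, enumerated by [pickle]. Only those whose closure lies in [U] are
    kept, so that bump functions on them are test functions of [U]. *)
Lemma open_bigcup_box (U : set 'rV[R]_n) : open U ->
  exists (D : set nat) (F : nat -> 'rV[R]_n * 'rV[R]_n),
    U = \bigcup_(k in D) open_box (F k) /\ forall k, D k -> closed_box (F k) `<=` U.
Proof.
move=> oU.
pose bx (f : {ffun 'I_n -> rat * rat}) : 'rV[R]_n * 'rV[R]_n :=
  (\row_i ratr (f i).1, \row_i ratr (f i).2).
pose F k := if unpickle k is Some f then bx f else (0, 0).
exists [set k | closed_box (F k) `<=` U], F; split => //.
apply/seteqP; split => x; last first.
  move=> [k /= Hk xk]; apply: Hk => i.
  by have /andP[h1 h2] := xk i; rewrite !ltW.
move=> Ux; have /nbhs_ballP[e /= e0 He] := oU _ Ux.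
have rat_near (i : 'I_n) : exists ab : rat * rat,
    x 0 i - e < ratr ab.1 < x 0 i /\ x 0 i < ratr ab.2 < x 0 i + e.
  have /rat_in_itvoo[a /itvP Ha] : x 0 i - e < x 0 i by rewrite ltrBlDr ltrDl.
  have /rat_in_itvoo[b /itvP Hb] : x 0 i < x 0 i + e by rewrite ltrDl.
  by exists (a, b); rewrite /= !Ha !Hb.
have [f Hf] := choice rat_near.
exists (pickle [ffun i => f i]); rewrite /= /F pickleK.
  move=> y /= Hy; apply: He; rewrite -ball_normE /=.
  apply: normrV_lt => // i; rewrite !mxE.
  have [] := Hf i; have := Hy i; rewrite !mxE ffunE ltr_norml.
  by move=> /andP[? ?] /andP[? ?] /andP[? ?]; apply/andP; split; lra.
by move=> i; rewrite !mxE ffunE; have [/andP[_ ->] /andP[->]] := Hf i.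
Qed.

Lemma measurable_preimage_box d (T : measurableType d) (D : set T)
    (g : T -> 'rV[R]_n) (ab : 'rV[R]_n * 'rV[R]_n) : measurable D ->
  (forall i, measurable_fun D (fun z => g z 0 i)) ->
  measurable (D `&` g @^-1` open_box ab).
Proof.
move=> mD mg.
(* The finite intersection over coordinates is written as a countable one, indices beyond [n]
   contributing the whole of [D]. *)
pose G (k : nat) : set T := if insub k is Some i then
  D `&` (fun z => g z 0 i) @^-1` `]ab.1 0 i, ab.2 0 i[%classic else D.
have -> : D `&` g @^-1` open_box ab = D `&` \bigcap_k G k.
  apply/seteqP; split => x.
    move=> [Dx Hx]; split => // k _; rewrite /G; case: insubP => // i _ _.
    by split => //=; rewrite in_itv; exact: Hx.
  move=> [Dx Hx]; split => // i; have := Hx i I; rewrite /G valK.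
  by move=> [_] /=; rewrite in_itv.
apply: measurableI => //; apply: bigcap_measurable; first by exists 0%N.
move=> k _; rewrite /G; case: insubP => // i _ _.
exact: mg.
Qed.

Lemma measurable_preimage_open d (T : measurableType d) (D : set T)
    (g : T -> 'rV[R]_n) (U : set 'rV[R]_n) : measurable D ->
  (forall i, measurable_fun D (fun z => g z 0 i)) -> open U ->
  measurable (D `&` g @^-1` U).
Proof.
move=> mD mg /open_bigcup_box[K [F [-> _]]].
rewrite preimage_bigcup setI_bigcupr; apply: bigcup_measurable => k _.
exact: measurable_preimage_box.
Qed.

Lemma measurable_comp_continuous d (T : measurableType d) (D : set T)
    (g : T -> 'rV[R]_n) (f : 'rV[R]_n -> R) :
  (forall i, measurable_fun D (fun z => g z 0 i)) -> continuous f ->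
  measurable_fun D (f \o g).
Proof.
move=> mg cf mD; apply: (measurability _ (RGenInftyO.measurableE R)) => //.
move=> _ [_ [c ->] <-]; rewrite set_itvE comp_preimage.
apply: measurable_preimage_open => //.
have : open [set x : R | x < c] by exact: open_lt.
by move: cf => /continuousP; apply.
Qed.

Lemma continuous_leb_measurable (f : 'rV[R]_n -> R) (D : set (lebT R n)) :
  continuous f -> measurable_fun D (f : lebT R n -> R).
Proof.
by move=> cf; exact: (@measurable_comp_continuous _ (lebT R n) D id f
  (fun i => @measurable_coord i D) cf).
Qed.

Lemma open_leb_measurable (U : set 'rV[R]_n) : open U ->
  measurable (U : set (lebT R n)).
Proof.
move=> oU; rewrite -[X in measurable X]setTI.
exact: (@measurable_preimage_open _ (lebT R n) setT id U measurableT
  (fun i => @measurable_coord i setT) oU).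
Qed.

Lemma closed_leb_measurable (U : set 'rV[R]_n) : closed U ->
  measurable (U : set (lebT R n)).
Proof.
move=> cU; rewrite -[X in measurable X]setCK; apply: measurableC.
by apply: open_leb_measurable; exact/closed_openC.
Qed.

Lemma leb_bounded_fin (A : set 'rV[R]_n) : bounded_set A -> (leb A < +oo)%E.
Proof.
move=> [M [_ HM]]; pose m := `|M| + 1.
have {}HM x : A x -> `|x| <= m by apply: HM; rewrite /m (le_lt_trans (ler_norm M))// ltrDl.
pose ab : 'rV[R]_n * 'rV[R]_n := (const_mx (- (m + 1)), const_mx (m + 1)).
have m0 : 0 <= m by rewrite addr_ge0.
apply: (@le_lt_trans _ _ (box_volume ab)); last exact: ltry.
apply: ereal_inf_lbound; exists ([set 0%N], fun=> ab) => /=; last first.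
  by rewrite esum_set1// box_volume_ge0.
move=> x /HM xm; exists 0%N => // i; rewrite !mxE -ltr_norml.
by rewrite (le_lt_trans (ler_coord_norm _ _))// (le_lt_trans xm)// ltrDl.
Qed.

End lebesgue_borel.

Section unit_cube.
Context {R : realType} {n : nat}.
Implicit Types ab : 'rV[R]_n * 'rV[R]_n.

Definition cube01 : set 'rV[R]_n := [set x | forall i, 0 <= x 0 i <= 1].

Let grid N (j : {ffun 'I_n -> 'I_N}) : 'rV[R]_n := \row_i ((j i)%:R / N%:R).

(** If [m] and [M] are the extreme indices counted, there are at most [M - m + 1] of them and
    [(M - m) / N < b - a]. *)
Let count_itv (N : nat) (a b : R) : (0 < N)%N ->
  (#|[pred j : 'I_N | a < j%:R / N%:R < b]|%:R : R) <= N%:R * Num.max (b - a) 0 + 1.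
Proof.
move=> N0; have N0' : 0 < N%:R :> R by rewrite ltr0n.
set P := [pred j : 'I_N | _]; have [->|P0] := posnP #|P|.
  by rewrite addr_ge0// mulr_ge0// le_max lexx orbT.
pose s := enum P.
have ss : size s = #|P| by rewrite /s -cardE.
have /card_gt0P[j0 Pj0] := P0.
have [m Pm mP] := @arg_minnP _ j0 P (fun j : 'I_N => j : nat) Pj0.
have [M PM MP] := @arg_maxnP _ j0 P (fun j : 'I_N => j : nat) Pj0.
have cP : (#|P| <= (M - m).+1)%N.
  pose g (j : 'I_N) : 'I_(M - m).+1 := inord (j - m).
  rewrite -[X in (_ <= X)%N]card_ord; apply: (@leq_card_in _ _ g).
  move=> x y Px Py /(congr1 val)/=; have := mP _ Px; have := mP _ Py.
  have := MP _ Px; have := MP _ Py => /= a1 a2 a3 a4.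
  rewrite !inordK; [|lia..] => h; apply: val_inj => /=; lia.
have mM : (m <= M)%N := mP _ PM.
move: Pm PM => /andP[am _] /andP[_ Mb].
apply: (@le_trans _ _ (M%:R - m%:R + 1)).
  by rewrite -natrB// natr1 ler_nat.
rewrite lerD2r; apply: (@le_trans _ _ (N%:R * (b - a))); last first.
  by rewrite ler_pM2l// le_max lexx.
move: am Mb; rewrite ltr_pdivlMr// ltr_pdivrMr//; lra.
Qed.

Let count_box (N : nat) ab : (0 < N)%N ->
  (#|[pred j : {ffun 'I_n -> 'I_N} | `[< open_box ab (grid j) >]]|%:R : R) <=
  \prod_(i < n) (N%:R * Num.max (ab.2 0 i - ab.1 0 i) 0 + 1).
Proof.
move=> N0.
rewrite (_ : #|_| = #|family (fun i => [pred j : 'I_N | ab.1 0 i < j%:R / N%:R < ab.2 0 i])|).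
  rewrite card_family foldrE big_map big_enum/= natr_prod.
  apply: ler_prod => i _; rewrite ler0n/=; exact: count_itv.
apply: eq_card => j; rewrite !inE; apply/asboolP/familyP => H i.
  by have := H i; rewrite !mxE inE.
by have := H i; rewrite inE !mxE.
Qed.

Let cvg_prod_seq (I : Type) (r : seq I) (f : I -> nat -> R) (l : I -> R) :
  (forall i, f i @ \oo --> l i) ->
  (fun m => \prod_(i <- r) f i m) @ \oo --> \prod_(i <- r) l i.
Proof.
move=> H; elim: r => [|i r IH].
  by under eq_fun do rewrite big_nil; rewrite big_nil; exact: cvg_cst.
by under eq_fun do rewrite big_cons; rewrite big_cons; exact: cvgM.
Qed.

Let cvg_sum_seq (I : Type) (r : seq I) (f : I -> nat -> R) (l : I -> R) :
  (forall i, f i @ \oo --> l i) ->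
  (fun m => \sum_(i <- r) f i m) @ \oo --> \sum_(i <- r) l i.
Proof.
move=> H; elim: r => [|i r IH].
  by under eq_fun do rewrite big_nil; rewrite big_nil; exact: cvg_cst.
by under eq_fun do rewrite big_cons; rewrite big_cons; exact: cvgD.
Qed.

(** Counting argument: each of the [(m+1)^n] grid points of mesh [1/(m+1)] lies in some box, and a
    box with sides [w_i] contains at most the product of [(m+1) w_i + 1] of them. Divide by
    [(m+1)^n] and let [m] grow. *)
Let finite_cover_volume (s : seq nat) (F : nat -> 'rV[R]_n * 'rV[R]_n) :
  (forall x, cube01 x -> exists2 k, k \in s & open_box (F k) x) ->
  1 <= \sum_(k <- s) \prod_(i < n) Num.max ((F k).2 0 i - (F k).1 0 i) 0.
Proof.
move=> sF; pose w k i := Num.max ((F k).2 0 i - (F k).1 0 i) 0.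
pose h (m : nat) := \sum_(k <- s) \prod_(i < n) (w k i + (m.+1%:R)^-1).
have hl : h @ \oo --> \sum_(k <- s) \prod_(i < n) w k i.
  apply: cvg_sum_seq => k; apply: cvg_prod_seq => i.
  rewrite -[X in _ --> X]addr0; apply: cvgD; first exact: cvg_cst.
  exact: cvg_harmonic.
rewrite -(cvg_lim (@Rhausdorff R) hl); apply: limr_ge; first exact: cvgP hl.
apply: nearW => m; rewrite /h.
have N0 : 0 < (m.+1%:R : R) ^+ n by rewrite exprn_gt0.
rewrite -(ler_pM2l N0) mulr1 mulr_sumr.
apply: (@le_trans _ _ (\sum_(k <- s) \prod_(i < n) (m.+1%:R * w k i + 1))); last first.
  rewrite le_eqVlt; apply/orP; left; apply/eqP; apply: eq_bigr => k _.
  rewrite -[n in _ ^+ n](card_ord n) -prodr_const -big_split/=.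
  by apply: eq_bigr => i _; rewrite mulrDr mulfV// pnatr_eq0.
apply: (@le_trans _ _ (\sum_(k <- s)
    (#|[pred j : {ffun 'I_n -> 'I_m.+1} | `[< open_box (F k) (grid j) >]]|%:R : R))); last first.
  by apply: ler_sum => k _; exact: count_box.
rewrite -natrX -natr_sum ler_nat -[X in (X ^ n)%N](card_ord m.+1) -[n in (_ ^ n)%N](card_ord n) -card_ffun.
under eq_bigr do rewrite -sum1_card big_mkcond/=.
rewrite exchange_big/= -sum1_card; apply: leq_sum => j _.
have [k ks Fk] : exists2 k, k \in s & open_box (F k) (grid j).
  apply: sF => i; rewrite !mxE divr_ge0//= ler_pdivrMr ?ltr0n// mul1r ler_nat ltnW//.
rewrite (big_rem k)//= inE; case: asboolP => // _; exact: leq_addr.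
Qed.

Lemma lebesgue_outer_cube01_ge1 : (1 <= lebesgue_outer cube01)%E.
Proof.
apply: le_ereal_inf_tmp => _ [DF cDF <-] /=.
have cK : compact cube01.
  have := @rV_compact R n (fun=> `[0, 1]%classic) (fun=> @segment_compact _ _ _).
  by congr compact; apply/seteqP; split => x /= H i; have := H i; rewrite in_itv.
(* Openness of the covering boxes is what allows the reduction to a finite subcover. *)
move: cK; rewrite compact_cover => /(_ _ DF.1 (fun k => open_box (DF.2 k))).
case=> [k _||E ED cE].
- exact: open_open_box.
- by move=> x /cDF[k Dk xk]; exists k.
have /(@finite_cover_volume (finmap.enum_fset E) DF.2) h x :
  cube01 x -> exists2 k, k \in finmap.enum_fset E & open_box (DF.2 k) x.
  by move=> /cE[k /= kE xk]; exists k.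
apply: le_trans (_ : (_)%:E <= _)%E; first by rewrite lee_fin; exact: h.
rewrite -sumEFin; apply: ereal_sup_ubound; exists [set` finmap.enum_fset E].
  by split; [exact: finite_seq|move=> k /= /ED; rewrite inE].
by rewrite -fsbig_seq//; exact: finmap.fset_uniq.
Qed.

End unit_cube.

Section cells.
Context {R : realType} {n : nat}.
Implicit Types (x y : 'rV[R]_n) (k : nat).

Let pow2 k : R := 2 ^+ k.

Let pow2_gt0 k : 0 < pow2 k.
Proof. exact: exprn_gt0. Qed.

(** The half-open dyadic cube of side [2^-k] containing [x]. With floors, lying in a common cell is
    an equivalence relation whose countably many classes are labelled by integer vectors. *)
Definition cell k x : set 'rV[R]_n :=
  [set y | forall i, Num.floor (2 ^+ k * y 0 i) = Num.floor (2 ^+ k * x 0 i)].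

Let cube_co : set 'rV[R]_n := [set x | forall i, 0 <= x 0 i < 1].

Definition unit_cell_volume : R := fine (lebesgue_outer cube_co).

Let cube_co_fin : lebesgue_outer cube_co = unit_cell_volume%:E.
Proof.
rewrite fineK// ge0_fin_numE ?lebesgue_outer_ge0//.
apply: leb_bounded_fin; exists 1; split; first exact: real1.
move=> M M1 x Hx; apply: normrV_le; first by lra.
by move=> i; have /andP[? ?] := Hx i; rewrite ger0_norm//; lra.
Qed.

(** The half-open unit cube contains the closed cube of side [1/2], whose measure is [2^-n] times
    that of [cube01]. *)
Lemma unit_cell_volume_gt0 : 0 < unit_cell_volume.
Proof.
rewrite -lte_fin -cube_co_fin.
have t0 : (0 : R) < 2 by [].
have := lebesgue_outer_affine (0 : 'rV[R]_n) cube01 t0.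
set A := _ @^-1` _ => /(congr1 (fun e => (2^-1 ^+ n)%:E * e)%E).
rewrite muleA -EFinM exprVn mulVf ?expf_neq0// mul1e => AE.
apply: (@lt_le_trans _ _ (lebesgue_outer A)).
  rewrite -AE mule_gt0//; apply: lt_le_trans lebesgue_outer_cube01_ge1.
  by rewrite lte_fin.
apply: le_lebesgue_outer => x /= Hx i; have := Hx i; rewrite !mxE addr0.
by move=> /andP[? ?]; apply/andP; split; lra.
Qed.

(** The affine map [y |-> 2^k y - floor(2^k x)] carries the cell onto the half-open unit cube. *)
Lemma leb_cell k x : leb (cell k x) = ((2 ^+ k) ^- n * unit_cell_volume)%:E.
Proof.
have := lebesgue_outer_affine (\row_i - (Num.floor (2 ^+ k * x 0 i))%:~R) cube_co (pow2_gt0 k).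
rewrite cube_co_fin.
have -> : (fun y : 'rV[R]_n => (pow2 k *: y + \row_i - (Num.floor (2 ^+ k * x 0 i))%:~R)%R) @^-1` cube_co = cell k x.
  apply/seteqP; split => y /= H i; have := H i; rewrite ?mxE.
    move=> /andP[h1 h2]; apply: Num.Theory.floor_def.
    by rewrite intrD; apply/andP; split; rewrite /pow2 in h1 h2; lra.
  move=> <-; have /andP[h1 h2] := Num.Theory.floor_itv (2 ^+ k * y 0 i).
  by move: h2; rewrite intrD /pow2 => h2; apply/andP; split; lra.
move=> h; rewrite EFinM h muleA -EFinM mulVf ?mul1e//.
Qed.

Lemma cell_refl k x : cell k x x. Proof. by move=> i. Qed.

Lemma cell_eq k x y : cell k x y -> cell k x = cell k y.
Proof. by move=> H; apply/seteqP; split => z Hz i; rewrite Hz ?H -?H. Qed.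

Lemma cell_norm_lt k x y : cell k x y -> `|y - x| < (2 ^+ k)^-1.
Proof.
move=> H; apply: normrV_lt; first by rewrite invr_gt0.
move=> i; rewrite !mxE -[X in _ < X]mul1r ltr_pdivlMr//.
rewrite -[X in _ * X](ger0_norm (ltW (pow2_gt0 k))) -normrM mulrBl ltr_norml.
have /andP[h1 h2] := Num.Theory.floor_itv (2 ^+ k * y 0 i).
have /andP[h3 h4] := Num.Theory.floor_itv (2 ^+ k * x 0 i).
move: h2 h4; rewrite !intrD; rewrite H in h1 *; rewrite /pow2 => h2 h4.
by apply/andP; split; lra.
Qed.

Lemma measurable_cell k x : measurable (cell k x : set (lebT R n)).
Proof.
pose G (j : nat) : set (lebT R n) := if insub j is Some i then
  [set y : 'rV[R]_n | (Num.floor (2 ^+ k * x 0 i))%:~R <= 2 ^+ k * y 0 i < (Num.floor (2 ^+ k * x 0 i) + 1)%:~R] else setT.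
have -> : cell k x = \bigcap_j G j.
  apply/seteqP; split => y.
    move=> Hy j _; rewrite /G; case: insubP => // i _ _ /=; rewrite -Hy.
    exact: Num.Theory.floor_itv.
  by move=> Hy i; have := Hy i I; rewrite /G valK/= => /Num.Theory.floor_def.
apply: bigcap_measurable; first by exists 0%N.
move=> j _; rewrite /G; case: insubP => [i _ _|_]; last exact: measurableT.
rewrite (_ : mkset _ = (fun y : lebT R n => 2 ^+ k * (y : 'rV[R]_n) 0 i) @^-1`
   `[(Num.floor (2 ^+ k * x 0 i))%:~R, (Num.floor (2 ^+ k * x 0 i) + 1)%:~R[%classic).
  rewrite -[X in measurable X]setTI.
  have mc := @measurable_coord R n i setT.
  have mf : measurable_fun setT (fun y : lebT R n => 2 ^+ k * (y : 'rV[R]_n) 0 i).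
    by apply: measurable_funM; [exact: measurable_cst|exact: mc].
  by apply: mf; [exact: measurableT|exact: measurable_itv].
by apply/seteqP; split => y /=; rewrite in_itv.
Qed.

End cells.

Section translation.
Context {R : realType} {n : nat}.
Implicit Types (b : 'rV[R]_n).

(** Measurability here is Caratheodory's condition, which is phrased with the outer measure alone
    and so inherits its translation invariance. *)
Lemma measurable_translation b :
  measurable_fun setT (fun x : lebT R n => ((x : 'rV[R]_n) + b : lebT R n)).
Proof.
move=> _ A mA; rewrite setTI.
suff : caratheodory_measurable (@lebesgue_outer R n)
  ((fun x : 'rV[R]_n => x + b) @^-1` A) by [].
have {}mA : caratheodory_measurable (@lebesgue_outer R n) A by exact: mA.
move=> X.
have tr B : lebesgue_outer B = lebesgue_outer ((fun x : 'rV[R]_n => x - b) @^-1` B).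
  by rewrite lebesgue_outer_translation.
rewrite [LHS]tr [in RHS]tr [X in (_ + X)%E]tr [LHS]mA.
by apply: (f_equal2 adde); congr lebesgue_outer; apply/seteqP; split => x /=; rewrite subrK.
Qed.

Local Open Scope ereal_scope.

Lemma ge0_integral_translation b (f : lebT R n -> \bar R) :
  measurable_fun setT f -> (forall x, 0 <= f x) ->
  \int[@leb R n]_x f ((x : 'rV[R]_n) + b)%R = \int[@leb R n]_x f x.
Proof.
move=> mf f0.
pose tr (x : lebT R n) : lebT R n := ((x : 'rV[R]_n) + b)%R.
have mtr : measurable_fun setT tr by exact: measurable_translation.
have H := @ge0_integral_pushforward _ _ (lebT R n) (lebT R n) R tr mtr (@leb R n) setT f measurableT mf (fun x _ => f0 x).
rewrite preimage_setT in H.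
transitivity (\int[@leb R n]_x (f \o tr) x) => //.
rewrite -H.
apply: (@eq_measure_integral _ (lebT R n) R setT (@leb R n)).
move=> A mA _; exact: lebesgue_outer_translation.
Qed.

Lemma sigma_finite_leb : sigma_finite setT (@leb R n).
Proof.
exists (fun k => ball_ Num.norm (0%R : 'rV[R]_n) k%:R).
  apply/seteqP; split => // x _; exists (Num.truncn `|x|).+1 => //.
  by rewrite /ball_/= sub0r normrN; exact: truncnS_gt.
move=> k; split.
  apply: open_leb_measurable; rewrite ball_normE; exact: ball_open.
apply: leb_bounded_fin; exists k%:R; split => // M kM x.
by rewrite /ball_/= sub0r normrN => /ltW xk; exact: le_trans (ltW kM).
Qed.

(** Required by Tonelli's theorem in [cell_avg_approx]. *)
HB.instance Definition _ := Measure_isSigmaFinite.Build _ _ _ (@leb R n) sigma_finite_leb.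

End translation.

(** * Smooth functions: closure properties, bump functions, smoothed absolute value *)

Section derive_aux.
Context {R : realType}.
Implicit Types (f : R -> R) (x d C : R).

Lemma is_derive_quadratic f x d C :
  (forall h, `|f (x + h) - f x - d * h| <= C * h ^+ 2) -> is_derive x 1 f d.
Proof.
move=> H; have C0 : 0 <= C.
  by apply: le_trans (normr_ge0 _) _; have := H 1; rewrite expr1n (mulr1 C); exact.
have cv : (fun h => h^-1 *: ((f \o shift x) (h *: 1) - f x)) @ 0^' --> d.
  apply/cvgrPdist_le => e e0; near=> h.
  have h0 : h != 0 by near: h; exact: nbhs_dnbhs_neq.
  rewrite /= /GRing.scale/= mulr1.
  have -> : d - h^-1 * (f (h + x) - f x) = - (h^-1 * (f (x + h) - f x - d * h)).
    by rewrite (addrC h); field.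
  rewrite normrN normrM normfV ler_pdivrMl ?normr_gt0//.
  apply: le_trans (H h) _; rewrite -real_normK ?num_real//.
  have hC : `|h| <= e / (C + 1) by near: h; apply: dnbhs0_le; rewrite divr_gt0// ltr_wpDl.
  move: hC; rewrite ler_pdivlMr ?ltr_wpDl// => hC.
  have := normr_ge0 h; nra.
apply: DeriveDef; first by apply: cvgP cv.
exact: cvg_lim cv.
Unshelve. all: by end_near. Qed.

Lemma is_derive_comp1 (V : normedModType R) (f : V -> R) (F : R -> R) (dF : R) (x v : V) :
  is_derive (f x) 1 F dF -> differentiable f x ->
  differentiable (F \o f) x /\ 'D_v (F \o f) x = dF * 'D_v f x.
Proof.
move=> [dFx <-] df; have DF : differentiable F (f x) by apply/derivable1_diffP.
have dFf : differentiable (F \o f) x by exact: differentiable_comp.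
split => //; rewrite !deriveE// diff_comp//= deriv1E// derive1E.
by rewrite scale1r mulrC.
Qed.

(** The classical flat function [exp(-1/x)] together with the factors [x^-k]: this family is what
    differentiation produces, since the derivative of [flat k] is a combination of [flat k.+1] and
    [flat k.+2]. *)
Definition flat (k : nat) (x : R) : R := if 0 < x then x ^- k * expR (- x^-1) else 0.

(** One term of the exponential series, [exp(1/x) >= x^-(k+2) / (k+2)!]. The quadratic bound gives
    derivative 0 at the origin. *)
Let flat_bound k x : `|flat k x| <= (k.+2)`!%:R * x ^+ 2.
Proof.
rewrite /flat; case: ifPn => [x0|_]; last by rewrite normr0 mulr_ge0// sqr_ge0.
rewrite ger0_norm ?mulr_ge0 ?invr_ge0 ?exprn_ge0 ?expR_ge0 ?(ltW x0)//.
rewrite expRN; have := @expR_ge1Dxn _ x^-1 k.+1 (_ : 0 <= x^-1).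
rewrite invr_ge0 (ltW x0) => /(_ isT) h.
have f0 : 0 < (k.+2)`!%:R :> R by rewrite ltr0n fact_gt0.
have {}h : (x ^+ k.+2)^-1 / (k.+2)`!%:R <= expR x^-1.
  by apply: le_trans h; rewrite exprVn lerDr.
rewrite ler_pdivrMl ?exprn_gt0// mulrCA -exprD.
rewrite -[X in _ <= X]invrK lef_pV2 ?posrE ?expR_gt0//; last first.
  by rewrite invr_gt0 mulr_gt0// exprn_gt0.
by rewrite invfM addn2 mulrC.
Qed.

Lemma is_derive_flat k x : is_derive x 1 (flat k) (- k%:R * flat k.+1 x + flat k.+2 x).
Proof.
have [x0|x0|<-] := ltgtP 0 x.
- rewrite /flat x0.
  have H : is_derive x 1 (fun y => y ^- k * expR (- y^-1))
     (- k%:R * (x ^- k.+1 * expR (- x^-1)) + x ^- k.+2 * expR (- x^-1)).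
    have di : is_derive x 1 (fun y : R => y^-1) (- x^-1 ^+ 2).
      have := is_deriveV (lt0r_neq0 x0) (is_derive_id x (1 : R)).
      by rewrite /GRing.scale/= mulr1 exprVn.
    have de : is_derive x 1 (fun y : R => expR (- y^-1)) (x^-1 ^+ 2 * expR (- x^-1)).
      have := @is_derive1_comp _ expR (fun y : R => - y^-1) x _ _ (is_derive_expR _) (is_deriveN di).
      by rewrite opprK mulrC.
    have -> : (fun y : R => y ^- k * expR (- y^-1)) = (fun y : R => y^-1 ^+ k * expR (- y^-1)).
      by apply/funext => y; rewrite exprVn.
    have := is_deriveM (is_deriveX k di) de.
    rewrite /GRing.scale/= -!exprVn.
    have -> : ((fun y : R => y^-1) ^+ k * (fun y : R => expR (- y^-1))) = (fun y : R => y^-1 ^+ k * expR (- y^-1)).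
      by apply/funext => y /=; rewrite fctE exprfctE.
    rewrite exprfctE; set a := (X in is_derive _ _ _ X -> _); set b := (X in _ -> is_derive _ _ _ X).
    suff -> : b = a by [].
    rewrite {}/a {}/b; case: k => [|k] /=.
      by rewrite expr0 !mulr0n !mul0r; ring.
    by rewrite !exprS; ring.
  apply: near_eq_is_derive H.
  by near=> y; rewrite ifT//; near: y; exact: lt_nbhsr.
- rewrite /flat ltNge (ltW x0)/= mulr0 addr0.
  have dc := is_derive_cst (0 : R) x (1 : R).
  apply: near_eq_is_derive dc.
  near=> y; rewrite ifF//; apply/negbTE; rewrite -leNgt ltW//; near: y; exact: lt_nbhsl.
- rewrite /flat ltxx mulr0 addr0.
  apply: (@is_derive_quadratic _ _ _ (k.+2)`!%:R) => h.
  rewrite mul0r subr0 ltxx subr0 add0r; exact: flat_bound.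
Unshelve. all: by end_near. Qed.

Lemma is_derive_sqrt1 x : is_derive x 1 (fun y => Num.sqrt (1 + y ^+ 2))
  (x * (Num.sqrt (1 + x ^+ 2))^-1).
Proof.
have p : 0 < 1 + x ^+ 2 by rewrite ltr_wpDr// sqr_ge0.
have dq : is_derive x 1 (fun y : R => 1 + y ^+ 2) (2 * x).
  have := is_deriveD (is_derive_cst (1 : R) x 1) (is_deriveX 2 (is_derive_id x (1 : R))).
  set a := (X in is_derive _ _ _ X -> _).
  have -> : a = 2 * x by rewrite /a /GRing.scale/=; ring.
  by rewrite exprfctE.
have := @is_derive1_comp _ Num.sqrt (fun y : R => 1 + y ^+ 2) x _ _ (is_derive1_sqrt p) dq.
set a := (X in is_derive _ _ _ X -> _).
suff -> : x * (Num.sqrt (1 + x ^+ 2))^-1 = a by [].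
by rewrite /a; field; rewrite gt_eqF// sqrtr_gt0.
Qed.

Lemma is_derive_isqrt1 x : is_derive x 1 (fun y => (Num.sqrt (1 + y ^+ 2))^-1)
  (- x * (Num.sqrt (1 + x ^+ 2))^-1 ^+ 3).
Proof.
have p : 0 < 1 + x ^+ 2 by rewrite ltr_wpDr// sqr_ge0.
have s0 : Num.sqrt (1 + x ^+ 2) != 0 by rewrite gt_eqF// sqrtr_gt0.
have := @is_deriveV _ (fun y : R => Num.sqrt (1 + y ^+ 2)) x _ 1 s0 (is_derive_sqrt1 x).
set a := (X in is_derive _ _ _ X -> _).
suff -> : - x * (Num.sqrt (1 + x ^+ 2))^-1 ^+ 3 = a by [].
by rewrite /a /GRing.scale/=; field.
Qed.

End derive_aux.

Section smooth_closure.
Context {R : realType} {n : nat}.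
Implicit Types (f g : 'rV[R]_n -> R).

(** A syntactic class stable under [partial], so that smoothness follows by one induction instead of
    formulas for higher derivatives of compositions. The last three constructors come as families
    closed under differentiation: [flat] at every order, and the square root along with its
    inverse. *)
Inductive smooth_expr : ('rV[R]_n -> R) -> Prop :=
| smooth_expr_base f : smooth f -> smooth_expr f
| smooth_expr_cst c : smooth_expr (fun=> c)
| smooth_expr_coord i : smooth_expr (fun x => x 0 i)
| smooth_expr_add f g : smooth_expr f -> smooth_expr g -> smooth_expr (fun x => f x + g x)
| smooth_expr_mul f g : smooth_expr f -> smooth_expr g -> smooth_expr (fun x => f x * g x)
| smooth_expr_flat k f : smooth_expr f -> smooth_expr (fun x => flat k (f x))
| smooth_expr_sqrt f : smooth_expr f -> smooth_expr (fun x => Num.sqrt (1 + f x ^+ 2))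
| smooth_expr_isqrt f : smooth_expr f ->
    smooth_expr (fun x => (Num.sqrt (1 + f x ^+ 2))^-1).

Lemma smooth_expr_differentiable f : smooth_expr f -> forall x, differentiable f x.
Proof.
elim=> {f}.
- by move=> f sf x; exact: (sf [::] x).
- by move=> c x; exact: differentiable_cst.
- by move=> i x; exact: differentiable_coord.
- by move=> f g _ df _ dg x; exact: differentiableD.
- by move=> f g _ df _ dg x; exact: differentiableM.
- by move=> k f _ df x; exact: (is_derive_comp1 0 (is_derive_flat k (f x)) (df x)).1.
- by move=> f _ df x; exact: (is_derive_comp1 0 (is_derive_sqrt1 (f x)) (df x)).1.
- by move=> f _ df x; exact: (is_derive_comp1 0 (is_derive_isqrt1 (f x)) (df x)).1.
Qed.

Lemma partialD i f g x : differentiable f x -> differentiable g x ->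
  partial i (fun x => f x + g x) x = partial i f x + partial i g x.
Proof. by move=> df dg; rewrite /partial deriveD//; exact: diff_derivable. Qed.

Lemma partialM i f g x : differentiable f x -> differentiable g x ->
  partial i (fun x => f x * g x) x = f x * partial i g x + g x * partial i f x.
Proof. by move=> df dg; rewrite /partial deriveM//; exact: diff_derivable. Qed.

Lemma partialZ i (c : R) f x : differentiable f x ->
  partial i (fun x => c * f x) x = c * partial i f x.
Proof.
move=> df; rewrite (@partialM i (fun=> c))//.
by rewrite [X in _ + f x * X]derive_cst mulr0 addr0.
Qed.

Lemma smooth_expr_partial i f : smooth_expr f -> smooth_expr (partial i f).
Proof.
have ext f' g' : f' =1 g' -> smooth_expr g' -> smooth_expr f'.
  by move=> /funext ->.
elim=> {f}.
- move=> f sf; apply: smooth_expr_base => s x.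
  by have := sf (rcons s i) x; rewrite foldr_rcons.
- move=> c; apply: (ext _ (fun=> 0)); last exact: smooth_expr_cst.
  by move=> x; rewrite /partial derive_cst.
- move=> j; apply: (ext _ (fun=> (j == i)%:R)); last exact: smooth_expr_cst.
  move=> x; rewrite /partial deriveE; last exact: differentiable_coord.
  pose g := fun x : 'rV[R]_n => x 0 j.
  have lg : linear g by move=> a u v; rewrite /g !mxE.
  pose gl := GRing.isLinear.Build _ _ _ _ _ lg.
  pose G : {linear 'rV[R]_n -> R} := HB.pack g gl.
  rewrite -[X in 'd X _]/(G : 'rV[R]_n -> R) diff_lin; last exact: coord_continuous.
  by rewrite /G/= /g mxE eqxx/= eq_sym.
- move=> f g sf pf sg pg; apply: (ext _ (fun x => partial i f x + partial i g x)).
    by move=> x; rewrite partialD//; exact: smooth_expr_differentiable.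
  exact: smooth_expr_add.
- move=> f g sf pf sg pg.
  apply: (ext _ (fun x => f x * partial i g x + g x * partial i f x)).
    by move=> x; rewrite partialM//; exact: smooth_expr_differentiable.
  by apply: smooth_expr_add; exact: smooth_expr_mul.
- move=> k f sf pf.
  apply: (ext _ (fun x => (- k%:R * flat k.+1 (f x) + flat k.+2 (f x)) * partial i f x)).
    move=> x; have df := smooth_expr_differentiable sf x.
    exact: (is_derive_comp1 _ (is_derive_flat k (f x)) df).2.
  apply: smooth_expr_mul => //; apply: smooth_expr_add; last exact: smooth_expr_flat.
  by apply: smooth_expr_mul; [exact: smooth_expr_cst|exact: smooth_expr_flat].
- move=> f sf pf.
  apply: (ext _ (fun x => (f x * (Num.sqrt (1 + f x ^+ 2))^-1) * partial i f x)).
    move=> x; have df := smooth_expr_differentiable sf x.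
    exact: (is_derive_comp1 _ (is_derive_sqrt1 (f x)) df).2.
  apply: smooth_expr_mul => //; apply: smooth_expr_mul => //.
  exact: smooth_expr_isqrt.
- move=> f sf pf.
  apply: (ext _ (fun x => (-1 * f x * ((Num.sqrt (1 + f x ^+ 2))^-1 *
     ((Num.sqrt (1 + f x ^+ 2))^-1 * (Num.sqrt (1 + f x ^+ 2))^-1))) * partial i f x)).
    move=> x; have df := smooth_expr_differentiable sf x.
    apply: eq_trans (is_derive_comp1 (delta_mx 0 i) (is_derive_isqrt1 (f x)) df).2 _.
    by rewrite /partial; ring.
  apply: smooth_expr_mul => //; apply: smooth_expr_mul => //.
    by apply: smooth_expr_mul => //; exact: smooth_expr_cst.
  by do 2 (apply: smooth_expr_mul; first exact: smooth_expr_isqrt); exact: smooth_expr_isqrt.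
Qed.

Lemma smooth_exprP f : smooth_expr f -> smooth f.
Proof.
move=> sf s x; apply: smooth_expr_differentiable.
by elim: s => //= i s IH; exact: smooth_expr_partial.
Qed.

Lemma smooth_partial i f : smooth f -> smooth (partial i f).
Proof. by move=> sf s x; have := sf (rcons s i) x; rewrite foldr_rcons. Qed.

Lemma smooth_differentiable f x : smooth f -> differentiable f x.
Proof. by move=> sf; exact: (sf [::] x). Qed.

Lemma smooth_continuous f : smooth f -> continuous f.
Proof. by move=> sf x; apply: differentiable_continuous; exact: smooth_differentiable. Qed.

End smooth_closure.

Section test_functions.
Context {R : realType} {n : nat}.
Implicit Types (f g phi psi : 'rV[R]_n -> R) (Om : set 'rV[R]_n) (x h : 'rV[R]_n).

Definition grad phi x : 'rV[R]_n := \row_i partial i phi x.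

Lemma derive_dotv_grad phi x h : differentiable phi x ->
  'D_h phi x = dotv h (grad phi x).
Proof.
move=> dphi; rewrite deriveE// {1}(row_sum_delta h) linear_sum/= /dotv.
by apply: eq_bigr => i _; rewrite linearZ/= mxE /partial deriveE.
Qed.

Lemma test_fun_smooth Om phi : test_fun Om phi -> smooth phi.
Proof. by case. Qed.

Lemma test_fun_out Om phi x : test_fun Om phi -> ~ Om x -> phi x = 0.
Proof.
move=> [_ _ sub] Ox; apply/eqP/negPn/negP => p0; apply/Ox/sub.
exact: subset_closure.
Qed.

Lemma test_fun_support Om phi psi : test_fun Om phi -> smooth psi ->
  (forall x, phi x = 0 -> psi x = 0) -> test_fun Om psi.
Proof.
move=> [_ cp sub] spsi H.
have cl : closure [set x | psi x != 0] `<=` closure [set x | phi x != 0].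
  by apply: closureS => x /=; apply: contra => /eqP /H /eqP.
split => //; last exact: subset_trans sub.
by apply: (subclosed_compact _ cp) => //; exact: closed_closure.
Qed.

Lemma test_funD Om phi psi : test_fun Om phi -> test_fun Om psi ->
  test_fun Om (fun x => phi x + psi x).
Proof.
move=> [s1 c1 sub1] [s2 c2 sub2].
have cl : closure [set x | phi x + psi x != 0] `<=`
    closure [set x | phi x != 0] `|` closure [set x | psi x != 0].
  rewrite -closureU; apply: closureS => x /=.
  by have [->|] := eqVneq (phi x) 0; [rewrite add0r; right|left].
split.
- by apply: smooth_exprP; apply: smooth_expr_add; exact: smooth_expr_base.
- apply: (subclosed_compact _ (compactU c1 c2)) => //; exact: closed_closure.
- by move=> x /cl[/sub1|/sub2].
Qed.

Lemma test_funMl Om f phi : smooth f -> test_fun Om phi ->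
  test_fun Om (fun x => f x * phi x).
Proof.
move=> sf tphi; apply: (test_fun_support tphi).
  by apply: smooth_exprP; apply: smooth_expr_mul; apply: smooth_expr_base => //; exact: test_fun_smooth tphi.
by move=> x ->; rewrite mulr0.
Qed.

Lemma smooth_cst (c : R) : smooth (fun _ : 'rV[R]_n => c).
Proof. by apply: smooth_exprP; exact: smooth_expr_cst. Qed.

Lemma test_funZ Om (c : R) phi : test_fun Om phi -> test_fun Om (fun x => c * phi x).
Proof. exact/test_funMl/smooth_cst. Qed.

Lemma test_funB Om phi psi : test_fun Om phi -> test_fun Om psi ->
  test_fun Om (fun x => phi x - psi x).
Proof.
move=> t1 t2; have := test_funD t1 (test_funZ (-1) t2).
by under eq_fun do rewrite mulN1r.
Qed.

Lemma test_fun_partial Om i phi : test_fun Om phi -> test_fun Om (partial i phi).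
Proof.
move=> [s1 c1 sub1]; have s2 := smooth_partial i s1.
have cl : closure [set x | partial i phi x != 0] `<=` closure [set x | phi x != 0].
  rewrite [X in _ `<=` X](closure_id _).1; last exact: closed_closure.
  apply: closureS => x /= /eqP px; apply: contrapT => Kx; apply: px.
  have nx : nbhs x (~` closure [set x | phi x != 0]).
    by apply: open_nbhs_nbhs; split => //; exact/closed_openC/closed_closure.
  rewrite /partial (@near_eq_derive _ _ _ _ (cst 0)) ?derive_cst//.
  near=> y; apply/eqP/negPn/negP => py.
  have : (~` closure [set x | phi x != 0]) y by near: y.
  by apply; exact: subset_closure.
split => //; last exact: subset_trans sub1.
by apply: (subclosed_compact _ c1) => //; exact: closed_closure.
Unshelve. all: by end_near. Qed.

Lemma test_fun_bounded Om phi : test_fun Om phi -> exists M : R, forall x, `|phi x| <= M.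
Proof.
move=> [s1 c1 sub1].
have cc : {within closure [set x | phi x != 0], continuous (fun x => `|phi x|)}.
  apply: continuous_subspaceT => x; apply: continuous_comp; last exact: norm_continuous.
  exact: smooth_continuous.
have [[x0 x0K]|K0] := pselect (closure [set x | phi x != 0] !=set0); last first.
  exists 0 => x; have [->|px] := eqVneq (phi x) 0; first by rewrite normr0.
  by exfalso; apply: K0; exists x; exact: subset_closure.
have [c cK cM] := EVT_max_rV (ex_intro _ x0 x0K) c1 cc.
exists `|phi c| => x; have [->|px] := eqVneq (phi x) 0; first by rewrite normr0.
by apply: cM; rewrite inE; exact: subset_closure.
Qed.

(** Vanishes off the open box and tends pointwise to its indicator as [m] grows, the factor [m + 1]
    pushing the arguments of [flat 0] to infinity inside the box. *)
Definition bump (m : nat) (ab : 'rV[R]_n * 'rV[R]_n) x : R :=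
  \prod_(i < n) (flat 0 (m.+1%:R * (x 0 i - ab.1 0 i)) * flat 0 (m.+1%:R * (ab.2 0 i - x 0 i))).

Lemma flat_itv (t : R) : 0 <= flat 0 t <= 1.
Proof.
rewrite /flat; case: ifPn => [t0|_]; last by rewrite lexx ler01.
by rewrite expr0 invr1 mul1r expR_ge0 expR_le1 oppr_le0 invr_ge0 ltW.
Qed.

Lemma bump_itv m ab x : 0 <= bump m ab x <= 1.
Proof.
have H i : 0 <= flat 0 (m.+1%:R * (x 0 i - ab.1 0 i)) * flat 0 (m.+1%:R * (ab.2 0 i - x 0 i)) <= 1.
  have /andP[a b] := flat_itv (m.+1%:R * (x 0 i - ab.1 0 i)).
  have /andP[c d] := flat_itv (m.+1%:R * (ab.2 0 i - x 0 i)).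
  by rewrite mulr_ge0//= mulr_ile1.
apply/andP; split; last by apply: prodr_ile1 => i _; exact: H.
by apply: prodr_ge0 => i _; have /andP[] := H i.
Qed.

Lemma bump_out m ab x : ~ open_box ab x -> bump m ab x = 0.
Proof.
move=> /existsNP[i /negP]; rewrite negb_and -!leNgt => H.
rewrite /bump (bigD1 i)//= (_ : flat 0 _ * _ = 0) ?mul0r//.
rewrite /flat; case/orP: H => H.
  by rewrite ltNge mulr_ge0_le0 ?subr_le0//= mul0r.
by rewrite [in X in _ * X]ltNge [in X in _ * X]mulr_ge0_le0 ?subr_le0//= mulr0.
Qed.

Let bump_out_closed m ab x : ~ closed_box ab x -> bump m ab x = 0.
Proof.
move=> H; apply: bump_out => H2; apply: H => i; have /andP[? ?] := H2 i.
by rewrite !ltW.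
Qed.

Lemma test_fun_bump m Om (ab : 'rV[R]_n * 'rV[R]_n) : closed_box ab `<=` Om -> test_fun Om (bump m ab).
Proof.
move=> abOm; have out x : bump m ab x != 0 -> closed_box ab x.
  by apply: contraNP => /bump_out_closed ->.
have cc : closed (closed_box ab).
  have -> : closed_box ab = \bigcap_(i in [set: 'I_n])
     ((fun x : 'rV[R]_n => x 0 i) @^-1` `[ab.1 0 i, ab.2 0 i]%classic).
    apply/seteqP; split => x H; first by move=> i _ /=; rewrite in_itv; exact: H.
    by move=> i; have /= := H i I; rewrite in_itv.
  apply: closed_bigI => i _; apply: closed_comp; last exact: itv_closed.
  by move=> x _; exact: coord_continuous.
have cl : closure [set x | bump m ab x != 0] `<=` closed_box ab.
  by rewrite [X in _ `<=` X](closure_id _).1//; exact: closureS.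
split.
- apply: smooth_exprP; rewrite /bump.
  elim: (index_enum _) => [|i s IH].
    by under eq_fun do rewrite big_nil; exact: smooth_expr_cst.
  under eq_fun do rewrite big_cons; apply: smooth_expr_mul => //.
  apply: smooth_expr_mul; apply: smooth_expr_flat.
    apply: smooth_expr_mul; first exact: smooth_expr_cst.
    by apply: smooth_expr_add; [exact: smooth_expr_coord|exact: smooth_expr_cst].
  apply: smooth_expr_mul; first exact: smooth_expr_cst.
  apply: smooth_expr_add; first exact: smooth_expr_cst.
  under eq_fun do rewrite -mulN1r.
  by apply: smooth_expr_mul; [exact: smooth_expr_cst|exact: smooth_expr_coord].
- have cK : compact (closed_box ab).
    have := @rV_compact R n (fun i => `[ab.1 0 i, ab.2 0 i]%classic) (fun i => @segment_compact _ _ _).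
    by congr compact; apply/seteqP; split => x /= H i; have := H i; rewrite in_itv.
  by apply: (subclosed_compact _ cK) => //; exact: closed_closure.
- exact: subset_trans abOm.
Qed.

Let cvg_prod_seq (I : Type) (r : seq I) (f : I -> nat -> R) (l : I -> R) :
  (forall i, f i @ \oo --> l i) ->
  (fun m => \prod_(i <- r) f i m) @ \oo --> \prod_(i <- r) l i.
Proof.
move=> H; elim: r => [|i r IH].
  by under eq_fun do rewrite big_nil; rewrite big_nil; exact: cvg_cst.
by under eq_fun do rewrite big_cons; rewrite big_cons; exact: cvgM.
Qed.

Lemma cvg_flat (t : R) : 0 < t -> flat 0 (m.+1%:R * t) @[m --> \oo] --> (1 : R).
Proof.
move=> t0; rewrite [X in _ --> X](_ : 1 = expR (- (0 * t^-1))); last by rewrite mul0r oppr0 expR0.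
have -> : (fun m => flat 0 (m.+1%:R * t)) = (fun m => expR (- (m.+1%:R^-1 * t^-1))).
  by apply/funext => m; rewrite /flat mulr_gt0// expr0 invr1 mul1r invfM.
apply: (@cvg_comp _ _ _ (fun m : nat => - (m.+1%:R^-1 * t^-1)) expR); last exact: continuous_expR.
by apply: cvgN; apply: cvgMl; exact: cvg_harmonic.
Qed.

Lemma cvg_bump ab x : bump m ab x @[m --> \oo] --> (\1_(open_box ab) x : R).
Proof.
rewrite indicE; have [xab|xab] := boolP (x \in open_box ab); last first.
  have -> : (fun m => bump m ab x) = (fun=> 0).
    by apply/funext => m; apply: bump_out; move: xab; rewrite notin_setE.
  exact: cvg_cst.
rewrite inE in xab; rewrite /bump [X in _ --> X](_ : true%:R = \prod_(i < n) (1 : R)); last by rewrite big1.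
apply: cvg_prod_seq => i; rewrite -[X in _ --> X](mulr1 1); have /andP[? ?] := xab i.
by apply: cvgM; apply: cvg_flat; rewrite subr_gt0.
Qed.

(** A smooth substitute for [|phi|]. Subtracting 1 makes it vanish wherever [phi] does, so the
    support does not grow. *)
Definition smooth_abs (e : R) phi x : R := e * (Num.sqrt (1 + (e^-1 * phi x) ^+ 2) + - 1).

Lemma test_fun_smooth_abs Om e phi : test_fun Om phi -> test_fun Om (smooth_abs e phi).
Proof.
move=> tphi; apply: (test_fun_support tphi); last first.
  by move=> x x0; rewrite /smooth_abs x0 mulr0 expr0n addr0 sqrtr1 subrr mulr0.
apply: smooth_exprP; apply: smooth_expr_mul; first exact: smooth_expr_cst.
apply: smooth_expr_add; last exact: smooth_expr_cst.
apply: smooth_expr_sqrt; apply: smooth_expr_mul; first exact: smooth_expr_cst.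
by apply: smooth_expr_base; exact: test_fun_smooth tphi.
Qed.

Lemma smooth_abs_dist e phi x : 0 < e -> `| smooth_abs e phi x - `|phi x| | <= e.
Proof.
move=> e0; rewrite /smooth_abs; set t := e^-1 * phi x.
have -> : phi x = e * t by rewrite /t mulrA divff ?mul1r// gt_eqF.
rewrite normrM (gtr0_norm e0) -mulrBr normrM (gtr0_norm e0) ger_pMr// ler_norml.
have s1 : `|t| <= Num.sqrt (1 + t ^+ 2) by rewrite -sqrtr_sqr ler_sqrt ?lerDr// addr_ge0// sqr_ge0.
have s2 : Num.sqrt (1 + t ^+ 2) <= 1 + `|t|.
  rewrite -[leRHS]ger0_norm ?addr_ge0// -sqrtr_sqr ler_sqrt ?sqr_ge0//.
  rewrite sqrrD expr1n mul1r real_normK ?num_real// -addrA lerD2l lerDr.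
  by rewrite mulrn_wge0.
by apply/andP; split; lra.
Qed.

Lemma enormE (v : 'rV[R]_n) : enorm v = Num.sqrt (\sum_(i < n) (v 0 i) ^+ 2).
Proof. by rewrite /enorm /dotv; under eq_bigr do rewrite -expr2. Qed.

(** By the chain rule the gradient is multiplied by [t / sqrt(1 + t^2)] with [t = phi x / e], a
    factor of modulus at most 1. *)
Lemma enorm_grad_smooth_abs e phi x : 0 < e -> smooth phi ->
  enorm (grad (smooth_abs e phi) x) <= enorm (grad phi x).
Proof.
move=> e0 sphi; have dphi := smooth_differentiable x sphi.
have dep : differentiable (fun x => e^-1 * phi x) x.
  by apply: differentiableM; first exact: differentiable_cst.
have de v := @is_derive_comp1 R _ (fun x => e^-1 * phi x) _ _ x v (is_derive_sqrt1 (e^-1 * phi x)) dep.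
set t := e^-1 * phi x; set c := t * (Num.sqrt (1 + t ^+ 2))^-1.
have gE i : partial i (smooth_abs e phi) x = c * partial i phi x.
  rewrite /smooth_abs partialZ; last first.
    by apply: differentiableD; [exact: (de 0).1|exact: differentiable_cst].
  rewrite (@partialD _ _ i _ (cst (-1))); [|exact: (de 0).1|exact: differentiable_cst].
  rewrite [X in _ * (_ + X)](_ : _ = 0) ?addr0; last by rewrite /partial derive_cst.
  rewrite [X in _ * X](_ : _ = c * (e^-1 * partial i phi x)); last first.
    apply: eq_trans (de (delta_mx 0 i)).2 _; congr (_ * _).
    exact: partialZ.
  by rewrite mulrCA [e * _]mulrA divff ?gt_eqF// mul1r.
have c1 : `|c| <= 1.
  have p : 0 < Num.sqrt (1 + t ^+ 2) by rewrite sqrtr_gt0 ltr_wpDr// sqr_ge0.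
  rewrite /c normrM normfV (gtr0_norm p) ler_pdivrMr// mul1r.
  by rewrite -sqrtr_sqr ler_sqrt ?lerDr// addr_ge0// sqr_ge0.
rewrite !enormE ler_sqrt; last by apply: sumr_ge0 => i _; exact: sqr_ge0.
apply: ler_sum => i _; rewrite !mxE gE exprMn ler_piMl ?sqr_ge0//.
by rewrite -real_normK ?num_real// expr_le1.
Qed.

End test_functions.

(** * Inequalities between real powers *)

Section power_inequalities.
Context {R : realType}.
Implicit Types (a b p r s e : R).

Lemma powR_mulB1 p a : 0 <= a -> 0 < p -> a `^ (p - 1) * a = a `^ p.
Proof. by move=> a0 p0; rewrite mulrC mulr_powRB1. Qed.

(** For positive [a], [b] write [b = a e^s]. After division by [a^p] the claim is
    [1 + p (e^s - 1) < e^(p s)], which follows from [e^((p-1) s) >= 1 + (p-1) s] and the strict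
    inequality [(1 - s) e^s < 1]. *)
Lemma ltr_powR_tangent p a b : 1 < p -> 0 <= a -> 0 <= b -> a != b ->
  a `^ p + p * a `^ (p - 1) * (b - a) < b `^ p.
Proof.
move=> p1; rewrite le_eqVlt => /predU1P[<- b0 ab|a0].
  rewrite powR0; last by lra.
  rewrite powR0; last by lra.
  by rewrite mulr0 mul0r addr0 powR_gt0// lt_neqAle ab.
rewrite le_eqVlt => /predU1P[<- _|b0 ab].
  rewrite [ltRHS]powR0; last by lra.
  rewrite sub0r mulrN -mulrA powR_mulB1 ?(ltW a0)//; last by lra.
  by have := powR_gt0 p a0; nra.
set s := ln b - ln a.
have s0 : s != 0.
  rewrite subr_eq0; apply: contra ab => /eqP/(congr1 expR).
  by rewrite !lnK ?posrE// => ->.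
have bE : b = a * expR s by rewrite /s expRB !lnK ?posrE// mulrCA divff ?mulr1// gt_eqF.
rewrite [b in ltRHS]bE powRM ?expR_ge0 ?(ltW a0)// -expRM.
have -> : a `^ p + p * a `^ (p - 1) * (b - a) = a `^ p * (1 + p * (expR s - 1)).
  by rewrite -(@powR_mulB1 p a) ?(ltW a0)//; [rewrite bE; ring|lra].
rewrite ltr_pM2l ?powR_gt0//.
have h1 : 1 + - s < expR (- s) by apply: expR_gt1Dx; rewrite oppr_eq0.
have h2 : 1 + (p - 1) * s <= expR ((p - 1) * s) by exact: expR_ge1Dx.
have -> : s * p = s + (p - 1) * s by ring.
rewrite expRD; have e0 := expR_gt0 s.
apply: (@lt_le_trans _ _ (expR s * (1 + (p - 1) * s))); last by rewrite ler_pM2l.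
have h3 : (1 - s) * expR s < expR (- s) * expR s by rewrite ltr_pM2r.
rewrite -expRD addNr expR0 in h3.
nra.
Qed.

Lemma ler_powR_tangent p a b : 1 < p -> 0 <= a -> 0 <= b ->
  a `^ p + p * a `^ (p - 1) * (b - a) <= b `^ p.
Proof.
move=> p1 a0 b0; have [->|ab] := eqVneq a b; first by rewrite subrr mulr0 addr0.
exact/ltW/ltr_powR_tangent.
Qed.

Lemma ltr_powR_mid p a b : 1 < p -> 0 <= a -> 0 <= b -> a != b ->
  ((a + b) / 2) `^ p < (a `^ p + b `^ p) / 2.
Proof.
move=> p1 a0 b0 ab; set m := (a + b) / 2.
have m0 : 0 <= m by rewrite divr_ge0// addr_ge0.
have ma : m != a by move: ab; rewrite /m; apply: contraNneq => /eqP h; lra.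
have h1 := ltr_powR_tangent p1 m0 a0 ma.
have h2 := ler_powR_tangent p1 m0 b0.
have : p * m `^ (p - 1) * (a - m) + p * m `^ (p - 1) * (b - m) = 0 by rewrite /m; field.
lra.
Qed.

Lemma ler_powR_mid p a b : 1 < p -> 0 <= a -> 0 <= b ->
  ((a + b) / 2) `^ p <= (a `^ p + b `^ p) / 2.
Proof.
move=> p1 a0 b0; have [->|ab] := eqVneq a b; last exact/ltW/ltr_powR_mid.
by rewrite -mulr2n -[_ *+ 2]mulr_natr mulfK// -mulr2n -[_ *+ 2]mulr_natr mulfK.
Qed.

Lemma powRD_le p a b : 0 <= p -> 0 <= a -> 0 <= b ->
  (a + b) `^ p <= 2 `^ p * (a `^ p + b `^ p).
Proof.
move=> p0; wlog ab : a b / a <= b => [H a0 b0|a0 b0].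
  case/orP: (le_total a b) => ab; first exact: H.
  by rewrite addrC [X in _ * X]addrC H.
apply: (@le_trans _ _ ((2 * b) `^ p)).
  by apply: ge0_ler_powR => //; rewrite ?nnegrE ?addr_ge0 ?mulr_ge0//; lra.
by rewrite powRM// ler_wpM2l ?powR_ge0// lerDr powR_ge0.
Qed.

Lemma powR_le1D r s a : 0 <= r -> r <= s -> 0 <= a -> a `^ r <= 1 + a `^ s.
Proof.
move=> r0 rs a0; have [a1|a1] := leP 1 a.
  by apply: (le_trans (ler_powR a1 rs)); rewrite lerDr.
apply: (@le_trans _ _ (1 `^ r)); last by rewrite powR1 lerDl powR_ge0.
by apply: ge0_ler_powR => //; rewrite ?nnegrE// ltW.
Qed.

Lemma powR_prod_le r s a b : 0 <= r -> 0 <= s -> 0 < r + s -> 0 <= a -> 0 <= b ->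
  a `^ r * b `^ s <= a `^ (r + s) + b `^ (r + s).
Proof.
move=> r0 s0 rs a0 b0; have [ab|ba] := leP a b.
  apply: (@le_trans _ _ (b `^ (r + s))); last by rewrite lerDr powR_ge0.
  rewrite powRD; last by rewrite gt_eqF.
  by rewrite ler_wpM2r ?powR_ge0//; apply: ge0_ler_powR.
apply: (@le_trans _ _ (a `^ (r + s))); last by rewrite lerDl powR_ge0.
rewrite powRD; last by rewrite gt_eqF.
by rewrite ler_wpM2l ?powR_ge0//; apply: ge0_ler_powR => //; rewrite ltW.
Qed.

(** With [d] defined by [(1 + d)^p = 1 + e], either [b <= d a] and the first term suffices, or
    [a < b / d] and the second does. A leading constant close to 1 lets this play the part of the
    triangle inequality in iterated estimates. *)
Lemma powRD_le_eps p e : 0 < p -> 0 < e -> exists2 C, 0 <= C &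
  forall a b, 0 <= a -> 0 <= b -> (a + b) `^ p <= (1 + e) * a `^ p + C * b `^ p.
Proof.
move=> p0 e0; pose d := (1 + e) `^ p^-1 - 1.
have d0 : 0 < d.
  rewrite subr_gt0; apply: (@le_lt_trans _ _ (1 `^ p^-1)); first by rewrite powR1.
  by apply: gt0_ltr_powR; rewrite ?invr_gt0 ?nnegrE//; lra.
have dE : (1 + d) `^ p = 1 + e.
  by rewrite /d addrC subrK -powRrM mulVf ?gt_eqF// powRr1//; lra.
exists ((1 + d^-1) `^ p); first exact: powR_ge0.
move=> a b a0 b0; have [bd|bd] := leP b (d * a).
  apply: (@le_trans _ _ (((1 + d) * a) `^ p)).
    by apply: ge0_ler_powR; rewrite ?nnegrE ?addr_ge0 ?mulr_ge0//; lra.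
  by rewrite powRM ?dE ?lerDl ?mulr_ge0 ?powR_ge0//; lra.
apply: (@le_trans _ _ (((1 + d^-1) * b) `^ p)).
  apply: ge0_ler_powR; rewrite ?nnegrE ?addr_ge0 ?mulr_ge0 ?addr_ge0 ?invr_ge0//; try lra.
  by rewrite mulrDl mul1r addrC lerD2l ler_pdivlMl// ltW.
by rewrite powRM ?lerDr ?mulr_ge0 ?powR_ge0 ?addr_ge0 ?invr_ge0//; lra.
Qed.

Lemma powR_dist1 s a : 0 < s -> s <= 1 -> 0 <= a -> `|a `^ s - 1| <= `|a - 1|.
Proof.
move=> s0 s1 a0; have [a1|a1] := leP 1 a.
  have h := ler1_powR a1 s1.
  have h2 : 1 <= a `^ s by rewrite -(powRr0 a); apply: ler_powR => //; exact: ltW.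
  by rewrite !ger0_norm; lra.
have [a00|a00] := eqVneq a 0; first by rewrite a00 powR0 ?gt_eqF.
have h := @ger1_powR _ a s; rewrite lt_neqAle eq_sym a00 a0 (ltW a1)/= in h.
have {}h := h isT s1.
have h2 : a `^ s <= 1.
  apply: (@le_trans _ _ (1 `^ s)); last by rewrite powR1.
  by apply: ge0_ler_powR; rewrite ?nnegrE// ltW.
by rewrite !ler0_norm; lra.
Qed.

(** Division by [a] reduces this to [|x^s - 1| <= |x - 1|]. The right-hand side is the dominating
    function for the difference quotients of the singular term. *)
Lemma powR_dist s a b : 0 < s -> s <= 1 -> 0 < a ->
  `| `|a + b| `^ s - a `^ s | <= a `^ (s - 1) * `|b|.
Proof.
move=> s0 s1 a0; have := @powR_dist1 s (`|a + b| / a) s0 s1.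
rewrite divr_ge0// ?(ltW a0)// => /(_ isT) h.
have E : `| `|a + b| `^ s - a `^ s | = a `^ s * `| (`|a + b| / a) `^ s - 1 |.
  rewrite -{2}(ger0_norm (powR_ge0 a s)) -normrM mulrBr mulr1 -powRM ?divr_ge0 ?(ltW a0)//.
  by rewrite mulrCA divff ?mulr1// gt_eqF.
rewrite E; apply: (le_trans (ler_wpM2l (powR_ge0 _ _) h)).
rewrite -(powR_mulB1 (ltW a0) s0) -mulrA ler_wpM2l ?powR_ge0//.
rewrite -{1}(gtr0_norm a0) -normrM mulrBr mulr1 mulrCA divff ?gt_eqF// mulr1.
by rewrite -{2}(gtr0_norm a0); apply: le_trans (ler_dist_dist _ _) _; rewrite addrAC subrr add0r.
Qed.

Lemma powR_dist_le p a b : 1 < p -> 0 <= a -> 0 <= b ->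
  `|a `^ p - b `^ p| <= p * (a + b) `^ (p - 1) * `|a - b|.
Proof.
move=> p1; wlog ab : a b / b <= a => [H a0 b0|a0 b0].
  case/orP: (le_total b a) => ab; first exact: H.
  by have := H b a ab b0 a0; rewrite distrC [`|b - a|]distrC [b + a]addrC.
have h := ler_powR_tangent p1 a0 b0.
have h2 : b `^ p <= a `^ p by apply: ge0_ler_powR; rewrite ?nnegrE//; lra.
rewrite !ger0_norm ?subr_ge0//.
have h3 : a `^ (p - 1) <= (a + b) `^ (p - 1).
  by apply: ge0_ler_powR; rewrite ?nnegrE//; lra.
apply: (@le_trans _ _ (p * a `^ (p - 1) * (a - b))); first by lra.
by rewrite ler_wpM2r ?subr_ge0// ler_wpM2l//; lra.
Qed.

(** Discrete Jensen inequality: sum the tangent inequalities at the arithmetic mean, where the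
    linear terms cancel. *)
Lemma powR_sum_le p (N : nat) (a : nat -> R) : 1 < p -> (forall j, 0 <= a j) ->
  (\sum_(j < N.+1) a j) `^ p <= N.+1%:R `^ (p - 1) * \sum_(j < N.+1) a j `^ p.
Proof.
move=> p1 a0; set S := \sum_(j < N.+1) a j.
have S0 : 0 <= S by apply: sumr_ge0.
have N0 : 0 < N.+1%:R :> R by [].
have m0 : 0 <= S / N.+1%:R by rewrite divr_ge0.
have : \sum_(j < N.+1) ((S / N.+1%:R) `^ p + p * (S / N.+1%:R) `^ (p - 1) * (a j - S / N.+1%:R))
    <= \sum_(j < N.+1) a j `^ p.
  by apply: ler_sum => j _; exact: ler_powR_tangent.
rewrite big_split/= -mulr_sumr sumrB !sumr_const card_ord -/S.
rewrite -[(S / _) *+ _]mulr_natr mulfVK ?gt_eqF// subrr mulr0 addr0 -[_ *+ _]mulr_natl.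
rewrite powRM ?invr_ge0// mulrCA => h; rewrite -ler_pdivrMl ?powR_gt0//.
apply: le_trans h; rewrite mulrC ler_wpM2l ?powR_ge0//.
have n1 : N.+1%:R^-1 `^ p * N.+1%:R `^ p = 1 :> R.
  by rewrite -powRM ?invr_ge0// mulVf ?gt_eqF// powR1.
have n2 : N.+1%:R `^ (p - 1) * N.+1%:R = N.+1%:R `^ p :> R by rewrite powR_mulB1//; lra.
have n3 : 0 < N.+1%:R `^ (p - 1) :> R by rewrite powR_gt0.
rewrite -(ler_pM2l n3) divff ?gt_eqF//.
by rewrite mulrA n2 mulrC n1.
Qed.

End power_inequalities.

(** * Integrals of test functions and integration by parts *)

Section whole_space.
Context {R : realType} {n : nat}.
Notation mu := (@leb R n).
Implicit Types (phi psi : 'rV[R]_n -> R) (x h : 'rV[R]_n) (Om : set 'rV[R]_n).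

Definition cball (r : R) : set 'rV[R]_n := [set x | `|x| <= r].

Lemma measurable_cball r : measurable (cball r : set (lebT R n)).
Proof.
apply: closed_leb_measurable.
have -> : cball r = (fun x : 'rV[R]_n => `|x|) @^-1` [set t | t <= r] by [].
apply: closed_comp; last exact: closed_le.
by move=> x _; exact: norm_continuous.
Qed.

Lemma bounded_sub_cball (A : set 'rV[R]_n) : bounded_set A -> exists2 r, 0 <= r & A `<=` cball r.
Proof.
move=> [M [_ HM]]; exists (`|M| + 1); first by rewrite addr_ge0.
by move=> x Ax; apply: HM => //; rewrite (le_lt_trans (ler_norm M))// ltrDl.
Qed.

Lemma leb_cball_fin r : (mu (cball r) < +oo)%E.
Proof.
by apply: leb_bounded_fin; exists r; split; [exact: num_real|move=> M rM x /le_trans; apply; exact: ltW].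
Qed.

Lemma test_fun_out_cball Om phi : test_fun Om phi ->
  exists2 r, 0 <= r & forall x, r < `|x| -> phi x = 0.
Proof.
move=> [_ c _]; have [r r0 Hr] := bounded_sub_cball (compact_bounded c).
exists r => // x rx; apply/eqP/negPn/negP => px.
have /Hr : closure [set x | phi x != 0] x by exact: subset_closure.
by rewrite /cball/= leNgt rx.
Qed.

Lemma measurable_smooth phi (D : set (lebT R n)) : smooth phi ->
  measurable_fun D (phi : lebT R n -> R).
Proof. by move=> sphi; apply: continuous_leb_measurable; exact: smooth_continuous. Qed.

Lemma integrable_cball_dominated (f : lebT R n -> R) (C r : R) : measurable_fun setT f ->
  (forall x : 'rV[R]_n, `|f x| <= C) -> (forall x : 'rV[R]_n, r < `|x| -> f x = 0) ->
  mu.-integrable setT (EFin \o f).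
Proof.
move=> mf fC f0.
have fE : f = f \_ (cball r : set (lebT R n)).
  apply/funext => x; rewrite patchE; case: ifPn => // /negP xr.
  by apply: f0; rewrite ltNge; apply/negP => h; apply: xr; rewrite inE.
have -> : EFin \o f = (EFin \o f) \_ (cball r : set (lebT R n)).
  by rewrite {1}fE restrict_EFin.
apply/(integrable_mkcond _ (measurable_cball r)).
apply: measurable_bounded_integrable.
- exact: measurable_cball.
- exact: leb_cball_fin.
- exact: measurable_funS mf.
- exists C; split; first exact: num_real.
  by move=> M CM x _ /=; exact: le_trans (ltW CM).
Qed.

Lemma integrable_test_fun Om phi : test_fun Om phi -> mu.-integrable setT (EFin \o phi).
Proof.
move=> tphi; have [M HM] := test_fun_bounded tphi.
have [r _ Hr] := test_fun_out_cball tphi.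
by apply: (integrable_cball_dominated _ HM Hr); apply: measurable_smooth; exact: test_fun_smooth tphi.
Qed.

Lemma smooth_derive phi h : smooth phi -> smooth (fun x => 'D_h phi x).
Proof.
move=> sphi; have -> : (fun x => 'D_h phi x) = (fun x => \sum_(i < n) h 0 i * partial i phi x).
  apply/funext => x; rewrite derive_dotv_grad /dotv; last exact: smooth_differentiable.
  by apply: eq_bigr => i _; rewrite mxE.
apply: smooth_exprP; elim: (index_enum _) => [|i s IH].
  by under eq_fun do rewrite big_nil; exact: smooth_expr_cst.
under eq_fun do rewrite big_cons; apply: smooth_expr_add => //.
apply: smooth_expr_mul; first exact: smooth_expr_cst.
by apply: smooth_expr_base; exact: smooth_partial.
Qed.

Lemma test_fun_derive_bounded Om phi : test_fun Om phi ->
  exists2 L, 0 <= L & forall x h, `|'D_h phi x| <= L * `|h|.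
Proof.
move=> tphi.
have /choice[M HM] : forall i : 'I_n, exists M : R, forall x, `|partial i phi x| <= M.
  by move=> i; exact: test_fun_bounded (test_fun_partial i tphi).
exists (\sum_(i < n) `|M i|); first by apply: sumr_ge0.
move=> x h; rewrite derive_dotv_grad /dotv; last by apply: smooth_differentiable; exact: test_fun_smooth tphi.
apply: (le_trans (ler_norm_sum _ _ _)); rewrite mulr_suml; apply: ler_sum => i _.
rewrite mxE normrM mulrC ler_pM//; last exact: ler_coord_norm.
by rewrite (le_trans (HM i x))// ler_norm.
Qed.

Lemma smooth_increment phi x h : smooth phi ->
  exists y, phi (x + h) - phi x = 'D_h phi y.
Proof.
move=> sphi; pose f (t : R) := phi (x + t *: h).
have df (t : R) : is_derive t (1 : R) f ('D_h phi (x + t *: h)).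
  have dphi : differentiable phi (x + t *: h) by exact: smooth_differentiable.
  pose l (t : R) : 'rV[R]_n := x + t *: h.
  have dl : is_diff t l (fun t : R => t *: h).
    by apply: is_diff_eq; rewrite add0r.
  have dl1 : differentiable l t by exact: ex_diff.
  have dl2 : 'd l t = (fun t : R => t *: h) :> (R -> 'rV[R]_n) by exact: diff_val.
  have fE : f = phi \o l by [].
  have dfl : differentiable f t.
    by rewrite fE; apply: differentiable_comp; [exact: dl1|exact: dphi].
  apply: DeriveDef; first exact: diff_derivable.
  rewrite !deriveE// fE diff_comp//=.
  by rewrite dl2 scale1r.
have cf : {within `[0, 1], continuous f}.
  apply: continuous_subspaceT => t; apply: differentiable_continuous.
  by apply/derivable1_diffP; have [] := df t.
have [c _ Hc] := MVT ltr01 (fun t _ => df t) cf.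
by exists (x + c *: h); move: Hc; rewrite /f scale1r scale0r addr0 subr0 mulr1.
Qed.

Definition diff_quotient phi h (k : nat) x : R := k.+1%:R * (phi (x + k.+1%:R^-1 *: h) - phi x).

Lemma cvg_diff_quotient phi h x : smooth phi ->
  diff_quotient phi h k x @[k --> \oo] --> 'D_h phi x.
Proof.
move=> sphi; have dv : derivable phi x h by apply: diff_derivable; exact: smooth_differentiable.
have Hl : (fun t : R => t^-1 *: ((phi \o shift x) (t *: h) - phi x)) @ 0^' --> 'D_h phi x.
  exact: dv.
have c0 : (k.+1%:R^-1 : R) @[k --> \oo] --> (0 : R)^'.
  move=> A nA; have := @cvg_harmonic R _ nA; rewrite !nbhs_simpl/=.
  by apply: filterS => k /=; apply; rewrite invr_eq0 pnatr_eq0.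
have := @cvg_comp _ _ _ (fun k : nat => k.+1%:R^-1 : R) _ _ _ _ c0 Hl; apply: cvg_trans; apply: near_eq_cvg; apply: nearW => k /=.
by rewrite /diff_quotient invrK /GRing.scale/= [_ + x]addrC.
Qed.

Lemma derive_scale phi x h (c : R) : smooth phi -> 'D_(c *: h) phi x = c * 'D_h phi x.
Proof.
move=> sphi; have dphi := smooth_differentiable x sphi.
by rewrite !derive_dotv_grad// /dotv mulr_sumr; apply: eq_bigr => i _; rewrite mxE mulrA.
Qed.

(** A common bound (mean value theorem) and a common ball (the support enlarged by [|h|]) for all
    quotients, as [integral_bounded_cvg] demands. *)
Lemma diff_quotient_dominated Om phi h : test_fun Om phi -> exists C r : R,
  [/\ 0 <= C, forall k x, `|diff_quotient phi h k x| <= C,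
    forall x, `|'D_h phi x| <= C &
   forall k x, r < `|x| -> diff_quotient phi h k x = 0].
Proof.
move=> tphi; have sphi := test_fun_smooth tphi.
have [L L0 HL] := test_fun_derive_bounded tphi.
have [r r0 Hr] := test_fun_out_cball tphi.
exists (L * `|h|), (r + `|h|); split => //; first by rewrite mulr_ge0.
  move=> k x; rewrite /diff_quotient.
  have [y ->] := smooth_increment x (k.+1%:R^-1 *: h) sphi.
  by rewrite derive_scale// mulrA divff ?mul1r ?pnatr_eq0.
move=> k x rx.
have k1 : `|k.+1%:R^-1 *: h| <= `|h|.
  by rewrite normrZ ler_piMl// ger0_norm ?invr_ge0// invf_le1 ?ler1n.
rewrite /diff_quotient !Hr ?subrr ?mulr0//.
  by rewrite (le_lt_trans _ rx)// lerDl.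
have := ler_normB (x + k.+1%:R^-1 *: h) (k.+1%:R^-1 *: h); rewrite addrK => h1.
rewrite -(ltrD2r `|h|); apply: (lt_le_trans rx); apply: (le_trans h1).
by rewrite lerD2l.
Qed.

Lemma integral_translation b (f : lebT R n -> \bar R) : measurable_fun setT f ->
  (\int[mu]_x f ((x : 'rV[R]_n) + b)%R = \int[mu]_x f x)%E.
Proof.
move=> mf; rewrite integralE [RHS]integralE.
congr (_ - _)%E.
  transitivity (\int[mu]_x (f^\+ ((x : 'rV[R]_n) + b)%R))%E.
    by apply: eq_integral => x _; rewrite !funeposE.
  exact: (@ge0_integral_translation R n b (f^\+)%E (measurable_funepos mf) (funepos_ge0 f)).
transitivity (\int[mu]_x (f^\- ((x : 'rV[R]_n) + b)%R))%E.
  by apply: eq_integral => x _; rewrite !funenegE.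
exact: (@ge0_integral_translation R n b (f^\-)%E (measurable_funeneg mf) (funeneg_ge0 f)).
Qed.

Lemma measurable_shift (b : 'rV[R]_n) d (T : measurableType d) (f : lebT R n -> T) :
  measurable_fun setT f -> measurable_fun setT (fun x : lebT R n => f ((x : 'rV[R]_n) + b)).
Proof. by move=> mf; exact: measurableT_comp mf (measurable_translation b). Qed.

Lemma integral_bounded_cvg (f_ : nat -> lebT R n -> R) (f : lebT R n -> R) (C r : R) :
  (forall k, measurable_fun setT (f_ k)) -> measurable_fun setT f ->
  (forall x, f_ k x @[k --> \oo] --> f x) ->
  (forall k x, `|f_ k x| <= C) ->
  (forall k (x : 'rV[R]_n), r < `|x| -> f_ k x = 0) ->
  (\int[mu]_x (f_ k x)%:E @[k --> \oo] --> \int[mu]_x (f x)%:E)%E.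
Proof.
move=> mf_ mf cf fC f0.
have C0 : 0 <= C by exact: le_trans (normr_ge0 _) (fC 0%N 0).
pose g (x : lebT R n) : R := C * \1_(cball r : set (lebT R n)) x.
have mg : measurable_fun setT g.
  by apply: measurable_funM; [exact: measurable_cst|exact/measurable_indic/measurable_cball].
have ig : mu.-integrable setT (EFin \o g).
  apply: (@integrable_cball_dominated g C r mg) => x.
    by rewrite /g indicE normrM (ger0_norm C0); case: (_ \in _); rewrite ?normr1 ?mulr1// normr0 mulr0.
  by move=> rx; rewrite /g indicE memNset ?mulr0//= /cball/= leNgt rx.
have h1 k : measurable_fun setT (fun x : lebT R n => (f_ k x)%:E) by exact/measurable_EFinP/mf_.
have h2 : measurable_fun setT (fun x : lebT R n => (f x)%:E) by exact/measurable_EFinP/mf.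
have h3 : {ae mu, forall x : lebT R n, setT x -> (f_ k x)%:E @[k --> \oo] --> (f x)%:E}.
  by apply: aeW => x _; apply: cvg_EFin; [by apply: nearW => k|exact: cf].
have h4 : {ae mu, forall (x : lebT R n) k, setT x -> (`|(f_ k x)%:E| <= (EFin \o g) x)%E}.
  apply: aeW => x k _; rewrite /= lee_fin /g indicE.
  have [xr|rx] := leP `|x : 'rV[R]_n| r; first by rewrite mem_set ?mulr1.
  by rewrite f0// normr0 mulr_ge0.
by have [] := @dominated_convergence _ (lebT R n) R mu setT measurableT _ _ _ h1 h2 h3 ig h4.
Qed.

(** Every difference quotient has integral zero by translation invariance of the measure; dominated
    convergence passes this to the derivative. Applied to a product, it is integration by parts. *)
Lemma integral_test_fun_partial Om phi h : test_fun Om phi ->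
  \int[mu]_x ('D_h phi x) = 0.
Proof.
move=> tphi; have sphi := test_fun_smooth tphi.
have [C [r [C0 H1 H2 H3]]] := diff_quotient_dominated h tphi.
have mphi : measurable_fun setT (phi : lebT R n -> R) by exact: measurable_smooth.
have mq k : measurable_fun setT (diff_quotient phi h k : lebT R n -> R).
  apply: measurable_funM; first exact: measurable_cst.
  exact: (measurable_funB (measurable_shift _ mphi) mphi).
have cv := integral_bounded_cvg mq (measurable_smooth (smooth_derive h sphi))
   (fun x => @cvg_diff_quotient phi h x sphi) H1 H3.
rewrite /Rintegral; move/cvg_lim : cv => <-//.
rewrite (_ : (fun k => _) = fun=> 0%E) ?lim_cst//.
apply/funext => k; rewrite /diff_quotient.
have iphi := integrable_test_fun tphi.
have ish : mu.-integrable setT (EFin \o (fun x : lebT R n => phi ((x : 'rV[R]_n) + k.+1%:R^-1 *: h))).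
  apply/integrableP; split; first by apply/measurable_EFinP; exact: (measurable_shift _ mphi).
  have /integrableP[_] := iphi; apply: le_lt_trans.
  rewrite le_eqVlt; apply/orP; left; apply/eqP.
  apply: (@integral_translation (k.+1%:R^-1 *: h) (fun x => `|phi x|%:E)%E).
  by apply/measurable_EFinP; exact: measurableT_comp.
transitivity (\int[mu]_x ((k.+1%:R)%:E * ((phi ((x : 'rV[R]_n) + k.+1%:R^-1 *: h))%:E - (phi x)%:E)))%E.
  by apply: eq_integral => x _; rewrite EFinM EFinB.
rewrite integralZl//; last exact: integrableB.
rewrite integralB//.
rewrite (@integral_translation (k.+1%:R^-1 *: h) (EFin \o phi)); last exact/measurable_EFinP.
by rewrite subee ?mule0// integrable_fin_num.
Qed.

Lemma compact_leb_measurable (K : set 'rV[R]_n) : compact K -> measurable (K : set (lebT R n)).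
Proof.
by move=> cK; apply: closed_leb_measurable; exact: compact_closed.
Qed.

Lemma loc_integrable_test_fun Om phi : test_fun Om phi -> open Om -> loc_integrable Om phi.
Proof.
move=> tphi oO; split; first by apply: measurable_smooth; exact: test_fun_smooth tphi.
move=> K cK _; apply: (integrableS _ _ _ (integrable_test_fun tphi)) => //.
exact: compact_leb_measurable.
Qed.

Lemma Rintegral_vanish Om (f : 'rV[R]_n -> R) : (forall x, ~ Om x -> f x = 0) ->
  \int[mu]_(x in Om) f x = \int[mu]_x f x.
Proof.
move=> f0; rewrite Rintegral_mkcond; congr (Rintegral _ _ _).
apply/funext => x; rewrite patchE; case: ifPn => // /negP xO.
by rewrite f0// => h; apply: xO; rewrite inE.
Qed.

Lemma is_weak_grad_test_fun Om phi : open Om -> test_fun Om phi -> is_weak_grad Om phi (grad phi).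
Proof.
move=> oO tphi; have sphi := test_fun_smooth tphi; split.
- exact: loc_integrable_test_fun.
- move=> i; have := loc_integrable_test_fun (test_fun_partial i tphi) oO.
  by congr loc_integrable; apply/funext => x; rewrite mxE.
move=> psi tpsi i; have spsi := test_fun_smooth tpsi.
rewrite (@Rintegral_vanish Om (fun z => phi z * partial i psi z)); last first.
  by move=> x xO; rewrite (test_fun_out tphi xO) mul0r.
rewrite (@Rintegral_vanish Om (fun z => grad phi z 0 i * psi z)); last first.
  by move=> x xO; rewrite (test_fun_out tpsi xO) mulr0.
have t1 := test_funMl sphi (test_fun_partial i tpsi).
have t2 := test_funMl spsi (test_fun_partial i tphi).
have := integral_test_fun_partial (delta_mx 0 i) (test_funMl sphi tpsi).
have -> : (fun x => 'D_(delta_mx 0 i) (fun x => phi x * psi x) x) =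
    (fun x => phi x * partial i psi x + psi x * partial i phi x).
  apply/funext => x; apply: partialM; exact: smooth_differentiable.
rewrite RintegralD; [|exact: measurableT|exact: integrable_test_fun t1|exact: integrable_test_fun t2].
move=> /eqP; rewrite addr_eq0 => /eqP ->; congr (- _).
by apply: eq_Rintegral => x _; rewrite mxE mulrC.
Qed.

End whole_space.

(** * The fundamental lemma of the calculus of variations *)

Section fundamental_lemma.
Context {R : realType} {n : nat}.
Notation mu := (@leb R n).
Implicit Types (ab c : 'rV[R]_n * 'rV[R]_n) (Om : set 'rV[R]_n).

Let cap_box ab c : 'rV[R]_n * 'rV[R]_n :=
  (\row_i Num.max (ab.1 0 i) (c.1 0 i), \row_i Num.min (ab.2 0 i) (c.2 0 i)).

Let cap_boxE ab c : open_box (cap_box ab c) = open_box ab `&` open_box c.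
Proof.
apply/seteqP; split => x.
  move=> H; split=> i; have := H i; rewrite !mxE gt_max lt_min => /andP[/andP[? ?] /andP[? ?]];
    by apply/andP.
move=> [H1 H2] i; rewrite !mxE gt_max lt_min.
by have /andP[-> ->] := H1 i; have /andP[-> ->] := H2 i.
Qed.

Let cap_box_closed ab c : closed_box (cap_box ab c) `<=` closed_box c.
Proof.
move=> x H i; have := H i; rewrite !mxE ge_max le_min => /andP[/andP[? ?] /andP[? ?]].
by apply/andP.
Qed.

(** Smooth approximation of the indicator of a union of boxes by inclusion-exclusion. One index [m]
    controls both the number of boxes taken and the sharpness of the bumps. *)
Let smooth_union (D : set nat) (F : nat -> 'rV[R]_n * 'rV[R]_n) (m : nat) (x : 'rV[R]_n) : R :=
  1 - \prod_(j < m | `[< D j >]) (1 - bump m (F j) x).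

Let smooth_union_test D F m (U : set 'rV[R]_n) : (forall j, D j -> closed_box (F j) `<=` U) ->
  test_fun U (smooth_union D F m).
Proof.
move=> DU; rewrite /smooth_union.
have : forall j : 'I_m, `[< D j >] -> closed_box (F j) `<=` U by move=> j /asboolP; exact: DU.
elim: (index_enum _) => [|j s IH] H.
  under eq_fun do rewrite big_nil subrr.
  split; first exact: smooth_cst.
    rewrite (_ : mkset _ = set0) ?closure0; first exact: compact0.
    by apply/seteqP; split => x //=; rewrite eqxx.
  rewrite (_ : mkset _ = set0) ?closure0//.
  by apply/seteqP; split => x //=; rewrite eqxx.
under eq_fun do rewrite big_cons.
case: (boolP `[< D j >]) => Dj; last exact: IH.
have tb := @test_fun_bump R n m U (F j) (H j Dj).
have t := IH H; set P := fun x => \prod_(j <- s | `[< D j >]) (1 - bump m (F j) x).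
have -> : (fun x => 1 - (1 - bump m (F j) x) * P x) =
  (fun x => (1 - P x) + (bump m (F j) x - (1 - P x) * bump m (F j) x)).
  by apply/funext => x; ring.
apply: test_funD => //; apply: test_funB => //; apply: test_funMl => //.
exact: test_fun_smooth t.
Qed.

Let prod_itv (D : set nat) (F : nat -> 'rV[R]_n * 'rV[R]_n) (m : nat) x : 0 <= \prod_(j < m | `[< D j >]) (1 - bump m (F j) x) <= 1.
Proof.
have H j : 0 <= 1 - bump m (F j) x <= 1 by have /andP[] := bump_itv m (F j) x; lra.
apply/andP; split; last by apply: prodr_ile1 => i _; exact: H.
by apply: prodr_ge0 => i _; have /andP[] := H i.
Qed.

Let cvg_smooth_union (D : set nat) (F : nat -> 'rV[R]_n * 'rV[R]_n) x :
  smooth_union D F m x @[m --> \oo] --> (\1_(\bigcup_(j in D) open_box (F j)) x : R).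
Proof.
rewrite indicE; have [|xU] := boolP (x \in _); last first.
  have -> : (fun m => smooth_union D F m x) = (fun=> 0); last exact: cvg_cst.
  apply/funext => m; rewrite /smooth_union big1 ?subrr// => j /asboolP Dj.
  rewrite bump_out ?subr0// => xj; move: xU; rewrite notin_setE; apply.
  by exists j.
rewrite inE => -[j Dj xj].
have cb : 1 - (1 - bump m (F j) x) @[m --> \oo] --> (1 : R).
  have := @cvg_bump R n (F j) x; rewrite indicE mem_set// => cb.
  rewrite [X in _ --> X](_ : 1 = 1 - (1 - 1)); last by ring.
  by do 2 (apply: cvgB; first exact: cvg_cst).
apply: (squeeze_cvgr _ cb (@cvg_cst _ (1 : R) _ _ _)).
near=> m; have /andP[p0 p1] := prod_itv D F m x; apply/andP; split; last by rewrite /smooth_union; lra.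
rewrite /smooth_union lerD2l lerN2.
have jm : (j < m)%N by near: m; exact: nbhs_infty_gt.
rewrite (bigD1 (Ordinal jm))/=; last exact/asboolP.
rewrite ler_piMr//; first by have /andP[] := bump_itv m (F j) x; lra.
apply: prodr_ile1 => i _; have /andP[] := bump_itv m (F i) x; lra.
Unshelve. all: by end_near. Qed.

Let integral_box_union Om (g : 'rV[R]_n -> R) c (D : set nat) (F : nat -> 'rV[R]_n * 'rV[R]_n) : open Om -> closed_box c `<=` Om ->
  loc_integrable Om g ->
  (forall phi, test_fun Om phi -> \int[mu]_(z in Om) (g z * phi z) = 0) ->
  \int[mu]_(z in open_box c) (g z * \1_(\bigcup_(j in D) open_box (F j)) z) = 0.
Proof.
move=> oO cO [mg ig] H.
(* Intersecting the boxes with [c] makes the approximations test functions of [Om] supported where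
   [g] is integrable. *)
pose F' j := cap_box (F j) c.
have th0 m x : ~ open_box c x -> smooth_union D F' m x = 0.
  move=> xc; rewrite /smooth_union big1 ?subrr// => j _; rewrite bump_out ?subr0//.
  by rewrite /F' cap_boxE => -[].
have ocO : open_box c `<=` Om.
  by move=> x xc; apply: cO => i; have /andP[? ?] := xc i; rewrite !ltW.
have th m : \int[mu]_(z in open_box c) (g z * smooth_union D F' m z) = 0.
  rewrite -(H (smooth_union D F' m)).
    rewrite Rintegral_mkcond [RHS]Rintegral_mkcond; congr (Rintegral _ _ _).
    apply/funext => x; rewrite !patchE; case: ifPn => [|/negP] xc.
      by rewrite ifT// inE; apply: ocO; rewrite inE in xc.
    case: ifPn => // _; rewrite th0 ?mulr0// => h; apply: xc; by rewrite inE.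
  apply: smooth_union_test => j _; exact: subset_trans (@cap_box_closed _ _) cO.
have mB : measurable (open_box c : set (lebT R n)) by exact/open_leb_measurable/open_open_box.
have iB : mu.-integrable (open_box c : set (lebT R n)) (EFin \o g).
  have cK : compact (closed_box c).
    have := @rV_compact R n (fun i => `[c.1 0 i, c.2 0 i]%classic) (fun i => @segment_compact _ _ _).
    by congr compact; apply/seteqP; split => x /= h i; have := h i; rewrite in_itv.
  apply: (integrableS _ _ _ (ig _ cK cO)) => //; first exact: compact_leb_measurable.
  by move=> x xc i; have /andP[? ?] := xc i; rewrite !ltW.
have mgB : measurable_fun (open_box c : set (lebT R n)) (g : lebT R n -> R).
  by apply/measurable_EFinP; exact: measurable_int iB.
have mth m : measurable_fun (open_box c : set (lebT R n)) (smooth_union D F' m : lebT R n -> R).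
  apply: measurable_smooth; apply: test_fun_smooth (_ : test_fun Om _).
  apply: smooth_union_test => j _; exact: subset_trans (@cap_box_closed _ _) cO.
have mU : measurable (\bigcup_(j in D) open_box (F j) : set (lebT R n)).
  by apply: bigcup_measurable => j _; exact/open_leb_measurable/open_open_box.
have h1 k : measurable_fun (open_box c : set (lebT R n)) (fun x : lebT R n => (g x * smooth_union D F' k x)%:E).
  by apply/measurable_EFinP; exact: measurable_funM mgB (mth k).
have h2 : measurable_fun (open_box c : set (lebT R n))
    (fun x : lebT R n => (g x * \1_(\bigcup_(j in D) open_box (F j) : set (lebT R n)) x)%:E).
  by apply/measurable_EFinP; apply: measurable_funM mgB _; exact: measurable_indic.
have h3 : {ae mu, forall x : lebT R n, (open_box c : set (lebT R n)) x ->
    (g x * smooth_union D F' k x)%:E @[k --> \oo] -->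
    (g x * \1_(\bigcup_(j in D) open_box (F j) : set (lebT R n)) x)%:E}.
  apply: aeW => x xc; apply: cvg_EFin; first by apply: nearW => k.
  apply: cvgM; first exact: cvg_cst.
  have := @cvg_smooth_union D F' x; congr (_ --> _); rewrite !indicE; congr (nat_of_bool _)%:R.
  apply/idP/idP; rewrite !inE => -[j Dj].
    by rewrite /F' cap_boxE => -[]; exists j.
  by move=> xj; exists j => //; rewrite /F' cap_boxE.
have le4 (x : lebT R n) k : (open_box c : set (lebT R n)) x ->
    (`|(g x * smooth_union D F' k x)%:E| <= (EFin \o (Num.norm \o g)) x)%E.
  move=> _; rewrite /= lee_fin normrM ler_piMr//.
  rewrite /smooth_union; have /andP[? ?] := prod_itv D F' k x.
  by rewrite ger0_norm; lra.
have h4 : {ae mu, forall (x : lebT R n) k, (open_box c : set (lebT R n)) x ->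
    (`|(g x * smooth_union D F' k x)%:E| <= (EFin \o (Num.norm \o g)) x)%E}.
  by apply: aeW => x k; exact: le4.
have [_ _] := @dominated_convergence _ (lebT R n) R mu _ mB _ _ _ h1 h2 h3 (integrable_norm iB) h4.
rewrite (_ : (fun k => _) = fun=> 0%E); last first.
  apply/funext => k; rewrite -[LHS]fineK; first by congr EFin; exact: th.
  apply: integrable_fin_num => //; apply: (le_integrable mB (h1 k) _ (integrable_norm iB)) => x xc.
  exact: le_trans (le4 x k xc) (lee_abs _).
move=> /(cvg_lim (@ereal_hausdorff R)); rewrite lim_cst; last exact: ereal_hausdorff.
by rewrite /Rintegral => <-.
Qed.

(** The definition of the outer measure gives unions [U i] of boxes around [A = {g > 0}] with small
    excess. The integral of [g] over each [U i] within the box vanishes, hence so does that over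
    [A], where [g] is positive. *)
Let pos_part_null Om (g : 'rV[R]_n -> R) c : open Om -> closed_box c `<=` Om ->
  loc_integrable Om g ->
  (forall phi, test_fun Om phi -> \int[mu]_(z in Om) (g z * phi z) = 0) ->
  {ae mu, forall z : lebT R n, (open_box c : set (lebT R n)) z -> g z <= 0}.
Proof.
move=> oO cO ig H.
have mB : measurable (open_box c : set (lebT R n)) by exact/open_leb_measurable/open_open_box.
have cK : compact (closed_box c).
  have := @rV_compact R n (fun i => `[c.1 0 i, c.2 0 i]%classic) (fun i => @segment_compact _ _ _).
  by congr compact; apply/seteqP; split => x /= h i; have := h i; rewrite in_itv.
have subK : open_box c `<=` closed_box c.
  by move=> x xc i; have /andP[? ?] := xc i; rewrite !ltW.
have iB : mu.-integrable (open_box c : set (lebT R n)) (EFin \o g).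
  by apply: (integrableS _ _ _ (ig.2 _ cK cO)) => //; exact: compact_leb_measurable.
have mgB : measurable_fun (open_box c : set (lebT R n)) (g : lebT R n -> R).
  by apply/measurable_EFinP; exact: measurable_int iB.
pose A : set (lebT R n) := open_box c `&` [set z | 0 < g z].
have mA : measurable A.
  have -> : A = open_box c `&` (g : lebT R n -> R) @^-1` `]0, +oo[%classic.
    by apply/seteqP; split => x [? /=]; rewrite ?in_itv/= ?andbT.
  by apply: mgB => //; exact: measurable_itv.
have Afin : (mu A < +oo)%E.
  apply: (@le_lt_trans _ _ (mu (closed_box c))).
    by apply: le_lebesgue_outer => x [/subK].
  by apply: leb_bounded_fin; exact: compact_bounded.
have cover_ex (i : nat) : exists DF : set nat * (nat -> 'rV[R]_n * 'rV[R]_n),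
    A `<=` \bigcup_(j in DF.1) open_box (DF.2 j) /\
    (mu (\bigcup_(j in DF.1) open_box (DF.2 j)) <= mu A + (1 / (2 ^ (i + 1))%:R)%:E)%E.
  have e0 : 0 < (1 / (2 ^ (i + 1))%:R : R) by rewrite divr_gt0// ltr0n expn_gt0.
  have Af : lebesgue_outer A \is a fin_num by rewrite ge0_fin_numE// lebesgue_outer_ge0.
  have [_ [DF AD <-] lt] := lb_ereal_inf_adherent e0 Af.
  exists DF; split; first exact: AD.
  apply: le_trans (ltW lt); apply: ereal_inf_lbound; exists DF => //.
have [DF HDF] := choice cover_ex.
pose U i : set (lebT R n) := \bigcup_(j in (DF i).1) open_box ((DF i).2 j).
have mU i : measurable (U i).
  by apply: bigcup_measurable => j _; exact/open_leb_measurable/open_open_box.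
have UA i : (mu (U i `\` A) <= (1 / (2 ^ (i + 1))%:R)%:E)%E.
  have := measureDI (@leb R n) (mU i) mA; rewrite (setIidr (HDF i).1) => h.
  have := (HDF i).2; rewrite -/(U i) h addeC leeD2lE//.
  by rewrite ge0_fin_numE.
(* Borel-Cantelli: the excesses are at most [2^-(i+1)], so almost every point outside [A] lies in
   only finitely many [U i] and the indicators converge. *)
have null : mu (lim_sup_set (fun i => U i `\` A)) = 0%E.
  apply: lim_sup_set_cvg0; first by move=> k; exact: measurableD.
  apply: (@le_lt_trans _ _ (\sum_(i <oo) (1 / (2 ^ (i + 1))%:R : R)%:E)%E).
    by apply: lee_nneseries => [k _ _|k _]; [exact: lebesgue_outer_ge0|exact: UA].
  by have /cvg_lim -> // := @cvg_geometric_eseries_half R 1 0; rewrite ltry.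
have null_ae : {ae mu, forall z : lebT R n, ~ lim_sup_set (fun i => U i `\` A) z}.
  exists (lim_sup_set (fun i => U i `\` A)); split => //.
    apply: bigcap_measurable; first by exists 0%N.
    by move=> k _; apply: bigcup_measurable => j _; exact: measurableD.
  by move=> z /= /contrapT.
have IU i : (\int[mu]_(z in open_box c) (g z * \1_(U i) z)%:E)%E = 0%E.
  have hi : mu.-integrable (open_box c : set (lebT R n)) (fun z => (g z * \1_(U i) z)%:E).
    apply: (le_integrable mB _ _ (integrable_norm iB)).
      by apply/measurable_EFinP; apply: measurable_funM mgB _; exact: measurable_indic.
    move=> x _; rewrite /= lee_fin [leRHS]ger0_norm// normrM ler_piMr// indicE.
    by case: (_ \in _); rewrite ?normr1 ?normr0.
  rewrite -[LHS]fineK; last exact: integrable_fin_num.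
  by congr EFin; exact: (integral_box_union (DF i).1 (DF i).2 oO cO ig H).
have h1 k : measurable_fun (open_box c : set (lebT R n)) (fun x : lebT R n => (g x * \1_(U k) x)%:E).
  by apply/measurable_EFinP; apply: measurable_funM mgB _; exact: measurable_indic.
have h2 : measurable_fun (open_box c : set (lebT R n)) (fun x : lebT R n => (g x * \1_A x)%:E).
  by apply/measurable_EFinP; apply: measurable_funM mgB _; exact: measurable_indic.
have h3 : {ae mu, forall x : lebT R n, (open_box c : set (lebT R n)) x ->
    (g x * \1_(U k) x)%:E @[k --> \oo] --> (g x * \1_A x)%:E}.
  apply: filterS null_ae => x /existsNP[N /not_implyP[_ xN]] xc.
  apply: cvg_EFin; first by apply: nearW => k.
  apply: cvgM; first exact: cvg_cst.
  apply: cvg_near_cst; near=> k; rewrite !indicE; congr (nat_of_bool _)%:R.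
  apply/idP/idP; rewrite !inE; last exact: (HDF k).1.
  move=> xU; apply: contrapT => xA; apply: xN; exists k => //.
  by near: k; exact: nbhs_infty_ge.
have h4 : {ae mu, forall (x : lebT R n) k, (open_box c : set (lebT R n)) x ->
    (`|(g x * \1_(U k) x)%:E| <= (EFin \o (Num.norm \o g)) x)%E}.
  apply: aeW => x k _; rewrite /= lee_fin normrM ler_piMr// indicE.
  by case: (_ \in _); rewrite ?normr1 ?normr0.
have [_ _] := @dominated_convergence _ (lebT R n) R mu _ mB _ _ _ h1 h2 h3 (integrable_norm iB) h4.
rewrite (_ : (fun k => _) = fun=> 0%E); last by apply/funext => k; exact: IU.
move=> /(cvg_lim (@ereal_hausdorff R)); rewrite lim_cst; last exact: ereal_hausdorff.
move=> /esym IA.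
have : ae_eq mu (open_box c : set (lebT R n)) (fun x => (g x * \1_A x)%:E) (cst 0%E).
  apply/(ae_eq_integral_abs (@leb R n) mB h2); rewrite -[RHS]IA.
  apply: eq_integral => x xc; rewrite gee0_abs// lee_fin indicE.
  by case: (boolP (x \in A)); rewrite ?mulr0 ?mulr1// inE => -[_ /= /ltW].
apply: filterS => x + xc => /(_ xc) /= [].
rewrite indicE; have [|] := boolP (x \in A); first by rewrite mulr1 => _ ->.
by rewrite notin_setE /A => xA _; rewrite leNgt; apply/negP => gx; exact: xA.
Unshelve. all: by end_near. Qed.

Lemma integral_test_fun_eq0 Om (g : 'rV[R]_n -> R) : open Om -> loc_integrable Om g ->
  (forall phi, test_fun Om phi -> \int[mu]_(z in Om) (g z * phi z) = 0) ->
  ae_on Om (fun z => g z = 0).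
Proof.
move=> oO ig H; have [D [F [OE FO]]] := open_bigcup_box oO.
have igN : loc_integrable Om (fun z => - g z).
  split; first exact: measurable_funN ig.1.
  move=> K cK KO; have := integrableN (ig.2 K cK KO).
  by apply: eq_integrable => //; exact: compact_leb_measurable.
have HN phi : test_fun Om phi -> \int[mu]_(z in Om) (- g z * phi z) = 0.
  move=> tphi; rewrite -(H _ (test_funZ (-1) tphi)).
  by apply: eq_Rintegral => z _; ring.
have H0 k : {ae mu, forall z : lebT R n, D k -> open_box (F k) z -> g z = 0}.
  have [Dk|nDk] := pselect (D k); last by apply: aeW.
  have h1 := pos_part_null oO (FO k Dk) ig H.
  have h2 := pos_part_null oO (FO k Dk) igN HN.
  apply: filterS2 h1 h2 => z h1 h2 _ zk; apply/eqP; rewrite eq_le h1//=.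
  by have := h2 zk; rewrite oppr_le0.
have := ae_foralln H0; apply: filterS => z Hz.
by rewrite {1}OE => -[k Dk zk]; exact: Hz Dk zk.
Qed.

End fundamental_lemma.

(** * Weak gradients, the Euclidean norm, Jensen's inequality *)

Section weak_gradient.
Context {R : realType} {n : nat}.
Notation mu := (@leb R n).
Implicit Types (Om : set 'rV[R]_n) (u f phi : 'rV[R]_n -> R) (g : 'rV[R]_n -> 'rV[R]_n).

Lemma loc_integrableM_test_fun Om f phi : open Om -> loc_integrable Om f -> test_fun Om phi ->
  mu.-integrable (Om : set (lebT R n)) (fun z => (f z * phi z)%:E).
Proof.
move=> oO [mf lf] tphi; have [s cK KO] := tphi.
set K := closure [set x | phi x != 0] in cK KO.
have mO : measurable (Om : set (lebT R n)) by exact: open_leb_measurable.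
have mK : measurable (K : set (lebT R n)) by exact: compact_leb_measurable.
have iK := lf K cK KO.
have [M HM] := test_fun_bounded tphi.
apply/integrableP; split.
  by apply/measurable_EFinP; apply: (measurable_funM mf); exact: measurable_smooth.
apply: (@le_lt_trans _ _ (\int[mu]_(z in (K : set (lebT R n))) (`|M|%:E * `|(f z)%:E|))%E).
  rewrite integral_mkcond [leRHS]integral_mkcond; apply: ge0_le_integral => //.
  - by move=> x _; rewrite patchE; case: ifPn.
  - apply/(measurable_restrictT _ mO); apply: measurableT_comp => //.
    by apply/measurable_EFinP; apply: (measurable_funM mf); exact: measurable_smooth.
  - apply/(measurable_restrictT _ mK); apply: measurable_funeM.
    by apply: measurableT_comp => //; exact: measurable_int iK.
  move=> x _; rewrite !patchE; case: (boolP (x \in (K : set (lebT R n)))) => xK.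
    case: ifPn => _; last by rewrite mule_ge0.
    rewrite abse_EFin -EFinM lee_fin normrM mulrC ler_wpM2r//.
    by rewrite (le_trans (HM x))// ler_norm.
  have ph0 : phi x = 0.
    apply/eqP/negPn/negP => px; move: xK; rewrite notin_setE; apply.
    exact: subset_closure.
  by rewrite ph0 mulr0 abse0; case: ifPn.
rewrite ge0_integralZl//.
- by rewrite lte_mul_pinfty//; have /integrableP[] := iK.
- by apply: measurableT_comp => //; exact: measurable_int iK.
Qed.

Lemma weak_grad_unique Om u g g' : open Om -> is_weak_grad Om u g -> is_weak_grad Om u g' ->
  ae_on Om (fun z => g z = g' z).
Proof.
move=> oO [_ lg Hg] [_ lg' Hg'].
have mO : measurable (Om : set (lebT R n)) by exact: open_leb_measurable.
have H i : ae_on Om (fun z => g z 0 i - g' z 0 i = 0).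
  apply: integral_test_fun_eq0 => //.
    split; first exact: measurable_funB (lg i).1 (lg' i).1.
    move=> K cK KO; have mK := compact_leb_measurable cK.
    exact: (integrableB mK ((lg i).2 K cK KO) ((lg' i).2 K cK KO)).
  move=> phi tphi.
  have -> : (fun z => (g z 0 i - g' z 0 i) * phi z) = (fun z => g z 0 i * phi z - g' z 0 i * phi z).
    by apply/funext => z; ring.
  rewrite RintegralB//; [|exact: loc_integrableM_test_fun..].
  have := Hg phi tphi i; rewrite (Hg' phi tphi i) => /oppr_inj ->; exact: subrr.
have : {ae mu, forall z : lebT R n, forall i, Om z -> g z 0 i - g' z 0 i = 0}.
  apply: (@filter_forall (lebT R n) _ (fun i (z : lebT R n) => Om z -> g z 0 i - g' z 0 i = 0)
    (almost_everywhere mu) _).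
  exact: H.
apply: filterS => z Hz Oz; apply/rowP => i; apply/eqP; rewrite -subr_eq0; apply/eqP.
exact: Hz.
Qed.

Lemma is_weak_grad_wgrad Om u g : is_weak_grad Om u g -> is_weak_grad Om u (wgrad Om u).
Proof. by move=> H; rewrite /wgrad; case: xgetP => [g' -> //|/(_ g)]. Qed.

Lemma wgrad_ae Om u g : open Om -> is_weak_grad Om u g ->
  ae_on Om (fun z => wgrad Om u z = g z).
Proof. by move=> oO H; apply: weak_grad_unique oO (is_weak_grad_wgrad H) H. Qed.

End weak_gradient.

Section euclidean_norm.
Context {R : realType} {n : nat}.
Implicit Types (a b : 'rV[R]_n).

Lemma enorm_ge0 a : 0 <= enorm a.
Proof. exact: sqrtr_ge0. Qed.

Lemma enorm_sqr a : enorm a ^+ 2 = \sum_(i < n) a 0 i ^+ 2.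
Proof. by rewrite enormE sqr_sqrtr//; apply: sumr_ge0 => i _; exact: sqr_ge0. Qed.

Lemma enorm_eq0 a : enorm a = 0 -> a = 0.
Proof.
move=> a0; apply/rowP => i; rewrite mxE; apply/eqP; rewrite -sqrf_eq0.
have /psumr_eq0P : forall j : 'I_n, true -> 0 <= a 0 j ^+ 2 by move=> j _; exact: sqr_ge0.
by rewrite -enorm_sqr a0 expr0n => /(_ erefl) ->.
Qed.

Lemma enorm0 : enorm (0 : 'rV[R]_n) = 0.
Proof. by rewrite enormE big1 ?sqrtr0// => i _; rewrite mxE expr0n. Qed.

Lemma enormZ (c : R) a : enorm (c *: a) = `|c| * enorm a.
Proof.
rewrite !enormE -sqrtr_sqr -sqrtrM ?sqr_ge0// mulr_sumr.
by congr Num.sqrt; apply: eq_bigr => i _; rewrite mxE exprMn.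
Qed.

Lemma enormN a : enorm (- a) = enorm a.
Proof. by rewrite -scaleN1r enormZ normrN1 mul1r. Qed.

Lemma cauchy_schwarz a b : `|dotv a b| <= enorm a * enorm b.
Proof.
have [a0|a0] := eqVneq (enorm a) 0.
  by rewrite (enorm_eq0 a0) enorm0 mul0r /dotv big1 ?normr0// => i _; rewrite mxE mul0r.
have [b0|b0] := eqVneq (enorm b) 0.
  by rewrite (enorm_eq0 b0) enorm0 mulr0 /dotv big1 ?normr0// => i _; rewrite mxE mulr0.
set A := enorm a in a0 *; set B := enorm b in b0 *.
have A0 : 0 < A by rewrite lt_neqAle eq_sym a0 enorm_ge0.
have B0 : 0 < B by rewrite lt_neqAle eq_sym b0 enorm_ge0.
apply: (le_trans (ler_norm_sum _ _ _)).
(* Termwise AM-GM with weight [B / A], chosen so that both halves sum to [A B / 2]. *)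
apply: (@le_trans _ _ (\sum_(i < n) (a 0 i ^+ 2 * (B / A) + b 0 i ^+ 2 * (A / B)) / 2)).
  apply: ler_sum => i _; rewrite normrM.
  rewrite -[a 0 i ^+ 2]real_normK ?num_real// -[b 0 i ^+ 2]real_normK ?num_real//.
  set x := `|a 0 i|; set y := `|b 0 i|.
  have : 0 <= (x * B - y * A) ^+ 2 / (2 * A * B) by rewrite divr_ge0 ?sqr_ge0// !mulr_ge0// ltW.
  suff -> : (x * B - y * A) ^+ 2 / (2 * A * B) = (x ^+ 2 * (B / A) + y ^+ 2 * (A / B)) / 2 - x * y by rewrite subr_ge0.
  by field; rewrite a0 b0.
rewrite -mulr_suml big_split/= -!mulr_suml -!enorm_sqr -/A -/B.
rewrite le_eqVlt; apply/orP; left; apply/eqP; field; by rewrite a0 b0.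
Qed.

Lemma enormD a b : enorm (a + b) <= enorm a + enorm b.
Proof.
rewrite -[leRHS]ger0_norm ?addr_ge0 ?enorm_ge0// -sqrtr_sqr enormE ler_sqrt ?sqr_ge0//.
rewrite sqrrD !enorm_sqr; apply: (@le_trans _ _ (\sum_(i < n) a 0 i ^+ 2 + dotv a b *+ 2 + \sum_(i < n) b 0 i ^+ 2)).
  rewrite /dotv -sumrMnl -!big_split/=; apply: ler_sum => i _.
  by rewrite mxE sqrrD.
rewrite lerD2r lerD2l lerMn2r/=.
by rewrite (le_trans (ler_norm _))// cauchy_schwarz.
Qed.

Lemma coord_le_enorm a i : `|a 0 i| <= enorm a.
Proof.
rewrite -sqrtr_sqr enormE ler_sqrt; last by apply: sumr_ge0 => j _; exact: sqr_ge0.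
rewrite (bigD1 i)//= lerDl; apply: sumr_ge0 => j _; exact: sqr_ge0.
Qed.

Lemma enorm_le_sum a : enorm a <= \sum_(i < n) `|a 0 i|.
Proof.
have : forall s : seq 'I_n, Num.sqrt (\sum_(i <- s) a 0 i ^+ 2) <= \sum_(i <- s) `|a 0 i|.
  elim=> [|i s IH]; first by rewrite !big_nil sqrtr0.
  rewrite !big_cons; set S := \sum_(j <- s) a 0 j ^+ 2 in IH *.
  have S0 : 0 <= S by apply: sumr_ge0 => j _; exact: sqr_ge0.
  apply: le_trans (lerD (lexx _) IH).
  rewrite -[leRHS]ger0_norm ?addr_ge0 ?sqrtr_ge0// -sqrtr_sqr ler_sqrt ?sqr_ge0//.
  rewrite sqrrD sqr_sqrtr// real_normK ?num_real// lerD2r lerDl.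
  by rewrite mulrn_wge0// mulr_ge0// sqrtr_ge0.
by move=> H; rewrite enormE; exact: H.
Qed.

Lemma enorm_le_norm a : enorm a <= n%:R * `|a|.
Proof.
apply: (le_trans (enorm_le_sum a)); rewrite -[n in n%:R](card_ord n) mulr_natl -sumr_const.
by apply: ler_sum => i _; exact: ler_coord_norm.
Qed.

Lemma continuous_enorm : continuous (@enorm R n).
Proof.
move=> a; suff : enorm x @[x --> (a : 'rV[R]_n)] --> enorm a by [].
have FF : Filter (nbhs (a : 'rV[R]_n)) by exact: nbhs_filter.
apply/(@cvgrPdist_le _ _ _ _ FF) => e e0.
have d0 : 0 < e / (n%:R + 1) by rewrite divr_gt0// ltr_wpDl.
near=> b; apply: (@le_trans _ _ (enorm (a - b))).
  rewrite ler_norml; have := enormD (a - b) b; have := enormD (b - a) a.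
  rewrite !subrK -[b - a]opprB enormN => h1 h2.
  by apply/andP; split; lra.
apply: (le_trans (enorm_le_norm _)).
have : `|a - b| <= e / (n%:R + 1) by near: b; exact: cvgr_dist_le.
rewrite ler_pdivlMr ?ltr_wpDl// mulrC; apply: le_trans.
by rewrite ler_wpM2r// lerDl.
Unshelve. all: by end_near. Qed.

End euclidean_norm.

Section norm_powR.
Context {R : realType}.

Lemma continuous_norm_powR (p : R) : 0 < p -> continuous (fun t : R => `|t| `^ p).
Proof.
move=> p0 a; have [->|a0] := eqVneq a 0.
  rewrite /continuous_at normr0 powR0 ?gt_eqF//; apply/cvgrPdist_le => e e0; near=> t.
  rewrite sub0r normrN ger0_norm ?powR_ge0//.
  have -> : e = (e `^ p^-1) `^ p by rewrite -powRrM mulVf ?gt_eqF// powRr1// ltW.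
  apply: ge0_ler_powR; rewrite ?nnegrE ?powR_ge0// ?(ltW p0)//.
  near: t; have := @nbhs0_le R R^o (e `^ p^-1) (powR_gt0 _ e0).
  by apply: filterS => t; rewrite ?sub0r ?normrN.
apply: (@continuous_comp _ _ _ (fun t : R => `|t|) (fun t : R => t `^ p)).
  exact: norm_continuous.
apply: differentiable_continuous; apply/derivable1_diffP.
by apply: derivable_powR; rewrite in_itv/= andbT normr_gt0.
Unshelve. all: by end_near. Qed.

End norm_powR.

Section jensen.
Local Open Scope ereal_scope.

Lemma measurable_norm_powR d (T : measurableType d) (R : realType) (D : set T) (p : R)
    (f : T -> R) : measurable_fun D f -> measurable_fun D (fun x => (`|f x| `^ p)%R).
Proof.
move=> mf; have h : measurable_fun D (fun x => `|f x|%R) by exact: measurableT_comp.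
exact: (measurableT_comp (measurable_powR p)).
Qed.

(** Integrate the tangent inequality of [t^p] taken at the mean [a] of [|f|]: the linear term
    contributes [c a w] on both sides and cancels. *)
Lemma jensen_powR d (T : measurableType d) (R : realType) (mu : {measure set T -> \bar R})
    (D : set T) (w p : R) (f : T -> R) : (1 < p)%R -> measurable D -> mu D = w%:E -> (0 < w)%R ->
  mu.-integrable D (EFin \o f) ->
  ((`|\int[mu]_(x in D) f x| / w) `^ p)%:E <= (w^-1)%:E * \int[mu]_(x in D) (`|f x| `^ p)%:E.
Proof.
move=> p1 mD muD w0 fi; have mf : measurable_fun D f by apply/measurable_EFinP; exact: measurable_int fi.
have p0 : (0 < p)%R by lra.
have ni := integrable_norm fi.
set a := (\int[mu]_(x in D) `|f x| / w)%R.
have a0 : (0 <= a)%R.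
  by rewrite divr_ge0// ?(ltW w0)//; apply: Rintegral_ge0 => x _.
have aE : \int[mu]_(x in D) (`|f x|)%:E = (a * w)%:E.
  by rewrite /a mulfVK ?gt_eqF// /Rintegral fineK//; exact: integrable_fin_num ni.
apply: (@le_trans _ _ (a `^ p)%:E).
  rewrite lee_fin; apply: ge0_ler_powR; [exact: ltW|by rewrite nnegrE divr_ge0// ltW|by rewrite nnegrE|].
  rewrite ler_wpM2r ?invr_ge0 ?(ltW w0)//.
  exact: le_normr_Rintegral.
rewrite -lee_pdivrMl ?invr_gt0// invrK.
pose c := (p * a `^ (p - 1))%R.
have c0 : (0 <= c)%R by rewrite mulr_ge0 ?powR_ge0// ltW.
have mp : measurable_fun D (fun x => (`|f x| `^ p)%:E).
  by apply/measurable_EFinP; exact: measurable_norm_powR.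
have H : \int[mu]_(x in D) ((a `^ p)%:E + c%:E * (`|f x|)%:E) <=
         \int[mu]_(x in D) ((`|f x| `^ p)%:E + (c * a)%:E).
  apply: ge0_le_integral => //.
  - by move=> x _; apply: adde_ge0; [rewrite lee_fin powR_ge0|apply: mule_ge0; rewrite lee_fin].
  - apply: emeasurable_funD => //; apply: measurable_funeM; apply/measurable_EFinP.
    exact: measurableT_comp mf.
  - by apply: emeasurable_funD.
  move=> x _; rewrite -EFinM -!EFinD lee_fin.
  by have := ler_powR_tangent p1 a0 (normr_ge0 (f x)); rewrite -/c; lra.
have e1 : \int[mu]_(x in D) ((a `^ p)%:E + c%:E * (`|f x|)%:E) = (a `^ p * w + c * (a * w))%:E.
  rewrite ge0_integralD//.
  - rewrite integral_cst// muD ge0_integralZl_EFin//; last first.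
      by apply/measurable_EFinP; exact: measurableT_comp mf.
    by rewrite aE -!EFinM -EFinD.
  - by move=> x _; rewrite lee_fin powR_ge0.
  - by move=> x _; rewrite mule_ge0// lee_fin.
  - apply: measurable_funeM; apply/measurable_EFinP; exact: measurableT_comp mf.
have e2 : \int[mu]_(x in D) ((`|f x| `^ p)%:E + (c * a)%:E) =
    \int[mu]_(x in D) (`|f x| `^ p)%:E + (c * a * w)%:E.
  rewrite ge0_integralD//.
  - by rewrite integral_cst// muD -EFinM.
  - by move=> x _; rewrite lee_fin mulr_ge0.
move: H; rewrite e1 e2 EFinD mulrA leeD2rE//.
by rewrite mulrC.
Qed.

End jensen.

(** * Translation estimate and averages over dyadic cells *)

Section translation_estimate.
Context {R : realType} {n : nat}.
Notation mu := (@leb R n).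
Implicit Types (phi : 'rV[R]_n -> R) (x h : 'rV[R]_n) (Om : set 'rV[R]_n).
Local Open Scope ereal_scope.

Definition grad_energy (p : R) phi : \bar R := \int[mu]_x (enorm (grad phi x) `^ p)%:E.

Let measurable_pow (p : R) (D : set (lebT R n)) (f : lebT R n -> R) : measurable_fun D f ->
  measurable_fun D (fun x => (`|f x| `^ p)%:E).
Proof.
by move=> mf; apply/measurable_EFinP; exact: measurable_norm_powR.
Qed.

Lemma measurable_grad_energy p Om phi (D : set (lebT R n)) : test_fun Om phi ->
  measurable_fun D (fun x : lebT R n => (enorm (grad phi x) `^ p)%:E).
Proof.
move=> tphi; apply/measurable_EFinP; apply: (measurableT_comp (measurable_powR p)).
apply: (@measurable_comp_continuous R n _ (lebT R n) D (grad phi) enorm); last exact: continuous_enorm.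
move=> i; have := measurable_smooth (D := D) (smooth_partial i (test_fun_smooth tphi)).
by congr measurable_fun; apply/funext => x; rewrite mxE.
Qed.

(** Cut the translation into [k+1] equal steps. Discrete Jensen and translation invariance bound the
    left side by the [p]-integral of the difference quotient with step [h/(k+1)], and [k] tends to
    infinity. *)
Lemma translation_estimate p Om phi h : (1 < p)%R -> test_fun Om phi ->
  \int[mu]_x (`|phi (x + h) - phi x|%R `^ p)%:E <= (enorm h `^ p)%:E * grad_energy p phi.
Proof.
move=> p1 tphi; have sphi := test_fun_smooth tphi.
have p0 : (0 < p)%R by lra.
have mphi : measurable_fun setT (phi : lebT R n -> R) by exact: measurable_smooth.
have md b : measurable_fun setT (fun x : lebT R n => phi (x + b) - phi x)%R.
  exact: (measurable_funB (measurable_shift b mphi) mphi).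
have [C [r [C0 H1 H2 H3]]] := diff_quotient_dominated h tphi.
have mq k : measurable_fun setT (diff_quotient phi h k : lebT R n -> R).
  exact: (measurable_funM (measurable_cst _) (md _)).
have mD : measurable_fun setT ((fun x => 'D_h phi x) : lebT R n -> R).
  exact: measurable_smooth (smooth_derive h sphi).
have step k : \int[mu]_x (`|phi (x + h) - phi x|%R `^ p)%:E <=
    \int[mu]_x (`|diff_quotient phi h k x| `^ p)%:E.
  set h' := (k.+1%:R^-1 *: h)%R.
  have N0 : (0 < k.+1%:R :> R)%R by [].
  (* The [j]-th increment along the segment. These telescope to [phi (x + h) - phi x], and each is a
     translate of the increment by [h']. *)
  pose a (j : nat) (x : 'rV[R]_n) := (phi ((x + j%:R *: h') + h') - phi (x + j%:R *: h'))%R.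
  have tele x : (phi (x + h) - phi x = \sum_(j < k.+1) a j x)%R.
    have aux m : (\sum_(j < m) a j x = phi (x + m%:R *: h') - phi x)%R.
      elim: m => [|m IH]; first by rewrite big_ord0 scale0r addr0 subrr.
      rewrite big_ord_recr/= IH /a -natr1 scalerDl scale1r [in RHS]addrA.
      by rewrite addrC addrA subrK.
    by rewrite aux /h' scalerA mulfV ?pnatr_eq0// scale1r.
  apply: (@le_trans _ _ (\int[mu]_x ((k.+1%:R `^ (p - 1))%:E * \sum_(j < k.+1) (`|a j x| `^ p)%:E))).
    apply: ge0_le_integral.
    - exact: measurableT.
    - by move=> x _; rewrite lee_fin powR_ge0.
    - exact: measurable_pow (md h).
    - apply: measurable_funeM; apply: emeasurable_sum => j.
      exact: (measurable_shift (j%:R *: h') (measurable_pow p (md h'))).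
    move=> x _; rewrite sumEFin -EFinM lee_fin tele.
    apply: le_trans (powR_sum_le k p1 (fun j => normr_ge0 (a j x))).
    by apply: ge0_ler_powR; rewrite ?nnegrE ?sumr_ge0 ?(ltW p0)// ler_norm_sum.
  rewrite ge0_integralZl_EFin ?powR_ge0//; last 2 first.
  - by move=> x _; rewrite sume_ge0// => j _; rewrite lee_fin powR_ge0.
  - apply: emeasurable_sum => j.
    exact: (measurable_shift (j%:R *: h') (measurable_pow p (md h'))).
  rewrite ge0_integral_sum; last 3 first.
  - exact: measurableT.
  - by move=> j; exact: (measurable_shift (j%:R *: h') (measurable_pow p (md h'))).
  - by move=> j x _; rewrite lee_fin powR_ge0.
  rewrite (eq_bigr (fun=> \int[mu]_x (`|phi (x + h') - phi x|%R `^ p)%:E)); last first.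
    move=> j _.
    exact: (@ge0_integral_translation R n (j%:R *: h')
      (fun x : lebT R n => (`|phi ((x : 'rV[R]_n) + h') - phi x|%R `^ p)%:E)
      (measurable_pow p (md h')) (fun x => powR_ge0 _ _)).
  have -> : \int[mu]_x (`|diff_quotient phi h k x| `^ p)%:E =
      (k.+1%:R `^ p)%:E * \int[mu]_x (`|phi (x + h') - phi x|%R `^ p)%:E.
    rewrite -ge0_integralZl_EFin ?powR_ge0//; last first.
      exact: measurable_pow (md h').
    apply: eq_integral => x _; rewrite -EFinM /diff_quotient normrM powRM//.
    by rewrite (ger0_norm (ltW N0)).
  set Z := \int[mu]_x _.
  have -> : (\sum_(i < k.+1) Z) = (k.+1%:R)%:E * Z.
    elim: (k.+1) => [|m IH]; first by rewrite big_ord0 mul0e.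
    by rewrite big_ord_recr/= IH -natr1 EFinD ge0_muleDl ?mul1e// lee_fin.
  by rewrite muleA -EFinM powR_mulB1 ?(ltW N0).
have cv : \int[mu]_x (`|diff_quotient phi h k x| `^ p)%:E @[k --> \oo] -->
    \int[mu]_x (`|'D_h phi x| `^ p)%:E.
  apply: (@integral_bounded_cvg R n (fun k x => `|diff_quotient phi h k x| `^ p)%R
    (fun x => `|'D_h phi x| `^ p)%R (C `^ p)%R r).
  - by move=> k; apply/measurable_EFinP; exact: measurable_pow (mq k).
  - by apply/measurable_EFinP; exact: measurable_pow mD.
  - move=> x; have c := @continuous_norm_powR R p p0 ('D_h phi x).
    exact: (cvg_comp _ _ (@cvg_diff_quotient R n phi h x sphi) c).
  - move=> k x; rewrite ger0_norm ?powR_ge0// ge0_ler_powR ?nnegrE//; exact: ltW.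
  - by move=> k x rx; rewrite H3// normr0 powR0// gt_eqF.
apply: (@le_trans _ _ (\int[mu]_x (`|'D_h phi x| `^ p)%:E)).
  rewrite -(cvg_lim (@ereal_hausdorff R) cv); apply: lime_ge; first exact: cvgP cv.
  by apply: nearW => k; exact: step.
rewrite /grad_energy -ge0_integralZl_EFin ?powR_ge0//; last 2 first.
- by move=> x _; rewrite lee_fin powR_ge0.
- exact: measurable_grad_energy tphi.
apply: ge0_le_integral.
- exact: measurableT.
- by move=> x _; rewrite lee_fin powR_ge0.
- exact: measurable_pow mD.
- by apply: measurable_funeM; exact: measurable_grad_energy tphi.
move=> x _; rewrite -EFinM lee_fin -powRM ?enorm_ge0// ge0_ler_powR ?nnegrE ?mulr_ge0 ?enorm_ge0 ?(ltW p0)//.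
by rewrite derive_dotv_grad ?cauchy_schwarz//; exact: smooth_differentiable.
Qed.

End translation_estimate.

Section cell_average.
Context {R : realType} {n : nat}.
Notation mu := (@leb R n).
Implicit Types (phi psi : 'rV[R]_n -> R) (x y : 'rV[R]_n) (k : nat).
Local Open Scope ereal_scope.

Definition cell_volume k : R := ((2 ^+ k) ^- n * @unit_cell_volume R n)%R.

Lemma cell_volume_gt0 k : (0 < cell_volume k)%R.
Proof. by rewrite mulr_gt0 ?unit_cell_volume_gt0// invr_gt0 !exprn_gt0. Qed.

Lemma leb_cellE k x : mu (cell k x) = (cell_volume k)%:E.
Proof. exact: leb_cell. Qed.

(** The floor of [2 s] determines the floor of [s]. *)
Lemma cell_mono k x y : cell k.+1 x y -> cell k x y.
Proof.
move=> H i; have := H i; rewrite exprS -!mulrA.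
move: (2 ^+ k * y 0 i)%R (2 ^+ k * x 0 i)%R => s t st.
have /andP[h1 h2] := Num.Theory.floor_itv (2 * s)%R.
have /andP[h3 h4] := Num.Theory.floor_itv (2 * t)%R.
have /andP[h5 h6] := Num.Theory.floor_itv s.
have /andP[h7 h8] := Num.Theory.floor_itv t.
move: h1 h2 h3 h4 h5 h6 h7 h8; rewrite st; move: (Num.floor (2 * t)%R) (Num.floor s) (Num.floor t) => m a b h1 h2 h3 h4 h5 h6 h7 h8.
have aux (u v : R) (c d : int) : (m%:~R <= 2 * u)%R -> (2 * u < (m + 1)%:~R)%R ->
    (m%:~R <= 2 * v)%R -> (2 * v < (m + 1)%:~R)%R -> (c%:~R <= u)%R -> (u < (c + 1)%:~R)%R ->
    (d%:~R <= v)%R -> (v < (d + 1)%:~R)%R -> (c <= d)%R.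
  move=> g1 g2 g3 g4 g5 g6 g7 g8.
  have i1 : (2 * c < m + 1)%R.
    by rewrite -(@ltr_int R) intrM; apply: le_lt_trans g2; rewrite ler_wpM2l.
  have i2 : (m < 2 * (d + 1))%R.
    by rewrite -(@ltr_int R) intrM; apply: le_lt_trans g3 _; rewrite ltr_pM2l.
  by clear -i1 i2; lia.
apply/eqP; rewrite eq_le; apply/andP; split.
  exact: (aux s t).
exact: (aux t s).
Qed.

(** Any preimage is a union of cells, and cells are countably many: [B m] is the cell whose integer
    label has code [m], or empty. *)
Lemma measurable_cell_const k (f : lebT R n -> R) (D : set (lebT R n)) : measurable D ->
  (forall x y : 'rV[R]_n, cell k x y -> f x = f y) -> measurable_fun D f.
Proof.
move=> mD fc; suff mf : measurable_fun setT f by exact: measurable_funS mf.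
move=> _ Y _; rewrite setTI.
pose key (x : 'rV[R]_n) : {ffun 'I_n -> int} := [ffun i => Num.floor (2 ^+ k * x 0 i)%R].
pose B (m : nat) : set (lebT R n) := [set x : lebT R n | Y (f x) /\ Some (key x) = unpickle m].
have -> : f @^-1` Y = \bigcup_m B m.
  apply/seteqP; split => x /=.
    by move=> Yx; exists (pickle (key x)) => //; split => //; rewrite pickleK.
  by move=> [m _ []].
apply: bigcup_measurable => m _.
have [[x [Yx kx]]|/forallNP none] := pselect (exists x, B m x); last first.
  by rewrite (_ : B m = set0) //; apply/seteqP; split => // x /none.
rewrite (_ : B m = cell k x); first exact: measurable_cell.
apply/seteqP; split => y.
  move=> [_]; rewrite -kx => -[] /ffunP H i; have := H i; rewrite !ffunE//.
move=> H; split; first by rewrite -(fc _ _ H).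
by rewrite -kx; congr Some; apply/ffunP => i; rewrite !ffunE H.
Qed.

Definition cell_avg k phi x : R := (\int[mu]_(y in cell k x) phi y / cell_volume k)%R.

Lemma cell_avg_const k phi x y : cell k x y -> cell_avg k phi x = cell_avg k phi y.
Proof. by move=> /cell_eq xy; rewrite /cell_avg xy. Qed.

Lemma measurable_cell_avg k phi : measurable_fun setT (cell_avg k phi : lebT R n -> R).
Proof. by apply: (@measurable_cell_const k) => // x y; exact: cell_avg_const. Qed.

Lemma cell_avg_pow p k phi (a : R) x : (1 < p)%R -> mu.-integrable setT (EFin \o phi) ->
  (`|cell_avg k phi x - a| `^ p)%:E <=
  ((cell_volume k)^-1)%:E * \int[mu]_(y in cell k x) (`|phi y - a| `^ p)%:E.
Proof.
move=> p1 iphi; have mc := @measurable_cell R n k x.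
have i1 : mu.-integrable (cell k x) (EFin \o phi).
  exact: (integrableS measurableT mc (@subsetT _ _) iphi).
have i2 : mu.-integrable (cell k x) (EFin \o (fun=> a)).
  apply: (@measurable_bounded_integrable _ (lebT R n) R mu (fun=> a) (cell k x) mc).
  - by rewrite [X in X < _](leb_cellE k x) ltry.
  - exact: measurable_cst.
  - by exists `|a|%R; split; [exact: num_real|move=> M aM y _; exact: ltW].
have i3 : mu.-integrable (cell k x) (EFin \o (fun y => phi y - a)%R).
  exact: (integrableB mc i1 i2).
have := jensen_powR p1 mc (leb_cellE k x) (cell_volume_gt0 k) i3.
rewrite (RintegralB mc i1 i2) Rintegral_cst// [X in (_ * fine X)%R](leb_cellE k x)/=.
set I := (\int[mu]_(y in _) phi y)%R.
have -> : (`|I - a * cell_volume k| / cell_volume k = `|cell_avg k phi x - a|)%R.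
  rewrite -[X in (_ / X)%R](gtr0_norm (cell_volume_gt0 k)) -normf_div mulrBl.
  by rewrite mulfK ?gt_eqF// cell_volume_gt0.
by [].
Qed.

Lemma cell_avg_dist k phi (a e : R) x : mu.-integrable setT (EFin \o phi) ->
  (forall y, cell k x y -> (`|phi y - a| <= e)%R) -> (`|cell_avg k phi x - a| <= e)%R.
Proof.
move=> iphi H; have e0 : (0 <= e)%R by exact: le_trans (H x (@cell_refl R n k x)).
(* The pointwise bound is obtained from the Jensen estimate [cell_avg_pow] with exponent 2. *)
have p1 : (1 < 2 :> R)%R by rewrite ltr1n.
rewrite -(@ler_pXn2r _ 2) ?nnegrE//.
have := cell_avg_pow k a x p1 iphi.
rewrite powR_mulrn// -lee_fin => /le_trans; apply.
have mc := @measurable_cell R n k x.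
rewrite lee_pdivrMl ?cell_volume_gt0//.
apply: (@le_trans _ _ (\int[mu]_(y in cell k x) (e ^+ 2)%:E)).
  apply: ge0_le_integral.
  - exact: mc.
  - by move=> y _; rewrite lee_fin powR_ge0.
  - apply/measurable_EFinP; apply: measurable_norm_powR; apply: measurable_funB => //.
    by apply: measurable_funS (@subsetT _ _) _ => //; apply/measurable_EFinP; exact: measurable_int iphi.
  - exact: measurable_cst.
  - by move=> y cy; rewrite lee_fin powR_mulrn// ler_pXn2r ?nnegrE// H.
by rewrite integral_cst// [X in _ * X <= _](leb_cellE k x) muleC -EFinM.
Qed.

End cell_average.

Section cell_approximation.
Context {R : realType} {n : nat}.
Notation mu := (@leb R n).
Notation cellv := (@cell_volume R n).
Implicit Types (phi psi : 'rV[R]_n -> R) (x y : 'rV[R]_n) (k : nat) (Om : set 'rV[R]_n).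
Local Open Scope ereal_scope.

Lemma leb_cball_dyadic k : mu (cball (2 ^+ k)^-1) = (((2 ^+ k) ^- n)%R * fine (mu (cball 1)))%:E.
Proof.
have t0 : (0 < 2 ^+ k :> R)%R by exact: exprn_gt0.
have := lebesgue_outer_affine (0 : 'rV[R]_n) (cball 1) t0.
have -> : (fun y : 'rV[R]_n => (2 ^+ k *: y + 0)%R) @^-1` cball 1 = cball (2 ^+ k)^-1.
  by apply/seteqP; split => y; rewrite /cball/= addr0 normrZ gtr0_norm// -ler_pdivlMl// mulr1.
move=> h; rewrite EFinM fineK; last first.
  by rewrite ge0_fin_numE// leb_cball_fin.
rewrite [mu (cball 1)]h muleA -EFinM mulVf ?mul1e// expf_neq0// gt_eqF//.
Qed.

(** The variable is [z = (h, x)]: the increment of [phi] at [x] by [h], restricted to [|h| <= l], as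
    a function on the product space for Tonelli. *)
Let incr_p p (l : R) phi (z : lebT R n * lebT R n) : \bar R :=
  (\1_(cball l : set (lebT R n)) z.1 * `|phi ((z.1 : 'rV[R]_n) + (z.2 : 'rV[R]_n)) - phi z.2| `^ p)%:E.

Let measurable_incr_p p l phi : continuous phi -> measurable_fun setT (incr_p p l phi).
Proof.
move=> cphi; apply/measurable_EFinP; apply: measurable_funM.
  have m1 : measurable_fun setT (\1_(cball l : set (lebT R n)) : lebT R n -> R).
    by apply: measurable_indic; exact: measurable_cball.
  exact: (measurableT_comp m1 measurable_fst).
apply: measurable_norm_powR; apply: measurable_funB; last first.
  have m2 : measurable_fun setT (phi : lebT R n -> R) by exact: continuous_leb_measurable.
  exact: (measurableT_comp m2 measurable_snd).
apply: (@measurable_comp_continuous R n _ (lebT R n * lebT R n)%type setT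
   (fun z => (z.1 : 'rV[R]_n) + (z.2 : 'rV[R]_n))%R phi) => // i.
have mc := @measurable_coord R n i setT.
have e : measurable_fun setT (fun z : lebT R n * lebT R n => ((z.1 : 'rV[R]_n) 0 i + (z.2 : 'rV[R]_n) 0 i)%R).
  by apply: measurable_funD; [exact: (measurableT_comp mc measurable_fst)|exact: (measurableT_comp mc measurable_snd)].
by congr measurable_fun : e; apply/funext => z; rewrite mxE.
Qed.

(** The ratio of the measures of a sup-norm ball of radius [2^-k] and of a cell of side [2^-k] does
    not depend on [k]; the factor [n^p] compares the Euclidean with the sup norm. *)
Definition cell_approx_cst (p : R) : R :=
  (n%:R `^ p * (fine (mu (cball 1)) / @unit_cell_volume R n))%R.

(** By Jensen the error at [x] is at most the mean of [|phi y - phi x|^p] over the cell, and such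
    [y] are at distance below [2^-k]. Enlarging the cell to a ball of increments [h] and exchanging
    the integrals leaves the translation estimate for each fixed [h]. *)
Lemma cell_avg_approx p k Om phi : (1 < p)%R -> test_fun Om phi -> grad_energy p phi <= 1 ->
  \int[mu]_x (`|cell_avg k phi x - phi x| `^ p)%:E <= (cell_approx_cst p * ((2 ^+ k)^-1 `^ p))%:E.
Proof.
move=> p1 tphi G1; have sphi := test_fun_smooth tphi.
have cphi := smooth_continuous sphi.
have iphi := integrable_test_fun tphi.
have p0 : (0 <= p)%R by lra.
have mphi : measurable_fun setT (phi : lebT R n -> R) by exact: measurable_smooth.
set l := (2 ^+ k)^-1%R; have l0 : (0 < l)%R by rewrite invr_gt0 exprn_gt0.
have w0 := @cell_volume_gt0 R n k.
have wi0 : 0 <= ((cellv k)^-1)%:E by rewrite lee_fin invr_ge0 ltW.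
have F0 z : 0 <= incr_p p l phi z by rewrite lee_fin mulr_ge0// powR_ge0.
have mF := @measurable_incr_p p l phi cphi.
have mFx x : measurable_fun setT (fun h : lebT R n => incr_p p l phi (h, x)).
  exact: (measurableT_comp mF (measurable_pair2 (x : lebT R n))).
have mG : measurable_fun setT (fun x : lebT R n => \int[mu]_h incr_p p l phi (h, x)).
  exact: (measurable_fun_fubini_tonelli_G (m1 := mu) (incr_p p l phi) mF F0).
have step1 x : (`|cell_avg k phi x - phi x| `^ p)%:E <=
    ((cellv k)^-1)%:E * \int[mu]_h incr_p p l phi (h, x).
  apply: le_trans (cell_avg_pow k (phi x) x p1 iphi) _.
  apply: (lee_wpmul2l wi0).
  (* Change of variable [h = y - x], so that both sides are integrals in [y]. *)
  rewrite -(@ge0_integral_translation R n (- x)%R (fun h => incr_p p l phi (h, x)) (mFx x) (fun h => F0 _)).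
  rewrite integral_mkcond; apply: ge0_le_integral.
  - exact: measurableT.
  - by move=> y _; rewrite patchE; case: ifP => // _; rewrite lee_fin powR_ge0.
  - apply/(measurable_restrictT _ (@measurable_cell R n k x)).
    apply/measurable_EFinP; apply: measurable_norm_powR.
    apply: (measurable_funS measurableT (@subsetT _ _)).
    exact: (measurable_funB mphi (measurable_cst _)).
  - exact: (measurable_shift (- x)%R (mFx x)).
  move=> y _; rewrite patchE; case: ifPn => // /[!inE] yx.
  rewrite /incr_p /= subrK lee_fin indicE mem_set ?mul1r//.
  by apply: ltW; exact: cell_norm_lt.
apply: (@le_trans _ _ (\int[mu]_x (((cellv k)^-1)%:E * \int[mu]_h incr_p p l phi (h, x)))).
  apply: ge0_le_integral.
  - exact: measurableT.
  - by move=> x _; rewrite lee_fin powR_ge0.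
  - apply/measurable_EFinP; apply: measurable_norm_powR.
    exact: (measurable_funB (measurable_cell_avg k phi) mphi).
  - exact: (measurable_funeM _ mG).
  - by move=> x _; exact: step1.
rewrite ge0_integralZl_EFin ?invr_ge0 ?(ltW w0)//; last first.
  by move=> x _; exact: integral_ge0.
rewrite -(fubini_tonelli (m1 := mu) (m2 := mu) (incr_p p l phi) mF F0).
apply: (@le_trans _ _ (((cellv k)^-1)%:E * \int[mu]_(h in cball l) ((n%:R * l) `^ p)%:E)).
  apply: (lee_wpmul2l wi0).
  rewrite [leRHS]integral_mkcond; apply: ge0_le_integral.
  - exact: measurableT.
  - by move=> h _; exact: integral_ge0.
  - exact: (measurable_fun_fubini_tonelli_F (m2 := mu) (incr_p p l phi) mF F0).
  - by apply/(measurable_restrictT _ (measurable_cball l)); exact: measurable_cst.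
  move=> h _; rewrite patchE; case: ifPn => hl.
    apply: (@le_trans _ _ (\int[mu]_x (`|phi (x + h)%R - phi x| `^ p)%:E)).
      rewrite le_eqVlt; apply/orP; left; apply/eqP; apply: eq_integral => x _.
      by rewrite /incr_p/= indicE hl mul1r [X in phi X]addrC.
    apply: (le_trans (translation_estimate h p1 tphi)).
    rewrite -[leRHS]mule1; apply: lee_pmul => //; rewrite ?lee_fin ?powR_ge0//.
      by apply: integral_ge0 => x _; rewrite lee_fin powR_ge0.
    rewrite ge0_ler_powR ?nnegrE ?enorm_ge0 ?mulr_ge0 ?(ltW l0)//.
    apply: (le_trans (enorm_le_norm _)); rewrite ler_wpM2l//.
    by move: hl; rewrite inE.
  rewrite integral0_eq// => x _; rewrite /incr_p/= indicE (negbTE hl) mul0r//.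
rewrite integral_cst; last exact: measurable_cball.
rewrite [X in _ * (_ * X)](leb_cball_dyadic k).
rewrite -!EFinM lee_fin /cell_approx_cst powRM ?(ltW l0)//.
rewrite le_eqVlt; apply/orP; left; apply/eqP.
rewrite /cell_volume; field.
by rewrite !expf_neq0//= gt_eqF// unit_cell_volume_gt0.
Qed.

End cell_approximation.

Lemma integral_powRD d (T : measurableType d) (R : realType) (mu : {measure set T -> \bar R})
    (D : set T) (r c1 c2 : R) (f g : T -> R) : measurable D -> measurable_fun D f ->
  measurable_fun D g -> 0 <= r -> 0 <= c1 -> 0 <= c2 ->
  (forall a b, 0 <= a -> 0 <= b -> (a + b) `^ r <= c1 * a `^ r + c2 * b `^ r) ->
  (\int[mu]_(x in D) (`|(f x + g x)%R| `^ r)%:E <=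
   c1%:E * \int[mu]_(x in D) (`|f x| `^ r)%:E + c2%:E * \int[mu]_(x in D) (`|g x| `^ r)%:E)%E.
Proof.
move=> mD mf mg r0 c10 c20 H.
have mfr : measurable_fun D (fun x => (`|f x| `^ r)%:E).
  by apply/measurable_EFinP; exact: measurable_norm_powR.
have mgr : measurable_fun D (fun x => (`|g x| `^ r)%:E).
  by apply/measurable_EFinP; exact: measurable_norm_powR.
have mfgr : measurable_fun D (fun x => (`|(f x + g x)%R| `^ r)%:E).
  by apply/measurable_EFinP; apply: measurable_norm_powR; exact: measurable_funD.
have f0 x : D x -> (0 <= (`|f x| `^ r)%:E)%E by rewrite lee_fin powR_ge0.
have g0 x : D x -> (0 <= (`|g x| `^ r)%:E)%E by rewrite lee_fin powR_ge0.
rewrite -ge0_integralZl_EFin// -ge0_integralZl_EFin//.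
rewrite -ge0_integralD//.
- apply: ge0_le_integral => //.
  + by apply: emeasurable_funD; exact: measurable_funeM.
  + move=> x Dx; rewrite -!EFinM -EFinD lee_fin.
    apply: le_trans (H _ _ (normr_ge0 _) (normr_ge0 _)).
    by apply: ge0_ler_powR; rewrite ?nnegrE ?addr_ge0// ler_normD.
- by move=> x Dx; apply: mule_ge0; [rewrite lee_fin|exact: f0].
- exact: measurable_funeM.
- by move=> x Dx; apply: mule_ge0; [rewrite lee_fin|exact: g0].
- exact: measurable_funeM.
Qed.

Lemma integral_powRD_le d (T : measurableType d) (R : realType) (mu : {measure set T -> \bar R})
    (D : set T) (r : R) (f g : T -> R) : measurable D -> measurable_fun D f ->
  measurable_fun D g -> 0 <= r ->
  (\int[mu]_(x in D) (`|(f x + g x)%R| `^ r)%:E <= (2 `^ r)%:E *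
   (\int[mu]_(x in D) (`|f x| `^ r)%:E + \int[mu]_(x in D) (`|g x| `^ r)%:E))%E.
Proof.
move=> mD mf mg r0; rewrite ge0_muleDr; last 2 first.
- by apply: integral_ge0 => x _; rewrite lee_fin powR_ge0.
- by apply: integral_ge0 => x _; rewrite lee_fin powR_ge0.
apply: integral_powRD; rewrite ?powR_ge0// => a b a0 b0.
by rewrite -mulrDr powRD_le.
Qed.

Lemma powR_inv_expn (R : realType) k (e : R) : (2 ^+ k)^-1 `^ e = (2^-1 `^ e) ^+ k.
Proof.
elim: k => [|k IH]; first by rewrite !expr0 invr1 powR1.
by rewrite !exprS invfM powRM ?IH ?invr_ge0 ?exprn_ge0.
Qed.

Section cell_increment.
Context {R : realType} {n : nat}.
Notation mu := (@leb R n).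
Notation cellv := (@cell_volume R n).
Notation K0 := (@cell_approx_cst R n).
Implicit Types (phi psi : 'rV[R]_n -> R) (x y : 'rV[R]_n) (k : nat) (Om : set 'rV[R]_n).
Local Open Scope ereal_scope.

Lemma cell_approx_cst_ge0 p : (0 <= K0 p)%R.
Proof.
apply: mulr_ge0; first exact: powR_ge0.
by apply: divr_ge0; [exact: fine_ge0|exact: ltW (@unit_cell_volume_gt0 R n)].
Qed.

Definition cell_incr k phi x : R := (cell_avg k.+1 phi x - cell_avg k phi x)%R.

Lemma measurable_cell_incr k phi : measurable_fun setT (cell_incr k phi : lebT R n -> R).
Proof. exact: (measurable_funB (measurable_cell_avg _ _) (measurable_cell_avg _ _)). Qed.

Let ia p k : R := (2 `^ p * 2 * K0 p * (2 ^+ k)^-1 `^ p)%R.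

Lemma cell_incr_p p k Om phi : (1 < p)%R -> test_fun Om phi -> grad_energy p phi <= 1 ->
  \int[mu]_x (`|cell_incr k phi x| `^ p)%:E <= (ia p k)%:E.
Proof.
move=> p1 tphi G1; have p0 : (0 <= p)%R by lra.
have mphi : measurable_fun setT (phi : lebT R n -> R) by exact: measurable_smooth (test_fun_smooth tphi).
have ma j : measurable_fun setT (fun x : lebT R n => (cell_avg j phi x - phi x)%R).
  exact: (measurable_funB (measurable_cell_avg _ _) mphi).
have mb j : measurable_fun setT (fun x : lebT R n => (phi x - cell_avg j phi x)%R).
  exact: (measurable_funB mphi (measurable_cell_avg _ _)).
have H := @integral_powRD_le _ (lebT R n) R mu setT p _ _ measurableT (ma k.+1) (mb k) p0.
have -> : \int[mu]_x (`|cell_incr k phi x| `^ p)%:E =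
    \int[mu]_x (`|cell_avg k.+1 phi x - phi x + (phi x - cell_avg k phi x)| `^ p)%:E.
  by apply: eq_integral => x _; rewrite addrA subrK.
apply: (le_trans H); rewrite /ia.
have h1 := cell_avg_approx k.+1 p1 tphi G1.
have h2 : \int[mu]_x (`|phi x - cell_avg k phi x| `^ p)%:E <= (K0 p * (2 ^+ k)^-1 `^ p)%:E.
  have -> : \int[mu]_x (`|phi x - cell_avg k phi x| `^ p)%:E = \int[mu]_x (`|cell_avg k phi x - phi x| `^ p)%:E.
    by apply: eq_integral => x _; rewrite distrC.
  exact: (cell_avg_approx k p1 tphi G1).
have h3 : \int[mu]_x (`|cell_avg k.+1 phi x - phi x| `^ p)%:E <= (K0 p * (2 ^+ k)^-1 `^ p)%:E.
  apply: (le_trans h1); rewrite lee_fin ler_wpM2l ?cell_approx_cst_ge0//.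
  apply: ge0_ler_powR => //; rewrite ?nnegrE ?invr_ge0 ?exprn_ge0//.
  by rewrite lef_pV2 ?posrE ?exprn_gt0// ler_eXn2l ?ltr1n.
have -> : (2 `^ p * 2 * K0 p * (2 ^+ k)^-1 `^ p = 2 `^ p * (K0 p * (2 ^+ k)^-1 `^ p + K0 p * (2 ^+ k)^-1 `^ p) :> R)%R by ring.
rewrite EFinM EFinD; apply: lee_wpmul2l; [by rewrite lee_fin powR_ge0|exact: (leeD h3 h2)].
Qed.

(** The increment is constant on each cell of level [k+1], so its [p]-th power times the volume of
    one cell is part of the whole integral. *)
Lemma cell_incr_sup p k Om phi x : (1 < p)%R -> test_fun Om phi -> grad_energy p phi <= 1 ->
  (`|cell_incr k phi x| `^ p <= ia p k / cellv k.+1)%R.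
Proof.
move=> p1 tphi G1; rewrite ler_pdivlMr ?cell_volume_gt0// -lee_fin.
apply: le_trans (cell_incr_p k p1 tphi G1).
have mc := @measurable_cell R n k.+1 x.
rewrite EFinM -(leb_cellE k.+1 x) -(integral_cst mu mc).
have mi : measurable_fun setT (fun x : lebT R n => (`|cell_incr k phi x| `^ p)%:E).
  by apply/measurable_EFinP; apply: measurable_norm_powR; exact: measurable_cell_incr.
apply: (@le_trans _ _ (\int[mu]_(y in cell k.+1 x) (`|cell_incr k phi y| `^ p)%:E)); last first.
  by apply: (ge0_subset_integral _ mc measurableT mi) => // y _; rewrite lee_fin powR_ge0.
rewrite le_eqVlt; apply/orP; left; apply/eqP; apply: eq_integral => y; rewrite inE => xy.
by rewrite /cell_incr (cell_avg_const phi xy) (cell_avg_const phi (cell_mono xy)).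
Qed.

(** Interpolation between the [L^p] bound, of order [2^(-k p)], and the sup bound, whose [p]-th
    power is of order [2^(-k (p - n))]. With [s = (r - p)/p] the total rate is [e = p + (p - n) s],
    and [p e = p r - n (r - p)] is positive by subcriticality. *)
Lemma cell_incr_r p r : (1 < p)%R -> (p < r)%R -> (n%:R * (r - p) < p * r)%R ->
  exists K d : R, [/\ (0 <= K)%R, (0 < d < 1)%R & forall k Om phi, test_fun Om phi -> grad_energy p phi <= 1 ->
  \int[mu]_x (`|cell_incr k phi x| `^ r)%:E <= (K * d ^+ k)%:E].
Proof.
move=> p1 pr crit; have p0 : (0 < p)%R by lra.
pose s : R := ((r - p) / p)%R; have s0 : (0 < s)%R by rewrite divr_gt0// subr_gt0.
pose e : R := (p + (p - n%:R) * s)%R.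
have e0 : (0 < e)%R.
  rewrite -(pmulr_rgt0 _ p0) /e mulrDr mulrCA /s (mulrCA p) mulfV ?gt_eqF// mulr1; nra.
pose c := @unit_cell_volume R n; have c0 : (0 < c)%R by exact: unit_cell_volume_gt0.
pose a : R := (2 `^ p * 2 * K0 p)%R.
have a0 : (0 <= a)%R by rewrite mulr_ge0 ?cell_approx_cst_ge0// mulr_ge0// powR_ge0.
pose A : R := (a * 2 ^+ n / c)%R.
have A0 : (0 <= A)%R by exact: (divr_ge0 (mulr_ge0 a0 (exprn_ge0 n (ler0n R 2))) (ltW c0)).
exists (A `^ s * a)%R, (2^-1 `^ e)%R; split.
- by rewrite mulr_ge0// powR_ge0.
- rewrite powR_gt0 ?invr_gt0//=.
  apply: (@lt_le_trans _ _ (1 `^ e))%R; last by rewrite powR1.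
  by apply: gt0_ltr_powR => //; rewrite ?nnegrE ?invr_ge0// invf_lt1// ltr1n.
move=> k Om phi tphi G1.
have mi (q : R) : measurable_fun setT (fun x : lebT R n => (`|cell_incr k phi x| `^ q)%:E).
  by apply/measurable_EFinP; apply: measurable_norm_powR; exact: measurable_cell_incr.
set l : R := ((2 ^+ k)^-1)%R; have l0 : (0 < l)%R by rewrite invr_gt0 exprn_gt0.
have iaE : ia p k = (a * l `^ p)%R by [].
have ratE : (ia p k / cellv k.+1 = A * l `^ (p - n%:R))%R.
  have e1 : (l `^ (p - n%:R) = l `^ p / l ^+ n)%R.
    by rewrite powRB ?powR_mulrn ?(ltW l0)//; apply/implyP => _; rewrite gt_eqF.
  rewrite e1 iaE /A /cell_volume -/c.
  move: (l `^ p)%R => lp; rewrite /l exprS exprMn exprVn.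
  have X0 : (2 ^+ k ^+ n != 0 :> R)%R by rewrite !expf_neq0.
  have Y0 : (2 ^+ n != 0 :> R)%R by rewrite expf_neq0.
  move: (2 ^+ k ^+ n)%R (2 ^+ n)%R X0 Y0 => X Y X0 Y0; field.
  by rewrite X0 Y0 gt_eqF.
have ia0 : (0 <= ia p k)%R by rewrite iaE mulr_ge0 ?powR_ge0.
apply: (@le_trans _ _ (\int[mu]_x (((A * l `^ (p - n%:R)) `^ s)%:E * (`|cell_incr k phi x| `^ p)%:E))).
  apply: ge0_le_integral.
  - exact: measurableT.
  - by move=> x _; rewrite lee_fin powR_ge0.
  - exact: mi.
  - exact: measurable_funeM (mi p).
  move=> x _; rewrite -EFinM lee_fin.
  have -> : r = (p * s + p)%R by rewrite /s mulrCA mulfV ?gt_eqF// mulr1 subrK.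
  rewrite powRD; last by apply/implyP; rewrite gt_eqF// addr_gt0// mulr_gt0.
  rewrite ler_wpM2r ?powR_ge0// powRrM; apply: ge0_ler_powR; rewrite ?nnegrE ?powR_ge0//.
  - exact: ltW.
  - by rewrite mulr_ge0// powR_ge0.
  - by rewrite -ratE; exact: cell_incr_sup p1 tphi G1.
rewrite ge0_integralZl_EFin ?powR_ge0//.
apply: (@le_trans _ _ (((A * l `^ (p - n%:R)) `^ s)%:E * (ia p k)%:E)).
  by apply: lee_wpmul2l; [rewrite lee_fin powR_ge0|exact: cell_incr_p p1 tphi G1].
rewrite -EFinM lee_fin iaE powRM ?powR_ge0// -powR_inv_expn -/l -powRrM.
rewrite /e [(p + _)%R]addrC powRD; last by apply/implyP => _; rewrite gt_eqF.
by rewrite le_eqVlt; apply/orP; left; apply/eqP; ring.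
Qed.

End cell_increment.

Section cell_limit.
Context {R : realType} {n : nat}.
Notation mu := (@leb R n).
Implicit Types (phi psi : 'rV[R]_n -> R) (x y : 'rV[R]_n) (k : nat) (Om : set 'rV[R]_n).

Lemma cell_avg_le k phi M x : mu.-integrable setT (EFin \o phi) ->
  (forall y, `|phi y| <= M) -> `|cell_avg k phi x| <= M.
Proof. by move=> iphi H; rewrite -[X in `|X|]subr0; apply: cell_avg_dist => // y _; rewrite subr0. Qed.

Lemma cell_avg_out k phi rho x : mu.-integrable setT (EFin \o phi) ->
  (forall y, rho < `|y| -> phi y = 0) -> rho + 1 < `|x| -> cell_avg k phi x = 0.
Proof.
move=> iphi H rx; apply/eqP; rewrite -normr_le0 -[X in `|X|]subr0.
apply: cell_avg_dist => // y cy; rewrite H ?subr0 ?normr0//.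
have h1 := cell_norm_lt cy.
have h2 : (2 ^+ k)^-1 <= 1 :> R by rewrite invf_le1 ?exprn_gt0// exprn_ege1// ler1n.
have := ler_normB y (y - x); rewrite opprB addrCA subrr addr0; lra.
Qed.

Lemma cvg_cell_avg phi x : mu.-integrable setT (EFin \o phi) -> continuous phi ->
  cell_avg k phi x @[k --> \oo] --> phi x.
Proof.
move=> iphi cphi; apply/cvgrPdist_le => e e0.
have /cvgrPdist_le/(_ _ e0) := cphi x; move/nbhs_ballP => [d /= d0 H].
have c0 : (2^-1 : R) ^+ k @[k --> \oo] --> (0 : R).
  by apply: cvg_expr; rewrite ger0_norm ?invr_ge0// invf_lt1// ltr1n.
have /cvgrPdist_lt/(_ _ d0) := c0; apply: filterS => k.
rewrite sub0r normrN exprVn ger0_norm ?invr_ge0 ?exprn_ge0// => kd.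
rewrite distrC; apply: cell_avg_dist => // y cy.
rewrite distrC; apply: H; rewrite -ball_normE/= distrC.
exact: lt_trans (cell_norm_lt cy) kd.
Qed.

Local Open Scope ereal_scope.

(** Induction on the number [m] of levels, peeling off the coarsest increment. The splitting
    constant [1 + e] must not destroy the geometric decay. *)
Lemma cell_avg_tail p r : (1 < p)%R -> (p < r)%R -> (n%:R * (r - p) < p * r)%R ->
  exists B d : R, [/\ (0 <= B)%R, (0 < d < 1)%R & forall Om phi, test_fun Om phi ->
    grad_energy p phi <= 1 -> forall m k,
  \int[mu]_x (`|cell_avg (k + m) phi x - cell_avg k phi x| `^ r)%:E <= (B * d ^+ k)%:E].
Proof.
move=> p1 pr crit; have r0 : (0 < r)%R by lra.
have [K [d [K0 /andP[d0 d1] H]]] := cell_incr_r p1 pr crit.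
(* Chosen so that [(1 + e) d = (1 + d)/2 < 1]. The induction then closes with [B] solving
   [(1 + e) B d + C K = B]. *)
pose e : R := ((1 - d) / (2 * d))%R.
have e0 : (0 < e)%R by rewrite divr_gt0 ?mulr_gt0// subr_gt0.
have [C C0 HC] := powRD_le_eps r0 e0.
pose B : R := (2 * C * K / (1 - d))%R.
have B0 : (0 <= B)%R.
  by apply: divr_ge0; [apply: mulr_ge0 => //; exact: mulr_ge0|rewrite subr_ge0 ltW].
exists B, d; split => //; first by rewrite d0 d1.
move=> Om phi tphi G1; elim=> [|m IH] k.
  rewrite integral0_eq ?lee_fin; first by rewrite mulr_ge0// exprn_ge0// ltW.
  by move=> x _; rewrite addn0 subrr normr0 powR0// gt_eqF.
have ma j l : measurable_fun setT (fun x : lebT R n => (cell_avg j phi x - cell_avg l phi x)%R).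
  exact: (measurable_funB (measurable_cell_avg _ _) (measurable_cell_avg _ _)).
have e1 : (0 <= 1 + e)%R by rewrite addr_ge0// ltW.
have T := @integral_powRD _ (lebT R n) R mu setT r (1 + e)%R C _ _ measurableT
  (ma (k.+1 + m)%N k.+1) (measurable_cell_incr k phi) (ltW r0) e1 C0 HC.
apply: (@le_trans _ _ ((1 + e)%:E * (B * d ^+ k.+1)%:E + C%:E * (K * d ^+ k)%:E)).
  apply: le_trans (le_trans _ T) _.
    rewrite le_eqVlt; apply/orP; left; apply/eqP; apply: eq_integral => x _.
    by rewrite /cell_incr addrA subrK addSnnS.
  by apply: leeD; apply: lee_wpmul2l; rewrite ?lee_fin//; exact: H tphi G1.
rewrite -!EFinM -EFinD lee_fin le_eqVlt; apply/orP; left; apply/eqP.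
rewrite exprS /e /B; field.
by rewrite (gt_eqF d0) subr_eq0 gt_eqF.
Qed.

Lemma cell_avg_approx_r p r : (1 < p)%R -> (p < r)%R -> (n%:R * (r - p) < p * r)%R ->
  exists B d : R, [/\ (0 <= B)%R, (0 < d < 1)%R & forall Om phi, test_fun Om phi ->
    grad_energy p phi <= 1 -> forall k,
  \int[mu]_x (`|phi x - cell_avg k phi x| `^ r)%:E <= (B * d ^+ k)%:E].
Proof.
move=> p1 pr crit; have r0 : (0 < r)%R by lra.
have [B [d [B0 d01 H]]] := cell_avg_tail p1 pr crit.
exists B, d; split => // Om phi tphi G1 k.
have iphi := integrable_test_fun tphi.
have [M HM] := test_fun_bounded tphi.
have M0 : (0 <= M)%R by exact: le_trans (HM 0%R).
have [rho rho0 Hrho] := test_fun_out_cball tphi.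
have sphi := test_fun_smooth tphi.
have mf (f g : lebT R n -> R) : measurable_fun setT f -> measurable_fun setT g ->
    measurable_fun setT (fun x : lebT R n => `|(f x - g x)%R| `^ r)%R.
  by move=> mf mg; apply: measurable_norm_powR; exact: (measurable_funB mf mg).
have cv : \int[mu]_x ((`|cell_avg (k + m) phi x - cell_avg k phi x| `^ r)%:E) @[m --> \oo] -->
    \int[mu]_x ((`|phi x - cell_avg k phi x| `^ r)%:E).
  apply: (@integral_bounded_cvg R n (fun m x => `|cell_avg (k + m) phi x - cell_avg k phi x| `^ r)%R
    (fun x => `|phi x - cell_avg k phi x| `^ r)%R ((M + M) `^ r)%R (rho + 1)%R).
  - by move=> m; apply: mf; exact: measurable_cell_avg.
  - by apply: mf; [exact: measurable_smooth|exact: measurable_cell_avg].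
  - move=> x; have c1 : (cell_avg (k + m) phi x - cell_avg k phi x)%R @[m --> \oo] --> (phi x - cell_avg k phi x)%R.
      apply: cvgB; last exact: cvg_cst.
      apply: (@cvg_comp _ _ _ (fun m => k + m)%N (fun j => cell_avg j phi x) _ \oo _ (cvg_addnl k)); exact: cvg_cell_avg (smooth_continuous sphi).
    exact: (cvg_comp _ _ c1 (@continuous_norm_powR R r r0 _)).
  - move=> m x; rewrite ger0_norm ?powR_ge0//; apply: ge0_ler_powR; rewrite ?nnegrE ?addr_ge0 ?(ltW r0)//.
    by apply: (le_trans (ler_normB _ _)); apply: lerD; exact: cell_avg_le.
  - move=> m x rx; rewrite !(cell_avg_out _ iphi Hrho rx) subr0 normr0 powR0// gt_eqF//.
rewrite -(cvg_lim (@ereal_hausdorff R) cv); apply: lime_le; first exact: cvgP cv.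
by apply: nearW => m; exact: H tphi G1 _ _.
Qed.

(** The shift by [2 rho + 1] in every coordinate moves [Om] out of the ball, so [phi (x + h) = 0]
    where [phi x] is nonzero and the translation estimate applies to [phi] itself. *)
Lemma poincare p rho Om phi : (0 < n)%N -> (1 < p)%R -> (0 <= rho)%R -> Om `<=` cball rho ->
  test_fun Om phi -> grad_energy p phi <= 1 ->
  \int[mu]_x (`|phi x| `^ p)%:E <= ((n%:R * (2 * rho + 1)) `^ p)%:E.
Proof.
move=> n0 p1 rho0 Orho tphi G1; have p0 : (0 <= p)%R by lra.
pose h : 'rV[R]_n := const_mx (2 * rho + 1)%R.
have a0 : (0 <= 2 * rho + 1)%R by rewrite addr_ge0// mulr_ge0.
have mphi : measurable_fun setT (phi : lebT R n -> R) by exact: measurable_smooth (test_fun_smooth tphi).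
apply: (@le_trans _ _ (\int[mu]_x (`|phi (x + h)%R - phi x| `^ p)%:E)).
  apply: ge0_le_integral.
  - exact: measurableT.
  - by move=> x _; rewrite lee_fin powR_ge0.
  - by apply/measurable_EFinP; exact: measurable_norm_powR.
  - apply/measurable_EFinP; apply: measurable_norm_powR.
    exact: (measurable_funB (measurable_shift h mphi) mphi).
  move=> x _; rewrite lee_fin.
  have [->|px] := eqVneq (phi x) 0%R.
    by rewrite normr0 powR0 ?powR_ge0// gt_eqF//; lra.
  have Ox : Om x by apply/not_notP => /(test_fun_out tphi) px0; rewrite px0 eqxx in px.
  have xr : (`|(x : 'rV[R]_n)| <= rho)%R := Orho _ Ox.
  rewrite (test_fun_out tphi (x := (x + h)%R)) ?sub0r ?normrN// => /Orho xh.
  have := ler_coord_norm (x + h)%R (Ordinal n0); rewrite !mxE => g1.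
  have g2 := ler_coord_norm x (Ordinal n0).
  have g3 := ler_norm (x 0 (Ordinal n0) + (2 * rho + 1))%R.
  have := ler_norm (- x 0 (Ordinal n0))%R; rewrite normrN => g4.
  move: xh; rewrite /cball/= => xh; lra.
apply: (le_trans (translation_estimate h p1 tphi)).
rewrite -[leRHS]mule1; apply: lee_pmul => //; rewrite ?lee_fin ?powR_ge0//.
  by apply: integral_ge0 => x _; rewrite lee_fin powR_ge0.
apply: ge0_ler_powR; rewrite ?nnegrE ?enorm_ge0 ?mulr_ge0//.
apply: (le_trans (enorm_le_norm _)); rewrite ler_wpM2l//.
by apply: normrV_le => // i; rewrite mxE ger0_norm.
Qed.

Definition cell_avg_bound p rho k : R :=
  (((n%:R * (2 * rho + 1)) `^ p / @cell_volume R n k) `^ p^-1)%R.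

Lemma cell_avg_boundP p rho Om phi k x : (0 < n)%N -> (1 < p)%R -> (0 <= rho)%R -> Om `<=` cball rho ->
  test_fun Om phi -> grad_energy p phi <= 1 -> (`|cell_avg k phi x| <= cell_avg_bound p rho k)%R.
Proof.
move=> n0 p1 rho0 Orho tphi G1; have p0 : (0 < p)%R by lra.
have w0 := @cell_volume_gt0 R n k.
rewrite -[leLHS](@powRr1 R)// -(mulfV (lt0r_neq0 p0)) powRrM.
apply: ge0_ler_powR; rewrite ?nnegrE ?invr_ge0 ?powR_ge0 ?(ltW p0)//.
  by rewrite divr_ge0 ?powR_ge0// ltW.
rewrite -lee_fin -[X in `|X|%R]subr0.
apply: le_trans (cell_avg_pow k 0 x p1 (integrable_test_fun tphi)) _.
rewrite mulrC EFinM; apply: lee_wpmul2l; first by rewrite lee_fin invr_ge0 ltW.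
apply: le_trans (poincare n0 p1 rho0 Orho tphi G1).
under eq_integral do rewrite subr0.
apply: ge0_subset_integral.
- exact: measurable_cell.
- exact: measurableT.
- apply/measurable_EFinP; apply: measurable_norm_powR.
  exact: measurable_smooth (test_fun_smooth tphi).
- by move=> y _; rewrite lee_fin powR_ge0.
- by [].
Qed.

End cell_limit.

(** A cluster point [l] of the sequence of rows exists in the compact product of segments. The index
    [s j] is taken beyond [j] and close to [l], within [1/(j+1)], in the first [j] coordinates. The
    extraction need not be increasing; [i <= s i] already preserves limits. *)
Lemma diagonal_cvg (R : realType) (v : nat -> nat -> R) (M : nat -> R) :
  (forall i m, `|v i m| <= M m) -> exists (s : nat -> nat) (l : nat -> R),
  (forall i, (i <= s i)%N) /\ forall m, v (s i) m @[i --> \oo] --> l m.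
Proof.
move=> vM; pose T (i : nat) : topologicalType := R.
have cK := @tychonoff _ T (fun m => [set` `[- M m, M m]]) (fun m => @segment_compact R _ _).
pose F : set_system (prod_topology T) := (v : nat -> prod_topology T) @ \oo.
have FF : ProperFilter F by exact: fmap_proper_filter.
have [|l [_ cl]] := cK F FF.
  by exists 0%N => // i _ m; rewrite /= in_itv/= -ler_norml.
have Hj j : exists i, (j <= i)%N /\ forall m, (m < j)%N -> `|l m - v i m| < j.+1%:R^-1.
  have FA : F [set f | exists2 i, (j <= i)%N & f = v i] by exists j => // i ji; exists i.
  have nB : nbhs l [set f : prod_topology T | forall m : 'I_j, `|l m - f m| < j.+1%:R^-1].
    have FN : Filter (nbhs (l : prod_topology T)) by exact: nbhs_filter.
    apply: (@filter_forall _ 'I_j (fun m (f : prod_topology T) => `|l m - f m| < j.+1%:R^-1) _ FN) => m.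
    have := @proj_continuous _ T m l.
    by move/cvgrPdist_lt; apply; rewrite invr_gt0.
  have [f [[i ji ->] H]] := cl _ _ FA nB.
  by exists i; split => // m mj; exact: (H (Ordinal mj)).
have [s Hs] := choice Hj.
exists s, l; split; first by move=> i; have [] := Hs i.
move=> m; apply/cvgrPdist_lt => e e0.
have : (k.+1%:R^-1 : R) @[k --> \oo] --> (0 : R) by exact: cvg_harmonic.
move/cvgrPdist_lt => /(_ _ e0) h; near=> i.
apply: (@lt_trans _ _ i.+1%:R^-1).
  by have [_] := Hs i; apply; near: i; exists m.+1.
have : `|0 - i.+1%:R^-1| < e by near: i.
by rewrite sub0r normrN ger0_norm// invr_ge0.
Unshelve. all: by end_near. Qed.

(** * Sobolev inequality and Rellich compactness for test functions *)

Section sobolev_compactness.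
Context {R : realType} {n : nat}.
Notation mu := (@leb R n).
Implicit Types (phi psi : 'rV[R]_n -> R) (x y : 'rV[R]_n) (k : nat) (Om : set 'rV[R]_n).
Local Open Scope ereal_scope.

Lemma integral_cball_le (f : lebT R n -> R) (C r : R) : measurable_fun setT f ->
  (forall x, 0 <= f x)%R -> (forall x, f x <= C)%R -> (forall x : 'rV[R]_n, r < `|x| -> f x = 0)%R ->
  \int[mu]_x (f x)%:E <= (C * fine (mu (cball r)))%:E.
Proof.
move=> mf f0 fC fr; have mc := @measurable_cball R n r.
rewrite EFinM fineK; last by rewrite ge0_fin_numE// leb_cball_fin.
rewrite -(integral_cst mu mc) [leRHS]integral_mkcond.
apply: ge0_le_integral.
- exact: measurableT.
- by move=> x _; rewrite lee_fin.
- exact/measurable_EFinP.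
- by apply/(measurable_restrictT _ mc); exact: measurable_cst.
move=> x _; rewrite patchE; case: ifPn => [_|xr]; first by rewrite lee_fin.
by rewrite fr// ltNge; apply/negP => h; move: xr; rewrite notin_setE; apply.
Qed.

(** Split [phi] into its level-0 average, bounded through Poincare and supported in a fixed ball,
    and the remainder, estimated by [cell_avg_approx_r] at [k = 0]. *)
Lemma sobolev p r rho : (0 < n)%N -> (1 < p)%R -> (p < r)%R -> (n%:R * (r - p) < p * r)%R ->
  (0 <= rho)%R -> exists2 C : R, (0 <= C)%R & forall Om phi, Om `<=` cball rho -> test_fun Om phi ->
  grad_energy p phi <= 1 -> \int[mu]_x (`|phi x| `^ r)%:E <= C%:E.
Proof.
move=> n0 p1 pr crit rho0; have r0 : (0 < r)%R by lra.
have [B [d [B0 d01 H]]] := cell_avg_approx_r p1 pr crit.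
pose M := (@cell_avg_bound R n p rho 0 `^ r * fine (mu (cball (rho + 1))))%R.
have M0 : (0 <= M)%R by apply: mulr_ge0; [exact: powR_ge0|exact: fine_ge0].
exists (2 `^ r * (B + M))%R; first by apply: mulr_ge0; [exact: powR_ge0|exact: addr_ge0].
move=> Om phi Orho tphi G1.
have mphi : measurable_fun setT (phi : lebT R n -> R) by exact: measurable_smooth (test_fun_smooth tphi).
have ma := @measurable_cell_avg R n 0 phi.
have md : measurable_fun setT (fun x : lebT R n => (phi x - cell_avg 0 phi x)%R).
  exact: (measurable_funB mphi ma).
have T := @integral_powRD_le _ (lebT R n) R mu setT r _ _ measurableT md ma (ltW r0).
apply: le_trans (le_trans _ T) _.
  by rewrite le_eqVlt; apply/orP; left; apply/eqP; apply: eq_integral => x _; rewrite subrK.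
rewrite EFinM EFinD; apply: lee_wpmul2l; first by rewrite lee_fin powR_ge0.
apply: leeD; first by have := H _ _ tphi G1 0%N; rewrite expr0 mulr1.
have iphi := integrable_test_fun tphi.
apply: integral_cball_le.
- exact: measurable_norm_powR.
- by move=> x; exact: powR_ge0.
- move=> x; apply: ge0_ler_powR; rewrite ?nnegrE ?powR_ge0 ?(ltW r0)//.
  exact: cell_avg_boundP tphi G1.
- move=> x xr; rewrite (cell_avg_out _ iphi _ xr) ?normr0 ?powR0 ?gt_eqF// => y ry.
  by apply: (test_fun_out tphi) => /Orho; rewrite /cball/= leNgt ry.
Qed.

(** Averages at level [k] approximate uniformly in [i], so it is enough to make the averages
    converge at every level. They are determined by countably many bounded numbers, to which the
    diagonal extraction applies; dominated convergence turns pointwise into [L^r] convergence. *)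
Lemma rellich p r rho Om (phi : nat -> 'rV[R]_n -> R) : (0 < n)%N -> (1 < p)%R -> (p < r)%R ->
  (n%:R * (r - p) < p * r)%R -> (0 <= rho)%R -> Om `<=` cball rho ->
  (forall i, test_fun Om (phi i)) -> (forall i, grad_energy p (phi i) <= 1) ->
  exists2 s : nat -> nat, (forall i, (i <= s i)%N) & forall e : R, (0 < e)%R ->
    exists N, forall i j, (N <= i)%N -> (N <= j)%N ->
    \int[mu]_x (`|phi (s i) x - phi (s j) x| `^ r)%:E <= e%:E.
Proof.
move=> n0 p1 pr crit rho0 Orho tphi G1; have r0 : (0 < r)%R by lra.
have [B [d [B0 /andP[d0 d1] H]]] := cell_avg_approx_r p1 pr crit.
have iphi i := integrable_test_fun (tphi i).
have mphi i : measurable_fun setT (phi i : lebT R n -> R) by exact: measurable_smooth (test_fun_smooth (tphi i)).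
have out i y : (rho < `|y|)%R -> phi i y = 0%R.
  by move=> ry; apply: (test_fun_out (tphi i)) => /Orho; rewrite /cball/= leNgt ry.
(* [key] labels the cell of [x] and [pt] is its lower corner, a point of the same cell. The pairs
   (level, label) are coded by natural numbers for the extraction. *)
pose key k (x : 'rV[R]_n) : {ffun 'I_n -> int} := [ffun i => Num.floor (2 ^+ k * x 0 i)%R].
pose pt k (w : {ffun 'I_n -> int}) : 'rV[R]_n := (\row_i ((2 ^+ k)^-1 * (w i)%:~R))%R.
have ptP k x : cell k x (pt k (key k x)).
  by move=> i; rewrite /pt /key !mxE ffunE mulrA mulfV ?mul1r ?intrKfloor// expf_neq0.
pose v (i m : nat) : R := if unpickle m is Some (k, w) then cell_avg k (phi i) (pt k w) else 0%R.
pose M (m : nat) : R := if @unpickle (nat * {ffun 'I_n -> int})%type m is Some (k, w)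
  then @cell_avg_bound R n p rho k else 0%R.
have vM i m : (`|v i m| <= M m)%R.
  rewrite /v /M; case: unpickle => [[k w]|]; last by rewrite normr0.
  exact: cell_avg_boundP (tphi i) (G1 i).
have [s [l [sge cvl]]] := diagonal_cvg vM.
exists s => //.
pose L k (x : lebT R n) : R := l (pickle (k, key k x)).
have cvL k x : cell_avg k (phi (s i)) x @[i --> \oo] --> L k x.
  have := cvl (pickle (k, key k x)); rewrite /v pickleK => h.
  by under eq_fun do rewrite (cell_avg_const _ (ptP k x)).
have mL k : measurable_fun setT (L k).
  apply: (@measurable_cell_const R n k) => // x y xy; rewrite /L; congr (l (pickle (_, _))).
  by apply/ffunP => i; rewrite !ffunE xy.
have Lb k x : (`|L k x| <= @cell_avg_bound R n p rho k)%R.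
  have h : `|cell_avg k (phi (s i)) x|%R @[i --> \oo] --> `|L k x|%R by apply: cvg_norm; exact: cvL.
  rewrite -(cvg_lim _ h)//; apply: limr_le; first exact: cvgP h.
  by apply: nearW => i; exact: cell_avg_boundP (tphi _) (G1 _).
have Lout k (x : 'rV[R]_n) : (rho + 1 < `|x|)%R -> L k x = 0%R.
  move=> xr; rewrite -(cvg_lim _ (cvL k x))// (_ : (fun i => _) = fun=> 0%R) ?lim_cst//.
  by apply/funext => i; rewrite (cell_avg_out _ (iphi _) (out _) xr).
have cvI k : \int[mu]_x ((`|cell_avg k (phi (s i)) x - L k x| `^ r)%:E) @[i --> \oo] --> 0.
  rewrite -[X in _ --> X](integral0 mu (setT : set (lebT R n))).
  apply: (@integral_bounded_cvg R n (fun i x => `|cell_avg k (phi (s i)) x - L k x| `^ r)%R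
    (fun=> 0%R) ((@cell_avg_bound R n p rho k + @cell_avg_bound R n p rho k) `^ r)%R (rho + 1)%R).
  - move=> i; apply: measurable_norm_powR.
    exact: (measurable_funB (measurable_cell_avg _ _) (mL k)).
  - exact: measurable_cst.
  - move=> x; have c1 : (cell_avg k (phi (s i)) x - L k x)%R @[i --> \oo] --> 0%R.
      by rewrite -[X in _ --> X](subrr (L k x)); apply: cvgB; [exact: cvL|exact: cvg_cst].
    have := cvg_comp _ _ c1 (@continuous_norm_powR R r r0 _).
    by rewrite normr0 powR0// gt_eqF.
  - move=> i x; rewrite ger0_norm ?powR_ge0//; apply: ge0_ler_powR; rewrite ?nnegrE ?addr_ge0 ?powR_ge0 ?(ltW r0)//.
    by apply: (le_trans (ler_normB _ _)); apply: lerD => //; exact: cell_avg_boundP (tphi _) (G1 _).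
  - by move=> i x rx; rewrite (cell_avg_out _ (iphi _) (out _) rx) Lout// subr0 normr0 powR0// gt_eqF.
move=> e e0; pose a : R := (2 `^ r)%R; have a0 : (0 < a)%R by rewrite powR_gt0.
(* Two nested uses of the quasi-triangle inequality with constant [a = 2^r], each doubling the
   error, give [4 a^2 e1 = e]. *)
pose e1 : R := (e / (4 * (a * a)))%R; have e10 : (0 < e1)%R by rewrite divr_gt0// mulr_gt0// mulr_gt0.
have [k Hk] : exists k, (B * d ^+ k <= e1)%R.
  have cd : (d ^+ k)%R @[k --> \oo] --> (0%R : R) by apply: cvg_expr; rewrite ger0_norm// ltW.
  have e2 : (0 < e1 / (B + 1))%R by rewrite divr_gt0// ltr_wpDl.
  have /cvgrPdist_le/(_ _ e2)[k _ /(_ k (leqnn k))] := cd.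
  rewrite /= sub0r normrN ger0_norm ?exprn_ge0 ?(ltW d0)// ler_pdivlMr ?ltr_wpDl// => hk.
  exists k; apply: le_trans hk; rewrite mulrC ler_wpM2l ?exprn_ge0 ?(ltW d0)//.
  by rewrite lerDl.
have [N HN] : exists N, forall i, (N <= i)%N -> \int[mu]_x ((`|cell_avg k (phi (s i)) x - L k x| `^ r)%:E) <= e1%:E.
  have /fine_cvgP[h1 h2] := cvI k.
  have /cvgrPdist_le/(_ _ e10) h3 := h2.
  have [N _ HN] := filterI h1 h3; exists N => i Ni; have /= [g1 g2] := HN i Ni.
  rewrite -(fineK g1) lee_fin; move: g2; rewrite sub0r normrN; apply: le_trans; exact: ler_norm.
have near_L i : (N <= i)%N -> \int[mu]_x ((`|phi (s i) x - L k x| `^ r)%:E) <= (a * (2 * e1))%:E.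
  move=> Ni.
  have m1 : measurable_fun setT (fun x : lebT R n => (phi (s i) x - cell_avg k (phi (s i)) x)%R).
    exact: (measurable_funB (mphi _) (measurable_cell_avg _ _)).
  have m2 : measurable_fun setT (fun x : lebT R n => (cell_avg k (phi (s i)) x - L k x)%R).
    exact: (measurable_funB (measurable_cell_avg _ _) (mL k)).
  have T := @integral_powRD_le _ (lebT R n) R mu setT r _ _ measurableT m1 m2 (ltW r0).
  apply: le_trans (le_trans _ T) _.
    by rewrite le_eqVlt; apply/orP; left; apply/eqP; apply: eq_integral => x _; rewrite addrA subrK.
  rewrite EFinM mulr_natl mulr2n EFinD; apply: lee_wpmul2l; first by rewrite lee_fin ltW.
  apply: leeD; last exact: HN.
  by apply: le_trans (H _ _ (tphi _) (G1 _) k) _; rewrite lee_fin.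
exists N => i j Ni Nj.
have m1 : measurable_fun setT (fun x : lebT R n => (phi (s i) x - L k x)%R).
  exact: (measurable_funB (mphi _) (mL k)).
have m2 : measurable_fun setT (fun x : lebT R n => (L k x - phi (s j) x)%R).
  exact: (measurable_funB (mL k) (mphi _)).
have T := @integral_powRD_le _ (lebT R n) R mu setT r _ _ measurableT m1 m2 (ltW r0).
apply: le_trans (le_trans _ T) _.
  by rewrite le_eqVlt; apply/orP; left; apply/eqP; apply: eq_integral => x _; rewrite addrA subrK.
have -> : e%:E = a%:E * ((a * (2 * e1))%:E + (a * (2 * e1))%:E).
  by rewrite -EFinD -EFinM; congr EFin; rewrite /e1; field; rewrite gt_eqF.
apply: lee_wpmul2l; first by rewrite lee_fin ltW.
apply: leeD; first exact: near_L.
have -> : \int[mu]_x ((`|L k x - phi (s j) x| `^ r)%:E) = \int[mu]_x ((`|phi (s j) x - L k x| `^ r)%:E).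
  by apply: eq_integral => x _; rewrite distrC.
exact: near_L.
Qed.

End sobolev_compactness.

(** * Fatou, dominated convergence and fast almost-everywhere convergence *)

Section measure_lemmas.
Context d (T : measurableType d) (R : realType) (mu : {measure set T -> \bar R}) (D : set T).
Hypothesis mD : measurable D.
Local Open Scope ereal_scope.

Lemma ge0_integral_le_lin (c : R) (f g h : T -> R) : (0 <= c)%R ->
  measurable_fun D f -> measurable_fun D g -> measurable_fun D h ->
  (forall x, D x -> 0 <= f x)%R -> (forall x, D x -> 0 <= g x)%R -> (forall x, D x -> 0 <= h x)%R ->
  (forall x, D x -> f x <= c * (g x + h x))%R ->
  \int[mu]_(x in D) (f x)%:E <= c%:E * (\int[mu]_(x in D) (g x)%:E + \int[mu]_(x in D) (h x)%:E).
Proof.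
move=> c0 mf mg mh f0 g0 h0 H.
have mgE : measurable_fun D (EFin \o g) by exact/measurable_EFinP.
have mhE : measurable_fun D (EFin \o h) by exact/measurable_EFinP.
rewrite -ge0_integralD//.
have msum : measurable_fun D (fun x => (g x)%:E + (h x)%:E) by exact: emeasurable_funD.
rewrite -ge0_integralZl_EFin//; last first.
  by move=> x Dx; rewrite -EFinD lee_fin addr_ge0 ?g0 ?h0.
apply: ge0_le_integral => //.
- exact/measurable_EFinP.
- exact: measurable_funeM.
Qed.

Lemma fatou_ae (f_ : nat -> T -> R) (f : T -> R) (e_ : nat -> R) (e : R) :
  (forall k, measurable_fun D (f_ k)) -> measurable_fun D f ->
  (forall k x, D x -> 0 <= f_ k x)%R -> (forall x, D x -> 0 <= f x)%R ->
  {ae mu, forall x, D x -> f_ k x @[k --> \oo] --> f x} ->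
  (forall k, \int[mu]_(x in D) (f_ k x)%:E <= (e_ k)%:E) -> e_ k @[k --> \oo] --> e ->
  \int[mu]_(x in D) (f x)%:E <= e%:E.
Proof.
move=> mf_ mf f_0 f0 cv H ce.
have mE k : measurable_fun D (fun x => (f_ k x)%:E) by exact/measurable_EFinP.
have F := @fatou _ T R mu D mD (fun k x => (f_ k x)%:E) mE (fun k x Dx => f_0 k x Dx).
apply: (@le_trans _ _ (\int[mu]_(x in D) limn_einf (fun k => (f_ k x)%:E))).
  apply: ae_ge0_le_integral => //.
  - exact/measurable_EFinP.
  - by move=> x Dx; rewrite limn_einf_lim; apply: lime_ge; [exact: is_cvg_einfs|apply: nearW => k; apply: le_ereal_inf_tmp => _ [j _ <-]; rewrite lee_fin f_0].
  - rewrite /limn_einf; apply: measurableT_comp => //.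
    by apply: measurable_fun_limn_esup => k; exact: measurableT_comp.
  apply: filterS cv => x H1 Dx; have c1 : (f_ k x)%:E @[k --> \oo] --> (f x)%:E.
    by apply: cvg_EFin; [exact: nearW|exact: H1].
  by have [-> _] := cvg_limn_einf_sup c1.
apply: (le_trans F).
have c2 : (e_ k)%:E @[k --> \oo] --> e%:E by apply: cvg_EFin; [exact: nearW|].
have [<- _] := cvg_limn_einf_sup c2.
rewrite !limn_einf_lim; apply: lee_lim.
- exact: is_cvg_einfs.
- exact: is_cvg_einfs.
apply: nearW => k; apply: le_ereal_inf_tmp => _ [m /= km <-].
by apply: le_trans (H m); apply: ereal_inf_lbound; exists m.
Qed.

Lemma Rdominated_cvg (f_ : nat -> T -> R) (f : T -> R) (h : T -> \bar R) :
  (forall k, measurable_fun D (f_ k)) -> measurable_fun D f ->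
  {ae mu, forall x, D x -> f_ k x @[k --> \oo] --> f x} ->
  mu.-integrable D h -> {ae mu, forall x k, D x -> `|f_ k x|%:E <= h x} ->
  mu.-integrable D (EFin \o f) /\
  (\int[mu]_(x in D) f_ k x)%R @[k --> \oo] --> (\int[mu]_(x in D) f x)%R.
Proof.
move=> mf_ mf cv ih dom.
have h1 k : measurable_fun D (fun x => (f_ k x)%:E) by exact/measurable_EFinP.
have h2 : measurable_fun D (fun x => (f x)%:E) by exact/measurable_EFinP.
have h3 : {ae mu, forall x, D x -> (f_ k x)%:E @[k --> \oo] --> (f x)%:E}.
  by apply: filterS cv => x H Dx; apply: cvg_EFin; [exact: nearW|exact: H].
have h4 : {ae mu, forall x k, D x -> `|(f_ k x)%:E| <= h x}.
  by apply: filterS dom => x H k Dx; exact: H.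
have [i1 _ c1] := @dominated_convergence _ T R mu D mD _ _ _ h1 h2 h3 ih h4.
split; first exact: i1.
have fin : \int[mu]_(x in D) (f x)%:E \is a fin_num by exact: integrable_fin_num.
by apply: fine_cvg; rewrite fineK.
Qed.

(** The rate [4^-k] is shared: a factor [2^k] is inserted into the increments, and what remains is
    still summable. The weighted sum is then finite almost everywhere, which bounds the increments
    by a multiple of [2^-k] and makes their series converge absolutely. *)
Lemma ae_cvg_fast (s : R) (f : nat -> T -> R) : (0 < s)%R ->
  (forall k, measurable_fun D (f k)) ->
  (forall k, \int[mu]_(x in D) (`|(f k.+1 x - f k x)%R| `^ s)%:E <= ((4^-1 ^+ k) `^ s)%:E) ->
  exists2 g : T -> R, measurable_fun D g & {ae mu, forall x, D x -> f k x @[k --> \oo] --> g x}.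
Proof.
move=> s0 mf H.
pose w k x : R := ((2 ^+ k * `|f k.+1 x - f k x|) `^ s)%R.
have mw k : measurable_fun D (fun x => (w k x)%:E).
  apply/measurable_EFinP; apply: (measurableT_comp (measurable_powR s)).
  apply: measurable_funM; first exact: measurable_cst.
  by apply: measurableT_comp => //; exact: measurable_funB.
have w0 k x : 0 <= (w k x)%:E by rewrite lee_fin powR_ge0.
have Hw k : \int[mu]_(x in D) (w k x)%:E <= ((2^-1 `^ s) ^+ k)%:E.
  have -> : \int[mu]_(x in D) (w k x)%:E = ((2 ^+ k) `^ s)%:E * \int[mu]_(x in D) (`|(f k.+1 x - f k x)%R| `^ s)%:E.
    rewrite -ge0_integralZl_EFin ?powR_ge0//.
    - by apply: eq_integral => x _; rewrite -EFinM /w powRM// exprn_ge0.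
    - by apply/measurable_EFinP; apply: measurable_norm_powR; exact: measurable_funB.
  apply: (@le_trans _ _ (((2 ^+ k) `^ s)%:E * ((4^-1 ^+ k) `^ s)%:E)).
    by apply: lee_wpmul2l; rewrite ?lee_fin ?powR_ge0.
  rewrite -EFinM -powRM ?exprn_ge0 ?invr_ge0// -exprMn lee_fin.
  have -> : (2 * 4^-1 = 2^-1 :> R)%R by field.
  by rewrite exprVn powR_inv_expn.
pose t : R := (2^-1 `^ s)%R.
have t1 : (`|t| < 1)%R.
  rewrite ger0_norm ?powR_ge0//; apply: (@lt_le_trans _ _ (1 `^ s)%R); last by rewrite powR1.
  by apply: gt0_ltr_powR => //; rewrite ?nnegrE ?invr_ge0// invf_lt1// ltr1n.
have sumfin : \int[mu]_(x in D) (\sum_(k <oo) (w k x)%:E) < +oo.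
  rewrite integral_nneseries//.
  apply: (@le_lt_trans _ _ (\sum_(k <oo) (t ^+ k)%:E)).
    apply: lee_nneseries => [k _ _|k _]; last exact: Hw.
    exact: integral_ge0.
  have -> : \sum_(k <oo) (t ^+ k)%:E = (limn (series (geometric 1 t)))%:E.
    rewrite -EFin_lim; last exact: is_cvg_geometric_series.
    by congr (limn _); apply/funext => k /=; rewrite /series/= sumEFin; congr EFin; apply: eq_bigr => i _; rewrite mul1r.
  exact: ltry.
have aeW : {ae mu, forall x, D x -> \sum_(k <oo) (w k x)%:E < +oo}.
  have i1 : mu.-integrable D (fun x => \sum_(k <oo) (w k x)%:E).
    apply/integrableP; split; first by apply: ge0_emeasurable_sum => // k x _ _; exact: w0.
    rewrite (eq_integral (fun x => \sum_(k <oo) (w k x)%:E))// => x _.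
    by rewrite gee0_abs// nneseries_ge0.
  have := integrable_ae mD i1; apply: filterS => x H1 Dx.
  by have := H1 Dx; rewrite ge0_fin_numE// nneseries_ge0.
have cvx x : \sum_(k <oo) (w k x)%:E < +oo -> cvgn (f ^~ x).
  move=> fin; set W := \sum_(k <oo) _ in fin.
  have W0 : 0 <= W by exact: nneseries_ge0.
  have wW k : (w k x <= fine W)%R.
    rewrite -lee_fin fineK ?ge0_fin_numE//.
    apply: le_trans (nneseries_lim_ge k.+1 _) => //.
    by rewrite big_nat_recr//= leeDr// sume_ge0.
  pose c : R := (fine W `^ s^-1)%R.
  have dk k : (`|f k.+1 x - f k x| <= c * 2^-1 ^+ k)%R.
    have : ((w k x) `^ s^-1 <= c)%R.
      by apply: ge0_ler_powR; rewrite ?nnegrE ?powR_ge0 ?invr_ge0 ?fine_ge0 ?(ltW s0).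
    rewrite /w -powRrM mulfV ?gt_eqF// powRr1 ?mulr_ge0 ?exprn_ge0//.
    by rewrite exprVn ler_pdivlMr ?exprn_gt0// mulrC.
  have cs : cvgn (series (fun k => f k.+1 x - f k x)%R).
    apply: (@normed_cvg R R^o).
    apply: (@series_le_cvg R _ (geometric c 2^-1)).
    - by move=> k; exact: normr_ge0.
    - by move=> k; rewrite /= mulr_ge0 ?exprn_ge0 ?invr_ge0 ?powR_ge0.
    - by move=> k; exact: dk.
    - by apply: is_cvg_geometric_series; rewrite ger0_norm ?invr_ge0// invf_lt1// ltr1n.
  have -> : f ^~ x = (fun k => series (fun k => f k.+1 x - f k x)%R k + f 0%N x)%R.
    apply/funext => k; rewrite /series/= telescope_sumr// ?subrK//.
  by apply: is_cvgD => //; exact: is_cvg_cst.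
(* The upper limit is measurable everywhere and equals the limit wherever it exists. *)
exists (fun x => fine (limn_esup (fun k => (f k x)%:E))).
  apply: (measurableT_comp (@fine_measurable R setT measurableT)).
  by apply: measurable_fun_limn_esup => k; exact/measurable_EFinP.
apply: filterS aeW => x H1 Dx; have := cvx x (H1 Dx) => /cvg_ex[l cl].
have cE : (f k x)%:E @[k --> \oo] --> l%:E by apply: cvg_EFin; [exact: nearW|].
by have [_ ->] := cvg_limn_einf_sup cE.
Qed.

End measure_lemmas.

(** * Uniform convexity of powers of the Euclidean norm *)

Section uniform_convexity.
Context {R : realType} {n : nat}.
Implicit Types (a b : 'rV[R]_n) (p e : R).

Lemma continuous_enorm_powR p : 0 < p -> continuous (fun a : 'rV[R]_n => enorm a `^ p).
Proof.
move=> p0.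
have -> : (fun a : 'rV[R]_n => enorm a `^ p) = (fun t : R => `|t| `^ p) \o (@enorm R n).
  by apply/funext => a /=; rewrite ger0_norm ?enorm_ge0.
by move=> a; apply: continuous_comp; [exact: continuous_enorm|exact: continuous_norm_powR].
Qed.

Lemma enorm_mid_le a b : enorm (2^-1 *: (a + b)) <= (enorm a + enorm b) / 2.
Proof.
rewrite enormZ ger0_norm ?invr_ge0// mulrC ler_wpM2r ?invr_ge0//.
exact: enormD.
Qed.

Lemma enorm_powR_mid p a b : 1 < p ->
  enorm (2^-1 *: (a + b)) `^ p <= (enorm a `^ p + enorm b `^ p) / 2.
Proof.
move=> p1; apply: le_trans (ler_powR_mid p1 (enorm_ge0 a) (enorm_ge0 b)).
apply: ge0_ler_powR; rewrite ?nnegrE ?enorm_ge0 ?divr_ge0 ?addr_ge0 ?enorm_ge0 ?enorm_mid_le//.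
lra.
Qed.

Lemma parallelogram a b : enorm (a - b) ^+ 2 + enorm (a + b) ^+ 2 = 2 * (enorm a ^+ 2 + enorm b ^+ 2).
Proof.
rewrite !enorm_sqr -!big_split/= mulr_sumr; apply: eq_bigr => i _.
by rewrite !mxE; ring.
Qed.

(** If the norms differ, strictness comes from [t^p]; if they agree, the parallelogram identity
    makes the midpoint strictly shorter. *)
Lemma enorm_powR_mid_lt p a b : 1 < p -> a != b ->
  enorm (2^-1 *: (a + b)) `^ p < (enorm a `^ p + enorm b `^ p) / 2.
Proof.
move=> p1 ab; have p0 : 0 < p by lra.
have a0 := enorm_ge0 a; have b0 := enorm_ge0 b.
have [e|ne] := eqVneq (enorm a) (enorm b); last first.
  apply: le_lt_trans (ltr_powR_mid p1 a0 b0 ne).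
  by apply: ge0_ler_powR; rewrite ?nnegrE ?enorm_ge0 ?divr_ge0 ?addr_ge0 ?enorm_mid_le ?(ltW p0).
have -> : (enorm a `^ p + enorm b `^ p) / 2 = enorm a `^ p by rewrite e; field.
apply: gt0_ltr_powR => //; rewrite ?nnegrE ?enorm_ge0//.
rewrite -(@ltr_pXn2r _ 2) ?nnegrE ?enorm_ge0//.
have h := parallelogram a b; rewrite -e in h.
rewrite enormZ exprMn ger0_norm ?invr_ge0//.
have : 0 < enorm (a - b) ^+ 2.
  rewrite exprn_gt0// lt_neqAle enorm_ge0 andbT eq_sym; apply: contra ab => /eqP/enorm_eq0/eqP.
  by rewrite subr_eq0.
rewrite exprVn; have -> : (2 : R) ^+ 2 = 4 by ring.
lra.
Qed.

(** An integrable form of uniform convexity: [|a - b|^p] is at most [e] times the sum of the powers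
    plus [C] times the midpoint gap. On the compact set [K] of normalised pairs with
    [|a - b|^p >= e] the gap has a positive minimum [c], whence [C = 2^p / c]; the general case
    follows by homogeneity. *)
Lemma enorm_powR_uniform_convex p e : 1 < p -> 0 < e -> exists2 C, 0 <= C &
  forall a b, enorm (a - b) `^ p + C * enorm (2^-1 *: (a + b)) `^ p <=
    (e + C / 2) * (enorm a `^ p + enorm b `^ p).
Proof.
move=> p1 e0; have p0 : 0 < p by lra.
pose F1 (z : 'rV[R]_n * 'rV[R]_n) := enorm z.1 `^ p + enorm z.2 `^ p.
pose F2 (z : 'rV[R]_n * 'rV[R]_n) := enorm (z.1 - z.2) `^ p.
pose F3 (z : 'rV[R]_n * 'rV[R]_n) := enorm (2^-1 *: (z.1 + z.2)) `^ p.
have c1 : continuous F1.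
  move=> z; have h1 : x.1 @[x --> z] --> z.1 by exact: cvg_fst.
  have h2 : x.2 @[x --> z] --> z.2 by exact: cvg_snd.
  apply: cvgD; first exact: (cvg_comp _ _ h1 (@continuous_enorm_powR p p0 _)).
  exact: (cvg_comp _ _ h2 (@continuous_enorm_powR p p0 _)).
have c2 : continuous F2.
  move=> z; have h : (x.1 - x.2) @[x --> z] --> (z.1 - z.2) by apply: cvgB; [exact: cvg_fst|exact: cvg_snd].
  exact: (cvg_comp _ _ h (@continuous_enorm_powR p p0 _)).
have c3 : continuous F3.
  move=> z; have h : (2^-1 *: (x.1 + x.2)) @[x --> z] --> (2^-1 *: (z.1 + z.2)).
    by apply: cvgZr; apply: cvgD; [exact: cvg_fst|exact: cvg_snd].
  exact: (cvg_comp _ _ h (@continuous_enorm_powR p p0 _)).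
pose K : set ('rV[R]_n * 'rV[R]_n) := F1 @^-1` [set t | t = 1] `&` F2 @^-1` [set t | e <= t].
have cK : compact K.
  apply: (@subclosed_compact _ _ (cball 1 `*` cball 1)).
  - apply: closedI; apply: closed_comp.
    + by move=> x _; exact: c1.
    + exact: closed_eq.
    + by move=> x _; exact: c2.
    + exact: closed_ge.
  - have cb : compact (cball 1 : set 'rV[R]_n).
      apply: bounded_closed_compact.
        by exists 1; split; [exact: num_real|move=> M M1 x /le_trans; apply; exact: ltW].
      have -> : (cball 1 : set 'rV[R]_n) = (fun x : 'rV[R]_n => `|x|) @^-1` [set t | t <= 1] by [].
      by apply: closed_comp; [move=> x _; exact: norm_continuous|exact: closed_le].
    exact: compact_setX.
  - have aux (x : 'rV[R]_n) t : 0 <= t -> enorm x `^ p + t = 1 -> cball 1 x.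
      move=> t0 h; have h1 : enorm x `^ p <= 1 by lra.
      apply: normrV_le => // i; apply: le_trans (coord_le_enorm _ _) _.
      rewrite leNgt; apply/negP => x1.
      have := @gt0_ltr_powR R p p0 1 (enorm x); rewrite !nnegrE enorm_ge0 ler01 powR1 => /(_ isT isT x1).
      lra.
    move=> [a b] [/= h _]; split => /=; first exact: (aux a _ (powR_ge0 _ _) h).
    by apply: (aux b (enorm a `^ p)); rewrite ?powR_ge0// addrC.
pose G z := F1 z / 2 - F3 z.
have G0 z : 0 <= G z by rewrite subr_ge0 /F3 /F1 enorm_powR_mid.
have [c c0 Hc] : exists2 c, 0 < c & forall z, K z -> c <= G z.
  have [K0|/set0P K0] := eqVneq K set0.
    by exists 1 => // z; rewrite K0.
  have cG : {within K, continuous G}.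
    apply: continuous_subspaceT => z; apply: cvgB; last exact: c3.
    by apply: cvgM; [exact: c1|exact: cvg_cst].
  have [z Kz Hz] := @compact_EVT_min _ R G K K0 cK cG.
  exists (G z); last by move=> w Kw; apply: Hz; rewrite inE.
  rewrite subr_gt0 /F3 /F1 enorm_powR_mid_lt//; apply/eqP => ab.
  move: Kz; rewrite inE => -[_]; rewrite /= /F2 ab subrr enorm0 powR0 ?gt_eqF//; lra.
exists (2 `^ p / c); first by rewrite divr_ge0 ?powR_ge0 ?ltW.
have unit_case a b : F1 (a, b) = 1 -> F2 (a, b) <= e + 2 `^ p / c * G (a, b).
  move=> h; have [lt|ge] := leP (F2 (a, b)) e.
    by apply: (le_trans lt); rewrite lerDl mulr_ge0// divr_ge0 ?powR_ge0 ?ltW.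
  have Kab : K (a, b) by split => //; exact: ltW.
  have h1 : 2 `^ p <= 2 `^ p / c * G (a, b).
    by rewrite -mulrA ler_peMr ?powR_ge0// mulrC ler_pdivlMr// mul1r; exact: Hc.
  have h2 : F2 (a, b) <= 2 `^ p.
    have := powRD_le (ltW p0) (enorm_ge0 a) (enorm_ge0 b).
    rewrite -[enorm a `^ p + _]/(F1 (a, b)) h mulr1; apply: le_trans; rewrite /F2/=.
    apply: ge0_ler_powR; rewrite ?nnegrE ?addr_ge0 ?enorm_ge0 ?(ltW p0)//.
    by apply: (le_trans (enormD _ _)); rewrite enormN.
  lra.
move=> a b; set N := F1 (a, b).
have [N0|Nn0] := eqVneq N 0.
  have [ea eb] : enorm a `^ p = 0 /\ enorm b `^ p = 0.
    by move: N0; rewrite /N /F1/=; have := powR_ge0 (enorm a) p; have := powR_ge0 (enorm b) p; split; lra.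
  have a0 : a = 0 by apply: enorm_eq0; apply/eqP; move: ea => /eqP; rewrite powR_eq0 => /andP[].
  have b0 : b = 0 by apply: enorm_eq0; apply/eqP; move: eb => /eqP; rewrite powR_eq0 => /andP[].
  by rewrite a0 b0 subrr addr0 scaler0 enorm0 powR0 ?gt_eqF// addr0 !mulr0.
have N0 : 0 < N by rewrite lt_neqAle eq_sym Nn0 addr_ge0 ?powR_ge0.
pose t := N `^ (- p^-1); have t0 : 0 <= t by exact: powR_ge0.
have tp : t `^ p = N^-1 by rewrite /t -powRrM mulNr mulVf ?gt_eqF// powR_inv1// ltW.
have sc x : enorm (t *: x) `^ p = N^-1 * enorm x `^ p.
  by rewrite enormZ ger0_norm// powRM ?enorm_ge0// tp.
have F1E : F1 (t *: a, t *: b) = 1.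
  by rewrite /F1/= !sc -mulrDr -[enorm a `^ p + _]/N mulVf.
have := unit_case _ _ F1E; rewrite /G F1E /F2 /F3/= -scalerBr -scalerDr scalerA [2^-1 * t]mulrC -scalerA !sc.
rewrite -[enorm a `^ p + _]/N -(ler_pM2l N0) mulrA mulfV// mul1r.
set X := enorm (_ *: _) `^ p; set C := 2 `^ p / c => h.
have -> : (e + C / 2) * N = N * (e + C * (1 / 2 - N^-1 * X)) + C * X by field.
by move: h; rewrite !mul1r lerD2r.
Qed.

End uniform_convexity.

Lemma uniform_convex_step (R : realFieldType) (e C C0 D G H m : R) : D + C0 * m <= (e + C0 / 2) * (G + H) ->
  0 <= (C - C0) * ((G + H) / 2 - m) -> D + C * m <= (e + C / 2) * (G + H).
Proof. by move=> h1 h2; lra. Qed.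

(** Comparison of two powers with a free threshold: the first term covers [x <= theta], the second
    [x > theta]. Choosing [theta] afterwards gives the effect of Holder's inequality on a set of
    finite measure. *)
Lemma powR_theta (R : realType) (a b theta x : R) : 0 < a -> a <= b -> 0 < theta -> 0 <= x ->
  x `^ a <= theta `^ a + theta `^ (a - b) * x `^ b.
Proof.
move=> a0 ab t0 x0; have [h|h] := leP x theta.
  rewrite ler_wpDr ?mulr_ge0 ?powR_ge0//.
  by apply: ge0_ler_powR; rewrite ?nnegrE// ltW.
rewrite ler_wpDl ?powR_ge0//.
have fx0 : 0 < x by exact: lt_trans h.
have -> : x `^ a = x `^ (a - b) * x `^ b.
  by rewrite -powRD ?subrK//; apply/implyP => _; rewrite gt_eqF.
rewrite ler_wpM2r ?powR_ge0// -opprB !powRN lef_pV2 ?posrE ?powR_gt0//.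
by apply: ge0_ler_powR; rewrite ?nnegrE ?subr_ge0// ltW.
Qed.

Section Lr_convergence.
Context d (T : measurableType d) (R : realType) (mu : {measure set T -> \bar R}) (D : set T).
Hypothesis mD : measurable D.
Local Open Scope ereal_scope.

(** The sum [V] of [2^k |f_k - f|^s] is integrable. It dominates every term, and its finiteness
    forces pointwise convergence. *)
Lemma fast_cvg_dominated (s : R) (f_ : nat -> T -> R) (f : T -> R) : (0 < s)%R ->
  (forall k, measurable_fun D (f_ k)) -> measurable_fun D f ->
  (forall k, \int[mu]_(x in D) (`|(f_ k x - f x)%R| `^ s)%:E <= (4^-1 ^+ k)%:E) ->
  exists V : T -> \bar R, [/\ mu.-integrable D V,
    forall x k, D x -> (`|(f_ k x - f x)%R| `^ s)%:E <= V x &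
    {ae mu, forall x, D x -> f_ k x @[k --> \oo] --> f x}].
Proof.
move=> s0 mf_ mf H.
pose w k x : R := (2 ^+ k * `|f_ k x - f x| `^ s)%R.
have mp k : measurable_fun D (fun x => (`|(f_ k x - f x)%R| `^ s)%:E).
  by apply/measurable_EFinP; apply: measurable_norm_powR; exact: measurable_funB.
have mw k : measurable_fun D (fun x => (w k x)%:E).
  have : measurable_fun D (fun x => (2 ^+ k)%:E * (`|(f_ k x - f x)%R| `^ s)%:E) by exact: measurable_funeM.
  by congr measurable_fun; apply/funext => x; rewrite -EFinM.
have w0 k x : 0 <= (w k x)%:E by rewrite lee_fin mulr_ge0 ?exprn_ge0 ?powR_ge0.
have Hw k : \int[mu]_(x in D) (w k x)%:E <= (2^-1 ^+ k)%:E.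
  have -> : \int[mu]_(x in D) (w k x)%:E = (2 ^+ k)%:E * \int[mu]_(x in D) (`|(f_ k x - f x)%R| `^ s)%:E.
    by rewrite -ge0_integralZl_EFin ?exprn_ge0//.
  apply: (@le_trans _ _ ((2 ^+ k)%:E * (4^-1 ^+ k)%:E)).
    by apply: lee_wpmul2l; rewrite ?lee_fin ?exprn_ge0.
  rewrite -EFinM -exprMn lee_fin.
  by have -> : (2 * 4^-1 = 2^-1 :> R)%R by field.
have h1 : (`|2^-1 : R| < 1)%R by rewrite ger0_norm ?invr_ge0// invf_lt1// ltr1n.
pose V x := \sum_(k <oo) (w k x)%:E.
have V0 x : 0 <= V x by exact: nneseries_ge0.
have wV x k : (w k x)%:E <= V x.
  apply: le_trans (nneseries_lim_ge k.+1 _) => //.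
  by rewrite big_nat_recr//= leeDr// sume_ge0.
have iV : mu.-integrable D V.
  apply/integrableP; split; first by apply: ge0_emeasurable_sum => // k x _ _; exact: w0.
  rewrite (eq_integral V); last by move=> x _; rewrite gee0_abs.
  rewrite /V integral_nneseries//.
  apply: (@le_lt_trans _ _ (\sum_(k <oo) (2^-1 ^+ k)%:E)).
    apply: lee_nneseries => [k _ _|k _]; last exact: Hw.
    exact: integral_ge0.
  pose t : R := (2^-1)%R.
  have -> : \sum_(k <oo) (t ^+ k)%:E = (limn (series (geometric 1 t)))%:E.
    rewrite -EFin_lim; last exact: is_cvg_geometric_series.
    by congr (limn _); apply/funext => k /=; rewrite /series/= sumEFin; congr EFin; apply: eq_bigr => i _; rewrite mul1r.
  exact: ltry.
exists V; split => //.
  move=> x k _; apply: le_trans (wV x k); rewrite lee_fin /w ler_peMl ?powR_ge0// exprn_ege1//.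
  by rewrite ler1n.
have := integrable_ae mD iV; apply: filterS => x H1 Dx.
have fin := H1 Dx.
have bd k : (`|f_ k x - f x| <= (fine (V x) * 2^-1 ^+ k) `^ s^-1)%R.
  have h2 : (`|f_ k x - f x| `^ s <= fine (V x) * 2^-1 ^+ k)%R.
    rewrite exprVn ler_pdivlMr ?exprn_gt0// mulrC -lee_fin fineK//; exact: wV.
  rewrite -[leLHS](@powRr1 R)// -[in leLHS](mulfV (lt0r_neq0 s0)) powRrM.
  apply: ge0_ler_powR; rewrite ?nnegrE ?powR_ge0 ?invr_ge0 ?(ltW s0)//.
  by rewrite mulr_ge0 ?fine_ge0 ?exprn_ge0 ?invr_ge0.
have c0 : (fine (V x) * 2^-1 ^+ k)%R @[k --> \oo] --> (0%R : R).
  rewrite -[X in _ --> X](mulr0 (fine (V x))); apply: cvgM; first exact: cvg_cst.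
  exact: cvg_expr.
have si : (0 < s^-1)%R by rewrite invr_gt0.
have c1 : (`|fine (V x) * 2^-1 ^+ k| `^ s^-1)%R @[k --> \oo] --> (0%R : R).
  have := cvg_comp _ _ c0 (@continuous_norm_powR R s^-1 si 0%R).
  by rewrite normr0 powR0// gt_eqF.
apply/cvgrPdist_le => e e0; move/cvgrPdist_le : c1 => /(_ _ e0); apply: filterS => k /=.
rewrite sub0r normrN (ger0_norm (powR_ge0 _ _)) distrC; apply: le_trans.
apply: (le_trans (bd k)); rewrite ger0_norm//.
by rewrite mulr_ge0 ?fine_ge0 ?exprn_ge0 ?invr_ge0.
Qed.

Lemma monotone_choice (N : nat -> nat) : exists t : nat -> nat,
  (forall k, (N k <= t k)%N) /\ forall k, (k <= t k)%N /\ (t k <= t k.+1)%N.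
Proof.
exists (fun k => k + \sum_(j < k.+1) N j)%N; split.
  by move=> k; rewrite big_ord_recr/= addnA leq_addl.
move=> k; rewrite leq_addr; split => //.
by rewrite addSn [in leqRHS]big_ord_recr/=; lia.
Qed.

(** A fast subsequence converges almost everywhere, and Fatou's lemma along it bounds the distance
    of each late [f i] to the limit. *)
Lemma Lr_complete (s : R) (f : nat -> T -> R) : (0 < s)%R -> (forall k, measurable_fun D (f k)) ->
  (forall e : R, (0 < e)%R -> exists N, forall i j, (N <= i)%N -> (N <= j)%N ->
     \int[mu]_(x in D) (`|(f i x - f j x)%R| `^ s)%:E <= e%:E) ->
  exists g : T -> R, [/\ measurable_fun D g,
    forall e : R, (0 < e)%R -> exists N, forall i, (N <= i)%N ->
     \int[mu]_(x in D) (`|(f i x - g x)%R| `^ s)%:E <= e%:E &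
    exists t : nat -> nat, (forall k, (k <= t k)%N) /\ {ae mu, forall x, D x -> f (t k) x @[k --> \oo] --> g x}].
Proof.
move=> s0 mf H.
have /choice[N HN] : forall k, exists N, forall i j, (N <= i)%N -> (N <= j)%N ->
     \int[mu]_(x in D) (`|(f i x - f j x)%R| `^ s)%:E <= ((4^-1 ^+ k) `^ s)%:E.
  by move=> k; apply: H; rewrite powR_gt0// exprn_gt0// invr_gt0.
have [t [tN tm]] := monotone_choice N.
have mt k : measurable_fun D (f (t k)) by exact: mf.
have [g mg cg] : exists2 g : T -> R, measurable_fun D g & {ae mu, forall x, D x -> f (t k) x @[k --> \oo] --> g x}.
  apply: (ae_cvg_fast mD s0 mt) => k.
  by apply: HN => //; apply: leq_trans (tN k) (tm k).2.
exists g; split => //; last by exists t; split => // k; exact: (tm k).1.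
move=> e /H[M HM]; exists M => i Mi.
apply: (@fatou_ae _ T R mu D mD (fun k x => `|f i x - f (t (k + M)%N) x| `^ s)%R _ (fun=> e)).
- by move=> k; apply: measurable_norm_powR; exact: measurable_funB.
- by apply: measurable_norm_powR; exact: measurable_funB.
- by move=> k x _; exact: powR_ge0.
- by move=> x _; exact: powR_ge0.
- apply: filterS cg => x cx Dx.
  have c1 : (f i x - f (t (k + M)%N) x)%R @[k --> \oo] --> (f i x - g x)%R.
    apply: cvgB; first exact: cvg_cst.
    exact: (@cvg_comp _ _ _ (fun k => k + M)%N (fun j => f (t j) x) _ \oo _ (cvg_addnr M) (cx Dx)).
  exact: (cvg_comp _ _ c1 (@continuous_norm_powR R s s0 _)).
- move=> k; apply: HM => //; apply: leq_trans (tm _).1; exact: leq_addl.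
- exact: cvg_cst.
Qed.

Lemma integral_powR_theta (a b theta : R) (f : T -> R) : (0 < a)%R -> (a <= b)%R -> (0 < theta)%R ->
  measurable_fun D f -> mu D < +oo ->
  \int[mu]_(x in D) (`|f x| `^ a)%:E <=
    (theta `^ a * fine (mu D))%:E + (theta `^ (a - b))%:E * \int[mu]_(x in D) (`|f x| `^ b)%:E.
Proof.
move=> a0 ab t0 mf muD.
have muf : mu D \is a fin_num by rewrite ge0_fin_numE.
rewrite EFinM fineK// -(integral_cst mu mD) -ge0_integralZl_EFin ?powR_ge0//.
- rewrite -ge0_integralD//.
  + apply: ge0_le_integral => //.
    * by apply/measurable_EFinP; exact: measurable_norm_powR.
    * apply: emeasurable_funD; first exact: measurable_cst.
      by apply: measurable_funeM; apply/measurable_EFinP; exact: measurable_norm_powR.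
    * move=> x _; rewrite -EFinM -EFinD lee_fin.
      exact: powR_theta.
  + by move=> x _; rewrite lee_fin powR_ge0.
  + by move=> x _; rewrite mule_ge0 ?lee_fin ?powR_ge0.
  + by apply: measurable_funeM; apply/measurable_EFinP; exact: measurable_norm_powR.
- by apply/measurable_EFinP; exact: measurable_norm_powR.
Qed.

Lemma ge0_integral_addZ (C : R) (f g : T -> R) : (0 <= C)%R ->
  measurable_fun D f -> measurable_fun D g ->
  (forall x, D x -> 0 <= f x)%R -> (forall x, D x -> 0 <= g x)%R ->
  \int[mu]_(x in D) (f x + C * g x)%:E = \int[mu]_(x in D) (f x)%:E + C%:E * \int[mu]_(x in D) (g x)%:E.
Proof.
move=> C0 mf mg f0 g0.
have mfE : measurable_fun D (EFin \o f) by exact/measurable_EFinP.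
have mgE : measurable_fun D (EFin \o g) by exact/measurable_EFinP.
rewrite -ge0_integralZl_EFin// -ge0_integralD//.
  by move=> x Dx; rewrite -EFinM lee_fin mulr_ge0 ?g0.
exact: measurable_funeM.
Qed.

End Lr_convergence.

(** * Weighted gradient energies *)

Definition vmeas {R : realType} {n : nat} (Om : set 'rV[R]_n) (g : 'rV[R]_n -> 'rV[R]_n) :=
  forall i, measurable_fun (Om : set (lebT R n)) (fun z : lebT R n => g z 0 i).

(** Treats both phases at once: weight 1 with exponent [p], and weight [eta] with exponent [q]. *)
Definition genergy {R : realType} {n : nat} (Om : set 'rV[R]_n) (w : 'rV[R]_n -> R) (s : R)
    (g : 'rV[R]_n -> 'rV[R]_n) : \bar R :=
  (\int[@leb R n]_(z in (Om : set (lebT R n))) (w z * enorm (g z) `^ s)%:E)%E.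

Lemma cvg_rV {R : realType} {n : nat} (g_ : nat -> 'rV[R]_n) (g : 'rV[R]_n) :
  (forall i, g_ k 0 i @[k --> \oo] --> g 0 i) -> g_ k @[k --> \oo] --> g.
Proof.
move=> H; apply/cvgrPdist_lt => e e0.
have : \forall k \near \oo, forall i : 'I_n, `|g 0 i - g_ k 0 i| < e.
  by apply: filter_forall => i; have /cvgrPdist_lt := H i; apply.
apply: filterS => k Hk; apply: normrV_lt => // i.
by rewrite !mxE.
Qed.

Section gradient_energy.
Context {R : realType} {n : nat} (Om : set 'rV[R]_n) (w : 'rV[R]_n -> R) (s : R).
Notation mu := (@leb R n).
Hypotheses (mOm : measurable (Om : set (lebT R n)))
  (mw : measurable_fun (Om : set (lebT R n)) (w : lebT R n -> R))
  (w0 : forall z, Om z -> 0 <= w z) (s1 : 1 < s).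
Implicit Types g h : 'rV[R]_n -> 'rV[R]_n.
Local Open Scope ereal_scope.

Lemma vmeasD g h : vmeas Om g -> vmeas Om h -> vmeas Om (fun z => g z + h z)%R.
Proof.
move=> mg mh i; have := measurable_funD (mg i) (mh i).
by congr measurable_fun; apply/funext => z; rewrite mxE.
Qed.

Lemma vmeasZ (t : R) g : vmeas Om g -> vmeas Om (fun z => t *: g z)%R.
Proof.
move=> mg i; have := measurable_funM (@measurable_cst _ _ (lebT R n) R Om t) (mg i).
by congr measurable_fun; apply/funext => z; rewrite mxE.
Qed.

Lemma vmeasB g h : vmeas Om g -> vmeas Om h -> vmeas Om (fun z => g z - h z)%R.
Proof.
move=> mg mh i; have := measurable_funB (mg i) (mh i).
by congr measurable_fun; apply/funext => z; rewrite !mxE.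
Qed.

Lemma measurable_genergy g : vmeas Om g ->
  measurable_fun (Om : set (lebT R n)) (fun z : lebT R n => w z * enorm (g z) `^ s)%R.
Proof.
move=> mg; apply: measurable_funM; first exact: mw.
apply: (measurableT_comp (measurable_powR s)).
by apply: (@measurable_comp_continuous R n _ (lebT R n) Om g enorm); [exact: mg|exact: continuous_enorm].
Qed.

Let s0 : (0 < s)%R. Proof. exact: lt_trans ltr01 s1. Qed.

Let e0 g z : Om z -> (0 <= w z * enorm (g z) `^ s)%R.
Proof. by move=> Oz; rewrite mulr_ge0 ?powR_ge0 ?w0. Qed.

Lemma genergy_ge0 g : 0 <= genergy Om w s g.
Proof. by apply: integral_ge0 => z Oz; rewrite lee_fin e0. Qed.

Lemma genergyD_le g h : vmeas Om g -> vmeas Om h ->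
  genergy Om w s (fun z => g z + h z)%R <= (2 `^ s)%:E * (genergy Om w s g + genergy Om w s h).
Proof.
move=> mg mh; apply: (ge0_integral_le_lin mu mOm (powR_ge0 _ _) (measurable_genergy (vmeasD mg mh))
  (measurable_genergy mg) (measurable_genergy mh) (e0 _) (e0 g) (e0 h)) => z Oz.
rewrite -mulrDr mulrCA ler_wpM2l ?w0//.
apply: le_trans (powRD_le (ltW s0) (enorm_ge0 _) (enorm_ge0 _)).
by apply: ge0_ler_powR; rewrite ?nnegrE ?addr_ge0 ?enorm_ge0 ?enormD ?(ltW s0).
Qed.

Lemma genergy_mid g h : vmeas Om g -> vmeas Om h ->
  genergy Om w s (fun z => 2^-1 *: (g z + h z))%R <= (2^-1)%:E * (genergy Om w s g + genergy Om w s h).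
Proof.
move=> mg mh; have h0 : (0 <= 2^-1 :> R)%R by rewrite invr_ge0.
apply: (ge0_integral_le_lin mu mOm h0 (measurable_genergy (vmeasZ _ (vmeasD mg mh)))
  (measurable_genergy mg) (measurable_genergy mh) (e0 _) (e0 g) (e0 h)) => z Oz.
rewrite -mulrDr mulrCA ler_wpM2l ?w0// mulrC.
exact: enorm_powR_mid.
Qed.

Let genergy_scale (C : R) g : vmeas Om g -> (0 <= C)%R ->
  \int[mu]_(z in (Om : set (lebT R n))) (C * (w z * enorm (g z) `^ s))%:E = C%:E * genergy Om w s g.
Proof.
move=> mg C0; have := ge0_integral_addZ mu mOm C0 (@measurable_cst _ _ (lebT R n) R Om 0%R)
  (measurable_genergy mg) (fun _ _ => lexx _) (e0 g).
rewrite integral0 add0e => <-; apply: eq_integral => z _ /=.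
by rewrite add0r.
Qed.

Lemma genergyZ (t : R) g : vmeas Om g ->
  genergy Om w s (fun z => t *: g z)%R = (`|t|%R `^ s)%:E * genergy Om w s g.
Proof.
move=> mg; rewrite -(genergy_scale mg (powR_ge0 _ _)).
by apply: eq_integral => z _; rewrite enormZ powRM ?enorm_ge0// mulrCA.
Qed.

Lemma genergyN g h : genergy Om w s (fun z => g z - h z)%R = genergy Om w s (fun z => h z - g z)%R.
Proof. by apply: eq_integral => z _; rewrite -opprB enormN. Qed.

Lemma genergyD_eps (e : R) : (0 < e)%R -> exists2 C : R, (0 <= C)%R & forall g h, vmeas Om g -> vmeas Om h ->
  genergy Om w s (fun z => g z + h z)%R <= (1 + e)%:E * genergy Om w s g + C%:E * genergy Om w s h.
Proof.
move=> e1.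
have [C C0 HC] := powRD_le_eps s0 e1; exists C => // g h mg mh.
have p1 : (0 <= 1 + e)%R by rewrite addr_ge0// ltW.
have m1 := measurable_funM (@measurable_cst _ _ (lebT R n) R Om (1 + e)%R) (measurable_genergy mg).
have m2 := measurable_funM (@measurable_cst _ _ (lebT R n) R Om C) (measurable_genergy mh).
have := @ge0_integral_le_lin _ (lebT R n) R mu Om mOm 1%R _ _ _ ler01
  (measurable_genergy (vmeasD mg mh)) m1 m2 (e0 _)
  (fun z Oz => mulr_ge0 p1 (e0 g Oz)) (fun z Oz => mulr_ge0 C0 (e0 h Oz)).
rewrite mul1e => T; apply: (le_trans (T _)).
  move=> z Oz; rewrite mul1r /= mulrCA [(C * _)%R]mulrCA -mulrDr ler_wpM2l ?w0//.
  apply: le_trans (HC _ _ (enorm_ge0 _) (enorm_ge0 _)).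
  by apply: ge0_ler_powR; rewrite ?nnegrE ?addr_ge0 ?enorm_ge0 ?enormD ?(ltW s0).
apply: leeD.
  by rewrite (genergy_scale mg p1).
by rewrite (genergy_scale mh C0).
Qed.

(** Any [C >= C0] is allowed so that one constant serves both phases: only the sum of the two
    midpoint energies has a known lower bound, hence the two gaps must carry the same factor before
    being added. *)
Lemma genergy_uniform_convex (e : R) : (0 < e)%R -> exists2 C0 : R, (0 <= C0)%R &
  forall (C x y m : R) g h, (C0 <= C)%R -> vmeas Om g -> vmeas Om h ->
  genergy Om w s g <= x%:E -> genergy Om w s h <= y%:E ->
  m%:E <= genergy Om w s (fun z => 2^-1 *: (g z + h z))%R ->
  genergy Om w s (fun z => g z - h z)%R <= (e * (x + y) + C * ((x + y) / 2 - m))%:E.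
Proof.
move=> e1; have [C0 C00 HC] := enorm_powR_uniform_convex (n := n) s1 e1.
exists C0 => // C x y m g h CC mg mh gx hy mm.
have C1 : (0 <= C)%R by exact: le_trans CC.
have m1 := measurable_genergy (vmeasB mg mh).
have m2 := measurable_genergy (vmeasZ 2^-1%R (vmeasD mg mh)).
have m3 := measurable_funM (@measurable_cst _ _ (lebT R n) R Om C) m2.
have c0 : (0 <= e + C / 2)%R by rewrite addr_ge0 ?divr_ge0// ltW.
have pw z : Om z -> (w z * enorm (g z - h z) `^ s + C * (w z * enorm (2^-1 *: (g z + h z)) `^ s) <=
    (e + C / 2) * (w z * enorm (g z) `^ s + w z * enorm (h z) `^ s))%R.
  move=> Oz; rewrite -mulrDr [(C * _)%R]mulrCA -mulrDr [leRHS]mulrCA ler_wpM2l ?w0//.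
  have h1 := HC (g z) (h z); have h2 := enorm_powR_mid (g z) (h z) s1.
  have h3 : (0 <= (C - C0) * ((enorm (g z) `^ s + enorm (h z) `^ s) / 2 - enorm (2^-1 *: (g z + h z)) `^ s))%R.
    by rewrite mulr_ge0// subr_ge0.
  exact: (uniform_convex_step h1 h3).
have T := @ge0_integral_le_lin _ (lebT R n) R mu Om mOm _ _ _ _ c0 (measurable_funD m1 m3)
  (measurable_genergy mg) (measurable_genergy mh)
  (fun z Oz => addr_ge0 (e0 (fun z => g z - h z)%R Oz) (mulr_ge0 C1 (e0 (fun z => 2^-1 *: (g z + h z))%R Oz)))
  (e0 g) (e0 h) pw.
have S := ge0_integral_addZ mu mOm C1 m1 m2 (e0 (fun z => g z - h z)%R) (e0 (fun z => 2^-1 *: (g z + h z))%R).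
have U : genergy Om w s (fun z => g z - h z)%R + (C * m)%:E <= ((e + C / 2) * (x + y))%:E.
  apply: (@le_trans _ _ (genergy Om w s (fun z => g z - h z)%R + C%:E * genergy Om w s (fun z => 2^-1 *: (g z + h z))%R)).
    by apply: (leeD (lexx _)); rewrite EFinM; apply: lee_wpmul2l; [rewrite lee_fin|exact: mm].
  rewrite -[leLHS]S; apply: (le_trans T); rewrite EFinM; apply: lee_wpmul2l; first by rewrite lee_fin.
  by rewrite EFinD; exact: leeD gx hy.
rewrite (_ : (e * (x + y) + C * ((x + y) / 2 - m))%R = ((e + C / 2) * (x + y) - C * m)%R); last by ring.
by rewrite EFinB leeBrDr.
Qed.

Lemma genergy_fatou (g_ : nat -> 'rV[R]_n -> 'rV[R]_n) g (e_ : nat -> R) (e : R) :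
  (forall k, vmeas Om (g_ k)) -> vmeas Om g ->
  {ae mu, forall z : lebT R n, Om z -> forall i, g_ k z 0%R i @[k --> \oo] --> g z 0%R i} ->
  (forall k, genergy Om w s (g_ k) <= (e_ k)%:E) -> e_ k @[k --> \oo] --> e ->
  genergy Om w s g <= e%:E.
Proof.
move=> mg_ mg cv H ce.
apply: (@fatou_ae _ (lebT R n) R mu Om mOm (fun k z => w z * enorm (g_ k z) `^ s)%R _ e_ e
  (fun k => measurable_genergy (mg_ k)) (measurable_genergy mg) (fun k => e0 (g_ k)) (e0 g) _ H ce).
apply: filterS cv => z cz Oz.
have c1 := cvg_rV (cz Oz).
have c2 := cvg_comp _ _ c1 (@continuous_enorm_powR R n s s0 _).
by apply: cvgM; [exact: cvg_cst|exact: c2].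
Qed.

Lemma genergy_test_fin (M : R) Om' phi : mu Om < +oo -> test_fun Om' phi -> ae_on Om (fun z => w z <= M)%R ->
  genergy Om w s (grad phi) < +oo.
Proof.
move=> muOm tphi wM.
have sphi := test_fun_smooth tphi.
have /choice[L HL] : forall i : 'I_n, exists L : R, forall x, (`|partial i phi x| <= L)%R.
  by move=> i; exact: test_fun_bounded (test_fun_partial i tphi).
have mg : vmeas Om (grad phi).
  move=> i; have := measurable_smooth (D := Om) (smooth_partial i sphi).
  by congr measurable_fun; apply/funext => x; rewrite mxE.
pose C : R := (`|M| * (\sum_(i < n) L i) `^ s)%R.
apply: (@le_lt_trans _ _ (\int[mu]_(z in (Om : set (lebT R n))) (C)%:E)); last first.
  by rewrite integral_cst// lte_mul_pinfty// lee_fin mulr_ge0 ?powR_ge0.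
apply: ae_ge0_le_integral.
- exact: mOm.
- by move=> z Oz; rewrite lee_fin; exact: e0.
- by apply/measurable_EFinP; exact: measurable_genergy.
- by move=> z _; rewrite lee_fin mulr_ge0 ?powR_ge0.
- exact: measurable_cst.
- have wM' : {ae mu, forall z : lebT R n, Om z -> (w z <= M)%R} := wM.
  apply: filterS wM' => z wz Oz; rewrite lee_fin /C.
  apply: ler_pM; rewrite ?w0 ?powR_ge0//.
    exact: le_trans (wz Oz) (ler_norm _).
  have b : (enorm (grad phi z) <= \sum_(i < n) L i)%R.
    apply: (le_trans (enorm_le_sum _)); apply: ler_sum => i _; rewrite mxE; exact: HL.
  apply: ge0_ler_powR; rewrite ?nnegrE ?enorm_ge0 ?(ltW s0)//.
  exact: le_trans (enorm_ge0 _) b.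
Qed.

End gradient_energy.

Lemma uniform_convex_bound (R : realFieldType) (e l c m a1 a2 a3 b1 b2 b3 C : R) : 0 < l + 1 -> 0 < e ->
  0 <= C -> c <= 1 -> a1 + b1 <= l + c -> a2 + b2 <= l + c -> m <= a3 + b3 ->
  C * (l + c - m) <= e / 2 ->
  e / (4 * (l + 1)) * (a1 + a2) + C * ((a1 + a2) / 2 - a3) +
   (e / (4 * (l + 1)) * (b1 + b2) + C * ((b1 + b2) / 2 - b3)) <= e.
Proof.
move=> l1 e0 C0 c1 h1 h2 hm hC; set d := e / (4 * (l + 1)).
have d0 : 0 < d by rewrite divr_gt0// mulr_gt0.
have g1 : d * ((a1 + b1) + (a2 + b2)) <= e / 2.
  apply: (@le_trans _ _ (d * (2 * (l + 1)))); first by rewrite ler_wpM2l ?(ltW d0)//; lra.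
  by rewrite /d le_eqVlt; apply/orP; left; apply/eqP; field; rewrite gt_eqF.
have g2 : C * (((a1 + b1) + (a2 + b2)) / 2 - (a3 + b3)) <= C * (l + c - m).
  by rewrite ler_wpM2l//; lra.
lra.
Qed.

Lemma half_frac (R : realFieldType) (e a : R) : 0 < e -> 0 <= a -> e / (2 * (a + 1)) * a <= e / 2.
Proof.
move=> e0 a0; have a1 : 0 < a + 1 by lra.
have -> : e / (2 * (a + 1)) * a = e / 2 * (a / (a + 1)) by field; rewrite gt_eqF.
by apply: ler_piMr; [rewrite divr_ge0// ltW|rewrite ler_pdivrMr// mul1r lerDl].
Qed.

Section grad_linear.
Context {R : realType} {n : nat}.
Implicit Types phi psi : 'rV[R]_n -> R.

Lemma gradD phi psi x : smooth phi -> smooth psi ->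
  grad (fun x => phi x + psi x) x = grad phi x + grad psi x.
Proof.
move=> sp ss; apply/rowP => i; rewrite !mxE.
have := partialD i (smooth_differentiable x sp) (smooth_differentiable x ss).
by [].
Qed.

Lemma gradZ (c : R) phi x : smooth phi -> grad (fun x => c * phi x) x = c *: grad phi x.
Proof.
move=> sp; apply/rowP => i; rewrite !mxE.
have := partialZ i c (smooth_differentiable x sp).
by [].
Qed.

Lemma vmeas_grad Om phi : smooth phi -> vmeas Om (grad phi).
Proof.
move=> sphi i; have := measurable_smooth (D := Om) (smooth_partial i sphi).
by congr measurable_fun; apply/funext => x; rewrite mxE.
Qed.

End grad_linear.

Lemma genergy_mono {R : realType} {n : nat} (Om : set 'rV[R]_n) (w : 'rV[R]_n -> R) (s : R)
    (g h : 'rV[R]_n -> 'rV[R]_n) : measurable (Om : set (lebT R n)) ->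
  measurable_fun (Om : set (lebT R n)) (w : lebT R n -> R) -> (forall z, Om z -> 0 <= w z) -> 1 < s ->
  vmeas Om g -> vmeas Om h -> (forall z, enorm (g z) <= enorm (h z)) ->
  (genergy Om w s g <= genergy Om w s h)%E.
Proof.
move=> mOm mw w0 s1 mg mh gh; apply: ge0_le_integral.
- exact: mOm.
- by move=> z Oz; rewrite lee_fin mulr_ge0 ?w0 ?powR_ge0.
- by apply/measurable_EFinP; exact: measurable_genergy.
- by apply/measurable_EFinP; exact: measurable_genergy.
move=> z Oz; rewrite lee_fin; apply: ler_wpM2l; first exact: w0.
by apply: ge0_ler_powR; [exact: ltW (lt_trans ltr01 s1)|rewrite nnegrE; exact: enorm_ge0|rewrite nnegrE; exact: enorm_ge0|exact: gh].
Qed.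

(** A modular rather than a norm: it satisfies the triangle inequality up to the factor [2^r]. The
    [L^r] part makes the coupling continuous. *)
Definition sdist {R : realType} {n : nat} (Om : set 'rV[R]_n) (p q : R) (eta : 'rV[R]_n -> R) (r : R)
    (u : 'rV[R]_n -> R) (g : 'rV[R]_n -> 'rV[R]_n) : \bar R :=
  (\int[@leb R n]_(z in (Om : set (lebT R n))) (`|u z| `^ r)%:E +
    (genergy Om (fun=> 1%R) p g + genergy Om eta q g))%E.

(** The working form of [W01H], with the gradient carried as a second component instead of being
    selected by [wgrad], which makes sums and limits immediate. The equivalence is [sob_W01H] and
    [W01H_sob]. *)
Definition sob {R : realType} {n : nat} (Om : set 'rV[R]_n) (p q : R) (eta : 'rV[R]_n -> R) (r : R)
    (u : 'rV[R]_n -> R) (g : 'rV[R]_n -> 'rV[R]_n) : Prop :=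
  [/\ leb_measurable_fun Om u, vmeas Om g & forall e : R, 0 < e -> exists2 phi, test_fun Om phi &
    (sdist Om p q eta r (fun z => u z - phi z)%R (fun z => g z - grad phi z)%R <= e%:E)%E].

Lemma sum_two_le (R : realFieldType) (x y a b e : R) : x <= a + e -> y <= b + e -> x + y <= a + b + 2 * e.
Proof. by move=> h1 h2; lra. Qed.

Lemma lt_third (R : realType) (e : R) : 0 < e -> e / 3 + e / 3 < e.
Proof. by move=> e0; lra. Qed.

(** * The space of limits of test functions and its identification with [W01H] *)

Section sobolev_space.
Context {R : realType} {n : nat} (Om : set 'rV[R]_n) (p q r rho M : R) (eta : 'rV[R]_n -> R).
Notation mu := (@leb R n).
Notation sd := (sdist Om p q eta r).
Notation W := (sob Om p q eta r).
Notation GA := (genergy Om (fun=> 1%R) p).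
Notation GB := (genergy Om eta q).
Notation IL u := (\int[mu]_(z in (Om : set (lebT R n))) (`|u z| `^ r)%:E)%E.
Hypotheses (n0 : (0 < n)%N) (oOm : open Om) (Orho : Om `<=` cball rho) (rho0 : 0 <= rho)
  (p1 : 1 < p) (pq : p < q) (qr : q < r) (crit : n%:R * (r - p) < p * r)
  (meta : leb_measurable_fun Om eta) (eta0 : forall z, Om z -> 0 <= eta z)
  (etaM : ae_on Om (fun z => eta z <= M)).
Implicit Types (u v phi : 'rV[R]_n -> R) (g h : 'rV[R]_n -> 'rV[R]_n).

Let mOm : measurable (Om : set (lebT R n)). Proof. exact: open_leb_measurable. Qed.
Let muOm : (mu Om < +oo)%E.
Proof. by apply: le_lt_trans (leb_cball_fin (n := n) rho); exact: le_lebesgue_outer. Qed.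
Let m1 : measurable_fun (Om : set (lebT R n)) ((fun=> 1) : lebT R n -> R). Proof. exact: measurable_cst. Qed.
Let w1 : forall z : 'rV[R]_n, Om z -> 0 <= (fun=> 1 : R) z. Proof. by []. Qed.
Let q1 : 1 < q. Proof. exact: lt_trans p1 pq. Qed.
Let r1 : 1 < r. Proof. exact: lt_trans q1 qr. Qed.
Let pr : p < r. Proof. exact: lt_trans pq qr. Qed.
Let p0 : 0 < p. Proof. exact: lt_trans ltr01 p1. Qed.
Let q0 : 0 < q. Proof. exact: lt_trans ltr01 q1. Qed.
Let r0 : 0 < r. Proof. exact: lt_trans ltr01 r1. Qed.
Local Open Scope ereal_scope.

Let IL_ge0 u : 0 <= IL u. Proof. by apply: integral_ge0 => z _; rewrite lee_fin powR_ge0. Qed.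
Let GA_ge0 g : 0 <= GA g. Proof. exact: (genergy_ge0 p w1 g). Qed.
Let GB_ge0 g : 0 <= GB g. Proof. exact: (genergy_ge0 q eta0 g). Qed.
Let sd_ge0 u g : 0 <= sd u g. Proof. exact: adde_ge0 (IL_ge0 u) (adde_ge0 (GA_ge0 g) (GB_ge0 g)). Qed.

Lemma sdist_L u g : IL u <= sd u g. Proof. exact: leeDl (adde_ge0 (GA_ge0 g) (GB_ge0 g)). Qed.
Lemma sdist_A u g : GA g <= sd u g.
Proof. exact: le_trans (leeDl _ (GB_ge0 g)) (leeDr _ (IL_ge0 u)). Qed.
Lemma sdist_B u g : GB g <= sd u g.
Proof. exact: le_trans (leeDr _ (GA_ge0 g)) (leeDr _ (IL_ge0 u)). Qed.

Let lmB u v : leb_measurable_fun Om u -> leb_measurable_fun Om v -> leb_measurable_fun Om (fun z => u z - v z)%R.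
Proof. exact: measurable_funB. Qed.

Let lmD u v : leb_measurable_fun Om u -> leb_measurable_fun Om v -> leb_measurable_fun Om (fun z => u z + v z)%R.
Proof. exact: measurable_funD. Qed.

Let lmZ (t : R) u : leb_measurable_fun Om u -> leb_measurable_fun Om (fun z => t * u z)%R.
Proof. by move=> mu_; exact: (measurable_funM (@measurable_cst _ _ (lebT R n) R Om t) mu_). Qed.

Let lmS phi : smooth phi -> leb_measurable_fun Om phi.
Proof. exact: measurable_smooth. Qed.

Lemma sdistD u v g h (a : 'rV[R]_n -> R) (k : 'rV[R]_n -> 'rV[R]_n) :
  leb_measurable_fun Om u -> leb_measurable_fun Om v -> vmeas Om g -> vmeas Om h ->
  (forall z, a z = u z + v z)%R -> (forall z, k z = g z + h z)%R ->
  sd a k <= (2 `^ r)%:E * (sd u g + sd v h).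
Proof.
move=> mu_ mv mg mh /funext -> /funext ->.
have two s : (s <= r)%R -> (2 `^ s)%:E <= (2 `^ r)%:E :> \bar R.
  by move=> sr; rewrite lee_fin ler_powR// ler1n.
have L := @integral_powRD_le _ (lebT R n) R mu Om r u v mOm mu_ mv (ltW r0).
have A := genergyD_le mOm m1 w1 p1 mg mh.
have B := genergyD_le mOm meta eta0 q1 mg mh.
have gA := adde_ge0 (GA_ge0 g) (GA_ge0 h).
have gB := adde_ge0 (GB_ge0 g) (GB_ge0 h).
rewrite /sdist (addeACA (IL u) (GA g + GB g) (IL v) (GA h + GB h)) (addeACA (GA g) (GB g) (GA h) (GB h)).
rewrite (ge0_muleDr _ (adde_ge0 (IL_ge0 u) (IL_ge0 v)) (adde_ge0 gA gB)) (ge0_muleDr _ gA gB).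
apply: (leeD L); apply: leeD.
  exact: le_trans A (lee_wpmul2r gA (two _ (ltW pr))).
exact: le_trans B (lee_wpmul2r gB (two _ (ltW qr))).
Qed.

Lemma integral_powRZ (t : R) u : leb_measurable_fun Om u ->
  IL (fun z => t * u z)%R = (`|t| `^ r)%:E * IL u.
Proof.
move=> mu_.
have := @ge0_integral_addZ _ (lebT R n) R mu Om mOm (`|t| `^ r)%R _ _ (powR_ge0 _ _)
    (@measurable_cst _ _ (lebT R n) R Om 0%R) (measurable_norm_powR r mu_) (fun _ _ => lexx _) (fun z _ => powR_ge0 _ _).
rewrite integral0 add0e => <-; apply: eq_integral => z _ /=.
by rewrite add0r normrM powRM.
Qed.

Lemma sdistZ (t : R) u g : leb_measurable_fun Om u -> vmeas Om g ->
  sd (fun z => t * u z)%R (fun z => t *: g z)%R <= (1 + `|t| `^ r)%:E * sd u g.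
Proof.
move=> mu_ mg; rewrite /sdist.
rewrite (ge0_muleDr _ (IL_ge0 u) (adde_ge0 (GA_ge0 g) (GB_ge0 g))) (ge0_muleDr _ (GA_ge0 g) (GB_ge0 g)).
rewrite (@genergyZ R n Om (fun=> 1%R) p mOm m1 w1 t g mg) (@genergyZ R n Om eta q mOm meta eta0 t g mg) (integral_powRZ t mu_).
have h s : (0 <= s)%R -> (s <= r)%R -> (`|t| `^ s)%:E <= (1 + `|t| `^ r)%:E.
  by move=> s0 sr; rewrite lee_fin powR_le1D.
apply: leeD; first exact: lee_wpmul2r (IL_ge0 u) _ _ (h _ (ltW r0) (lexx r)).
apply: leeD; first exact: lee_wpmul2r (GA_ge0 g) _ _ (h _ (ltW p0) (ltW pr)).
exact: lee_wpmul2r (GB_ge0 g) _ _ (h _ (ltW q0) (ltW qr)).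
Qed.

Lemma sdistN u v g h : sd (fun z => u z - v z)%R (fun z => g z - h z)%R =
  sd (fun z => v z - u z)%R (fun z => h z - g z)%R.
Proof.
have E : IL (fun z => u z - v z)%R = IL (fun z => v z - u z)%R.
  by apply: eq_integral => z _; rewrite distrC.
by rewrite /sdist E (genergyN Om (fun=> 1%R) p g h) (genergyN Om eta q g h).
Qed.

Lemma sdistB u v w g h k : leb_measurable_fun Om u -> leb_measurable_fun Om v -> leb_measurable_fun Om w ->
  vmeas Om g -> vmeas Om h -> vmeas Om k ->
  sd (fun z => u z - w z)%R (fun z => g z - k z)%R <=
  (2 `^ r)%:E * (sd (fun z => u z - v z)%R (fun z => g z - h z)%R + sd (fun z => v z - w z)%R (fun z => h z - k z)%R).
Proof.
by move=> a b c d e f; apply: (sdistD (lmB a b) (lmB b c) (vmeasB d e) (vmeasB e f)) => z; rewrite addrA subrK.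
Qed.

Let c2 : (0 < 2 `^ r :> R)%R. Proof. by rewrite powR_gt0. Qed.
Let c2e : 0 <= (2 `^ r : R)%:E. Proof. by rewrite lee_fin ltW. Qed.

Let half_bound (a b : \bar R) (e : R) : a <= (e / (2 * 2 `^ r))%:E -> b <= (e / (2 * 2 `^ r))%:E ->
  (2 `^ r)%:E * (a + b) <= e%:E.
Proof.
move=> ha hb; apply: le_trans (lee_wpmul2l c2e (leeD ha hb)) _.
rewrite -EFinD -EFinM lee_fin le_eqVlt; apply/orP; left; apply/eqP; field.
exact: lt0r_neq0.
Qed.

Let half_gt0 (e : R) : (0 < e)%R -> (0 < e / (2 * 2 `^ r))%R.
Proof. by move=> e0; rewrite divr_gt0// mulr_gt0. Qed.

Lemma sob_test phi : test_fun Om phi -> W phi (grad phi).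
Proof.
move=> tphi; have sphi := test_fun_smooth tphi; split.
- exact: measurable_smooth.
- exact: vmeas_grad.
move=> e e0; exists phi => //; rewrite /sdist /genergy !integral0_eq ?adde0 ?lee_fin ?(ltW e0)// => z _.
- by rewrite subrr enorm0 powR0 ?mulr0// gt_eqF.
- by rewrite subrr enorm0 powR0 ?mulr0// gt_eqF.
- by rewrite subrr normr0 powR0// gt_eqF.
Qed.

Lemma sobD u v g h : W u g -> W v h -> W (fun z => u z + v z)%R (fun z => g z + h z)%R.
Proof.
move=> [mu_ mg Hu] [mv mh Hv]; split; [exact: lmD|exact: vmeasD|].
move=> e /half_gt0 e0; have [phi tphi Hphi] := Hu _ e0; have [psi tpsi Hpsi] := Hv _ e0.
have sphi := test_fun_smooth tphi; have spsi := test_fun_smooth tpsi.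
exists (fun z => phi z + psi z)%R; first exact: test_funD.
apply: le_trans _ (half_bound Hphi Hpsi).
apply: (sdistD (lmB mu_ (lmS sphi)) (lmB mv (lmS spsi)) (vmeasB mg (@vmeas_grad R n Om _ sphi)) (vmeasB mh (@vmeas_grad R n Om _ spsi))) => z.
  by rewrite opprD addrACA.
by rewrite gradD// opprD addrACA.
Qed.

Lemma sobZ (t : R) u g : W u g -> W (fun z => t * u z)%R (fun z => t *: g z)%R.
Proof.
move=> [mu_ mg Hu]; split.
- exact: lmZ.
- exact: vmeasZ.
move=> e e0; have k0 : (0 < 1 + `|t| `^ r)%R by rewrite ltr_wpDr// powR_ge0.
have [phi tphi Hphi] := Hu _ (divr_gt0 e0 k0).
have sphi := test_fun_smooth tphi.
exists (fun z => t * phi z)%R; first exact: test_funZ.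
have := sdistZ t (lmB mu_ (lmS sphi)) (vmeasB mg (@vmeas_grad R n Om _ sphi)).
rewrite (_ : (fun z => t * (u z - phi z))%R = (fun z => t * u z - t * phi z)%R); last by apply/funext => z; rewrite mulrBr.
rewrite (_ : (fun z => t *: (g z - grad phi z))%R = (fun z => t *: g z - grad (fun z => t * phi z) z)%R); last first.
  by apply/funext => z; rewrite gradZ// scalerBr.
move=> T; apply: (le_trans T).
apply: (@le_trans _ _ ((1 + `|t| `^ r)%:E * (e / (1 + `|t| `^ r))%:E)).
  by apply: lee_wpmul2l => //; rewrite lee_fin ltW.
by rewrite -EFinM mulrC mulfVK// gt_eqF.
Qed.

Lemma sobB u v g h : W u g -> W v h -> W (fun z => u z - v z)%R (fun z => g z - h z)%R.
Proof.
move=> Wu /(sobZ (-1)) Wv; have := sobD Wu Wv.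
rewrite (_ : (fun z => u z + -1 * v z)%R = (fun z => u z - v z)%R); last by apply/funext => z; rewrite mulN1r.
rewrite (_ : (fun z => g z + -1 *: h z)%R = (fun z => g z - h z)%R)//; last by apply/funext => z; rewrite scaleN1r.
Qed.

Lemma sob_closed u g : leb_measurable_fun Om u -> vmeas Om g ->
  (forall e : R, (0 < e)%R -> exists v h, W v h /\ sd (fun z => u z - v z)%R (fun z => g z - h z)%R <= e%:E) ->
  W u g.
Proof.
move=> mu_ mg H; split => // e /half_gt0 e0.
have [v [h [[mv mh Hv] Hvh]]] := H _ e0.
have [phi tphi Hphi] := Hv _ e0; have sphi := test_fun_smooth tphi.
exists phi => //.
apply: le_trans (sdistB mu_ mv (lmS sphi) mg mh (@vmeas_grad R n Om _ sphi)) _.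
exact: half_bound Hvh Hphi.
Qed.

Lemma sdist_test_fin phi : test_fun Om phi -> sd phi (grad phi) < +oo.
Proof.
move=> tphi; have sphi := test_fun_smooth tphi.
have h1 : ae_on Om (fun z => (fun=> 1%R) z <= 1 :> R)%R by apply: aeW => z _.
apply: lte_add_pinfty; last first.
  apply: lte_add_pinfty.
  exact: (genergy_test_fin mOm m1 w1 p1 muOm tphi h1).
  exact: (genergy_test_fin mOm meta eta0 q1 muOm tphi etaM).
have [C HC] := test_fun_bounded tphi.
apply: (@le_lt_trans _ _ (\int[mu]_(z in (Om : set (lebT R n))) (C `^ r)%:E)); last first.
  rewrite (integral_cst mu mOm); apply: lte_mul_pinfty; [by rewrite lee_fin powR_ge0|by []|exact: muOm].
apply: ge0_le_integral.
- exact: mOm.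
- by move=> z _; rewrite lee_fin powR_ge0.
- by apply/measurable_EFinP; apply: measurable_norm_powR; exact: measurable_smooth.
- exact: measurable_cst.
- by move=> z _; rewrite lee_fin; apply: ge0_ler_powR; rewrite ?nnegrE ?(ltW r0)// (le_trans _ (HC z)).
Qed.

Lemma sob_fin u g : W u g -> sd u g < +oo.
Proof.
move=> [mu_ mg Hu]; have [phi tphi Hphi] := Hu _ ltr01.
have sphi := test_fun_smooth tphi.
have T := @sdistD _ phi _ (grad phi) u g (lmB mu_ (lmS sphi)) (lmS sphi) (vmeasB mg (@vmeas_grad R n Om _ sphi))
  (@vmeas_grad R n Om _ sphi) (fun z => esym (subrK _ _)) (fun z => esym (subrK _ _)).
apply: (le_lt_trans T); apply: lte_mul_pinfty; [exact: c2e|by []|].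
apply: lte_add_pinfty; last exact: sdist_test_fin.
exact: le_lt_trans Hphi (ltry _).
Qed.

(** Multiplying by [b^(-1/p)] brings the energy below 1; the inequality for the normalised function
    scales back with [b^(r/p)]. *)
Let test_sobolev : exists2 C : R, (0 <= C)%R & forall phi (b : R), test_fun Om phi -> (0 < b)%R ->
  GA (grad phi) <= b%:E -> grad_energy p (fun z => b `^ (- p^-1) * phi z)%R <= 1 /\
  IL phi <= (C * b `^ (r / p))%:E.
Proof.
have [C C0 HC] := sobolev n0 p1 pr crit rho0; exists C => // phi b tphi b0 Gb.
have sphi := test_fun_smooth tphi.
pose t : R := (b `^ (- p^-1))%R; have t0 : (0 <= t)%R by exact: powR_ge0.
have tt : test_fun Om (fun z => t * phi z)%R by exact: test_funZ.
have tp : (t `^ p = b^-1)%R by rewrite /t -powRrM mulNr mulVf ?gt_eqF// powR_inv1// ltW.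
have G1 : grad_energy p (fun z => t * phi z)%R <= 1.
  have -> : grad_energy p (fun z => t * phi z)%R = GA (grad (fun z => t * phi z)%R).
    rewrite /grad_energy /genergy [RHS]integral_mkcond; apply: eq_integral => z _.
    rewrite patchE; case: ifPn => [_|]; first by rewrite mul1r.
    rewrite notin_setE => nO; have -> : grad (fun z => t * phi z)%R z = 0%R.
      by apply/rowP => i; rewrite !mxE; exact: (test_fun_out (test_fun_partial i tt)).
    by rewrite enorm0 powR0 ?gt_eqF.
  have -> : GA (grad (fun z => t * phi z)%R) = GA (fun z => t *: grad phi z)%R.
    by apply: eq_integral => z _; rewrite gradZ.
  rewrite (@genergyZ R n Om (fun=> 1%R) p mOm m1 w1 t _ (@vmeas_grad R n Om _ sphi)) ger0_norm// tp.
  apply: (@le_trans _ _ ((b^-1)%:E * b%:E)).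
    by apply: lee_wpmul2l => //; rewrite lee_fin invr_ge0 ltW.
  by rewrite -EFinM mulVf// gt_eqF.
split; first exact: G1.
have := HC Om _ Orho tt G1.
have -> : \int[mu]_x (`|t * phi x| `^ r)%:E = (t `^ r)%:E * IL phi.
  have := integral_powRZ t (lmS sphi); rewrite (ger0_norm t0) => <-.
  rewrite [RHS]integral_mkcond; apply: eq_integral => z _.
  rewrite patchE; case: ifPn => // ; rewrite notin_setE => nO.
  by rewrite (test_fun_out tphi nO) mulr0 normr0 powR0// gt_eqF.
have tr : (t `^ r = (b `^ (r / p))^-1)%R.
  by rewrite /t -powRrM -powRN; congr (_ `^ _)%R; rewrite mulNr mulrC.
rewrite tr -lee_pdivlMl ?invr_gt0 ?powR_gt0// invrK => h; apply: (le_trans h).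
by rewrite -EFinM mulrC.
Qed.

Lemma sob_sobolev : exists2 K : R, (0 <= K)%R & forall u g (a : R), W u g -> (0 < a)%R -> GA g <= a%:E ->
  IL u <= (K * a `^ (r / p))%:E.
Proof.
have [C C0 HC] := test_sobolev.
exists (2 `^ r * (1 + C * (2 `^ p * 2) `^ (r / p)))%R.
  by rewrite mulr_ge0 ?powR_ge0// addr_ge0 ?mulr_ge0 ?powR_ge0.
move=> u g a [mu_ mg Hu] a0 Ga.
(* The accuracy is tied to [a] in both parts, so that the error terms scale like the bound to be
   proved. *)
have e0 : (0 < Num.min a (a `^ (r / p)))%R by rewrite lt_min a0 powR_gt0.
have [phi tphi Hphi] := Hu _ e0; have sphi := test_fun_smooth tphi.
have b0 : (0 < 2 `^ p * 2 * a)%R by rewrite mulr_gt0// mulr_gt0// powR_gt0.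
have Gphi : GA (grad phi) <= (2 `^ p * 2 * a)%:E.
  have := genergyD_le mOm m1 w1 p1 (vmeasB (@vmeas_grad R n Om _ sphi) mg) mg.
  rewrite (_ : (fun z => grad phi z - g z + g z)%R = grad phi); last by apply/funext => z; rewrite subrK.
  move=> T; apply: (le_trans T).
  have -> : (2 `^ p * 2 * a = 2 `^ p * (a + a))%R by ring.
  rewrite EFinM; apply: lee_wpmul2l; first by rewrite lee_fin powR_ge0.
  rewrite EFinD; apply: (leeD _ Ga).
  rewrite genergyN; apply: (le_trans (sdist_A _ _)); apply: (le_trans Hphi).
  by rewrite lee_fin ge_min lexx.
have [_ Lphi] := HC _ _ tphi b0 Gphi.
have T := @integral_powRD_le _ (lebT R n) R mu Om r _ _ mOm (lmB mu_ (lmS sphi)) (lmS sphi) (ltW r0).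
have E : \int[mu]_(z in (Om : set (lebT R n))) (`|u z - phi z + phi z| `^ r)%:E = IL u.
  by apply: eq_integral => z _; rewrite subrK.
rewrite E in T; apply: (le_trans T); rewrite -mulrA EFinM; apply: (lee_wpmul2l c2e).
have -> : ((1 + C * (2 `^ p * 2) `^ (r / p)) * a `^ (r / p) = a `^ (r / p) + C * ((2 `^ p * 2) `^ (r / p) * a `^ (r / p)))%R by ring.
rewrite EFinD; apply: leeD.
  apply: (le_trans (sdist_L _ _)); apply: (le_trans Hphi).
  by rewrite lee_fin ge_min lexx orbT.
apply: (le_trans Lphi); rewrite lee_fin -powRM ?(ltW a0)// mulr_ge0// powR_ge0.
Qed.

Let test_near u g (a : R) phi : W u g -> GA g <= a%:E -> test_fun Om phi ->
  sd (fun z => u z - phi z)%R (fun z => g z - grad phi z)%R <= a%:E -> GA (grad phi) <= (2 `^ p * 2 * a)%:E.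
Proof.
move=> [mu_ mg _] Ga tphi Hphi; have sphi := test_fun_smooth tphi.
have := genergyD_le mOm m1 w1 p1 (vmeasB (@vmeas_grad R n Om _ sphi) mg) mg.
rewrite (_ : (fun z => grad phi z - g z + g z)%R = grad phi); last by apply/funext => z; rewrite subrK.
move=> T; apply: (le_trans T).
have -> : (2 `^ p * 2 * a = 2 `^ p * (a + a))%R by ring.
rewrite EFinM; apply: lee_wpmul2l; first by rewrite lee_fin powR_ge0.
rewrite EFinD; apply: (leeD _ Ga).
by rewrite genergyN; exact: le_trans (sdist_A (fun z => u z - phi z)%R _) Hphi.
Qed.

Let ILD u v w : leb_measurable_fun Om u -> leb_measurable_fun Om v -> leb_measurable_fun Om w ->
  IL (fun z => u z - w z)%R <= (2 `^ r)%:E * (IL (fun z => u z - v z)%R + IL (fun z => v z - w z)%R).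
Proof.
move=> a b c; have T := @integral_powRD_le _ (lebT R n) R mu Om r _ _ mOm (lmB a b) (lmB b c) (ltW r0).
apply: le_trans T; rewrite le_eqVlt; apply/orP; left; apply/eqP.
by apply: eq_integral => z _; rewrite addrA subrK.
Qed.

Let harm (k : nat) : R := (k.+1%:R^-1)%R.

Let harm_gt0 k : (0 < harm k)%R. Proof. by rewrite invr_gt0. Qed.

Let harm_small (e : R) : (0 < e)%R -> exists N, forall k, (N <= k)%N -> (harm k <= e)%R.
Proof.
move=> e0; have c : harm k @[k --> \oo] --> (0%R : R) by exact: cvg_harmonic.
move/cvgrPdist_le : c => /(_ _ e0)[N _ H]; exists N => k Nk; have := H k Nk.
by rewrite /= sub0r normrN ger0_norm// ltW.
Qed.

Let harm_le k j : (k <= j)%N -> (harm j <= harm k)%R.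
Proof. by move=> kj; rewrite /harm lef_pV2 ?posrE// ler_nat. Qed.

(** Replace [u_ k] by a test function within [1/(k+1)], normalise, apply [rellich], and undo the
    scaling on the limit. *)
Lemma sob_compact (u_ : nat -> 'rV[R]_n -> R) (g_ : nat -> 'rV[R]_n -> 'rV[R]_n) (a : R) :
  (0 < a)%R -> (forall k, W (u_ k) (g_ k)) -> (forall k, GA (g_ k) <= a%:E) ->
  exists (s : nat -> nat) u, [/\ forall i, (i <= s i)%N, leb_measurable_fun Om u &
    forall e : R, (0 < e)%R -> exists N, forall i, (N <= i)%N -> IL (fun z => u_ (s i) z - u z)%R <= e%:E].
Proof.
move=> a0 Wk Gk; have [C C0 HC] := test_sobolev.
have /choice[phi Hphi] : forall k, exists phi, test_fun Om phi /\
    sd (fun z => u_ k z - phi z)%R (fun z => g_ k z - grad phi z)%R <= (Num.min a (harm k))%:E.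
  move=> k; have [_ _ H] := Wk k.
  have e0 : (0 < Num.min a (harm k))%R by rewrite lt_min a0 harm_gt0.
  by have [phi t h] := H _ e0; exists phi.
have tphi k : test_fun Om (phi k) by have [] := Hphi k.
have sphi k := test_fun_smooth (tphi k).
pose b : R := (2 `^ p * 2 * a)%R.
have b0 : (0 < b)%R by rewrite mulr_gt0// mulr_gt0// powR_gt0.
pose t : R := (b `^ (- p^-1))%R; have t0 : (0 < t)%R by rewrite powR_gt0.
have G1 k : grad_energy p (fun z => t * phi k z)%R <= 1.
  have Gb : GA (grad (phi k)) <= b%:E.
    apply: (test_near (Wk k) (Gk k) (tphi k)); apply: (le_trans (Hphi k).2).
    by rewrite lee_fin ge_min lexx.
  by have [] := HC _ _ (tphi k) b0 Gb.
have [s sge Hs] := rellich n0 p1 pr crit rho0 Orho (fun k => test_funZ t (tphi k)) G1.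
have mt k : leb_measurable_fun Om (fun z => t * phi k z)%R by exact: lmZ (lmS (sphi k)).
have Hc (e : R) : (0 < e)%R -> exists N, forall i j, (N <= i)%N -> (N <= j)%N ->
    \int[mu]_(x in (Om : set (lebT R n))) (`|t * phi (s i) x - t * phi (s j) x| `^ r)%:E <= e%:E.
  move=> /Hs[N HN]; exists N => i j Ni Nj; apply: le_trans (HN i j Ni Nj).
  apply: ge0_subset_integral.
  - exact: mOm.
  - exact: measurableT.
  - apply/measurable_EFinP; apply: measurable_norm_powR.
    apply: measurable_funB; apply: measurable_smooth; exact: test_fun_smooth (test_funZ t (tphi _)).
  - by move=> x _; rewrite lee_fin powR_ge0.
  - by [].
have [v [mv Hv _]] := @Lr_complete _ (lebT R n) R mu Om mOm r (fun i z => t * phi (s i) z)%R r0 (fun i => mt (s i)) Hc.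
have mu_ k : leb_measurable_fun Om (u_ k) by have [] := Wk k.
have mlim : leb_measurable_fun Om (fun z => t^-1 * v z)%R by exact: lmZ.
exists s, (fun z => t^-1 * v z)%R; split => // e /half_gt0 e0.
set d := (e / (2 * 2 `^ r))%R in e0.
have d0 : (0 < t `^ r * d)%R by rewrite mulr_gt0// powR_gt0.
have [N1 HN1] := harm_small e0; have [N2 HN2] := Hv _ d0.
exists (maxn N1 N2) => i; rewrite geq_max => /andP[i1 i2].
apply: le_trans (ILD (mu_ (s i)) (lmS (sphi (s i))) mlim) _; apply: half_bound.
  apply: (le_trans (sdist_L _ _)); apply: (le_trans (Hphi (s i)).2).
  by rewrite lee_fin ge_min HN1 ?orbT// (leq_trans i1).
have -> : IL (fun z => phi (s i) z - t^-1 * v z)%R = IL (fun z => t^-1 * (t * phi (s i) z - v z))%R.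
  by apply: eq_integral => z _; rewrite mulrBr mulrA mulVf ?mul1r// gt_eqF.
rewrite (integral_powRZ t^-1 (lmB (mt (s i)) mv)) ger0_norm ?invr_ge0 ?(ltW t0)//.
apply: (@le_trans _ _ ((t^-1 `^ r)%:E * (t `^ r * d)%:E)).
  by apply: lee_wpmul2l; [rewrite lee_fin powR_ge0|exact: HN2].
rewrite -EFinM mulrA -powRM ?invr_ge0 ?(ltW t0)// mulVf ?gt_eqF// powR1 mul1r.
exact: lexx.
Qed.

Let sob_mid v w h k : W v h -> W w k -> W (fun z => 2^-1 * (v z + w z))%R (fun z => 2^-1 *: (h z + k z))%R.
Proof. by move=> a b; exact: sobZ (sobD a b). Qed.

Let IL_mid u v w : leb_measurable_fun Om u -> leb_measurable_fun Om v -> leb_measurable_fun Om w ->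
  IL (fun z => 2^-1 * (v z + w z) - u z)%R <= (2^-1)%:E * (IL (fun z => v z - u z)%R + IL (fun z => w z - u z)%R).
Proof.
move=> a b c; have h0 : (0 <= 2^-1 :> R)%R by rewrite invr_ge0.
have mm : leb_measurable_fun Om (fun z => 2^-1 * (v z + w z) - u z)%R by exact: lmB (lmZ _ (lmD b c)) a.
apply: (@ge0_integral_le_lin _ (lebT R n) R mu Om mOm _ _ _ _ h0 (measurable_norm_powR r mm)
  (measurable_norm_powR r (lmB b a)) (measurable_norm_powR r (lmB c a))
  (fun _ _ => powR_ge0 _ _) (fun _ _ => powR_ge0 _ _) (fun _ _ => powR_ge0 _ _)) => z _.
rewrite [leRHS]mulrC; apply: le_trans (ler_powR_mid r1 (normr_ge0 _) (normr_ge0 _)).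
apply: ge0_ler_powR; rewrite ?nnegrE ?divr_ge0 ?addr_ge0 ?(ltW r0)//.
rewrite (_ : 2^-1 * (v z + w z) - u z = (v z - u z + (w z - u z)) / 2)%R; last by field.
rewrite normrM (ger0_norm h0); apply: ler_wpM2r; [exact: h0|exact: ler_normD].
Qed.

(** The sets [K e] of competitors are stable under midpoints and shrink with [e]. Total energies of
    near-minimisers over [K (1/(k+1))] approach a common limit [l], and a midpoint cannot fall below
    the infimum, so uniform convexity makes their gradients Cauchy. The limit gradient belongs to
    [u], and Fatou gives the two separate bounds. *)
Lemma sob_weak_closed u (a b : R) : leb_measurable_fun Om u ->
  (forall e : R, (0 < e)%R -> exists v h, [/\ W v h, IL (fun z => v z - u z)%R <= e%:E,
     GA h <= (a + e)%:E & GB h <= (b + e)%:E]) ->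
  exists g, [/\ W u g, GA g <= a%:E & GB g <= b%:E].
Proof.
move=> mu_ H.
pose K (e : R) (x : ('rV[R]_n -> R) * ('rV[R]_n -> 'rV[R]_n)) : Prop := [/\ W x.1 x.2,
  IL (fun z => x.1 z - u z)%R <= e%:E, GA x.2 <= (a + e)%:E & GB x.2 <= (b + e)%:E].
pose F (x : ('rV[R]_n -> R) * ('rV[R]_n -> 'rV[R]_n)) : R := (fine (GA x.2) + fine (GB x.2))%R.
have F0 x : (0 <= F x)%R by rewrite addr_ge0// fine_ge0.
have Kle e e' x : (e <= e')%R -> K e x -> K e' x.
  move=> ee [k1 k2 k3 k4]; split => //; first by apply: (le_trans k2); rewrite lee_fin.
    by apply: (le_trans k3); rewrite lee_fin lerD2l.
  by apply: (le_trans k4); rewrite lee_fin lerD2l.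
have fA e x : K e x -> GA x.2 = (fine (GA x.2))%:E.
  by move=> [k1 _ k3 _]; rewrite fineK// ge0_fin_numE//; exact: le_lt_trans k3 (ltry _).
have fB e x : K e x -> GB x.2 = (fine (GB x.2))%:E.
  by move=> [k1 _ _ k3]; rewrite fineK// ge0_fin_numE//; exact: le_lt_trans k3 (ltry _).
have leA e x : K e x -> GA x.2 <= (fine (GA x.2))%:E by move=> /fA E; rewrite -E.
have leB e x : K e x -> GB x.2 <= (fine (GB x.2))%:E by move=> /fB E; rewrite -E.
have geA e x : K e x -> (fine (GA x.2))%:E <= GA x.2 by move=> /fA E; rewrite -E.
have geB e x : K e x -> (fine (GB x.2))%:E <= GB x.2 by move=> /fB E; rewrite -E.
have FK e x : K e x -> (F x <= a + b + 2 * e)%R.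
  move=> k; have [_ _ k3 k4] := k; move: k3 k4; rewrite (fA _ _ k) (fB _ _ k) !lee_fin => h3 h4.
  exact: (sum_two_le h3 h4).
have Kn k : exists x, K (harm k) x by have [v [h Hvh]] := H _ (harm_gt0 k); exists (v, h).
(* Nondecreasing because the sets shrink, and bounded by [FK]; hence convergent, and
   [l + harm N - m N] tends to 0. *)
pose m k := inf (F @` K (harm k)).
have hi k : has_inf (F @` K (harm k)).
  split; last by exists 0%R => _ [x _ <-].
  by have [x Kx] := Kn k; exists (F x), x.
have mle k x : K (harm k) x -> (m k <= F x)%R.
  by move=> Kx; apply: ge_inf; [exact: (hi k).2|exists x].
have mnd : {homo m : i j / (i <= j)%N >-> (i <= j)%R}.
  move=> i j ij; apply: lb_le_inf; first exact: (hi j).1.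
  by move=> _ [x Kx <-]; apply: mle; exact: Kle (harm_le ij) Kx.
have mub k : (m k <= a + b + 2)%R.
  have [x Kx] := Kn k; apply: (le_trans (mle _ _ Kx)); apply: (le_trans (FK _ _ Kx)).
  rewrite lerD2l -[leRHS]mulr1 ler_wpM2l// /harm invf_le1// ler1n//.
have mc : cvgn m by apply: nondecreasing_is_cvgn => //; exists (a + b + 2)%R => _ [k _ <-].
pose l := limn m.
have ml k : (m k <= l)%R by exact: nondecreasing_cvgn_le.
have /choice[X HX] : forall k, exists x, K (harm k) x /\ (F x < m k + harm k)%R.
  by move=> k; have [_ [x Kx <-] h] := inf_adherent (harm_gt0 k) (hi k); exists x.
have KX k : K (harm k) (X k) by have [] := HX k.
have l0 : (0 <= l)%R.
  by apply: le_trans (ml 0%N); apply: lb_le_inf; [exact: (hi 0%N).1|move=> _ [x _ <-]].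
have WX k : W (X k).1 (X k).2 by have [] := KX k.
have mX k : leb_measurable_fun Om (X k).1 by have [] := WX k.
have vX k : vmeas Om (X k).2 by have [] := WX k.
have FX k i : (k <= i)%N -> (F (X i) <= l + harm k)%R.
  move=> ki; apply: ltW; apply: (lt_le_trans (HX i).2); apply: lerD => //; exact: harm_le.
have Cau (e : R) : (0 < e)%R -> exists N, forall i j, (N <= i)%N -> (N <= j)%N ->
    GA (fun z => (X i).2 z - (X j).2 z)%R <= e%:E /\ GB (fun z => (X i).2 z - (X j).2 z)%R <= e%:E.
  move=> e0; pose d : R := (e / (4 * (l + 1)))%R.
  have l1 : (0 < l + 1)%R by rewrite ltr_wpDl.
  have d0 : (0 < d)%R by rewrite divr_gt0// mulr_gt0.
  have [CA CA0 HA] := genergy_uniform_convex mOm m1 w1 p1 d0.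
  have [CB CB0 HB] := genergy_uniform_convex mOm meta eta0 q1 d0.
  pose C : R := (CA + CB)%R; have C0 : (0 <= C)%R by rewrite addr_ge0.
  have [N HN] : exists N, (C * (l + harm N - m N) <= e / 2)%R.
    have c1 : (C * (l + harm k - m k))%R @[k --> \oo] --> (C * (l + 0 - l))%R.
      apply: cvgM; first exact: cvg_cst.
      by apply: cvgB => //; apply: cvgD; [exact: cvg_cst|exact: cvg_harmonic].
    have e2 : (0 < e / 2)%R by rewrite divr_gt0.
    move/cvgrPdist_le : c1 => /(_ _ e2)[N _ /(_ N (leqnn N))] h; exists N; move: h => /=.
    rewrite addr0 subrr mulr0 sub0r normrN; apply: le_trans; exact: ler_norm.
  exists N => i j Ni Nj.
  have Ki := Kle _ _ _ (harm_le Ni) (KX i); have Kj := Kle _ _ _ (harm_le Nj) (KX j).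
  have [_ i2 i3 i4] := Ki; have [_ j2 j3 j4] := Kj.
  pose Y := ((fun z => 2^-1 * ((X i).1 z + (X j).1 z))%R, (fun z => 2^-1 *: ((X i).2 z + (X j).2 z))%R).
  have h0 : 0 <= (2^-1 : R)%:E by rewrite lee_fin invr_ge0.
  have av (x : R) (A B : \bar R) : A <= x%:E -> B <= x%:E -> (2^-1)%:E * (A + B) <= x%:E.
    move=> Ax Bx; apply: le_trans (lee_wpmul2l h0 (leeD Ax Bx)) _.
    by rewrite -EFinD -EFinM lee_fin le_eqVlt; apply/orP; left; apply/eqP; field.
  (* The midpoint is again a competitor, so its total energy is at least [m N]: this is the lower
     bound that uniform convexity needs. *)
  have KY : K (harm N) Y.
    split; first exact: sob_mid.
    - exact: le_trans (IL_mid mu_ (mX i) (mX j)) (av _ _ _ i2 j2).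
    - exact: le_trans (genergy_mid mOm m1 w1 p1 (vX i) (vX j)) (av _ _ _ i3 j3).
    - exact: le_trans (genergy_mid mOm meta eta0 q1 (vX i) (vX j)) (av _ _ _ i4 j4).
  have mY := mle _ _ KY.
  have FA := HA C (fine (GA (X i).2)) (fine (GA (X j).2)) (fine (GA Y.2)) _ _ (ler_wpDr CB0 (lexx CA)) (vX i) (vX j).
  have FB := HB C (fine (GB (X i).2)) (fine (GB (X j).2)) (fine (GB Y.2)) _ _ (ler_wpDl CA0 (lexx CB)) (vX i) (vX j).
  have {}FA := FA (leA _ _ Ki) (leA _ _ Kj) (geA _ _ KY).
  have {}FB := FB (leB _ _ Ki) (leB _ _ Kj) (geB _ _ KY).
  have S := leeD FA FB; rewrite -EFinD in S.
  have hN : (harm N <= 1)%R by rewrite /harm invf_le1// ler1n.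
  have bound := uniform_convex_bound l1 e0 C0 hN (FX _ _ Ni) (FX _ _ Nj) mY HN.
  have Se := le_trans S (bound : _%:E <= e%:E).
  split; first exact: le_trans (leeDl _ (GB_ge0 _)) Se.
  exact: le_trans (leeDr _ (GA_ge0 _)) Se.
have /choice[N HN] : forall k, exists N, forall i j, (N <= i)%N -> (N <= j)%N ->
    GA (fun z => (X i).2 z - (X j).2 z)%R <= ((4^-1 ^+ k) `^ p)%:E /\
    GB (fun z => (X i).2 z - (X j).2 z)%R <= ((4^-1 ^+ k) `^ p)%:E.
  by move=> k; apply: Cau; rewrite powR_gt0// exprn_gt0// invr_gt0.
have [t [tN tm]] := monotone_choice N.
have /choice[G HG] : forall i : 'I_n, exists G : lebT R n -> R, measurable_fun (Om : set (lebT R n)) G /\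
    {ae mu, forall z : lebT R n, Om z -> (X (t k)).2 z 0%R i @[k --> \oo] --> G z}.
  move=> i; have [G mG cG] : exists2 G : lebT R n -> R, measurable_fun (Om : set (lebT R n)) G &
      {ae mu, forall z : lebT R n, Om z -> (X (t k)).2 z 0%R i @[k --> \oo] --> G z}.
    apply: (@ae_cvg_fast _ (lebT R n) R mu Om mOm p (fun k z => (X (t k)).2 z 0%R i) p0 (fun k => vX (t k) i)) => k.
    (* The first phase has weight 1, so it controls each coordinate in [L^p] and yields
       almost-everywhere limits of the gradients; the weight [eta] may vanish. *)
    have [A _] := HN k (t k.+1) (t k) (leq_trans (tN k) (tm k).2) (tN k).
    apply: le_trans A; apply: ge0_le_integral.
    - exact: mOm.
    - by move=> z _; rewrite lee_fin powR_ge0.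
    - apply/measurable_EFinP; apply: measurable_norm_powR.
      exact: (measurable_funB (vX (t k.+1) i) (vX (t k) i)).
    - by apply/measurable_EFinP; exact: (@measurable_genergy R n Om (fun=> 1%R) p m1 _ (vmeasB (vX _) (vX _))).
    - move=> z _; rewrite lee_fin mul1r; apply: ge0_ler_powR; rewrite ?nnegrE ?enorm_ge0 ?(ltW p0)//.
      by have := coord_le_enorm ((X (t k.+1)).2 z - (X (t k)).2 z)%R i; rewrite !mxE.
  by exists G.
pose g z : 'rV[R]_n := \row_i G i z.
have vg : vmeas Om g.
  by move=> i; have := (HG i).1; congr measurable_fun; apply/funext => z; rewrite mxE.
have cg : {ae mu, forall z : lebT R n, Om z -> forall i, (X (t k)).2 z 0%R i @[k --> \oo] --> g z 0%R i}.
  have cG : {ae mu, forall (z : lebT R n) (i : 'I_n), Om z -> (X (t k)).2 z 0%R i @[k --> \oo] --> G i z}.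
    apply: (@filter_forall (lebT R n) 'I_n (fun i z => Om z -> (X (t k)).2 z 0%R i @[k --> \oo] --> G i z)
      (almost_everywhere mu) _) => i.
    exact: (HG i).2.
  apply: filterS cG => z Hz Oz i.
  by rewrite mxE; exact: Hz.
have close (e : R) : (0 < e)%R -> exists N, forall i, (N <= i)%N ->
    GA (fun z => (X i).2 z - g z)%R <= e%:E /\ GB (fun z => (X i).2 z - g z)%R <= e%:E.
  move=> /Cau[N0 HN0]; exists N0 => i Ni.
  have cg' : {ae mu, forall z : lebT R n, Om z -> forall j,
      ((X i).2 z - (X (t (k + N0)%N)).2 z)%R 0%R j @[k --> \oo] --> ((X i).2 z - g z)%R 0%R j}.
    apply: filterS cg => z Hz Oz j; rewrite !mxE.
    under eq_fun do rewrite !mxE.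
    apply: cvgB; first exact: cvg_cst.
    have := Hz Oz j; rewrite !mxE => c.
    exact: (@cvg_comp _ _ _ (fun k => k + N0)%N (fun k => (X (t k)).2 z 0%R j) _ \oo _ (cvg_addnr N0) c).
  have tk k : (N0 <= t (k + N0))%N by apply: leq_trans (tm _).1; exact: leq_addl.
  split.
    apply: (@genergy_fatou R n Om (fun=> 1%R) p mOm m1 w1 p1 (fun k z => (X i).2 z - (X (t (k + N0)%N)).2 z)%R _
      (fun=> e) e (fun k => vmeasB (vX i) (vX _)) (vmeasB (vX i) vg) cg'); last exact: cvg_cst.
    by move=> k; exact: (HN0 i _ Ni (tk k)).1.
  apply: (@genergy_fatou R n Om eta q mOm meta eta0 q1 (fun k z => (X i).2 z - (X (t (k + N0)%N)).2 z)%R _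
      (fun=> e) e (fun k => vmeasB (vX i) (vX _)) (vmeasB (vX i) vg) cg'); last exact: cvg_cst.
  by move=> k; exact: (HN0 i _ Ni (tk k)).2.
exists g; split.
- apply: sob_closed => // e e0.
  have e3 : (0 < e / 3)%R by rewrite divr_gt0.
  have [N1 HN1] := close _ e3; have [N2 HN2] := harm_small e3.
  pose i := maxn N1 N2; exists (X i).1, (X i).2; split; first exact: WX.
  have [A B] := HN1 i (leq_maxl _ _).
  rewrite sdistN; have [_ k2 _ _] := KX i.
  have k2' : IL (fun z => (X i).1 z - u z)%R <= (e / 3)%:E.
    by apply: (le_trans k2); rewrite lee_fin HN2// leq_maxr.
  apply: le_trans (leeD k2' (leeD A B)) _.
  by rewrite -!EFinD lee_fin le_eqVlt; apply/orP; left; apply/eqP; field.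
- apply: (@genergy_fatou R n Om (fun=> 1%R) p mOm m1 w1 p1 (fun k => (X (t k)).2) g (fun k => a + harm k)%R a (fun k => vX _) vg cg).
    move=> k; have [_ _ k3 _] := KX (t k); apply: (le_trans k3); rewrite lee_fin lerD2l.
    exact: harm_le (tm k).1.
  by rewrite -[X in _ --> X]addr0; apply: cvgD; [exact: cvg_cst|exact: cvg_harmonic].
- apply: (@genergy_fatou R n Om eta q mOm meta eta0 q1 (fun k => (X (t k)).2) g (fun k => b + harm k)%R b (fun k => vX _) vg cg).
    move=> k; have [_ _ _ k3] := KX (t k); apply: (le_trans k3); rewrite lee_fin lerD2l.
    exact: harm_le (tm k).1.
  by rewrite -[X in _ --> X]addr0; apply: cvgD; [exact: cvg_cst|exact: cvg_harmonic].
Qed.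

Let near_energy w s g (e : R) (mw : measurable_fun (Om : set (lebT R n)) (w : lebT R n -> R))
  (w0 : forall z, Om z -> (0 <= w z)%R) (s1 : (1 < s)%R) : (0 < e)%R -> vmeas Om g -> genergy Om w s g < +oo ->
  exists2 d : R, (0 < d)%R & forall phi, smooth phi ->
    genergy Om w s (fun z => g z - grad phi z)%R <= d%:E -> genergy Om w s (grad phi) <= (fine (genergy Om w s g) + e)%:E.
Proof.
move=> e0 mg fin; pose a := fine (genergy Om w s g).
have aE : genergy Om w s g = a%:E by rewrite /a fineK// ge0_fin_numE//; exact: genergy_ge0.
have a0 : (0 <= a)%R by apply: fine_ge0; exact: genergy_ge0.
have t0 : (0 < e / (2 * (a + 1)))%R by rewrite divr_gt0// mulr_gt0// ltr_wpDl.
have [C C0 HC] := genergyD_eps mOm mw w0 s1 t0.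
exists (e / (2 * (C + 1)))%R; first by rewrite divr_gt0// mulr_gt0// ltr_wpDl.
move=> phi sphi Hd.
have T := HC _ _ mg (vmeasB (@vmeas_grad R n Om _ sphi) mg).
have E : genergy Om w s (fun z => g z + (grad phi z - g z))%R = genergy Om w s (grad phi).
  by apply: eq_integral => z _; rewrite addrC subrK.
rewrite E genergyN aE in T; apply: (le_trans T).
have C0e : 0 <= C%:E by rewrite lee_fin.
apply: le_trans (leeD (lexx _) (lee_wpmul2l C0e Hd)) _.
rewrite -!EFinM -EFinD lee_fin -/a.
have h1 := half_frac e0 a0; have h2 := half_frac e0 C0.
rewrite mulrDl mul1r -addrA lerD2l [X in (_ + X <= _)%R]mulrC [leRHS]splitr; exact: lerD.
Qed.

Lemma sob_near u g (e : R) : W u g -> (0 < e)%R -> exists phi, [/\ test_fun Om phi,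
  sd (fun z => u z - phi z)%R (fun z => g z - grad phi z)%R <= e%:E,
  GA (grad phi) <= (fine (GA g) + e)%:E & GB (grad phi) <= (fine (GB g) + e)%:E].
Proof.
move=> Wu e0; have [mu_ mg H] := Wu; have fin := sob_fin Wu.
have [d1 d10 H1] := near_energy m1 w1 p1 e0 mg (le_lt_trans (sdist_A u g) fin).
have [d2 d20 H2] := near_energy meta eta0 q1 e0 mg (le_lt_trans (sdist_B u g) fin).
have d0 : (0 < Num.min e (Num.min d1 d2))%R by rewrite !lt_min e0 d10 d20.
have [phi tphi Hphi] := H _ d0; exists phi.
have le (x : R) : (Num.min e (Num.min d1 d2) <= x)%R ->
    sd (fun z => u z - phi z)%R (fun z => g z - grad phi z)%R <= x%:E.
  by move=> h; apply: (le_trans Hphi); rewrite lee_fin.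
split => //.
- by apply: le; rewrite ge_min lexx.
- apply: H1 (test_fun_smooth tphi) _; apply: (le_trans (sdist_A (fun z => u z - phi z)%R _)).
  by apply: le; rewrite !ge_min lexx orbT.
- apply: H2 (test_fun_smooth tphi) _; apply: (le_trans (sdist_B (fun z => u z - phi z)%R _)).
  by apply: le; rewrite !ge_min lexx !orbT.
Qed.

(** The smoothed absolute values of approximating test functions converge to [|u|] in [L^r] without
    increasing the energies. Their gradients need not converge, which is exactly the situation of
    [sob_weak_closed]. *)
Lemma sob_abs u g : W u g -> exists g', [/\ W (fun z => `|u z|)%R g', GA g' <= GA g & GB g' <= GB g].
Proof.
move=> Wu; have [mu_ mg _] := Wu; have fin := sob_fin Wu.
have EA : GA g = (fine (GA g))%:E by rewrite fineK// ge0_fin_numE//; exact: le_lt_trans (sdist_A u g) fin.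
have EB : GB g = (fine (GB g))%:E by rewrite fineK// ge0_fin_numE//; exact: le_lt_trans (sdist_B u g) fin.
have mabs : leb_measurable_fun Om (fun z => `|u z|)%R by exact: measurableT_comp mu_.
rewrite EA EB; apply: sob_weak_closed => // e e0.
have d0 := half_gt0 e0; set d := (e / (2 * 2 `^ r))%R in d0.
pose m := fine (mu Om); have m0 : (0 <= m)%R by exact: fine_ge0.
(* Smoothing parameter: a uniform error [x] costs [x^r] times the measure of [Om], hence at most
   [d]. *)
pose x : R := ((d / (m + 1)) `^ r^-1)%R.
have x0 : (0 < x)%R by rewrite powR_gt0// divr_gt0// ltr_wpDl.
have xr : (x `^ r * m <= d)%R.
  rewrite /x -powRrM mulVf ?gt_eqF// powRr1; last by rewrite divr_ge0 ?(ltW d0)// addr_ge0.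
  by rewrite mulrAC ler_pdivrMr ?ltr_wpDl// ler_wpM2l ?(ltW d0)// lerDl.
have me : (0 < Num.min e d)%R by rewrite lt_min e0 d0.
have [phi [tphi Hphi HA HB]] := sob_near Wu me.
have sphi := test_fun_smooth tphi.
have tv : test_fun Om (smooth_abs x phi) by exact: test_fun_smooth_abs.
have mv := lmS (test_fun_smooth tv).
exists (smooth_abs x phi), (grad (smooth_abs x phi)); split.
- exact: sob_test.
- have mc : leb_measurable_fun Om (fun=> x) by exact: measurable_cst.
  have md : leb_measurable_fun Om (fun z => `|u z - phi z|)%R by exact: measurableT_comp (lmB mu_ (lmS sphi)).
  have T := @integral_powRD_le _ (lebT R n) R mu Om r _ _ mOm mc md (ltW r0).
  apply: (@le_trans _ _ (\int[mu]_(z in (Om : set (lebT R n))) (`|x + `|u z - phi z| | `^ r)%:E)).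
    apply: ge0_le_integral.
    + exact: mOm.
    + by move=> z _; rewrite lee_fin powR_ge0.
    + by apply/measurable_EFinP; apply: measurable_norm_powR; exact: lmB.
    + by apply/measurable_EFinP; apply: measurable_norm_powR; exact: (lmD mc md).
    move=> z _; rewrite lee_fin; apply: ge0_ler_powR; rewrite ?nnegrE ?(ltW r0)//.
    rewrite [leRHS]ger0_norm ?addr_ge0 ?(ltW x0)//.
    have h1 := smooth_abs_dist phi z x0; have h2 := ler_dist_dist (phi z) (u z).
    rewrite -(subrKA `|phi z|); apply: (le_trans (ler_normD _ _)); apply: lerD => //.
    by rewrite [leRHS]distrC.
  apply: (le_trans T); apply: half_bound.
    under eq_integral do rewrite (ger0_norm (ltW x0)).
    rewrite (integral_cst mu mOm) [X in _ * X](_ : _ = m%:E); last by rewrite /m fineK// ge0_fin_numE.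
    by rewrite -EFinM lee_fin; exact: xr.
  under eq_integral do rewrite normr_id.
  apply: (le_trans (sdist_L _ _)); apply: (le_trans Hphi).
  by rewrite lee_fin ge_min lexx orbT.
- have T := genergy_mono mOm m1 w1 p1 (@vmeas_grad R n Om _ (test_fun_smooth tv)) (@vmeas_grad R n Om _ sphi)
    (fun z => enorm_grad_smooth_abs z x0 sphi).
  apply: (le_trans T); apply: (le_trans HA); rewrite lee_fin lerD2l ge_min lexx.
  by [].
- have T := genergy_mono mOm meta eta0 q1 (@vmeas_grad R n Om _ (test_fun_smooth tv)) (@vmeas_grad R n Om _ sphi)
    (fun z => enorm_grad_smooth_abs z x0 sphi).
  apply: (le_trans T); apply: (le_trans HB); rewrite lee_fin lerD2l ge_min lexx.
  by [].
Qed.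

Lemma Lp_integrable (s : R) u : (1 <= s)%R -> leb_measurable_fun Om u ->
  \int[mu]_(z in (Om : set (lebT R n))) (`|u z| `^ s)%:E < +oo -> mu.-integrable (Om : set (lebT R n)) (EFin \o u).
Proof.
move=> s1 mu_ fin; apply/integrableP; split; first exact/measurable_EFinP.
have T := @integral_powR_theta _ (lebT R n) R mu Om mOm 1%R s 1%R u ltr01 s1 ltr01 mu_ muOm.
apply: (@le_lt_trans _ _ (\int[mu]_(z in (Om : set (lebT R n))) (`|u z| `^ 1)%:E)).
  by rewrite le_eqVlt; apply/orP; left; apply/eqP; apply: eq_integral => z _; rewrite powRr1.
apply: (le_lt_trans T); apply: lte_add_pinfty; first exact: ltry.
by apply: lte_mul_pinfty; rewrite ?lee_fin ?powR_ge0.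
Qed.

Let coord_le g i : vmeas Om g -> \int[mu]_(z in (Om : set (lebT R n))) (`|g z 0%R i| `^ p)%:E <= GA g.
Proof.
move=> mg; apply: ge0_le_integral.
- exact: mOm.
- by move=> z _; rewrite lee_fin powR_ge0.
- by apply/measurable_EFinP; apply: measurable_norm_powR; exact: mg.
- by apply/measurable_EFinP; exact: (@measurable_genergy R n Om (fun=> 1%R) p m1 _ mg).
move=> z _; rewrite lee_fin mul1r; apply: ge0_ler_powR; rewrite ?nnegrE ?enorm_ge0 ?(ltW p0)//.
exact: coord_le_enorm.
Qed.

(** Uses [integral_powR_theta] with exponent 1 against [s]: the threshold [t] makes its constant
    term at most [e/2], and then [d] makes the other one equal to [e/2]. *)
Let small_pairing (s K : R) (e : R) : (1 < s)%R -> (0 < e)%R -> (0 <= K)%R ->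
  exists2 d : R, (0 < d)%R & forall f psi, leb_measurable_fun Om f -> smooth psi -> (forall x, `|psi x| <= K)%R ->
  mu.-integrable (Om : set (lebT R n)) (EFin \o (fun z => f z * psi z)%R) ->
  \int[mu]_(z in (Om : set (lebT R n))) (`|f z| `^ s)%:E <= d%:E ->
  (`|\int[mu]_(z in (Om : set (lebT R n))) (f z * psi z)| <= e)%R.
Proof.
move=> s1 e0 K0; pose m := fine (mu Om); have m0 : (0 <= m)%R by exact: fine_ge0.
pose t : R := (e / (2 * ((K + 1) * (m + 1))))%R.
have k1 : (0 < (K + 1) * (m + 1))%R by rewrite mulr_gt0// ltr_wpDl.
have t0 : (0 < t)%R by rewrite divr_gt0// mulr_gt0.
pose d : R := (e / (2 * ((K + 1) * t `^ (1 - s))))%R.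
have k2 : (0 < (K + 1) * t `^ (1 - s))%R by rewrite mulr_gt0 ?powR_gt0// ltr_wpDl.
exists d; first by rewrite divr_gt0// mulr_gt0.
move=> f psi mf spsi Kpsi ifp Hd.
apply: (le_trans (le_normr_Rintegral mOm ifp)); rewrite -lee_fin /Rintegral.
have inn := integrable_norm ifp.
rewrite fineK; last exact: integrable_fin_num inn.
have T := @integral_powR_theta _ (lebT R n) R mu Om mOm 1%R s t f ltr01 (ltW s1) t0 mf muOm.
have mf1 : measurable_fun (Om : set (lebT R n)) (fun z : lebT R n => (`|f z| `^ 1)%:E).
  by apply/measurable_EFinP; exact: measurable_norm_powR.
apply: (@le_trans _ _ (K%:E * \int[mu]_(z in (Om : set (lebT R n))) (`|f z| `^ 1)%:E)).
  rewrite -ge0_integralZl_EFin//.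
  apply: ge0_le_integral.
  - exact: mOm.
  - by move=> z _; rewrite lee_fin.
  - exact: measurable_int inn.
  - exact: measurable_funeM.
  - by move=> z _; rewrite -EFinM lee_fin normrM powRr1// mulrC ler_wpM2r.
apply: (@le_trans _ _ ((K + 1)%:E * ((t * m)%:E + (t `^ (1 - s))%:E * d%:E))).
  apply: lee_pmul.
  - by rewrite lee_fin.
  - by apply: integral_ge0 => z _; rewrite lee_fin powR_ge0.
  - by rewrite lee_fin lerDl.
  apply: (le_trans T); rewrite powRr1 ?(ltW t0)//; apply: leeD; first exact: lexx.
  by apply: lee_wpmul2l; rewrite ?lee_fin ?powR_ge0.
rewrite -[X in (_ + X)]EFinM -EFinD -EFinM lee_fin mulrDr.
have h1 : ((K + 1) * (t * m) <= e / 2)%R.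
  apply: (@le_trans _ _ ((K + 1) * (t * (m + 1)))%R).
    by rewrite !ler_wpM2l ?(ltW t0) ?addr_ge0// lerDl.
  rewrite /t le_eqVlt; apply/orP; left; apply/eqP; field.
  by rewrite !gt_eqF// ltr_wpDl.
have h2 : ((K + 1) * (t `^ (1 - s) * d) = e / 2)%R.
  rewrite mulrA /d; move: ((K + 1) * _)%R k2 => y y0; field.
  by rewrite gt_eqF.
by rewrite h2 [leRHS]splitr lerD2r.
Qed.

(** Integration by parts holds for the approximating test function, and both sides change by at most
    [e/2] when it is replaced by [u]. *)
Lemma sob_weak_grad u g : W u g -> is_weak_grad Om u g.
Proof.
move=> Wu; have [mu_ mg Hu] := Wu; have fin := sob_fin Wu.
have loc s f : (1 <= s)%R -> leb_measurable_fun Om f ->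
    \int[mu]_(z in (Om : set (lebT R n))) (`|f z| `^ s)%:E < +oo -> loc_integrable Om f.
  move=> s1 mf ff; split => // K cK KO; apply: integrableS (Lp_integrable s1 mf ff) => //.
  exact: compact_leb_measurable.
have lu : loc_integrable Om u by apply: (loc r _ (ltW r1) mu_); exact: le_lt_trans (sdist_L u g) fin.
have lg i : loc_integrable Om (fun z => g z 0%R i).
  apply: (loc p _ (ltW p1) (mg i)); apply: le_lt_trans (coord_le i mg) _.
  exact: le_lt_trans (sdist_A u g) fin.
split => // psi tpsi i.
have tpi := test_fun_partial i tpsi.
have [K1 HK1] := test_fun_bounded tpi; have [K2 HK2] := test_fun_bounded tpsi.
have K10 : (0 <= K1)%R by exact: le_trans (HK1 0%R).
have K20 : (0 <= K2)%R by exact: le_trans (HK2 0%R).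
apply/eqP; rewrite -subr_eq0 opprK -normr_le0; apply/ler_addgt0Pr => e e0; rewrite add0r.
have e2 : (0 < e / 2)%R by rewrite divr_gt0.
have [d1 d10 H1] := small_pairing r1 e2 K10.
have [d2 d20 H2] := small_pairing p1 e2 K20.
have d0 : (0 < Num.min d1 d2)%R by rewrite lt_min d10 d20.
have [phi tphi Hphi] := Hu _ d0; have sphi := test_fun_smooth tphi.
have [wl1 wl2 wid] := is_weak_grad_test_fun oOm tphi.
have i1 := loc_integrableM_test_fun oOm lu tpi.
have i2 := loc_integrableM_test_fun oOm wl1 tpi.
have i3 := loc_integrableM_test_fun oOm (lg i) tpsi.
have i4 := loc_integrableM_test_fun oOm (wl2 i) tpsi.
have j1 : mu.-integrable (Om : set (lebT R n)) (EFin \o (fun z => (u z - phi z) * partial i psi z)%R).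
  have := integrableB mOm i1 i2; apply: eq_integrable => // z _ /=.
  by rewrite mulrBl EFinB.
have j2 : mu.-integrable (Om : set (lebT R n)) (EFin \o (fun z => (g z 0 i - grad phi z 0 i) * psi z)%R).
  have := integrableB mOm i3 i4; apply: eq_integrable => // z _ /=.
  by rewrite mulrBl EFinB.
have E1 : (\int[mu]_(z in (Om : set (lebT R n))) ((u z - phi z) * partial i psi z) =
   \int[mu]_(z in (Om : set (lebT R n))) (u z * partial i psi z) - \int[mu]_(z in (Om : set (lebT R n))) (phi z * partial i psi z))%R.
  by rewrite -(RintegralB mOm i1 i2); apply: eq_Rintegral => z _; rewrite mulrBl.
have E2 : (\int[mu]_(z in (Om : set (lebT R n))) ((g z 0 i - grad phi z 0 i) * psi z) =
   \int[mu]_(z in (Om : set (lebT R n))) (g z 0 i * psi z) - \int[mu]_(z in (Om : set (lebT R n))) (grad phi z 0 i * psi z))%R.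
  by rewrite -(RintegralB mOm i3 i4); apply: eq_Rintegral => z _; rewrite mulrBl.
have B1 := H1 _ _ (lmB mu_ (lmS sphi)) (test_fun_smooth tpi) HK1 j1.
have B2 := H2 _ _ (measurable_funB (mg i) (@vmeas_grad R n Om _ sphi i)) (test_fun_smooth tpsi) HK2 j2.
have {}B1 : (`|\int[mu]_(z in (Om : set (lebT R n))) ((u z - phi z) * partial i psi z)| <= e / 2)%R.
  apply: B1; apply: (le_trans (sdist_L _ (fun z => g z - grad phi z)%R)); apply: (le_trans Hphi).
  by rewrite lee_fin ge_min lexx.
have {}B2 : (`|\int[mu]_(z in (Om : set (lebT R n))) ((g z 0 i - grad phi z 0 i) * psi z)| <= e / 2)%R.
  apply: B2; have c := coord_le i (vmeasB mg (@vmeas_grad R n Om _ sphi)).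
  apply: le_trans (le_trans _ c) _.
    by rewrite le_eqVlt; apply/orP; left; apply/eqP; apply: eq_integral => z _; rewrite /= !mxE.
  apply: (le_trans (sdist_A (fun z => u z - phi z)%R _)); apply: (le_trans Hphi).
  by rewrite lee_fin ge_min lexx orbT.
have wi := wid _ tpsi i.
move: B1 B2; rewrite E1 E2 wi opprK => B1 B2.
set A := (\int[mu]_(z in _) (u z * _))%R in B1 *; set B := (\int[mu]_(z in _) (g z 0 i * _))%R in B2 *.
set D := (\int[mu]_(z in _) (grad phi z 0 i * _))%R in B1 B2.
have -> : (A + B = (A + D) + (B - D))%R by ring.
apply: (le_trans (ler_normD _ _)); rewrite [leRHS]splitr; exact: lerD.
Qed.

Lemma sob_wgrad u g : W u g -> ae_on Om (fun z => wgrad Om u z = g z).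
Proof. by move=> Wu; apply: wgrad_ae oOm _; exact: sob_weak_grad. Qed.

Let vmeas_wgrad u : (exists g, is_weak_grad Om u g) -> vmeas Om (wgrad Om u).
Proof. by move=> [g /is_weak_grad_wgrad[_ H _]] i; have [] := H i. Qed.

Lemma genergy_ae w s g h : measurable_fun (Om : set (lebT R n)) (w : lebT R n -> R) ->
  (forall z, Om z -> 0 <= w z)%R -> vmeas Om g -> vmeas Om h -> ae_on Om (fun z => g z = h z) ->
  genergy Om w s g = genergy Om w s h.
Proof.
move=> mw w0 mg mh gh; apply: ge0_ae_eq_integral.
- exact: mOm.
- by apply/measurable_EFinP; exact: (measurable_genergy s mw).
- by apply/measurable_EFinP; exact: (measurable_genergy s mw).
- by move=> z Oz; rewrite lee_fin mulr_ge0 ?w0 ?powR_ge0.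
- by move=> z Oz; rewrite lee_fin mulr_ge0 ?w0 ?powR_ge0.
- have gh' : {ae mu, forall z : lebT R n, Om z -> g z = h z} := gh.
  by apply: filterS gh' => z H Oz; rewrite H.
Qed.

Let modE v : leb_measurable_fun Om v -> modular Om p q eta v =
  \int[mu]_(z in (Om : set (lebT R n))) (`|v z| `^ p)%:E + \int[mu]_(z in (Om : set (lebT R n))) (eta z * `|v z| `^ q)%:E.
Proof.
move=> mv; rewrite -[X in _ = _ + X]mul1e.
have := @ge0_integral_addZ _ (lebT R n) R mu Om mOm 1%R _ _ ler01 (measurable_norm_powR p mv)
  (measurable_funM meta (measurable_norm_powR q mv)) (fun _ _ => powR_ge0 _ _)
  (fun z Oz => mulr_ge0 (eta0 Oz) (powR_ge0 _ _)).
by move=> <-; apply: eq_integral => z _; rewrite /calH mul1r.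
Qed.

Let mod_grad g : vmeas Om g -> modular Om p q eta (enorm \o g) = GA g + GB g.
Proof.
move=> mg; rewrite modE; last by apply: (@measurable_comp_continuous R n _ (lebT R n) Om g enorm); [exact: mg|exact: continuous_enorm].
congr (_ + _).
  by apply: eq_integral => z _; rewrite /= mul1r ger0_norm ?enorm_ge0.
by apply: eq_integral => z _; rewrite /= ger0_norm ?enorm_ge0.
Qed.

Let mod_ge0 v : 0 <= modular Om p q eta v.
Proof. by apply: integral_ge0 => z Oz; rewrite lee_fin /calH addr_ge0 ?powR_ge0// mulr_ge0 ?powR_ge0// eta0. Qed.

Let mod_meas v : leb_measurable_fun Om v ->
  measurable_fun (Om : set (lebT R n)) (fun z : lebT R n => calH p q eta z `|v z|).
Proof.
move=> mv; apply: measurable_funD; first exact: measurable_norm_powR.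
by apply: measurable_funM; [exact: meta|exact: measurable_norm_powR].
Qed.

Let powR_small (s x : R) : (1 < s)%R -> (0 <= x)%R -> (x <= 1)%R -> (x `^ s <= x)%R.
Proof.
move=> s1 x0 x1; rewrite -(@powR_mulB1 R s x x0 (lt_trans ltr01 s1)).
apply: ler_piMl => //; apply: (@le_trans _ _ (1 `^ (s - 1))%R); last by rewrite powR1.
by apply: ge0_ler_powR; rewrite ?nnegrE ?subr_ge0 ?(ltW s1).
Qed.

Let mod_scale (t : R) v : leb_measurable_fun Om v -> (0 < t)%R -> (t <= 1)%R ->
  modular Om p q eta (fun z => t * v z)%R <= t%:E * modular Om p q eta v.
Proof.
move=> mv t0 t1; have T := @ge0_integral_le_lin _ (lebT R n) R mu Om mOm t _ _ _ (ltW t0)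
  (mod_meas (lmZ t mv)) (mod_meas mv) (@measurable_cst _ _ (lebT R n) R Om 0%R).
rewrite integral0 adde0 in T; apply: T => // z Oz.
- by rewrite /calH addr_ge0 ?powR_ge0// mulr_ge0 ?powR_ge0// eta0.
- by rewrite /calH addr_ge0 ?powR_ge0// mulr_ge0 ?powR_ge0// eta0.
rewrite addr0 /calH normrM !powRM// (ger0_norm (ltW t0)) mulrDr mulrCA; apply: lerD.
  by apply: ler_wpM2r; [exact: powR_ge0|exact: powR_small p1 (ltW t0) t1].
by apply: ler_wpM2r; [rewrite mulr_ge0 ?powR_ge0// eta0|exact: powR_small q1 (ltW t0) t1].
Qed.

(** Below the threshold [t <= 1] both powers are at most [t], since [p, q > 1]; above it they are
    multiples of [|v|^r]. Small [t] first and then small [L^r] mass make the modular small. *)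
Let mod_le (t : R) : (0 < t)%R -> (t <= 1)%R -> exists2 k : R, (0 <= k)%R & forall v, leb_measurable_fun Om v ->
  modular Om p q eta v <= ((1 + `|M|) * fine (mu Om) * t)%:E + k%:E * IL v.
Proof.
move=> t0 t1; set m := fine (mu Om); have m0 : (0 <= m)%R by exact: fine_ge0.
set N := (1 + `|M|)%R; have N0 : (0 < N)%R by rewrite ltr_wpDr.
pose k : R := (t `^ (p - r) + `|M| * t `^ (q - r))%R.
have k0 : (0 <= k)%R by rewrite addr_ge0 ?mulr_ge0 ?powR_ge0.
exists k => // v mv.
have pw (x E : R) : (0 <= x)%R -> (0 <= E)%R -> (E <= M)%R -> (x `^ p + E * x `^ q <= N * t + k * x `^ r)%R.
  move=> x0 E0 EM; have h1 := powR_theta p0 (ltW pr) t0 x0; have h2 := powR_theta q0 (ltW qr) t0 x0.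
  have g1 := powR_small p1 (ltW t0) t1; have g2 := powR_small q1 (ltW t0) t1.
  have EM' : (E <= `|M|)%R by exact: le_trans EM (ler_norm _).
  have h3 : (E * x `^ q <= `|M| * (t + t `^ (q - r) * x `^ r))%R.
    by apply: ler_pM; rewrite ?powR_ge0//; apply: (le_trans h2); rewrite lerD2r.
  have h4 : (x `^ p <= t + t `^ (p - r) * x `^ r)%R by apply: (le_trans h1); rewrite lerD2r.
  apply: (le_trans (lerD h4 h3)); rewrite le_eqVlt; apply/orP; left; apply/eqP.
  by rewrite /N /k; ring.
have mc : measurable_fun (Om : set (lebT R n)) (fun z : lebT R n => (N * t + k * `|v z| `^ r)%R).
  apply: measurable_funD; first exact: measurable_cst.
  by apply: measurable_funM; [exact: measurable_cst|exact: measurable_norm_powR].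
apply: (@le_trans _ _ (\int[mu]_(z in (Om : set (lebT R n))) (N * t + k * `|v z| `^ r)%:E)).
  apply: ae_ge0_le_integral.
  - exact: mOm.
  - by move=> z Oz; rewrite lee_fin /calH addr_ge0 ?powR_ge0// mulr_ge0 ?powR_ge0// eta0.
  - by apply/measurable_EFinP; exact: mod_meas.
  - by move=> z _; rewrite lee_fin addr_ge0 ?mulr_ge0 ?powR_ge0// ltW.
  - exact/measurable_EFinP.
  have eM : {ae mu, forall z : lebT R n, Om z -> (eta z <= M)%R} := etaM.
  by apply: filterS eM => z Hz Oz; rewrite lee_fin; apply: pw; [exact: normr_ge0|exact: eta0|exact: Hz].
have S := @ge0_integral_addZ _ (lebT R n) R mu Om mOm k _ _ k0 (@measurable_cst _ _ (lebT R n) R Om (N * t)%R)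
  (measurable_norm_powR r mv) (fun _ _ => mulr_ge0 (ltW N0) (ltW t0)) (fun _ _ => powR_ge0 _ _).
have c1 : \int[mu]_(z in (Om : set (lebT R n))) (cst (N * t)%R z)%:E = (N * t)%:E * mu Om.
  transitivity (\int[mu]_(z in (Om : set (lebT R n))) (cst (N * t)%:E z)); first by apply: eq_integral.
  by rewrite integral_cst.
rewrite [leLHS]S c1 [X in _ * X + _](_ : _ = m%:E); last by rewrite /m fineK// ge0_fin_numE.
by rewrite -EFinM mulrAC.
Qed.

Let mod_fin v : leb_measurable_fun Om v -> IL v < +oo -> modular Om p q eta v < +oo.
Proof.
move=> mv fin; have [k k0 Hk] := mod_le ltr01 (lexx 1%R).
apply: (le_lt_trans (Hk v mv)); apply: lte_add_pinfty; first exact: ltry.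
by apply: lte_mul_pinfty; rewrite ?lee_fin.
Qed.

Let mod_small (e : R) : (0 < e)%R -> exists2 d : R, (0 < d)%R & forall v, leb_measurable_fun Om v ->
  IL v <= d%:E -> modular Om p q eta v <= e%:E.
Proof.
move=> e0; pose Nm : R := ((1 + `|M|) * fine (mu Om))%R.
have Nm0 : (0 <= Nm)%R by rewrite mulr_ge0 ?addr_ge0 ?fine_ge0.
pose t := (Num.min 1 (e / (2 * (Nm + 1))))%R.
have t0 : (0 < t)%R by rewrite lt_min ltr01 divr_gt0// mulr_gt0// ltr_wpDl.
have t1 : (t <= 1)%R by rewrite ge_min lexx.
have [k k0 Hk] := mod_le t0 t1.
exists (e / (2 * (k + 1)))%R; first by rewrite divr_gt0// mulr_gt0// ltr_wpDl.
move=> v mv Hv; apply: (le_trans (Hk v mv)).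
have k0e : 0 <= k%:E by rewrite lee_fin.
apply: le_trans (leeD (lexx _) (lee_wpmul2l k0e Hv)) _.
rewrite -EFinM -EFinD lee_fin [leRHS]splitr; apply: lerD; last by rewrite mulrC half_frac.
apply: (@le_trans _ _ (e / (2 * (Nm + 1)) * Nm)%R); last exact: half_frac.
by rewrite mulrC; apply: ler_wpM2r => //; rewrite ge_min lexx orbT.
Qed.

Let normLH_le (t : R) v : (0 < t)%R -> modular Om p q eta (fun z => v z / t)%R <= 1 -> (normLH Om p q eta v <= t)%R.
Proof. by move=> t0 H; apply: ge_inf; [exists 0%R => x [/ltW]|split]. Qed.

(** Some [t < e] has [modular (v/t) <= 1], and for [t <= 1] scaling by [t] reduces the modular at
    least by the factor [t]. *)
Let normLH_lt (e : R) v : leb_measurable_fun Om v -> modular Om p q eta v < +oo -> (0 < e)%R -> (e <= 1)%R ->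
  (normLH Om p q eta v < e)%R -> modular Om p q eta v <= e%:E.
Proof.
move=> mv fin e0 e1 H; pose S := [set t : R | (0 < t)%R /\ modular Om p q eta (fun z => v z / t)%R <= 1].
pose m := fine (modular Om p q eta v); have m0 : (0 <= m)%R by exact: fine_ge0.
have hS : has_inf S.
  split; last by exists 0%R => x [/ltW].
  exists (m + 1)%R; split; first by rewrite ltr_wpDl.
  have i0 : (0 < (m + 1)^-1)%R by rewrite invr_gt0 ltr_wpDl.
  have i1 : ((m + 1)^-1 <= 1)%R by rewrite invf_le1 ?ltr_wpDl// lerDr.
  have T := mod_scale mv i0 i1.
  rewrite (_ : (fun z => v z / (m + 1))%R = (fun z => (m + 1)^-1 * v z)%R); last by apply/funext => z; rewrite mulrC.
  apply: (le_trans T); rewrite -[modular _ _ _ _ v]fineK ?ge0_fin_numE// -EFinM lee_fin.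
  by rewrite mulrC ler_pdivrMr ?ltr_wpDl// mul1r lerDl.
have d0 : (0 < e - inf S)%R by rewrite subr_gt0.
have [t [t0 Ht] te] := inf_adherent d0 hS; rewrite addrC subrK in te.
have t1 : (t <= 1)%R by apply: le_trans (ltW te) e1.
have mt : leb_measurable_fun Om (fun z => v z / t)%R.
  by rewrite (_ : (fun z => v z / t)%R = (fun z => t^-1 * v z)%R); [exact: lmZ|apply/funext => z; rewrite mulrC].
have T := mod_scale mt t0 t1.
rewrite (_ : (fun z => t * (v z / t))%R = v) in T; last by apply/funext => z; rewrite mulrCA mulfV ?mulr1// gt_eqF.
apply: (le_trans T); apply: (@le_trans _ _ (t%:E * 1)); first by apply: lee_wpmul2l => //; rewrite lee_fin ltW.
by rewrite mule1 lee_fin ltW.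
Qed.

(** A Luxemburg norm is at most [t] as soon as the modular of the function divided by [t] is at most
    1. This is arranged with [t = e/3] for the function and for its gradient. *)
Lemma sob_W01H u g : W u g -> W01H Om p q eta u.
Proof.
move=> Wu; have [mu_ mg Hu] := Wu; have fin := sob_fin Wu.
have wg := sob_weak_grad Wu; have wa := sob_wgrad Wu.
have ex : exists g, is_weak_grad Om u g by exists g.
have mw := vmeas_wgrad ex.
split.
  split => //.
  - split => //.
    by apply: mod_fin => //; exact: le_lt_trans (sdist_L u g) fin.
  - split; first by apply: (@measurable_comp_continuous R n _ (lebT R n) Om (wgrad Om u) enorm); [exact: mw|exact: continuous_enorm].
    rewrite mod_grad// (genergy_ae p m1 w1 mw mg wa) (genergy_ae q meta eta0 mw mg wa).
    apply: lte_add_pinfty; [exact: le_lt_trans (sdist_A u g) fin|exact: le_lt_trans (sdist_B u g) fin].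
move=> e e0; pose t : R := (e / 3)%R; have t0 : (0 < t)%R by rewrite divr_gt0.
have [d d0 Hd] := mod_small ltr01.
have k0 : (0 < 1 + `|t^-1| `^ r)%R by rewrite ltr_wpDr// powR_ge0.
have m0 : (0 < Num.min d 1)%R by rewrite lt_min d0 ltr01.
have [phi tphi Hphi] := Hu _ (divr_gt0 m0 k0); have sphi := test_fun_smooth tphi.
exists phi => //.
have Wd := sobB Wu (sob_test tphi); have [md mgd _] := Wd.
have T := sdistZ t^-1 md mgd.
have {}T : sd (fun z => t^-1 * (u z - phi z))%R (fun z => t^-1 *: (g z - grad phi z))%R <= (Num.min d 1)%:E.
  have k0e : 0 <= (1 + `|t^-1| `^ r)%:E by rewrite lee_fin ltW.
  apply: (le_trans T); apply: le_trans (lee_wpmul2l k0e Hphi) _.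
  by rewrite -EFinM mulrC mulfVK// gt_eqF.
have n1 : (normLH Om p q eta (fun z => u z - phi z)%R <= t)%R.
  apply: normLH_le t0 _.
  rewrite (_ : (fun z => _ / t)%R = (fun z => t^-1 * (u z - phi z))%R); last by apply/funext => z; rewrite mulrC.
  apply: Hd (lmZ _ md) _; apply: (le_trans (sdist_L _ _)); apply: (le_trans T).
  by rewrite lee_fin ge_min lexx.
have n2 : (normLH Om p q eta (enorm \o wgrad Om (fun z => u z - phi z)%R) <= t)%R.
  have wd := sob_weak_grad Wd; have ea := sob_wgrad Wd.
  have md' := vmeas_wgrad (ex_intro _ _ wd).
  apply: (normLH_le t0 _).
  rewrite (_ : (fun z => _ / t)%R = enorm \o (fun z => t^-1 *: wgrad Om (fun z => u z - phi z) z)%R); last first.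
    have ti : (0 <= t^-1)%R by rewrite invr_ge0; exact: ltW t0.
    apply: funext => z.
    rewrite [RHS](enormZ (t^-1)%R (wgrad Om (fun z => u z - phi z)%R z)) (ger0_norm ti).
    exact: (mulrC (enorm _)).
  rewrite mod_grad; last exact: vmeasZ.
  have ea2 : ae_on Om (fun z => t^-1 *: wgrad Om (fun z => u z - phi z) z = t^-1 *: (g z - grad phi z))%R.
    have ea' : {ae mu, forall z : lebT R n, Om z -> wgrad Om (fun z => u z - phi z)%R z = (g z - grad phi z)%R} := ea.
    by apply: filterS ea' => z H Oz; rewrite H.
  rewrite (genergy_ae p m1 w1 (vmeasZ _ md') (vmeasZ _ mgd) ea2) (genergy_ae q meta eta0 (vmeasZ _ md') (vmeasZ _ mgd) ea2).
  apply: le_trans (leeDr _ (IL_ge0 (fun z => t^-1 * (u z - phi z))%R)) _.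
  by apply: (le_trans T); rewrite lee_fin ge_min lexx orbT.
apply: le_lt_trans (lerD n2 n1) _.
exact: lt_third.
Qed.

Let is_weak_gradB u v g h : is_weak_grad Om u g -> is_weak_grad Om v h ->
  is_weak_grad Om (fun z => u z - v z)%R (fun z => g z - h z)%R.
Proof.
move=> [a1 a2 a3] [b1 b2 b3].
have lB (f f' : 'rV[R]_n -> R) : loc_integrable Om f -> loc_integrable Om f' -> loc_integrable Om (fun z => f z - f' z)%R.
  move=> [mf Hf] [mf' Hf']; split; first exact: lmB.
  move=> K cK KO; have := integrableB (compact_leb_measurable cK) (Hf K cK KO) (Hf' K cK KO).
  by apply: eq_integrable => //; exact: compact_leb_measurable.
split; first exact: lB.
  by move=> i; rewrite (_ : (fun z => _) = (fun z => g z 0 i - h z 0 i)%R); [exact: lB|apply/funext => z; rewrite !mxE].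
move=> psi tpsi i; have tpi := test_fun_partial i tpsi.
have E1 : (\int[mu]_(z in (Om : set (lebT R n))) ((u z - v z) * partial i psi z) =
   \int[mu]_(z in (Om : set (lebT R n))) (u z * partial i psi z) - \int[mu]_(z in (Om : set (lebT R n))) (v z * partial i psi z))%R.
  rewrite -(RintegralB mOm (loc_integrableM_test_fun oOm a1 tpi) (loc_integrableM_test_fun oOm b1 tpi)).
  by apply: eq_Rintegral => z _; rewrite mulrBl.
have E2 : (\int[mu]_(z in (Om : set (lebT R n))) ((g z - h z)%R 0 i * psi z) =
   \int[mu]_(z in (Om : set (lebT R n))) (g z 0 i * psi z) - \int[mu]_(z in (Om : set (lebT R n))) (h z 0 i * psi z))%R.
  rewrite -(RintegralB mOm (loc_integrableM_test_fun oOm (a2 i) tpsi) (loc_integrableM_test_fun oOm (b2 i) tpsi)).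
  by apply: eq_Rintegral => z _; rewrite !mxE mulrBl.
by rewrite E1 E2 (a3 _ tpsi) (b3 _ tpsi) opprB opprK addrC.
Qed.

Let mod_finB u v : leb_measurable_fun Om u -> leb_measurable_fun Om v -> modular Om p q eta u < +oo ->
  modular Om p q eta v < +oo -> modular Om p q eta (fun z => u z - v z)%R < +oo.
Proof.
move=> mu_ mv fu fv.
have pos (w : 'rV[R]_n -> R) z : Om z -> (0 <= calH p q eta z `|w z|)%R.
  by move=> Oz; rewrite /calH addr_ge0 ?powR_ge0// mulr_ge0 ?powR_ge0// eta0.
have S := @ge0_integral_le_lin _ (lebT R n) R mu Om mOm (2 `^ q)%R _ _ _ (powR_ge0 _ _)
  (mod_meas (lmB mu_ mv)) (mod_meas mu_) (mod_meas mv) (pos _) (pos u) (pos v).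
apply: le_lt_trans (S _) _; last first.
  apply: lte_mul_pinfty; [by rewrite lee_fin powR_ge0|by []|apply: lte_add_pinfty; [exact: fu|exact: fv]].
move=> z Oz; rewrite /calH addrACA mulrDr; apply: lerD.
  apply: (@le_trans _ _ (2 `^ p * (`|u z| `^ p + `|v z| `^ p)))%R.
    apply: le_trans (powRD_le (ltW p0) (normr_ge0 _) (normr_ge0 _)).
    by apply: ge0_ler_powR; rewrite ?nnegrE ?addr_ge0 ?ler_normB ?(ltW p0).
  apply: ler_wpM2r; first by rewrite addr_ge0 ?powR_ge0.
  by rewrite ler_powR ?ler1n// ltW.
rewrite -mulrDr mulrCA; apply: ler_wpM2l; first exact: eta0.
apply: le_trans (powRD_le (ltW q0) (normr_ge0 _) (normr_ge0 _)).
by apply: ge0_ler_powR; rewrite ?nnegrE ?addr_ge0 ?ler_normB ?(ltW q0).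
Qed.

Let genergyB_fin w s g h : measurable_fun (Om : set (lebT R n)) (w : lebT R n -> R) ->
  (forall z, Om z -> 0 <= w z)%R -> (1 < s)%R -> vmeas Om g -> vmeas Om h ->
  genergy Om w s g < +oo -> genergy Om w s h < +oo -> genergy Om w s (fun z => g z - h z)%R < +oo.
Proof.
move=> mw w0 s1 mg mh fg fh.
have E : (fun z => g z - h z)%R = (fun z => g z + -1 *: h z)%R by apply/funext => z; rewrite scaleN1r.
have T := @genergyD_le R n Om w s mOm mw w0 s1 g (fun z => -1 *: h z)%R mg (vmeasZ (-1)%R mh).
have Z := @genergyZ R n Om w s mOm mw w0 (-1)%R h mh.
have Z2 : genergy Om w s (fun z => -1 *: h z)%R = genergy Om w s h.
  by apply: (eq_trans Z); rewrite normrN1 powR1 mul1e.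
rewrite E; apply: (le_lt_trans T); apply: lte_mul_pinfty; [by rewrite lee_fin powR_ge0|by []|].
by apply: lte_add_pinfty; [exact: fg|have := fh; rewrite -Z2].
Qed.

(** Small Luxemburg norms give small modulars, hence convergence in [L^p] and of both energies. What
    has to be gained is convergence in [L^r]: Sobolev for differences of approximants, then Fatou
    along an almost everywhere convergent sequence. *)
Lemma W01H_sob u : W01H Om p q eta u -> W u (wgrad Om u).
Proof.
move=> [[[mu_ finu] ex [_ fing]] H]; have mw := vmeas_wgrad ex.
have wu : is_weak_grad Om u (wgrad Om u) by have [g0 wg0] := ex; exact: is_weak_grad_wgrad wg0.
rewrite (mod_grad mw) in fing.
have fA : GA (wgrad Om u) < +oo by apply: le_lt_trans fing; exact: leeDl (GB_ge0 _).
have fB : GB (wgrad Om u) < +oo by apply: le_lt_trans fing; exact: leeDr (GA_ge0 _).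
have near (e : R) : (0 < e)%R -> (e <= 1)%R -> exists phi, [/\ test_fun Om phi,
    \int[mu]_(z in (Om : set (lebT R n))) (`|phi z - u z| `^ p)%:E <= e%:E,
    GA (fun z => wgrad Om u z - grad phi z)%R <= e%:E & GB (fun z => wgrad Om u z - grad phi z)%R <= e%:E].
  move=> e0 e1; have [phi tphi Hphi] := H e e0; have sphi := test_fun_smooth tphi.
  exists phi; rewrite /normW1H in Hphi.
  have md := lmB mu_ (lmS sphi).
  have wd := is_weak_gradB wu (is_weak_grad_test_fun oOm tphi).
  have md' := vmeas_wgrad (ex_intro _ _ wd).
  have mgd := vmeasB mw (@vmeas_grad R n Om _ sphi).
  have ea := wgrad_ae oOm wd.
  have nn v : (0 <= normLH Om p q eta v)%R.
    rewrite /normLH; set S := [set _ | _].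
    have [->|/set0P S0] := eqVneq S set0; first by rewrite inf0.
    by apply: lb_le_inf => // x [/ltW].
  have sfin := sdist_test_fin tphi.
  have finphi : modular Om p q eta phi < +oo by apply: mod_fin (lmS sphi) _; exact: le_lt_trans (sdist_L phi (grad phi)) sfin.
  have find := mod_finB mu_ (lmS sphi) finu finphi.
  have b1 := normLH_lt md find e0 e1 (le_lt_trans (ler_wpDl (nn _) (lexx _)) Hphi).
  have EE : modular Om p q eta (enorm \o wgrad Om (fun z => u z - phi z)%R) =
      GA (fun z => wgrad Om u z - grad phi z)%R + GB (fun z => wgrad Om u z - grad phi z)%R.
    by rewrite (mod_grad md') (genergy_ae p m1 w1 md' mgd ea) (genergy_ae q meta eta0 md' mgd ea).
  have fing2 : modular Om p q eta (enorm \o wgrad Om (fun z => u z - phi z)%R) < +oo.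
    rewrite EE; apply: lte_add_pinfty.
      apply: (genergyB_fin m1 w1 p1 mw (@vmeas_grad R n Om _ sphi) fA); exact: le_lt_trans (sdist_A phi _) sfin.
    apply: (genergyB_fin meta eta0 q1 mw (@vmeas_grad R n Om _ sphi) fB); exact: le_lt_trans (sdist_B phi _) sfin.
  have men : leb_measurable_fun Om (enorm \o wgrad Om (fun z => u z - phi z)%R).
    by apply: (@measurable_comp_continuous R n _ (lebT R n) Om _ enorm); [exact: md'|exact: continuous_enorm].
  have b2 := normLH_lt men fing2 e0 e1 (le_lt_trans (ler_wpDr (nn _) (lexx _)) Hphi).
  rewrite EE in b2; split => //.
  - rewrite (modE md) in b1; apply: le_trans (le_trans _ b1).
      by rewrite le_eqVlt; apply/orP; left; apply/eqP; apply: eq_integral => z _; rewrite distrC.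
    apply: leeDl; apply: integral_ge0 => z Oz; rewrite lee_fin mulr_ge0 ?powR_ge0//; exact: eta0.
  - exact: le_trans (leeDl _ (GB_ge0 _)) b2.
  - exact: le_trans (leeDr _ (GA_ge0 _)) b2.
have q4 k : (0 < 4^-1 ^+ k :> R)%R by rewrite exprn_gt0// invr_gt0.
have q41 k : (4^-1 ^+ k <= 1 :> R)%R by rewrite exprn_ile1 ?invr_ge0// invf_le1// ler1n.
have /choice[phi Hphi] := fun k => near _ (q4 k) (q41 k).
have tphi k : test_fun Om (phi k) by have [] := Hphi k.
have sphi k := test_fun_smooth (tphi k).
have [_ [_ _ cphi]] := @fast_cvg_dominated _ (lebT R n) R mu Om mOm p phi u p0 (fun k => lmS (sphi k)) mu_
  (fun k => let: And4 _ b _ _ := Hphi k in b).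
have [K K0 HK] := sob_sobolev.
(* The Sobolev bound for [phi (j + k) - phi k], uniform in [j]: both gradients are within [4^-k] of
   that of [u], and the quasi-triangle inequality contributes [2^p] and the sum. *)
pose c k : R := (K * (2 `^ p * 2 * 4^-1 ^+ k) `^ (r / p))%R.
have ILk k : IL (fun z => u z - phi k z)%R <= (c k)%:E.
  apply: (@fatou_ae _ (lebT R n) R mu Om mOm (fun j z => `|phi (j + k)%N z - phi k z| `^ r)%R _ (fun=> c k)).
  - by move=> j; apply: measurable_norm_powR; exact: lmB (lmS (sphi _)) (lmS (sphi _)).
  - by apply: measurable_norm_powR; exact: lmB mu_ (lmS (sphi _)).
  - by move=> j z _; exact: powR_ge0.
  - by move=> z _; exact: powR_ge0.
  - apply: filterS cphi => z Hz Oz.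
    have c1 : (phi (j + k)%N z - phi k z)%R @[j --> \oo] --> (u z - phi k z)%R.
      apply: cvgB; last exact: cvg_cst.
      exact: (@cvg_comp _ _ _ (fun j => j + k)%N (fun j => phi j z) _ \oo _ (cvg_addnr k) (Hz Oz)).
    exact: (cvg_comp _ _ c1 (@continuous_norm_powR R r r0 _)).
  - move=> j; have Wd := sobB (sob_test (tphi (j + k)%N)) (sob_test (tphi k)).
    apply: HK Wd _ _; first by rewrite mulr_gt0// mulr_gt0// powR_gt0.
    have T := genergyD_le mOm m1 w1 p1 (vmeasB (@vmeas_grad R n Om _ (sphi (j + k)%N)) mw) (vmeasB mw (@vmeas_grad R n Om _ (sphi k))).
    rewrite (_ : (fun z => _ + _)%R = (fun z => grad (phi (j + k)%N) z - grad (phi k) z)%R) in T; last first.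
      by apply/funext => z; rewrite addrA subrK.
    apply: (le_trans T); have -> : (2 `^ p * 2 * 4^-1 ^+ k = 2 `^ p * (4^-1 ^+ k + 4^-1 ^+ k) :> R)%R by ring.
    rewrite EFinM; apply: lee_wpmul2l; first by rewrite lee_fin powR_ge0.
    rewrite EFinD; apply: leeD; last by have [] := Hphi k.
    rewrite genergyN; have [_ _ A _] := Hphi (j + k)%N; apply: (le_trans A); rewrite lee_fin.
    by apply: ler_wiXn2l; rewrite ?invr_ge0 ?leq_addl// invf_le1// ler1n.
  - exact: cvg_cst.
split => // e e0.
have e3 : (0 < e / 3)%R by rewrite divr_gt0.
have cq : (4^-1 ^+ k : R)%R @[k --> \oo] --> (0%R : R).
  by apply: cvg_expr; rewrite ger0_norm ?invr_ge0// invf_lt1// ltr1n.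
have cc : c k @[k --> \oo] --> (0%R : R).
  have a1 : (2 `^ p * 2 * 4^-1 ^+ k)%R @[k --> \oo] --> (0%R : R).
    by rewrite -[X in _ --> X](mulr0 (2 `^ p * 2)%R); apply: cvgM; [exact: cvg_cst|exact: cq].
  have rp0 : (0 < r / p)%R by rewrite divr_gt0.
  have a2 := cvg_comp _ _ a1 (@continuous_norm_powR R (r / p) rp0 0%R).
  rewrite normr0 powR0 ?gt_eqF// in a2.
  rewrite -[X in _ --> X](mulr0 K); apply: cvgM; first exact: cvg_cst.
  apply: cvg_trans a2; apply: near_eq_cvg; near=> k => /=.
  by rewrite ger0_norm// !mulr_ge0 ?powR_ge0 ?exprn_ge0 ?invr_ge0.
have [k [k1 k2]] : exists k, (c k <= e / 3)%R /\ (4^-1 ^+ k <= e / 3)%R.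
  move/cvgrPdist_le : cc => /(_ _ e3) h1; move/cvgrPdist_le : cq => /(_ _ e3) h2.
  have [k _ /(_ k (leqnn k))[g1 g2]] := filterI h1 h2; exists k.
  move: g1 g2; rewrite /= !sub0r !normrN => g1 g2.
  by split; [exact: le_trans (ler_norm _) g1|exact: le_trans (ler_norm _) g2].
exists (phi k) => //; have [_ _ A B] := Hphi k.
have A' : GA (fun z => wgrad Om u z - grad (phi k) z)%R <= (e / 3)%:E by apply: (le_trans A); rewrite lee_fin.
have B' : GB (fun z => wgrad Om u z - grad (phi k) z)%R <= (e / 3)%:E by apply: (le_trans B); rewrite lee_fin.
have C' : IL (fun z => u z - phi k z)%R <= (e / 3)%:E by apply: (le_trans (ILk k)); rewrite lee_fin.
apply: le_trans (leeD C' (leeD A' B')) _.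
by rewrite -!EFinD lee_fin le_eqVlt; apply/orP; left; apply/eqP; field.
Unshelve. all: by end_near. Qed.

End sobolev_space.

(** * Fibre maps along rays *)

Section fibre.
Context {R : realType}.
Implicit Types (p q s r P Q S C M t tau : R).

(** In the applications [s = 1 - nu] and [C] includes the factor [lam]. *)
Definition fibre p q s r P Q S C t : R := P * t `^ p + Q * t `^ q - S * t `^ s - C * t `^ r.

Lemma cvg_le_cst (u : nat -> R) (l c : R) : u k @[k --> \oo] --> l -> (forall k, u k <= c) -> l <= c.
Proof. by move=> ul uc; apply: (ler_cvg_to ul (cvg_cst c)); apply: nearW. Qed.

Lemma cvg_ge_cst (u : nat -> R) (l c : R) : u k @[k --> \oo] --> l -> (forall k, c <= u k) -> c <= l.
Proof. by move=> ul uc; apply: (ler_cvg_to (cvg_cst c) ul); apply: nearW. Qed.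

Lemma cvg_sub (T : topologicalType) (u : nat -> T) (l : T) (j : nat -> nat) : u k @[k --> \oo] --> l -> (forall k, (k <= j k)%N) ->
  u (j k) @[k --> \oo] --> l.
Proof.
move=> ul jk; apply: (cvg_comp _ _ _ ul) => A [N _ NA].
by exists N => // k Nk; apply: NA => /=; exact: leq_trans Nk (jk k).
Qed.

Lemma powR_ge1 (x y : R) : 1 <= x -> 0 <= y -> 1 <= x `^ y.
Proof.
move=> x1 y0; have := ge0_ler_powR y0 (_ : 1 \in Num.nneg) (_ : x \in Num.nneg) x1.
by rewrite powR1; apply; rewrite nnegrE// (le_trans ler01).
Qed.

Lemma powR_le1 (x y : R) : 0 <= x -> x <= 1 -> 0 <= y -> x `^ y <= 1.
Proof.
move=> x0 x1 y0; have := ge0_ler_powR y0 (_ : x \in Num.nneg) (_ : 1 \in Num.nneg) x1.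
by rewrite powR1; apply; rewrite nnegrE.
Qed.

Lemma powR_split (t x y : R) : 0 < t -> t `^ x = t `^ y * t `^ (x - y).
Proof. by move=> t0; rewrite -powRD ?(gt_eqF t0) ?implybT// addrC subrK. Qed.

Lemma powR_anti (t x y : R) : 0 < t -> t <= 1 -> x <= y -> t `^ y <= t `^ x.
Proof.
move=> t0 t1 xy; rewrite (powR_split y x t0) ler_piMr ?powR_ge0// powR_le1 ?(ltW t0)// subr_ge0//.
Qed.

Lemma powR_anti_lt (t x y : R) : 0 < t -> t < 1 -> x < y -> t `^ y < t `^ x.
Proof.
move=> t0 t1 xy; rewrite (powR_split y x t0) -[ltRHS]mulr1 ltr_pM2l ?powR_gt0//.
have d0 : 0 < y - x by rewrite subr_gt0.
have := gt0_ltr_powR d0 (_ : t \in Num.nneg) (_ : 1 \in Num.nneg) t1.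
by rewrite powR1; apply; rewrite nnegrE ?ltW.
Qed.

Lemma powR_root (D x : R) : 0 < D -> 0 <= x -> (x `^ D^-1) `^ D = x.
Proof. by move=> D0 x0; rewrite -powRrM mulVf ?gt_eqF// powRr1. Qed.

Lemma powR_fracM (D x y : R) : 0 < D -> 0 <= x -> (x `^ D) `^ (y / D) = x `^ y.
Proof. by move=> D0 x0; rewrite -powRrM mulrC divfK ?gt_eqF. Qed.

Lemma ler_powR_concave_mid (a v : R) : 0 < a -> a < 1 -> 0 <= v -> (1 + v `^ a) / 2 <= ((1 + v) / 2) `^ a.
Proof.
move=> a0 a1 v0; have a1' : 1 < a^-1 by rewrite invf_gt1.
have := ler_powR_mid a1' ler01 (powR_ge0 v a).
rewrite powR1 -powRrM mulfV ?gt_eqF// powRr1// => H.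
have m0 : 0 <= (1 + v `^ a) / 2 by rewrite divr_ge0// addr_ge0 ?powR_ge0.
have := ge0_ler_powR (ltW a0) (_ : _ \in Num.nneg) (_ : _ \in Num.nneg) H.
rewrite -powRrM mulVf ?gt_eqF// powRr1//; by apply; rewrite nnegrE ?powR_ge0 ?divr_ge0 ?addr_ge0.
Qed.

(** The arithmetic mean dominates the geometric mean [z = sqrt v], and [y = z^(-c)] satisfies
    [y <= (1 + y^2)/2]. *)
Lemma powR_inv_convex_mid (c v : R) : 0 < c -> 0 < v -> (((1 + v) / 2) `^ c)^-1 <= (1 + (v `^ c)^-1) / 2.
Proof.
move=> c0 v0; set z := v `^ 2^-1; have z0 : 0 < z by rewrite powR_gt0.
have zz : z * z = v.
  rewrite /z -powRD ?(gt_eqF v0) ?implybT// (_ : 2^-1 + 2^-1 = 1 :> R) ?powRr1 ?(ltW v0)//.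
  lra.
have w0 : 0 < (1 + v) / 2 by rewrite divr_gt0// addr_gt0.
have h1 : z <= (1 + v) / 2 by rewrite -zz; have := sqr_ge0 (z - 1); nra.
have h2 : z `^ c <= ((1 + v) / 2) `^ c by apply: ge0_ler_powR; rewrite ?nnegrE ?(ltW c0) ?(ltW z0) ?(ltW w0).
have zc0 : 0 < z `^ c by rewrite powR_gt0.
have h3 : (((1 + v) / 2) `^ c)^-1 <= (z `^ c)^-1 by rewrite lef_pV2 ?posrE ?powR_gt0.
apply: (le_trans h3); have -> : v `^ c = z `^ c * z `^ c by rewrite -powRM ?zz ?ltW.
rewrite invfM; set y := (z `^ c)^-1; have := sqr_ge0 (y - 1); nra.
Qed.

Lemma fibre_factor p q s r P Q S C t : 0 < t ->
  fibre p q s r P Q S C t = t `^ s * (P * t `^ (p - s) + Q * t `^ (q - s) - S - C * t `^ (r - s)).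
Proof.
move=> t0; have E x : t `^ x = t `^ s * t `^ (x - s) by rewrite -powRD ?(gt_eqF t0) ?implybT// addrC subrK.
by rewrite /fibre (E p) (E q) (E r); ring.
Qed.

Lemma fibre0 p q s r P Q S C : 0 < s -> s < p -> p < q -> q < r -> fibre p q s r P Q S C 0 = 0.
Proof.
move=> s0 sp pq qr; have p0 := lt_trans s0 sp; have q0 := lt_trans p0 pq; have r0 := lt_trans q0 qr.
by rewrite /fibre !powR0 ?gt_eqF// !mulr0 !subr0 addr0.
Qed.

Lemma fibre1 p q s r P Q S C : fibre p q s r P Q S C 1 = P + Q - S - C.
Proof. by rewrite /fibre !powR1 !mulr1. Qed.

(** The contradiction behind uniqueness: averaging the values at two maximisers and using midpoint
    concavity of the first term and strict convexity of the last one exceeds the bound at the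
    midpoint. *)
Lemma lin_mid (P Q S C M wa w wc va v vc X Y : R) : 0 <= P -> 0 < C -> 0 <= M -> (1 + va) / 2 <= wa -> w = (1 + v) / 2 ->
  wc < (1 + vc) / 2 -> X <= (1 + Y) / 2 -> P * wa + Q * w - S - C * wc <= M * X -> P + Q - S - C = M ->
  M * Y <= P * va + Q * v - S - C * vc -> False.
Proof.
move=> P0 C0 M0 h1 -> h2 h3 h4 h5 h6.
have g1 : P * ((1 + va) / 2) <= P * wa by exact: ler_wpM2l.
have g2 : C * wc < C * ((1 + vc) / 2) by rewrite ltr_pM2l.
have g3 : M * X <= M * ((1 + Y) / 2) by exact: ler_wpM2l.
lra.
Qed.

(* In the variable [u = t `^ (q - s)], [fibre = t `^ s * G u] with [G] strictly midpoint concave, while the bound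
   [fibre <= M] reads [G u <= M * u `^ (- (s / (q - s)))], whose right-hand side is convex. *)
Lemma fibre_max_unique p q s r P Q S C M tau : 0 < s -> s < p -> p < q -> q < r -> 0 <= P -> 0 < C -> 0 < M ->
  (forall t, 0 <= t -> fibre p q s r P Q S C t <= M) -> fibre p q s r P Q S C 1 = M -> 0 <= tau ->
  M <= fibre p q s r P Q S C tau -> tau = 1.
Proof.
move=> s0 sp pq qr P0 C0 M0 le f1 tau0 Mtau.
have t0 : 0 < tau.
  rewrite lt_neqAle tau0 andbT; apply: contraTN Mtau => /eqP <-; rewrite fibre0// -ltNge//.
have D0 : 0 < q - s by rewrite subr_gt0 (lt_trans sp).
set D := q - s in D0; set v := tau `^ D; set w := (1 + v) / 2; set t := w `^ D^-1.
have v0 : 0 < v by rewrite powR_gt0.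
have w0 : 0 < w by rewrite divr_gt0// addr_gt0.
have tt0 : 0 < t by rewrite powR_gt0.
have tD : t `^ D = w by rewrite powR_root// ltW.
have [v1|v1] := eqVneq v 1.
  by rewrite -[tau]powRr1// -(powR_fracM 1 D0 tau0) -/v v1 powR1.
exfalso.
have a0 : 0 < (p - s) / D by rewrite divr_gt0// subr_gt0.
have a1 : (p - s) / D < 1 by rewrite ltr_pdivrMr// mul1r ltrD2r.
have c1 : 1 < (r - s) / D by rewrite ltr_pdivlMr// mul1r ltrD2r.
have g0 : 0 < s / D by rewrite divr_gt0.
have h1 := ler_powR_concave_mid a0 a1 (ltW v0).
have h2 := ltr_powR_mid c1 ler01 (ltW v0) (_ : 1 != v); rewrite powR1 eq_sym v1 in h2.
have h3 := powR_inv_convex_mid g0 v0.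
have ts0 : 0 < t `^ s by rewrite powR_gt0.
have us0 : 0 < tau `^ s by rewrite powR_gt0.
apply: (@lin_mid P Q S C M _ w _ _ v _ _ _ P0 C0 (ltW M0) h1 erefl (h2 isT) h3).
- rewrite -/w -tD !powR_fracM ?(ltW tt0)// ler_pdivlMr// mulrC -/D.
  by have := le t (ltW tt0); rewrite fibre_factor.
- by rewrite -(fibre1 p q s r).
rewrite /v !powR_fracM ?(ltW t0)// ler_pdivrMr// mulrC -/D.
by move: Mtau; rewrite fibre_factor.
Qed.

(** For [t >= 1] both energy terms are below [(P + Q) t^q], and [T^(r - q) = |D|/c + 1] makes the
    [t^r] term win. That [T] depends only on bounds for the coefficients keeps maximisers of a
    sequence of fibres bounded. *)
Lemma fibre_le0 p q s r (D c : R) : p < q -> q < r -> 0 < c -> exists2 T, 1 <= T & forall P Q S C t,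
  0 <= P -> 0 <= Q -> 0 <= S -> c <= C -> P + Q <= D -> T <= t -> fibre p q s r P Q S C t <= 0.
Proof.
move=> pq qr c0; have d0 : 0 < r - q by rewrite subr_gt0.
set B := `|D| / c + 1; have B1 : 1 <= B by rewrite lerDr divr_ge0// ltW.
have B0 : 0 <= B by exact: le_trans ler01 B1.
have T1 : 1 <= B `^ (r - q)^-1.
  by apply: powR_ge1 => //; rewrite invr_ge0 ltW.
exists (B `^ (r - q)^-1) => // P Q S C t P0 Q0 S0 cC PQ Tt.
have t1 : 1 <= t := le_trans T1 Tt; have t0 : 0 < t := lt_le_trans ltr01 t1.
have h1 : B <= t `^ (r - q).
  by rewrite -(powR_root d0 B0); apply: ge0_ler_powR; rewrite ?nnegrE ?powR_ge0 ?(ltW d0) ?(ltW t0).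
have tr : t `^ r = t `^ q * t `^ (r - q) by rewrite -powRD ?(gt_eqF t0) ?implybT// addrC subrK.
have tq0 : 0 < t `^ q by rewrite powR_gt0.
have h2 : t `^ p <= t `^ q by rewrite ler_powR// ltW.
have h3 : P * t `^ p <= P * t `^ q by exact: ler_wpM2l.
have h4 : 0 <= S * t `^ s by rewrite mulr_ge0 ?powR_ge0.
have h5 : `|D| * t `^ q <= C * t `^ r.
  rewrite tr mulrCA [leLHS]mulrC ler_pM2l//; apply: (@le_trans _ _ (c * B)).
    by rewrite /B mulrDr mulrCA mulfV ?gt_eqF// !mulr1 lerDl ltW.
  by apply: ler_pM => //; exact: ltW.
have h6 : (P + Q) * t `^ q <= `|D| * t `^ q by rewrite ler_pM2r//; exact: le_trans PQ (ler_norm _).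
rewrite /fibre; lra.
Qed.

Lemma cvg_fibre p q s r (P_ Q_ S_ C_ t_ : nat -> R) P Q S C t : 0 < s -> s < p -> p < q -> q < r ->
  P_ k @[k --> \oo] --> P -> Q_ k @[k --> \oo] --> Q -> S_ k @[k --> \oo] --> S -> C_ k @[k --> \oo] --> C ->
  (forall k, 0 <= t_ k) -> t_ k @[k --> \oo] --> t ->
  fibre p q s r (P_ k) (Q_ k) (S_ k) (C_ k) (t_ k) @[k --> \oo] --> fibre p q s r P Q S C t.
Proof.
move=> s0 sp pq qr hP hQ hS hC t0 ht; have tt0 : 0 <= t by exact: cvg_ge_cst ht t0.
have p0 := lt_trans s0 sp; have q0 := lt_trans p0 pq; have r0 := lt_trans q0 qr.
have E x : 0 < x -> t_ k `^ x @[k --> \oo] --> t `^ x.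
  move=> x0; have := cvg_comp _ _ ht (@continuous_norm_powR R x x0 t).
  rewrite ger0_norm//; apply: cvg_trans; apply: near_eq_cvg; apply: nearW => k /=.
  by rewrite ger0_norm.
by apply: cvgB; [apply: cvgB; [apply: cvgD|]|]; apply: cvgM => //; exact: E.
Qed.

Lemma fibre_continuous p q s r P Q S C : 0 < s -> s < p -> p < q -> q < r ->
  continuous (fun t => fibre p q s r P Q S C `|t|).
Proof.
move=> s0 sp pq qr t.
have p0 := lt_trans s0 sp; have q0 := lt_trans p0 pq; have r0 := lt_trans q0 qr.
by apply: cvgB; [apply: cvgB; [apply: cvgD|]|]; apply: cvgM; try (exact: cvg_cst); exact: continuous_norm_powR.
Qed.

Lemma fibre_max p q s r P Q S C t0 : 0 < s -> s < p -> p < q -> q < r -> 0 <= P -> 0 <= Q -> 0 <= S -> 0 < C ->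
  0 <= t0 -> 0 < fibre p q s r P Q S C t0 ->
  exists2 t, 0 < t & forall u, 0 <= u -> fibre p q s r P Q S C u <= fibre p q s r P Q S C t.
Proof.
move=> s0 sp pq qr P0 Q0 S0 C0 t00 ft0.
have [T T1 HT] := @fibre_le0 p q s r (P + Q) C pq qr C0.
have T0 : 0 <= T by exact: le_trans ler01 T1.
have cf := @fibre_continuous p q s r P Q S C s0 sp pq qr.
have [t /itvP tT Ht] := EVT_max T0 (continuous_subspaceT cf).
have t0' : 0 <= t by rewrite tT.
have le u : 0 <= u -> u <= T -> fibre p q s r P Q S C u <= fibre p q s r P Q S C t.
  by move=> u0 uT; have := Ht u; rewrite in_itv/= u0 uT !ger0_norm//; exact.
have t0T : t0 <= T.
  by rewrite leNgt; apply/negP => /ltW H; have := HT P Q S C t0 P0 Q0 S0 (lexx _) (lexx _) H; rewrite leNgt ft0.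
have ft : 0 < fibre p q s r P Q S C t := lt_le_trans ft0 (le _ t00 t0T).
exists t => [|u u0].
  by rewrite lt_neqAle t0' andbT; apply: contraTN ft => /eqP <-; rewrite fibre0// ltxx.
have [uT|/ltW uT] := leP u T; first exact: le.
exact: le_trans (HT P Q S C u P0 Q0 S0 (lexx _) (lexx _) uT) (ltW ft).
Qed.

(** The [t_ k] are eventually bounded by [fibre_le0], and any limit point attains at least [M] for
    the limit fibre, hence is 1 by [fibre_max_unique]. *)
Lemma fibre_max_cvg p q s r (P_ Q_ S_ C_ t_ : nat -> R) P Q S C M : 0 < s -> s < p -> p < q -> q < r ->
  (forall k, 0 <= P_ k) -> (forall k, 0 <= Q_ k) -> (forall k, 0 <= S_ k) ->
  P_ k @[k --> \oo] --> P -> Q_ k @[k --> \oo] --> Q -> S_ k @[k --> \oo] --> S -> C_ k @[k --> \oo] --> C ->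
  0 < C -> 0 < M -> (forall t, 0 <= t -> fibre p q s r P Q S C t <= M) -> fibre p q s r P Q S C 1 = M ->
  (forall k, 0 <= t_ k) -> (forall k, M <= fibre p q s r (P_ k) (Q_ k) (S_ k) (C_ k) (t_ k)) ->
  exists j : nat -> nat, (forall k, (k <= j k)%N) /\ t_ (j k) @[k --> \oo] --> (1 : R).
Proof.
move=> s0 sp pq qr P0 Q0 S0 hP hQ hS hC C0 M0 le f1 t0 Mt.
have C2 : 0 < C / 2 by rewrite divr_gt0.
have [T T1 HT] := @fibre_le0 p q s r (P + Q + 1) (C / 2) pq qr C2.
have [N _ HN] : \forall k \near \oo, C / 2 <= C_ k /\ P_ k + Q_ k <= P + Q + 1.
  have h1 := cvgr_ge _ hC (C / 2) (_ : C / 2 < C).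
  have h2 := cvgr_le _ (cvgD hP hQ) (P + Q + 1) (_ : P + Q < P + Q + 1).
  near=> k; split; near: k; [apply: h1; lra|apply: h2; lra].
have bT k : t_ (N + k)%N <= T.
  have [h1 h2] := HN (N + k)%N (leq_addr _ _); rewrite leNgt; apply/negP => /ltW H.
  by have := lt_le_trans M0 (le_trans (Mt _) (HT _ _ _ _ _ (P0 _) (Q0 _) (S0 _) h1 h2 H)); rewrite ltxx.
(* Bolzano-Weierstrass, obtained from the diagonal lemma with a single repeated coordinate. *)
have [j [l [jk Hl]]] := @diagonal_cvg R (fun k _ => t_ (N + k)%N) (fun=> T)
  (fun k _ => (eq_ind_r (fun x => x <= T) (bT k) (ger0_norm (t0 _)))).
have J k : (k <= N + j k)%N by exact: leq_trans (jk k) (leq_addl _ _).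
exists (fun k => N + j k)%N; split => //.
have c := Hl 0%N; have l0 : 0 <= l 0%N by exact: cvg_ge_cst c _.
suff <- : l 0%N = 1 by [].
apply: (@fibre_max_unique p q s r P Q S C M) => //; first exact: cvg_ge_cst hP _.
exact: cvg_ge_cst (cvg_fibre s0 sp pq qr (cvg_sub hP J) (cvg_sub hQ J) (cvg_sub hS J) (cvg_sub hC J) (fun k => t0 _) c) (fun k => Mt _).
Unshelve. all: by end_near. Qed.

Lemma min_seq (X : Type) (A : X -> Prop) (f : X -> R) (x0 : X) (b : R) : A x0 -> (forall x, A x -> b <= f x) ->
  exists (m : R) (u : nat -> X), [/\ forall x, A x -> m <= f x, forall k, A (u k), forall k, f (u k) <= m + 1 &
    f (u k) @[k --> \oo] --> m].
Proof.
move=> A0 bf; pose E := [set y | exists2 x, A x & f x = y].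
have hE : has_inf E by split; [exists (f x0), x0|exists b => _ [x Ax <-]; exact: bf].
have H k : exists x, A x /\ f x <= inf E + k.+1%:R^-1.
  have k0 : 0 < k.+1%:R^-1 :> R by rewrite invr_gt0.
  by have [_ [x Ax <-] /ltW h] := inf_adherent k0 hE; exists x.
have [u Hu] := choice H; exists (inf E), u.
have m x : A x -> inf E <= f x by move=> Ax; apply: ge_inf; [exact: hE.2|exists x].
split => //; [by move=> k; have [] := Hu k| |].
  move=> k; have [_ h] := Hu k; apply: (le_trans h); rewrite lerD2l invf_le1 ?ler1n//.
have c : (inf E + k.+1%:R^-1) @[k --> \oo] --> inf E + 0.
  by apply: cvgD; [exact: cvg_cst|exact: cvg_harmonic].
rewrite addr0 in c; apply: (squeeze_cvgr _ (cvg_cst (inf E)) c).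
by apply: nearW => k; rewrite m ?(Hu k).2//; exact: (Hu k).1.
Qed.

End fibre.

(** Here [hp], [hq], [hs], [hr] are the powers of [1/2]. Comparing the fibre at [t = 1/2] with its
    value [J] at [t = 1] and eliminating [C] bounds the energy by [S + J]. *)
Lemma coercive_half (R : realFieldType) (P Q S C J hp hq hs hr : R) : 0 <= P -> 0 <= S -> 0 <= J ->
  hq <= hp -> 0 <= hs -> 0 <= hr -> hr < 1 ->
  J = P + Q - S - C -> P * hp + Q * hq - S * hs - C * hr <= J -> hs <= 1 ->
  (hq - hr) * (P + Q) <= S + J.
Proof.
move=> P0 S0 J0 h1 h2 h3 h4 E h5 h6.
have g1 : P * hq <= P * hp by exact: ler_wpM2l.
have g2 : S * hs <= S by rewrite ler_piMr.
have g4 : 0 <= S * hr by rewrite mulr_ge0.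
have g5 : 0 <= J * hr by rewrite mulr_ge0.
have EC : C = P + Q - S - J by rewrite E; ring.
rewrite EC in h5; lra.
Qed.

(** * The two critical points in an abstract setting *)

Section mountain.
(** [X] has no linear structure beyond the scaling [sc], and [nn] stands for nonnegativity. [CP] is
    compactness: [S] and [C] pass to the limit, while [P] and [Q] may drop. [HS] says that [S] grows
    more slowly than the energy, [HC] is the Sobolev bound. *)
Context {R : realType} (X : Type) (P Q S C : X -> R) (sc : R -> X -> X) (nn : X -> Prop) (p q s r : R).
Hypotheses (s0 : 0 < s) (sp : s < p) (pq : p < q) (qr : q < r)
  (P0 : forall x, 0 <= P x) (Q0 : forall x, 0 <= Q x) (S0 : forall x, 0 <= S x) (C0 : forall x, 0 <= C x)
  (scP : forall t x, 0 < t -> P (sc t x) = P x * t `^ p) (scQ : forall t x, 0 < t -> Q (sc t x) = Q x * t `^ q)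
  (scS : forall t x, 0 < t -> S (sc t x) = S x * t `^ s) (scC : forall t x, 0 < t -> C (sc t x) = C x * t `^ r)
  (scN : forall t x, 0 < t -> nn x -> nn (sc t x))
  (CP : forall (x_ : nat -> X) a, (forall k, P (x_ k) + Q (x_ k) <= a) -> exists (j : nat -> nat) x P' Q',
    [/\ nn x, forall k, (k <= j k)%N, (P (x_ (j k)) @[k --> \oo] --> P') /\ (Q (x_ (j k)) @[k --> \oo] --> Q'),
        (S (x_ (j k)) @[k --> \oo] --> S x) /\ (C (x_ (j k)) @[k --> \oo] --> C x) & P x <= P' /\ Q x <= Q'])
  (HS : forall d, 0 < d -> exists2 K, 0 <= K & forall x, S x <= d * (P x + Q x) + K)
  (HC : exists2 K, 0 <= K & forall x a, 0 < a -> P x + Q x <= a -> C x <= K * a `^ (r / p))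
  (HX : exists x, 0 < S x /\ 0 < C x).
Let p0 : 0 < p. Proof. exact: lt_trans s0 sp. Qed.
Let q0 : 0 < q. Proof. exact: lt_trans p0 pq. Qed.
Let r0 : 0 < r. Proof. exact: lt_trans q0 qr. Qed.
Let J lam x := P x + Q x - S x - lam * C x.
Let fib lam x t := fibre p q s r (P x) (Q x) (S x) (lam * C x) t.

Let fib_sc lam x t : 0 < t -> J lam (sc t x) = fib lam x t.
Proof. by move=> t0; rewrite /J /fib /fibre scP// scQ// scS// scC// mulrA. Qed.

Let fib_sc2 lam x t u : 0 < t -> 0 <= u -> fib lam (sc t x) u = fib lam x (t * u).
Proof.
move=> t0 u0; rewrite /fib /fibre scP// scQ// scS// scC//.
by rewrite !powRM ?(ltW t0)// !mulrA.
Qed.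

Let fib1 lam x : fib lam x 1 = J lam x. Proof. by rewrite /fib fibre1. Qed.

(** Since [S] is at most half the energy plus [K1], the level [rho = 2 (K1 + 2)] leaves
    [P + Q - S >= 2]. Then [ls] is small enough that the coupling takes away at most 1. *)
Let ring_bound : exists rho, 0 < rho /\ exists2 ls, 0 < ls & forall lam x, 0 < lam -> lam < ls ->
  P x + Q x = rho -> 1 <= J lam x.
Proof.
have h2 : (0 : R) < 2^-1 by rewrite invr_gt0.
have [K1 K10 H1] := HS h2; have [K K0 H2] := HC.
pose rho := 2 * (K1 + 2); have r00 : 0 < rho by rewrite mulr_gt0// ltr_wpDl.
have D0 : 0 < K * rho `^ (r / p) + 1 by rewrite ltr_wpDl// mulr_ge0 ?powR_ge0.
exists rho; split => //; exists (K * rho `^ (r / p) + 1)^-1; first by rewrite invr_gt0.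
move=> lam x l0 l1 E; have h1 := H1 x; have h3 := H2 x rho r00 (_ : _ <= _); rewrite E lexx in h3.
have h4 : lam * C x <= 1.
  apply: (@le_trans _ _ (lam * (K * rho `^ (r / p) + 1))).
    by rewrite ler_pM2l//; apply: (le_trans (h3 isT)); rewrite lerDl.
  by rewrite -ler_pdivlMr// mul1r ltW.
move: h1; rewrite /J E /rho; lra.
Qed.

(** Near [t = 0] the term [S t^s] dominates because [s < p]. The number [c = t^(p - s)] is
    prescribed so that the energy is at most half of [S] after scaling and also stays below
    [rho]. *)
Let small_neg x lam rho : 0 < lam -> 0 < rho -> 0 < S x ->
  exists t, 0 < t /\ P (sc t x) + Q (sc t x) <= rho /\ J lam (sc t x) < 0.
Proof.
move=> l0 rho0 Sx; set F := P x + Q x; have F0 : 0 <= F by rewrite addr_ge0.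
have D0 : 0 < p - s by rewrite subr_gt0.
pose c := Num.min 1 (Num.min (S x / (F + 1) / 2) (rho / (F + 1))).
have F1 : 0 < F + 1 by rewrite ltr_wpDl.
have c0 : 0 < c by rewrite !lt_min ltr01 !divr_gt0.
have c1 : c <= 1 by rewrite ge_min lexx.
have c2 : c * (F + 1) <= S x / 2.
  rewrite -ler_pdivlMr// -mulrAC; first by rewrite /c !ge_min lexx orbT.
have c3 : c * (F + 1) <= rho by rewrite -ler_pdivlMr//; rewrite /c !ge_min lexx !orbT.
pose t := c `^ (p - s)^-1; have t0 : 0 < t by rewrite powR_gt0.
have t1 : t <= 1.
  by apply: powR_le1 => //; rewrite ?invr_ge0 ltW.
have tc : t `^ (p - s) = c by rewrite powR_root// ltW.
have ts0 : 0 < t `^ s by rewrite powR_gt0.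
have ts1 : t `^ s <= 1 by apply: powR_le1 => //; exact: ltW.
have tp : t `^ p = t `^ s * c by rewrite -tc -powRD ?(gt_eqF t0) ?implybT// addrC subrK.
have tq : t `^ q <= t `^ p by apply: powR_anti => //; exact: ltW.
exists t; split => //.
have e1 : P (sc t x) + Q (sc t x) <= t `^ s * (c * F).
  rewrite scP// scQ// mulrA -tp /F mulrDr ![_ * t `^ _]mulrC lerD2l; exact: ler_wpM2r.
have e2 : c * F <= c * (F + 1) by rewrite ler_pM2l// lerDl.
have cF0 : 0 <= c * F by rewrite mulr_ge0// ltW.
have e3 : t `^ s * (c * F) <= c * F by rewrite ler_piMl.
split; first exact: le_trans e1 (le_trans e3 (le_trans e2 c3)).
have e4 : t `^ s * (c * F) <= t `^ s * (S x / 2) by rewrite ler_pM2l//; exact: le_trans e2 c2.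
have e5 : 0 <= lam * C (sc t x) by rewrite mulr_ge0// ltW.
have e6 : 0 < t `^ s * S x by rewrite mulr_gt0.
have e7 : S (sc t x) = t `^ s * S x by rewrite scS// mulrC.
rewrite /J e7; move: e1 e4 e5 e6; rewrite mulrA; lra.
Qed.

Let local_min lam rho : 0 < lam -> 0 < rho -> (forall x, P x + Q x = rho -> 1 <= J lam x) ->
  exists x, [/\ nn x, P x + Q x < rho, J lam x < 0 & forall x', P x' + Q x' <= rho -> J lam x <= J lam x'].
Proof.
move=> l0 rho0 Hr; have [x0 [Sx0 _]] := HX.
have h1 : (0 : R) < 1 by []; have [K1 K10 H1] := HS h1; have [K K0 H2] := HC.
have [t [t0 [Ft Jt]]] := small_neg l0 rho0 Sx0.
have lb x : P x + Q x <= rho -> - K1 - lam * (K * rho `^ (r / p)) <= J lam x.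
  move=> Fx; have g1 := H1 x; have g2 : lam * C x <= lam * (K * rho `^ (r / p)) by rewrite ler_pM2l// H2.
  rewrite /J; lra.
have [m [u [mle Au Hu mu]]] := min_seq (A := fun x => P x + Q x <= rho) Ft lb.
have [j [x [P' [Q' [nx jk [cP cQ] [cS cC] [PP QQ]]]]]] := CP Au.
have Fx : P' + Q' <= rho by apply: cvg_le_cst (cvgD cP cQ) _ => k; exact: Au.
have Fx' : P x + Q x <= rho by apply: le_trans Fx; exact: lerD.
have cJ : J lam (u (j k)) @[k --> \oo] --> P' + Q' - S x - lam * C x.
  by apply: cvgB; [apply: cvgB => //; exact: cvgD|apply: cvgM => //; exact: cvg_cst].
have Em : m = P' + Q' - S x - lam * C x.
  by have c1 := cvg_sub mu jk; exact: (cvg_unique (@Rhausdorff R) c1 cJ).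
have Jx : J lam x <= m by rewrite Em /J; lra.
have J0 : J lam x < 0 by apply: le_lt_trans Jt; apply: (le_trans Jx); exact: mle.
exists x; split => //; last by move=> x' H; exact: le_trans Jx (mle _ H).
rewrite lt_neqAle Fx' andbT; apply/negP => /eqP E; have := Hr x E; lra.
Qed.

(** Positive [C] forces positive energy through the Sobolev bound, so [P t^p + Q t^q] goes
    continuously from 0 to beyond [rho]; it is the fibre with [S = C = 0]. *)
Let ray lam rho x : 0 < lam -> 0 < rho -> (forall x, P x + Q x = rho -> 1 <= J lam x) -> 0 < C x ->
  exists2 t, 0 < t & P x * t `^ p + Q x * t `^ q = rho.
Proof.
move=> l0 rho0 Hr Cx; have [K K0 H2] := HC.
have F0 : 0 < P x + Q x.
  rewrite lt_neqAle addr_ge0// andbT; apply/negP => /eqP E.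
  have rp0 : 0 < r / p by rewrite divr_gt0.
  have K1 : 0 < K + 1 by rewrite ltr_wpDl.
  pose b := C x / (K + 1) / 2; have b0 : 0 < b by rewrite !divr_gt0.
  have a0 : 0 < b `^ (r / p)^-1 by rewrite powR_gt0.
  have := H2 x _ a0 (_ : _ <= _); rewrite -E (ltW a0) powR_root ?(ltW b0)// => /(_ isT) h.
  have h2 : K * b <= (K + 1) * b by rewrite ler_pM2r// lerDl.
  have h3 : (K + 1) * b = C x / 2 by rewrite /b; field; rewrite gt_eqF.
  by move: h h2; rewrite h3; lra.
pose b := rho / (P x + Q x) + 1; have b1 : 1 <= b by rewrite lerDr divr_ge0 ?(ltW rho0) ?(ltW F0).
have b0 : 0 <= b by exact: le_trans ler01 b1.
pose T := b `^ p^-1; have T1 : 1 <= T by apply: powR_ge1 => //; rewrite invr_ge0 ltW.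
have T0 : 0 <= T by exact: le_trans ler01 T1.
have cf := @fibre_continuous R p q s r (P x) (Q x) 0 0 s0 sp pq qr.
have f0 : fibre p q s r (P x) (Q x) 0 0 `|0 : R| = 0 by rewrite normr0 fibre0.
have fT : rho <= fibre p q s r (P x) (Q x) 0 0 `|T|.
  rewrite ger0_norm// /fibre !mul0r !subr0.
  have Tp : T `^ p = b by rewrite powR_root.
  have Tq : b <= T `^ q by rewrite -Tp ler_powR// ltW.
  have h1 : rho <= (P x + Q x) * b by rewrite /b mulrDr mulrCA mulfV ?gt_eqF// !mulr1 lerDl ltW.
  by rewrite Tp; apply: (le_trans h1); rewrite mulrDl lerD2l ler_wpM2l.
have rb : Num.min (fibre p q s r (P x) (Q x) 0 0 `|0 : R|) (fibre p q s r (P x) (Q x) 0 0 `|T|) <= rho <=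
    Num.max (fibre p q s r (P x) (Q x) 0 0 `|0 : R|) (fibre p q s r (P x) (Q x) 0 0 `|T|).
  by rewrite f0 ge_min (ltW rho0)/= le_max fT orbT.
have [t /itvP tT Et] := IVT T0 (continuous_subspaceT cf) rb.
have t0 : 0 <= t by rewrite tT.
rewrite ger0_norm// in Et; exists t; last by move: Et; rewrite /fibre !mul0r !subr0.
by rewrite lt_neqAle t0 andbT; apply: contraTN rho0 => /eqP E; rewrite -Et -E fibre0// ltxx.
Qed.

(** [A] consists of the points whose fibre is maximal at [t = 1], and [J] is minimised over it. The
    limit of a minimising sequence may leave [A] because [P] and [Q] can drop, so it is rescaled to
    its own maximiser, which does not raise the value. *)
Let nehari lam : 0 < lam -> (forall x, 0 < C x -> exists2 t, 0 < t & 1 <= fib lam x t) ->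
  exists z, [/\ nn z, 0 < C z, 0 < J lam z, forall t, 0 <= t -> fib lam z t <= J lam z &
    forall x', 0 < C x' -> exists2 t, 0 <= t & J lam z <= fib lam x' t].
Proof.
move=> l0 H1; have [x0 [_ Cx0]] := HX.
pose A x := 0 < C x /\ forall u, 0 <= u -> fib lam x u <= J lam x.
have mx x : 0 < C x -> exists t, 0 < t /\ A (sc t x).
  move=> Cx; have [t0 t00 h] := H1 x Cx.
  have lC : 0 < lam * C x by exact: mulr_gt0.
  have [t tt0 Ht] := fibre_max s0 sp pq qr (P0 x) (Q0 x) (S0 x) lC (ltW t00) (lt_le_trans ltr01 h).
  exists t; split => //; split; first by rewrite scC// mulr_gt0// powR_gt0.
  by move=> u u0; rewrite fib_sc2// fib_sc//; apply: Ht; rewrite mulr_ge0// ltW.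
have J1 x : A x -> 1 <= J lam x.
  by move=> [Cx Ax]; have [t t0 h] := H1 x Cx; apply: (le_trans h); exact: Ax (ltW t0).
have [t0 [t00 A0]] := mx x0 Cx0.
have [m [u [mle Au Hu mu]]] := min_seq A0 J1.
have m1 : 1 <= m by apply: (cvg_ge_cst mu) => k; exact: J1 (Au k).
have half0 : 0 < 2^-1 :> R by rewrite invr_gt0.
have half1 : 2^-1 < 1 :> R by rewrite invf_lt1// ltr1n.
pose kap : R := 2^-1 `^ q - 2^-1 `^ r.
have kap0 : 0 < kap by rewrite subr_gt0; exact: powR_anti_lt.
have k20 : 0 < kap / 2 by rewrite divr_gt0.
have [K K0 HK] := HS k20.
(* From [kap (P + Q) <= S + J], with [S] absorbed at rate [kap/2] and [J <= m + 1]. *)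
have bd k : P (u k) + Q (u k) <= (K + (m + 1)) * 2 / kap.
  have [Cu Mu] := Au k; have h := Mu _ (ltW half0).
  have hqp : 2^-1 `^ q <= 2^-1 `^ p :> R by apply: powR_anti; rewrite ?ltW.
  have hr1 : 2^-1 `^ r < 1 :> R.
    by rewrite -[ltRHS](powRr0 2^-1); apply: powR_anti_lt.
  have J0 : 0 <= J lam (u k) by apply: le_trans ler01 (J1 _ (Au k)).
  have hs1 : 2^-1 `^ s <= 1 :> R by apply: powR_le1; rewrite ?ltW.
  have T := coercive_half (P0 (u k)) (S0 (u k)) J0 hqp (powR_ge0 _ s) (powR_ge0 _ r) hr1 erefl h hs1.
  have T2 := HK (u k); have T3 := Hu k.
  rewrite ler_pdivlMr// [leLHS]mulrC -/kap in T *; lra.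
have [j [x [P' [Q' [nx jk [cP cQ] [cS cC] [PP QQ]]]]]] := CP bd.
have cJ : J lam (u (j k)) @[k --> \oo] --> P' + Q' - S x - lam * C x.
  by apply: cvgB; [apply: cvgB => //; exact: cvgD|apply: cvgM => //; exact: cvg_cst].
have c1 := cvg_sub mu jk.
have Em : m = P' + Q' - S x - lam * C x by exact: (cvg_unique (@Rhausdorff R) c1 cJ).
have P'0 : 0 <= P' by exact: le_trans (P0 x) PP.
have Q'0 : 0 <= Q' by exact: le_trans (Q0 x) QQ.
have lim t : 0 <= t -> fibre p q s r P' Q' (S x) (lam * C x) t <= m.
  move=> t0'; have cl : (lam * C (u (j k))) @[k --> \oo] --> lam * C x by apply: cvgM => //; exact: cvg_cst.
  apply: (ler_cvg_to (cvg_fibre s0 sp pq qr cP cQ cS cl (fun=> t0') (cvg_cst t)) c1).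
  by apply: nearW => k; have [_ Mu] := Au (j k); exact: Mu.
(* If [C x = 0], the limit fibre at [t = 2] is at least [2^s m], which exceeds its bound
   [m >= 1]. *)
have Cx : 0 < C x.
  rewrite lt_neqAle C0 andbT; apply/negP => /eqP E; have := lim 2 (ler0n _ 2); rewrite /fibre -E mulr0 mul0r subr0.
  have b1 : 1 < 2 `^ s :> R.
    have l12 : (1 : R) < 2 by rewrite ltr1n.
    have := gt0_ltr_powR s0 (_ : 1 \in Num.nneg) (_ : 2 \in Num.nneg) l12.
    by rewrite powR1; apply; rewrite nnegrE.
  have bp : 2 `^ s <= 2 `^ p :> R by rewrite ler_powR ?ler1n// ltW.
  have bq : 2 `^ s <= 2 `^ q :> R by rewrite ler_powR ?ler1n// ltW// (lt_trans sp).
  have g1 : P' * 2 `^ s <= P' * 2 `^ p by exact: ler_wpM2l.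
  have g2 : Q' * 2 `^ s <= Q' * 2 `^ q by exact: ler_wpM2l.
  rewrite -E mulr0 subr0 in Em.
  have g3 : m < m * 2 `^ s by rewrite ltr_pMr// (lt_le_trans ltr01 m1).
  rewrite Em in g3 *; lra.
have [t [tt0 Az]] := mx x Cx; have [Cz Mz] := Az.
have Jz : J lam (sc t x) <= m.
  rewrite fib_sc//; apply: le_trans (lim t (ltW tt0)); rewrite /fib /fibre !lerD2r.
  by apply: lerD; apply: ler_wpM2r; rewrite ?powR_ge0.
exists (sc t x); split => //; first exact: scN.
  by apply: lt_le_trans ltr01 (J1 _ Az).
move=> x' Cx'; have [t' [t'0 Az']] := mx x' Cx'; exists t'; first exact: ltW.
by rewrite -fib_sc//; exact: le_trans Jz (mle _ Az').
Qed.

Lemma two_critical_points : exists2 ls, 0 < ls & forall lam, 0 < lam -> lam < ls ->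
  (exists x rho, [/\ nn x, P x + Q x < rho, P x + Q x - S x - lam * C x < 0 &
     forall x', P x' + Q x' <= rho -> P x + Q x - S x - lam * C x <= P x' + Q x' - S x' - lam * C x']) /\
  (exists z, [/\ nn z, 0 < C z, 0 < P z + Q z - S z - lam * C z,
     forall t, 0 <= t -> fibre p q s r (P z) (Q z) (S z) (lam * C z) t <= P z + Q z - S z - lam * C z &
     forall x', 0 < C x' -> exists2 t, 0 <= t &
       P z + Q z - S z - lam * C z <= fibre p q s r (P x') (Q x') (S x') (lam * C x') t]).
Proof.
have [rho [rho0 [ls ls0 H]]] := ring_bound; exists ls => // lam l0 l1.
have Hr x : P x + Q x = rho -> 1 <= J lam x by exact: H.
split; first by have [x h] := local_min l0 rho0 Hr; exists x, rho.
apply: (nehari l0) => x Cx; have [t t0 Et] := ray l0 rho0 Hr Cx.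
exists t => //; rewrite -fib_sc//; apply: Hr; rewrite scP// scQ//.
Qed.

End mountain.

(** The threshold [T] of [powR_theta] is chosen with [T^(e - 1) = d/(c + 1)], which brings the slope
    below [d]. *)
Lemma powR_le_affine (R : realType) (c e d : R) : 0 < e -> e < 1 -> 0 <= c -> 0 < d -> exists2 K, 0 <= K &
  forall x, 0 <= x -> c * x `^ e <= d * x + K.
Proof.
move=> e0 e1 c0 d0; have c1 : 0 < c + 1 by rewrite ltr_wpDl.
have b0 : 0 < d / (c + 1) by rewrite divr_gt0.
pose T := (d / (c + 1)) `^ (e - 1)^-1; have T0 : 0 < T by rewrite powR_gt0.
have TE : T `^ (e - 1) = d / (c + 1).
  by rewrite -powRrM mulVf ?powRr1 ?(ltW b0)// subr_eq0 lt_eqF.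
exists (c * T `^ e); first by rewrite mulr_ge0 ?powR_ge0.
move=> x x0; have h := powR_theta e0 (ltW e1) T0 x0.
rewrite powRr1// TE in h; apply: (le_trans (ler_wpM2l c0 h)).
rewrite mulrDr addrC lerD2r mulrA; apply: ler_wpM2r => //.
by rewrite mulrCA ler_piMr ?(ltW d0)// ler_pdivrMr// mul1r lerDl.
Qed.

Lemma four_bound (R : realFieldType) (p q b x1 x2 y1 y2 : R) : 0 < p -> 0 < q -> 0 <= x1 -> 0 <= x2 -> 0 <= y1 -> 0 <= y2 ->
  (x1 + x2) / p + (y1 + y2) / q <= b -> [/\ x1 <= p * b, x2 <= p * b, y1 <= q * b & y2 <= q * b].
Proof.
move=> p0 q0 x10 x20 y10 y20 H.
have P0 : 0 <= (x1 + x2) / p by rewrite divr_ge0 ?addr_ge0// ltW.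
have Q0 : 0 <= (y1 + y2) / q by rewrite divr_ge0 ?addr_ge0// ltW.
have H1 : (x1 + x2) / p <= b by lra.
have H2 : (y1 + y2) / q <= b by lra.
rewrite ler_pdivrMr// mulrC in H1; rewrite ler_pdivrMr// mulrC in H2.
by split; lra.
Qed.

(** * The functionals on pairs: continuity, compactness, growth *)

Section pairs.
Context {R : realType} {n : nat} (Om : set 'rV[R]_n) (p q r rho M : R) (eta : 'rV[R]_n -> R).
Notation mu := (@leb R n).
Notation W := (sob Om p q eta r).
Notation GA := (genergy Om (fun=> 1%R) p).
Notation GB := (genergy Om eta q).
Notation IL u := (\int[mu]_(z in (Om : set (lebT R n))) (`|u z| `^ r)%:E)%E.
Hypotheses (n0 : (0 < n)%N) (oOm : open Om) (Om0 : Om !=set0) (Orho : Om `<=` cball rho) (rho0 : 0 <= rho)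
  (p1 : 1 < p) (pq : p < q) (qr : q < r) (crit : n%:R * (r - p) < p * r)
  (meta : leb_measurable_fun Om eta) (eta0 : forall z, Om z -> 0 <= eta z)
  (etaM : ae_on Om (fun z => eta z <= M)).
Variables (s al be N : R).
Hypotheses (s0 : 0 < s) (s1 : s < 1) (al0 : 0 < al) (be0 : 0 < be) (alb : al + be = r).
Implicit Types (u v phi : 'rV[R]_n -> R) (g h : 'rV[R]_n -> 'rV[R]_n) (a : 'rV[R]_n -> R).

Let mOm : measurable (Om : set (lebT R n)). Proof. exact: open_leb_measurable. Qed.
Let muOm : (mu Om < +oo)%E.
Proof. by apply: le_lt_trans (leb_cball_fin (n := n) rho); exact: le_lebesgue_outer. Qed.
Let w1 : forall z : 'rV[R]_n, Om z -> 0 <= (fun=> 1 : R) z. Proof. by []. Qed.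
Let m1 : measurable_fun (Om : set (lebT R n)) ((fun=> 1) : lebT R n -> R). Proof. exact: measurable_cst. Qed.
Let p0 : 0 < p. Proof. exact: lt_trans ltr01 p1. Qed.
Let q1 : 1 < q. Proof. exact: lt_trans p1 pq. Qed.
Let q0 : 0 < q. Proof. exact: lt_trans ltr01 q1. Qed.
Let pr : p < r. Proof. exact: lt_trans pq qr. Qed.
Let r1 : 1 < r. Proof. exact: lt_trans p1 pr. Qed.
Let r0 : 0 < r. Proof. exact: lt_trans ltr01 r1. Qed.
Let sr : s <= r. Proof. exact: ltW (lt_trans s1 r1). Qed.

(** Bounds at every point rather than almost everywhere, so that pointwise estimates apply directly;
    the given weights are truncated to this form at the end. *)
Definition bounded_weight a := leb_measurable_fun Om a /\ forall z, Om z -> 0 <= a z <= N.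

Definition singular_term a u : R := \int[mu]_(z in (Om : set (lebT R n))) (a z * `|u z| `^ s).
Definition coupling u v : R := \int[mu]_(z in (Om : set (lebT R n))) (`|u z| `^ al * `|v z| `^ be).
Notation SS := singular_term.
Notation CC := coupling.

Lemma sob_IL_fin u g : W u g -> (IL u < +oo)%E.
Proof. by move=> Wu; apply: le_lt_trans (sob_fin oOm Orho p1 pq qr meta eta0 etaM Wu); exact: sdist_L. Qed.

Lemma sob_GA_fin u g : W u g -> (GA g < +oo)%E.
Proof. by move=> Wu; apply: le_lt_trans (sob_fin oOm Orho p1 pq qr meta eta0 etaM Wu); exact: sdist_A. Qed.

Lemma sob_GB_fin u g : W u g -> (GB g < +oo)%E.
Proof. by move=> Wu; apply: le_lt_trans (sob_fin oOm Orho p1 pq qr meta eta0 etaM Wu); exact: sdist_B. Qed.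

Lemma GAE u g : W u g -> GA g = (fine (GA g))%:E.
Proof. by move=> /sob_GA_fin h; rewrite fineK// ge0_fin_numE//; exact: (genergy_ge0 p w1 g). Qed.

Lemma GBE u g : W u g -> GB g = (fine (GB g))%:E.
Proof. by move=> /sob_GB_fin h; rewrite fineK// ge0_fin_numE//; exact: (genergy_ge0 q eta0 g). Qed.

Lemma GA_fine_ge0 g : 0 <= fine (GA g). Proof. by apply: fine_ge0; exact: (genergy_ge0 p w1 g). Qed.

Lemma GB_fine_ge0 g : 0 <= fine (GB g). Proof. by apply: fine_ge0; exact: (genergy_ge0 q eta0 g). Qed.

Lemma integrable_powR_IL u : leb_measurable_fun Om u -> (IL u < +oo)%E ->
  mu.-integrable (Om : set (lebT R n)) (fun z => (`|u z| `^ r)%:E).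
Proof.
move=> mu_ fin; apply/integrableP; split; first by apply/measurable_EFinP; exact: measurable_norm_powR.
by apply: le_lt_trans fin; rewrite le_eqVlt; apply/orP; left; apply/eqP; apply: eq_integral => z _; rewrite /= ger0_norm ?powR_ge0.
Qed.

Lemma integrable_cst_Om (c : R) : mu.-integrable (Om : set (lebT R n)) (fun=> c%:E).
Proof.
apply/integrableP; split; first exact: measurable_cst.
have -> : (\int[mu]_(z in (Om : set (lebT R n))) `|c%:E| = `|c|%:E * mu Om)%E by rewrite integral_cst.
by apply: lte_mul_pinfty; rewrite ?lee_fin.
Qed.

Lemma measurable_singular a u : bounded_weight a -> leb_measurable_fun Om u ->
  measurable_fun (Om : set (lebT R n)) (fun z : lebT R n => a z * `|u z| `^ s).
Proof. by move=> [ma _] mu_; apply: measurable_funM; [exact: ma|exact: measurable_norm_powR]. Qed.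

Lemma measurable_coupling u v : leb_measurable_fun Om u -> leb_measurable_fun Om v ->
  measurable_fun (Om : set (lebT R n)) (fun z : lebT R n => `|u z| `^ al * `|v z| `^ be).
Proof. by move=> mu_ mv; apply: measurable_funM; exact: measurable_norm_powR. Qed.

Lemma singular_le a u z : bounded_weight a -> Om z -> a z * `|u z| `^ s <= N * (1 + `|u z| `^ r).
Proof.
move=> [_ Ha] Oz; have /andP[a0 aN] := Ha z Oz.
by apply: ler_pM; rewrite ?powR_ge0//; apply: powR_le1D => //; exact: ltW.
Qed.

Lemma coupling_le u v z : `|u z| `^ al * `|v z| `^ be <= `|u z| `^ r + `|v z| `^ r.
Proof. by rewrite -alb; apply: powR_prod_le => //; rewrite ?ltW// addr_gt0. Qed.

Lemma integrable_singular a u : bounded_weight a -> leb_measurable_fun Om u -> (IL u < +oo)%E ->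
  mu.-integrable (Om : set (lebT R n)) (fun z => (a z * `|u z| `^ s)%:E).
Proof.
move=> ba mu_ fin.
have I1 : mu.-integrable (Om : set (lebT R n)) (fun z => (N * (1 + `|u z| `^ r))%:E) := integrableZl mOm N (integrableD mOm (integrable_cst_Om 1) (integrable_powR_IL mu_ fin)).
apply: (le_integrable mOm _ _ I1); first by apply/measurable_EFinP; exact: measurable_singular.
move=> z Oz; have [_ Ha] := ba; have /andP[a0 aN] := Ha z Oz.
have h := singular_le u ba Oz; rewrite lee_fin ger0_norm ?mulr_ge0 ?powR_ge0//.
exact: le_trans h (ler_norm _).
Qed.

Lemma integrable_coupling u v : leb_measurable_fun Om u -> leb_measurable_fun Om v -> (IL u < +oo)%E -> (IL v < +oo)%E ->
  mu.-integrable (Om : set (lebT R n)) (fun z => (`|u z| `^ al * `|v z| `^ be)%:E).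
Proof.
move=> mu_ mv fu fv.
have I1 : mu.-integrable (Om : set (lebT R n)) (fun z => (`|u z| `^ r + `|v z| `^ r)%:E) := integrableD mOm (integrable_powR_IL mu_ fu) (integrable_powR_IL mv fv).
apply: (le_integrable mOm _ _ I1); first by apply/measurable_EFinP; exact: measurable_coupling.
move=> z Oz; have h := coupling_le u v z; rewrite lee_fin ger0_norm ?mulr_ge0 ?powR_ge0//.
exact: le_trans h (ler_norm _).
Qed.

Lemma singular_ge0 a u : bounded_weight a -> 0 <= SS a u.
Proof.
move=> [_ Ha]; apply: Rintegral_ge0 => z Oz; have /andP[a0 aN] := Ha z Oz.
by rewrite mulr_ge0 ?powR_ge0.
Qed.

Lemma coupling_ge0 u v : 0 <= CC u v.
Proof. by apply: Rintegral_ge0 => z Oz; rewrite mulr_ge0 ?powR_ge0. Qed.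

Lemma singularZ a u (t : R) : bounded_weight a -> leb_measurable_fun Om u -> (IL u < +oo)%E ->
  SS a (fun z => t * u z) = SS a u * `|t| `^ s.
Proof.
move=> ba mu_ fu; rewrite mulrC -(@RintegralZl _ (lebT R n) R mu Om _ _ mOm (integrable_singular ba mu_ fu)).
by apply: eq_Rintegral => z _; rewrite normrM powRM// mulrCA.
Qed.

Lemma couplingZ u v (t : R) : leb_measurable_fun Om u -> leb_measurable_fun Om v -> (IL u < +oo)%E -> (IL v < +oo)%E ->
  CC (fun z => t * u z) (fun z => t * v z) = CC u v * `|t| `^ r.
Proof.
move=> mu_ mv fu fv; rewrite mulrC -(@RintegralZl _ (lebT R n) R mu Om _ _ mOm (integrable_coupling mu_ mv fu fv)).
apply: eq_Rintegral => z _; rewrite !normrM !powRM// -alb.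
by have [->|t0] := eqVneq t 0; [rewrite normr0 !powR0 ?gt_eqF ?addr_gt0//; ring|rewrite powRD ?normr_eq0 ?(negPf t0) ?implybT//; ring].
Qed.

Lemma singular_abs a u : SS a (fun z => `|u z|) = SS a u.
Proof. by apply: eq_Rintegral => z _; rewrite normr_id. Qed.

Lemma coupling_abs u v : CC (fun z => `|u z|) (fun z => `|v z|) = CC u v.
Proof. by apply: eq_Rintegral => z _; rewrite !normr_id. Qed.

(** Fast [L^r] convergence supplies at once almost everywhere convergence and one integrable
    majorant of all [|u_k|^r], which dominates both the singular and the coupling integrands. *)
Lemma IL_dominated (u_ : nat -> 'rV[R]_n -> R) u : (forall k, leb_measurable_fun Om (u_ k)) -> leb_measurable_fun Om u ->
  (IL u < +oo)%E -> (forall k, IL (fun z => u_ k z - u z)%R <= (4^-1 ^+ k)%:E)%E ->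
  exists U : lebT R n -> \bar R, [/\ mu.-integrable (Om : set (lebT R n)) U,
    forall z k, Om z -> ((`|u_ k z| `^ r)%:E <= U z)%E &
    {ae mu, forall z : lebT R n, Om z -> u_ k z @[k --> \oo] --> u z}].
Proof.
move=> mk mu_ fu H.
have [V [IV HV ae]] := @fast_cvg_dominated _ (lebT R n) R mu Om mOm r u_ u r0 mk mu_ H.
exists (fun z => (2 `^ r)%:E * (V z + (`|u z| `^ r)%:E))%E; split => //.
  exact: (integrableZl mOm _ (integrableD mOm IV (integrable_powR_IL mu_ fu))).
move=> z k Oz; apply: (@le_trans _ _ ((2 `^ r)%:E * ((`|u_ k z - u z| `^ r)%:E + (`|u z| `^ r)%:E))%E); last first.
  by apply: lee_wpmul2l; [rewrite lee_fin powR_ge0|apply: leeD => //; exact: HV].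
rewrite -EFinD -EFinM lee_fin; apply: le_trans (powRD_le (ltW r0) (normr_ge0 _) (normr_ge0 _)).
apply: ge0_ler_powR; rewrite ?nnegrE ?addr_ge0 ?(ltW r0)//.
by have := ler_normD (u_ k z - u z) (u z); rewrite subrK.
Qed.

Lemma singular_cvg a (u_ : nat -> 'rV[R]_n -> R) u : bounded_weight a -> (forall k, leb_measurable_fun Om (u_ k)) ->
  leb_measurable_fun Om u -> (IL u < +oo)%E -> (forall k, IL (fun z => u_ k z - u z)%R <= (4^-1 ^+ k)%:E)%E ->
  SS a (u_ k) @[k --> \oo] --> SS a u.
Proof.
move=> ba mk mu_ fu H; have [U [IU HU ae]] := IL_dominated mk mu_ fu H.
apply: (@Rdominated_cvg _ (lebT R n) R mu Om mOm (fun k z => a z * `|u_ k z| `^ s) (fun z => a z * `|u z| `^ s)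
  (fun z => N%:E * (1 + U z))%E _ _ _ _ _).2.
- by move=> k; exact: measurable_singular.
- exact: measurable_singular.
- apply: filterS ae => z Hz Oz; apply: cvgM; first exact: cvg_cst.
  exact: (cvg_comp _ _ (Hz Oz) (@continuous_norm_powR R s s0 _)).
- exact: (integrableZl mOm _ (integrableD mOm (integrable_cst_Om 1) IU)).
apply: aeW => z k Oz; have [_ Ha] := ba; have /andP[a0 aN] := Ha z Oz.
rewrite ger0_norm ?mulr_ge0 ?powR_ge0//; apply: (@le_trans _ _ (N * (1 + `|u_ k z| `^ r))%:E).
  by rewrite lee_fin; exact: singular_le.
rewrite EFinM; apply: lee_wpmul2l; first by rewrite lee_fin (le_trans a0).
by rewrite EFinD leeD2l// HU.
Qed.

Lemma coupling_cvg (u_ v_ : nat -> 'rV[R]_n -> R) u v : (forall k, leb_measurable_fun Om (u_ k)) ->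
  leb_measurable_fun Om u -> (IL u < +oo)%E -> (forall k, IL (fun z => u_ k z - u z)%R <= (4^-1 ^+ k)%:E)%E ->
  (forall k, leb_measurable_fun Om (v_ k)) ->
  leb_measurable_fun Om v -> (IL v < +oo)%E -> (forall k, IL (fun z => v_ k z - v z)%R <= (4^-1 ^+ k)%:E)%E ->
  CC (u_ k) (v_ k) @[k --> \oo] --> CC u v.
Proof.
move=> mk mu_ fu H mk' mv fv H'; have [U [IU HU ae]] := IL_dominated mk mu_ fu H.
have [V [IV HV ae']] := IL_dominated mk' mv fv H'.
apply: (@Rdominated_cvg _ (lebT R n) R mu Om mOm (fun k z => `|u_ k z| `^ al * `|v_ k z| `^ be)
  (fun z => `|u z| `^ al * `|v z| `^ be) (fun z => U z + V z)%E _ _ _ _ _).2.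
- by move=> k; exact: measurable_coupling.
- exact: measurable_coupling.
- apply: filterS2 ae ae' => z Hz Hz' Oz; apply: cvgM.
    exact: (cvg_comp _ _ (Hz Oz) (@continuous_norm_powR R al al0 _)).
  exact: (cvg_comp _ _ (Hz' Oz) (@continuous_norm_powR R be be0 _)).
- exact: (integrableD mOm IU IV).
apply: aeW => z k Oz; rewrite ger0_norm ?mulr_ge0 ?powR_ge0//.
apply: (@le_trans _ _ (`|u_ k z| `^ r + `|v_ k z| `^ r)%:E); first by rewrite lee_fin; exact: coupling_le.
by rewrite EFinD; apply: leeD; [exact: HU|exact: HV].
Qed.

Lemma fast_index (u_ : nat -> 'rV[R]_n -> R) u :
  (forall e : R, (0 < e)%R -> exists N, forall i, (N <= i)%N -> (IL (fun z => u_ i z - u z)%R <= e%:E)%E) ->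
  exists m : nat -> nat, forall k i, (m k <= i)%N -> (IL (fun z => u_ i z - u z)%R <= (4^-1 ^+ k)%:E)%E.
Proof.
move=> H; have /choice[m Hm] : forall k, exists m, forall i, (m <= i)%N -> (IL (fun z => u_ i z - u z)%R <= (4^-1 ^+ k)%:E)%E.
  by move=> k; apply: H; rewrite exprn_gt0.
by exists m.
Qed.

Lemma sob_limit (u_ : nat -> 'rV[R]_n -> R) (g_ : nat -> 'rV[R]_n -> 'rV[R]_n) u (A B : R) :
  leb_measurable_fun Om u -> (forall k, W (u_ k) (g_ k)) -> (forall k, IL (fun z => u_ k z - u z)%R <= (4^-1 ^+ k)%:E)%E ->
  fine (GA (g_ k)) @[k --> \oo] --> A -> fine (GB (g_ k)) @[k --> \oo] --> B ->
  exists g, [/\ W u g, (GA g <= A%:E)%E & (GB g <= B%:E)%E].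
Proof.
move=> mu_ Wk H cA cB; apply: (sob_weak_closed oOm p1 pq qr meta eta0 mu_) => e e0.
have c4 : (4^-1 ^+ k : R) @[k --> \oo] --> (0 : R).
  by apply: cvg_expr; rewrite ger0_norm ?invr_ge0// invf_lt1// ltr1n.
have Ae : A < A + e by rewrite ltrDl.
have Be : B < B + e by rewrite ltrDl.
have [k _ /(_ k (leqnn k))[[g1 g2] g3]] : \forall k \near \oo,
    (fine (GA (g_ k)) <= A + e /\ fine (GB (g_ k)) <= B + e) /\ 4^-1 ^+ k <= e.
  by apply: filterI; [apply: filterI; [exact: (cvgr_le _ cA _ Ae)|exact: (cvgr_le _ cB _ Be)]|exact: (cvgr_le _ c4 _ e0)].
exists (u_ k), (g_ k); split => //.
- by apply: le_trans (H k) _; rewrite lee_fin.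
- by rewrite (GAE (Wk k)) lee_fin.
- by rewrite (GBE (Wk k)) lee_fin.
Qed.

(** The type that instantiates [X] in the abstract argument; functions travel with their gradients,
    so the functionals are defined without selecting a gradient. *)
Definition sob_pair := {x : ('rV[R]_n -> R) * ('rV[R]_n -> 'rV[R]_n) * (('rV[R]_n -> R) * ('rV[R]_n -> 'rV[R]_n)) |
  W x.1.1 x.1.2 /\ W x.2.1 x.2.2}.

Definition mk_pair u1 g1 u2 g2 (h1 : W u1 g1) (h2 : W u2 g2) : sob_pair :=
  exist _ ((u1, g1), (u2, g2)) (conj h1 h2).

Implicit Types x : sob_pair.
Let P x : R := (fine (GA (sval x).1.2) + fine (GA (sval x).2.2)) / p.
Let Q x : R := (fine (GB (sval x).1.2) + fine (GB (sval x).2.2)) / q.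
Let C x : R := CC (sval x).1.1 (sval x).2.1.
Let nn x := (forall z, 0 <= (sval x).1.1 z) /\ (forall z, 0 <= (sval x).2.1 z).

Let W1 x : W (sval x).1.1 (sval x).1.2. Proof. by have [] := svalP x. Qed.
Let W2 x : W (sval x).2.1 (sval x).2.2. Proof. by have [] := svalP x. Qed.
Let sobm u g : W u g -> leb_measurable_fun Om u. Proof. by case. Qed.

Let PQ_bound x b : P x + Q x <= b -> [/\ fine (GA (sval x).1.2) <= p * b, fine (GA (sval x).2.2) <= p * b,
  fine (GB (sval x).1.2) <= q * b & fine (GB (sval x).2.2) <= q * b].
Proof.
by apply: (four_bound p0 q0); [exact: GA_fine_ge0|exact: GA_fine_ge0|exact: GB_fine_ge0|exact: GB_fine_ge0].
Qed.

Variables (a1 a2 : 'rV[R]_n -> R).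
Hypotheses (ba1 : bounded_weight a1) (ba2 : bounded_weight a2).
Let S x : R := (SS a1 (sval x).1.1 + SS a2 (sval x).2.1) / s.

(** Extractions for the first component, then the second, then the four energies, and a last one
    making the [L^r] convergence fast. *)
Lemma pair_compact (x_ : nat -> sob_pair) (b : R) : (forall k, P (x_ k) + Q (x_ k) <= b) ->
  exists (j : nat -> nat) (x : sob_pair) (P' Q' : R),
  [/\ nn x, forall k, (k <= j k)%N, (P (x_ (j k)) @[k --> \oo] --> P') /\ (Q (x_ (j k)) @[k --> \oo] --> Q'),
      (S (x_ (j k)) @[k --> \oo] --> S x) /\ (C (x_ (j k)) @[k --> \oo] --> C x) & P x <= P' /\ Q x <= Q'].
Proof.
move=> Hb; pose B := Num.max 1 (Num.max (p * b) (q * b)); have B0 : 0 < B by rewrite lt_max ltr01.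
have Bp : p * b <= B by rewrite !le_max lexx orbT.
have Bq : q * b <= B by rewrite !le_max lexx !orbT.
have bd k := PQ_bound (Hb k).
have G1 k : (GA (sval (x_ k)).1.2 <= B%:E)%E.
  by rewrite (GAE (W1 (x_ k))) lee_fin; have [h _ _ _] := bd k; exact: le_trans h Bp.
have G2 k : (GA (sval (x_ k)).2.2 <= B%:E)%E.
  by rewrite (GAE (W2 (x_ k))) lee_fin; have [_ h _ _] := bd k; exact: le_trans h Bp.
have [t1 [u1 [t1k mu1 Hu1]]] := sob_compact n0 oOm Orho rho0 p1 pq qr crit eta0 B0 (fun k => W1 (x_ k)) G1.
have [t2 [u2 [t2k mu2 Hu2]]] := sob_compact n0 oOm Orho rho0 p1 pq qr crit eta0 B0
  (fun k => W2 (x_ (t1 k))) (fun k => G2 (t1 k)).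
(* The four real sequences of energies are listed as coordinates 0 to 3, so that one diagonal
   extraction handles them. *)
pose V k (m : nat) : R := let y := sval (x_ (t1 (t2 k))) in
  if m == 0%N then fine (GA y.1.2) else if m == 1%N then fine (GA y.2.2) else
  if m == 2%N then fine (GB y.1.2) else fine (GB y.2.2).
have nb (x1 c : R) : 0 <= x1 -> x1 <= c -> c <= B -> `|x1| <= B.
  by move=> h1 h2 h3; rewrite ger0_norm//; exact: le_trans h2 h3.
have VB k m : `|V k m| <= B.
  have [h1 h2 h3 h4] := bd (t1 (t2 k)); rewrite /V.
  case: (m == 0%N); first exact: nb (GA_fine_ge0 _) h1 Bp.
  case: (m == 1%N); first exact: nb (GA_fine_ge0 _) h2 Bp.
  case: (m == 2%N); [exact: nb (GB_fine_ge0 _) h3 Bq|exact: nb (GB_fine_ge0 _) h4 Bq].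
have [t3 [l [t3k Hl]]] := @diagonal_cvg R V (fun=> B) VB.
have H1 : forall e : R, (0 < e)%R -> exists N, forall i, (N <= i)%N ->
    (IL (fun z => (sval (x_ (t1 (t2 (t3 i))))).1.1 z - u1 z)%R <= e%:E)%E.
  move=> e e0; have [N' HN] := Hu1 e e0; exists N' => i Ni; apply: HN.
  exact: leq_trans Ni (leq_trans (t3k i) (t2k _)).
have H2 : forall e : R, (0 < e)%R -> exists N, forall i, (N <= i)%N ->
    (IL (fun z => (sval (x_ (t1 (t2 (t3 i))))).2.1 z - u2 z)%R <= e%:E)%E.
  by move=> e e0; have [N' HN] := Hu2 e e0; exists N' => i Ni; apply: HN; exact: leq_trans Ni (t3k i).
have [m1' Hm1] := fast_index H1; have [m2' Hm2] := fast_index H2.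
pose k_ k := maxn k (maxn (m1' k) (m2' k)).
pose j k := t1 (t2 (t3 (k_ k))).
have kk k : (k <= k_ k)%N by exact: leq_maxl.
have L m : V (t3 (k_ k)) m @[k --> \oo] --> l m by exact: (cvg_sub (Hl m) kk).
have F1 k : (IL (fun z => (sval (x_ (j k))).1.1 z - u1 z)%R <= (4^-1 ^+ k)%:E)%E.
  by apply: Hm1; rewrite /k_ !leq_max leqnn orbT.
have F2 k : (IL (fun z => (sval (x_ (j k))).2.1 z - u2 z)%R <= (4^-1 ^+ k)%:E)%E.
  by apply: Hm2; rewrite /k_ !leq_max leqnn !orbT.
have [g1 [Wg1 Ag1 Bg1]] := sob_limit mu1 (fun k => W1 (x_ (j k))) F1 (L 0%N) (L 2%N).
have [g2 [Wg2 Ag2 Bg2]] := sob_limit mu2 (fun k => W2 (x_ (j k))) F2 (L 1%N) (L 3%N).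
have [h1 [Wh1 Ah1 Bh1]] := sob_abs oOm Orho p1 pq qr meta eta0 etaM Wg1.
have [h2 [Wh2 Ah2 Bh2]] := sob_abs oOm Orho p1 pq qr meta eta0 etaM Wg2.
have fu1 := sob_IL_fin Wg1; have fu2 := sob_IL_fin Wg2.
(* The limit is replaced by its absolute values: energies do not increase, and the singular and
   coupling terms do not see the sign. *)
exists j, (mk_pair Wh1 Wh2), ((l 0%N + l 1%N) / p), ((l 2%N + l 3%N) / q); split.
- by split => z; rewrite /= normr_ge0.
- by move=> k; rewrite /j (leq_trans (kk k))// (leq_trans (t3k _))// (leq_trans (t2k _)).
- by split; apply: cvgMl; apply: cvgD; [exact: (L 0%N)|exact: (L 1%N)|exact: (L 2%N)|exact: (L 3%N)].
- split.
    rewrite /S /= !singular_abs; apply: cvgMl; apply: cvgD.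
      exact: (singular_cvg ba1 (fun k => sobm (W1 (x_ (j k)))) mu1 fu1 F1).
    exact: (singular_cvg ba2 (fun k => sobm (W2 (x_ (j k)))) mu2 fu2 F2).
  rewrite /C /= coupling_abs.
  exact: (coupling_cvg (fun k => sobm (W1 (x_ (j k)))) mu1 fu1 F1 (fun k => sobm (W2 (x_ (j k)))) mu2 fu2 F2).
have fA u g (c : R) : W u g -> (GA g <= c%:E)%E -> fine (GA g) <= c by move=> /GAE E; rewrite E lee_fin.
have fB u g (c : R) : W u g -> (GB g <= c%:E)%E -> fine (GB g) <= c by move=> /GBE E; rewrite E lee_fin.
have PD (x1 x2 c : R) : 0 < c -> x1 <= x2 -> x1 / c <= x2 / c by move=> c0 h; rewrite ler_pM2r// invr_gt0.
split; apply: PD => //; apply: lerD.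
- exact: (fA _ _ _ Wh1 (le_trans Ah1 Ag1)).
- exact: (fA _ _ _ Wh2 (le_trans Ah2 Ag2)).
- exact: (fB _ _ _ Wh1 (le_trans Bh1 Bg1)).
- exact: (fB _ _ _ Wh2 (le_trans Bh2 Bg2)).
Qed.

Lemma Rintegral_eq0 (f : 'rV[R]_n -> R) : leb_measurable_fun Om f -> (forall z, Om z -> 0 <= f z) ->
  mu.-integrable (Om : set (lebT R n)) (EFin \o f) -> \int[mu]_(z in (Om : set (lebT R n))) f z = 0 -> ae_on Om (fun z => f z = 0).
Proof.
move=> mf f0 /integrableP[_ fin] E0.
have Ea : (\int[mu]_(z in (Om : set (lebT R n))) `|(EFin \o f) z| = \int[mu]_(z in (Om : set (lebT R n))) (f z)%:E)%E.
  by apply: eq_integral => z; rewrite inE => Oz; rewrite /= ger0_norm// f0.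
have I0 : (\int[mu]_(z in (Om : set (lebT R n))) `|(EFin \o f) z| = 0)%E.
  rewrite Ea; rewrite Ea in fin; rewrite -[LHS]fineK; first by congr EFin.
  by rewrite ge0_fin_numE//; apply: integral_ge0 => z Oz; rewrite lee_fin f0.
have mEf : measurable_fun (Om : set (lebT R n)) (EFin \o f) by apply/measurable_EFinP.
have := (ae_eq_integral_abs mu mOm mEf).1 I0.
by apply: filterS => z H Oz; have [] := H Oz.
Qed.

(** A small dyadic cell around any point of [Om] lies inside [Om]. *)
Lemma leb_open_gt0 : (0 < mu Om)%E.
Proof.
have [x Ox] := Om0; have /nbhs_ballP[e /= e0 He] : nbhs x Om by exact: open_nbhs_nbhs.
have c2 : (2^-1 ^+ k : R) @[k --> \oo] --> (0 : R).
  by apply: cvg_expr; rewrite ger0_norm ?invr_ge0// invf_lt1// ltr1n.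
have [k _ /(_ k (leqnn k)) /= k2] := cvgr_lt _ c2 _ e0.
have SO : cell k x `<=` Om.
  move=> y /cell_norm_lt h; apply: He; rewrite -ball_normE /= distrC; apply: (lt_trans h).
  by rewrite -exprVn.
apply: (@lt_le_trans _ _ (mu (cell k x))); last exact: le_lebesgue_outer.
by rewrite leb_cellE lte_fin cell_volume_gt0.
Qed.

Lemma integrable_weightM a phi : bounded_weight a -> test_fun Om phi -> ae_on Om (fun z => a z * phi z = 0) ->
  \int[mu]_(z in (Om : set (lebT R n))) (a z * phi z) = 0.
Proof.
move=> [ma _] tphi ae0.
rewrite /Rintegral (_ : (\int[mu]_(z in (Om : set (lebT R n))) (a z * phi z)%:E = 0)%E)//.
have mEf : measurable_fun (Om : set (lebT R n)) (fun z : lebT R n => (a z * phi z)%:E).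
  apply/measurable_EFinP; apply: measurable_funM; [exact: ma|exact: measurable_smooth (test_fun_smooth tphi)].
have ae1 : {ae mu, forall z : lebT R n, Om z -> a z * phi z = 0} := ae0.
have I0 : (\int[mu]_(z in (Om : set (lebT R n))) `|(a z * phi z)%:E| = 0)%E.
  by apply/(ae_eq_integral_abs mu mOm mEf); apply: filterS ae1 => z H Oz; rewrite H.
apply/eqP; rewrite -abse_eq0 eq_le abse_ge0 andbT -[leRHS]I0.
exact: le_abse_integral.
Qed.

Lemma loc_integrable_weight a : bounded_weight a -> loc_integrable Om a.
Proof.
move=> [ma Ha]; split => // K cK KO.
apply: (@integrableS _ (lebT R n) R mu Om K) => //; first exact: compact_leb_measurable.
apply: (le_integrable mOm _ _ (integrable_cst_Om N)); first exact/measurable_EFinP.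
move=> z Oz; have /andP[h1 h2] := Ha z Oz; rewrite /= lee_fin !ger0_norm//; exact: le_trans h2.
Qed.

Lemma weight_test_eq0 a : bounded_weight a -> (forall phi, test_fun Om phi -> ae_on Om (fun z => a z * phi z = 0)) ->
  ae_on Om (fun z => a z = 0).
Proof.
move=> ba H; apply: (integral_test_fun_eq0 oOm (loc_integrable_weight ba)) => phi tphi.
exact: integrable_weightM ba tphi (H _ tphi).
Qed.

(** If [a1 phi] vanished almost everywhere for each test function, the fundamental lemma would give
    [a1 = 0] almost everywhere, against positivity on a set of positive measure. Both integrals are
    positive for any [phi] where this fails. *)
Lemma exists_test_positive : ae_on Om (fun z => 0 < a1 z) ->
  exists2 phi, test_fun Om phi & 0 < SS a1 phi /\ 0 < CC phi phi.
Proof.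
move=> pos; have [phi tphi Hphi] : exists2 phi, test_fun Om phi & ~ ae_on Om (fun z => a1 z * phi z = 0).
  apply: contrapT => Hn; have H0 : ae_on Om (fun z => a1 z = 0).
    apply: (weight_test_eq0 ba1) => phi tphi; apply: contrapT => H; apply: Hn; by exists phi.
  have h1 : {ae mu, forall z : lebT R n, Om z -> 0 < a1 z} := pos.
  have h2 : {ae mu, forall z : lebT R n, Om z -> a1 z = 0} := H0.
  have [B [mB B0 HB]] := filterI h1 h2.
  have := leb_open_gt0; rewrite lt_neqAle => /andP[/eqP + _]; apply; apply/esym/eqP.
  rewrite eq_le measure_ge0 andbT -B0; apply: le_lebesgue_outer => z Oz; apply: HB => /= -[H1 H2].
  by have := H1 Oz; rewrite H2// ltxx.
have fin := sob_IL_fin (sob_test eta p1 pq qr tphi).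
have mphi : leb_measurable_fun Om phi by exact: measurable_smooth (test_fun_smooth tphi).
exists phi => //; have [_ Ha] := ba1; split.
  rewrite lt_neqAle singular_ge0 ?andbT//; apply/eqP => E; apply: Hphi.
  have nn0 z : Om z -> 0 <= a1 z * `|phi z| `^ s by move=> Oz; have /andP[? _] := Ha z Oz; rewrite mulr_ge0 ?powR_ge0.
  have ae1 : {ae mu, forall z : lebT R n, Om z -> a1 z * `|phi z| `^ s = 0} :=
    Rintegral_eq0 (measurable_singular ba1 mphi) nn0 (integrable_singular ba1 mphi fin) (esym E).
  apply: filterS ae1 => z H Oz; have /eqP := H Oz.
  by rewrite mulf_eq0 powR_eq0 normr_eq0 => /orP[/eqP ->|/andP[/eqP -> _]]; rewrite ?mul0r ?mulr0.
rewrite lt_neqAle coupling_ge0 ?andbT//; apply/eqP => E; apply: Hphi.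
have nn0 z : Om z -> 0 <= `|phi z| `^ al * `|phi z| `^ be by rewrite mulr_ge0 ?powR_ge0.
have ae1 : {ae mu, forall z : lebT R n, Om z -> `|phi z| `^ al * `|phi z| `^ be = 0} :=
    Rintegral_eq0 (measurable_coupling mphi mphi) nn0 (integrable_coupling mphi mphi fin fin) (esym E).
apply: filterS ae1 => z H Oz; have /eqP := H Oz.
by rewrite mulf_eq0 !powR_eq0 !normr_eq0 => /orP[/andP[/eqP -> _]|/andP[/eqP -> _]]; rewrite mulr0.
Qed.

(** Interpolates the exponent [s] between a constant and [r], then uses Sobolev. As [s/p < 1], the
    singular term grows more slowly than the energy. *)
Lemma singular_bound a : bounded_weight a -> exists2 c : R, 0 <= c & forall u g, W u g -> SS a u <= c * (fine (GA g) + 1) `^ (s / p).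
Proof.
move=> ba; have [K K0 HK] := sob_sobolev n0 oOm Orho rho0 p1 pq qr crit eta0.
pose m := fine (mu Om); have m0 : 0 <= m by exact: fine_ge0.
have [z0 Oz0] := Om0; have [_ Ha] := ba; have N0 : 0 <= N by have /andP[h1 h2] := Ha _ Oz0; exact: le_trans h1 h2.
exists (N * (m + K)); first by rewrite mulr_ge0// addr_ge0.
move=> u g Wu; pose A := fine (GA g) + 1; have A0 : 0 < A by rewrite ltr_wpDl// GA_fine_ge0.
have h := HK u g A Wu A0 (_ : _ <= _)%E; rewrite (GAE Wu) lee_fin lerDl in h; have {}h := h ler01.
(* The threshold that balances both terms: each becomes a multiple of [A^(s/p)]. *)
pose th := A `^ p^-1; have th0 : 0 < th by rewrite powR_gt0.
have mu_ := sobm Wu; have fin := sob_IL_fin Wu.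
have T := @integral_powR_theta _ (lebT R n) R mu Om mOm s r th u s0 sr th0 mu_ muOm.
have Is : SS a u <= N * fine (\int[mu]_(z in (Om : set (lebT R n))) (`|u z| `^ s)%:E).
  have f1 : (\int[mu]_(z in (Om : set (lebT R n))) (`|u z| `^ s)%:E < +oo)%E.
    by apply: (le_lt_trans T); apply: lte_add_pinfty; [exact: ltry|apply: lte_mul_pinfty; rewrite ?lee_fin ?powR_ge0].
  have Ius : mu.-integrable (Om : set (lebT R n)) (fun z => (`|u z| `^ s)%:E).
    apply/integrableP; split; first by apply/measurable_EFinP; exact: measurable_norm_powR.
    by apply: le_lt_trans f1; rewrite le_eqVlt; apply/orP; left; apply/eqP; apply: eq_integral => z _; rewrite /= ger0_norm ?powR_ge0.
  rewrite -[X in N * X]/(\int[mu]_(z in (Om : set (lebT R n))) (`|u z| `^ s)) -(@RintegralZl _ (lebT R n) R mu Om _ N mOm Ius).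
  apply: le_Rintegral => //; [exact: integrable_singular|exact: (integrableZl mOm N Ius)|].
  by move=> z Oz; have /andP[h1 h2] := Ha z Oz; apply: ler_wpM2r; rewrite ?powR_ge0.
apply: (le_trans Is); rewrite -mulrA; apply: ler_wpM2l => //.
rewrite -lee_fin fineK; last first.
  rewrite ge0_fin_numE; last by apply: integral_ge0 => z _; rewrite lee_fin powR_ge0.
  by apply: (le_lt_trans T); apply: lte_add_pinfty; [exact: ltry|apply: lte_mul_pinfty; rewrite ?lee_fin ?powR_ge0].
apply: (le_trans T); apply: (@le_trans _ _ ((th `^ s * m)%:E + (th `^ (s - r))%:E * (K * A `^ (r / p))%:E)%E).
  by apply: leeD => //; apply: lee_wpmul2l => //; rewrite lee_fin powR_ge0.
rewrite -EFinM -EFinD lee_fin le_eqVlt; apply/orP; left; apply/eqP.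
have e1 : th `^ s = A `^ (s / p) by rewrite /th -powRrM mulrC.
have e2 : th `^ (s - r) * A `^ (r / p) = A `^ (s / p).
  rewrite /th -powRrM -powRD ?(gt_eqF A0) ?implybT//; congr (_ `^ _); by field; rewrite gt_eqF.
rewrite e1 mulrCA e2 -/A; ring.
Qed.

Let sobZ' t u g : W u g -> W (fun z => t * u z) (fun z => t *: g z).
Proof. exact: (sobZ oOm p1 pq qr meta eta0 t). Qed.

Definition scale_pair (t : R) x : sob_pair := mk_pair (sobZ' t (W1 x)) (sobZ' t (W2 x)).

Let GAZ (t : R) u g : 0 < t -> W u g -> fine (GA (fun z => t *: g z)) = fine (GA g) * t `^ p.
Proof.
move=> t0 Wu; have [_ mg _] := Wu.
rewrite (@genergyZ R n Om (fun=> 1) p mOm m1 w1 t g mg) (GAE Wu) -EFinM /= mulrC ger0_norm// ltW//.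
Qed.

Let GBZ (t : R) u g : 0 < t -> W u g -> fine (GB (fun z => t *: g z)) = fine (GB g) * t `^ q.
Proof.
move=> t0 Wu; have [_ mg _] := Wu.
rewrite (@genergyZ R n Om eta q mOm meta eta0 t g mg) (GBE Wu) -EFinM /= mulrC ger0_norm// ltW//.
Qed.

Let sum_bound (d A B c K D Q0 : R) : 0 < p -> 0 < s -> 0 <= Q0 -> 0 <= d -> c <= d * s / p * A + K -> D <= d * s / p * B + K ->
  (c + D) / s <= d * ((A + B) / p + Q0) + 2 * K / s.
Proof.
move=> p_gt0 s_gt0 Q00 d0 h1 h2; rewrite ler_pdivrMr//.
apply: (le_trans (lerD h1 h2)).
have -> : (d * ((A + B) / p + Q0) + 2 * K / s) * s = (d * s / p * A + K + (d * s / p * B + K)) + d * Q0 * s.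
  by field; rewrite !gt_eqF.
by rewrite lerDl !mulr_ge0// ltW.
Qed.

Let P0' x : 0 <= P x.
Proof. by apply: divr_ge0; [apply: addr_ge0; exact: GA_fine_ge0|exact: ltW p0]. Qed.

Let Q0' x : 0 <= Q x.
Proof. by apply: divr_ge0; [apply: addr_ge0; exact: GB_fine_ge0|exact: ltW q0]. Qed.

Let S0' x : 0 <= S x.
Proof. by apply: divr_ge0; [apply: addr_ge0; [exact: singular_ge0 ba1|exact: singular_ge0 ba2]|exact: ltW s0]. Qed.

Let C0' x : 0 <= C x. Proof. exact: coupling_ge0. Qed.

Let sum_scale (x1 x2 y1 y2 c w : R) : x1 = y1 * w -> x2 = y2 * w -> (x1 + x2) / c = (y1 + y2) / c * w.
Proof. by move=> -> ->; rewrite -mulrDl mulrAC. Qed.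

Let scP t x : 0 < t -> P (scale_pair t x) = P x * t `^ p.
Proof.
move=> t0; have e1 := GAZ t0 (W1 x); have e2 := GAZ t0 (W2 x).
exact: (sum_scale p e1 e2).
Qed.

Let scQ t x : 0 < t -> Q (scale_pair t x) = Q x * t `^ q.
Proof.
move=> t0; have e1 := GBZ t0 (W1 x); have e2 := GBZ t0 (W2 x).
exact: (sum_scale q e1 e2).
Qed.

Let scS t x : 0 < t -> S (scale_pair t x) = S x * t `^ s.
Proof.
move=> t0; have e1 := singularZ t ba1 (sobm (W1 x)) (sob_IL_fin (W1 x)).
have e2 := singularZ t ba2 (sobm (W2 x)) (sob_IL_fin (W2 x)).
rewrite (ger0_norm (ltW t0)) in e1 e2.
exact: (sum_scale s e1 e2).
Qed.

Let scC t x : 0 < t -> C (scale_pair t x) = C x * t `^ r.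
Proof.
move=> t0; have e1 := couplingZ t (sobm (W1 x)) (sobm (W2 x)) (sob_IL_fin (W1 x)) (sob_IL_fin (W2 x)).
by rewrite (ger0_norm (ltW t0)) in e1; exact: e1.
Qed.

Let scN t x : 0 < t -> nn x -> nn (scale_pair t x).
Proof. by move=> t0 [h1 h2]; split => z; [exact: mulr_ge0 (ltW t0) (h1 z)|exact: mulr_ge0 (ltW t0) (h2 z)]. Qed.

Let S_le d : 0 < d -> exists2 K, 0 <= K & forall x, S x <= d * (P x + Q x) + K.
Proof.
move=> d0; have [c1 c10 H1] := singular_bound ba1; have [c2 c20 H2] := singular_bound ba2.
have e0 : 0 < s / p by rewrite divr_gt0.
have e1 : s / p < 1 by rewrite ltr_pdivrMr// mul1r (lt_trans s1).
have d1 : 0 < d * s / p by rewrite divr_gt0// mulr_gt0.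
have c0 : 0 <= c1 + c2 by exact: addr_ge0.
have [K K0 HK] := powR_le_affine e0 e1 c0 d1.
have B0 : 0 <= d * s / p + K by rewrite addr_ge0// ltW.
exists (2 * (d * s / p + K) / s); first by rewrite divr_ge0 ?mulr_ge0 ?(ltW s0).
have one (a : 'rV[R]_n -> R) c u g : c <= c1 + c2 -> W u g -> SS a u <= c * (fine (GA g) + 1) `^ (s / p) ->
    SS a u <= d * s / p * fine (GA g) + (d * s / p + K).
  move=> cc Wu h; have A0 : 0 <= fine (GA g) + 1 by rewrite addr_ge0 ?GA_fine_ge0.
  apply: (le_trans h); apply: (@le_trans _ _ ((c1 + c2) * (fine (GA g) + 1) `^ (s / p))).
    by apply: ler_wpM2r => //; exact: powR_ge0.
  by apply: (le_trans (HK _ A0)); rewrite mulrDr mulr1 addrA.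
move=> x; have l1 : c1 <= c1 + c2 by rewrite lerDl.
have l2 : c2 <= c1 + c2 by rewrite lerDr.
exact: (sum_bound p0 s0 (Q0' x) (ltW d0) (one a1 c1 _ _ l1 (W1 x) (H1 _ _ (W1 x))) (one a2 c2 _ _ l2 (W2 x) (H2 _ _ (W2 x)))).
Qed.

Let C_le : exists2 K, 0 <= K & forall x b, 0 < b -> P x + Q x <= b -> C x <= K * b `^ (r / p).
Proof.
have [K K0 HK] := sob_sobolev n0 oOm Orho rho0 p1 pq qr crit eta0.
exists (2 * K * p `^ (r / p)); first by apply: mulr_ge0; [apply: mulr_ge0|exact: powR_ge0].
move=> x b b0 Hb; have [h1 h2 _ _] := PQ_bound Hb; have pb0 : 0 < p * b by exact: mulr_gt0.
have G u g : W u g -> fine (GA g) <= p * b -> fine (IL u) <= K * (p * b) `^ (r / p).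
  move=> Wu h; have T := HK u g _ Wu pb0 (_ : _ <= _)%E; rewrite (GAE Wu) lee_fin in T.
  have IL0 : (0 <= IL u)%E by apply: integral_ge0 => z _; rewrite lee_fin powR_ge0.
  have {}T := T h; rewrite -lee_fin fineK// ge0_fin_numE//; exact: sob_IL_fin Wu.
have g1 := G _ _ (W1 x) h1; have g2 := G _ _ (W2 x) h2.
have I1 := integrable_powR_IL (sobm (W1 x)) (sob_IL_fin (W1 x)).
have I2 := integrable_powR_IL (sobm (W2 x)) (sob_IL_fin (W2 x)).
have I3 := integrable_coupling (sobm (W1 x)) (sobm (W2 x)) (sob_IL_fin (W1 x)) (sob_IL_fin (W2 x)).
have E := @RintegralD _ (lebT R n) R mu Om _ _ mOm I1 I2.
have L := @le_Rintegral _ (lebT R n) R mu Om _ _ mOm I3 (integrableD mOm I1 I2) (fun z _ => coupling_le (sval x).1.1 (sval x).2.1 z).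
apply: (le_trans L); rewrite [leLHS]E.
apply: (le_trans (lerD g1 g2)); rewrite powRM ?(ltW p0) ?(ltW b0)// le_eqVlt; apply/orP; left; apply/eqP; ring.
Qed.

Lemma sob_pair_critical : ae_on Om (fun z => 0 < a1 z) -> exists2 ls, 0 < ls & forall lam, 0 < lam -> lam < ls ->
  (exists x rho, [/\ nn x, P x + Q x < rho, P x + Q x - S x - lam * C x < 0 &
     forall x', P x' + Q x' <= rho -> P x + Q x - S x - lam * C x <= P x' + Q x' - S x' - lam * C x']) /\
  (exists z, [/\ nn z, 0 < C z, 0 < P z + Q z - S z - lam * C z,
     forall t, 0 <= t -> fibre p q s r (P z) (Q z) (S z) (lam * C z) t <= P z + Q z - S z - lam * C z &
     forall x', 0 < C x' -> exists2 t, 0 <= t &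
       P z + Q z - S z - lam * C z <= fibre p q s r (P x') (Q x') (S x') (lam * C x') t]).
Proof.
move=> pos; have sp : s < p by exact: lt_trans s1 p1.
have ex : exists x, 0 < S x /\ 0 < C x.
  have [phi tphi [h1 h2]] := exists_test_positive pos.
  have Wp := sob_test eta p1 pq qr tphi.
  exists (mk_pair Wp Wp); split; last exact: h2.
  by apply: divr_gt0 s0; exact: ltr_wpDr (singular_ge0 phi ba2) h1.
exact: (@two_critical_points R sob_pair P Q S C scale_pair nn p q s r s0 sp pq qr P0' Q0' S0' C0' scP scQ scS scC scN
  pair_compact S_le C_le ex).
Qed.

End pairs.

(** * Difference quotients of powers and of integrals *)

Section quotients.
Context {R : realType}.
Implicit Types (e : nat -> R).

Lemma cvg_powR (u : nat -> R) (l x : R) : 0 < x -> (forall k, 0 <= u k) -> u k @[k --> \oo] --> l -> u k `^ x @[k --> \oo] --> l `^ x.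
Proof.
move=> x0 u0 ul; have l0 : 0 <= l by exact: cvg_ge_cst ul u0.
have := cvg_comp _ _ ul (@continuous_norm_powR R x x0 l).
rewrite ger0_norm//; apply: cvg_trans; apply: near_eq_cvg; apply: nearW => k /=.
by rewrite ger0_norm.
Qed.

(** Written for a quadratic polynomial because [|y + e h|^2] and the squared norm of [g + e k] are
    such polynomials in [e]; other powers of these quantities are powers of the square. *)
Lemma powR_quot_cvg e (th a c1 c2 : R) : 0 < a -> (forall k, 0 < e k) -> e k @[k --> \oo] --> (0 : R) ->
  (e k)^-1 * ((a + e k * c1 + e k ^+ 2 * c2) `^ th - a `^ th) @[k --> \oo] --> th * a `^ (th - 1) * c1.
Proof.
move=> a0 e0 ec; pose phi (x : R) := a + x * c1 + x ^+ 2 * c2.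
have phi0 : phi 0 = a by rewrite /phi mul0r expr2 !mul0r !addr0.
have d1 : is_derive (0 : R) 1 phi c1.
  apply/is_derive1_caratheodory; exists (fun z => c1 + z * c2); split.
  - by move=> z; rewrite /phi; ring.
  - by apply: cvgD; [exact: cvg_cst|apply: cvgM; [exact: cvg_id|exact: cvg_cst]].
  - by rewrite mul0r addr0.
have d2 : is_derive (phi 0) 1 (fun x : R => x `^ th) (th * a `^ (th - 1)).
  by rewrite phi0; exact: is_derive1_powR.
have /is_derive1_caratheodory[G [GE Gc G0]] := is_derive1_comp d2 d1.
have c : G (e k) @[k --> \oo] --> G 0 by exact: (cvg_comp _ _ ec Gc).
rewrite -G0; apply: cvg_trans c; apply: near_eq_cvg; apply: nearW => k /=.
have := GE (e k); rewrite /= phi0 subr0 => ->.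
by rewrite mulrCA mulVf ?mulr1// gt_eqF.
Qed.

Lemma abs_quot_cvg e (th y h : R) : 0 < y -> (forall k, 0 < e k) -> e k @[k --> \oo] --> (0 : R) ->
  (e k)^-1 * (`|y + e k * h| `^ th - `|y| `^ th) @[k --> \oo] --> th * (y `^ (th - 1) * h).
Proof.
move=> y0 e0 ec; have yy : 0 < y ^+ 2 by rewrite exprn_gt0.
have sq (x : R) : `|x| `^ th = (x ^+ 2) `^ (th / 2).
  rewrite -[x ^+ 2]ger0_norm ?sqr_ge0// normrX -powR_mulrn// -powRrM; congr (_ `^ _).
  by rewrite mulrCA mulfV ?mulr1.
have T := @powR_quot_cvg e (th / 2) (y ^+ 2) (2 * y * h) (h ^+ 2) yy e0 ec.
have -> : th * (y `^ (th - 1) * h) = th / 2 * (y ^+ 2) `^ (th / 2 - 1) * (2 * y * h).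
  rewrite -powR_mulrn ?(ltW y0)// -powRrM.
  have -> : 2%:R * (th / 2 - 1) = (th - 1) - 1 :> R by field.
  have -> : y `^ (th - 1) = y `^ (th - 1 - 1) * y.
    by rewrite -{3}(powRr1 (ltW y0)) -powRD ?(gt_eqF y0) ?implybT// subrK.
  by field.
apply: cvg_trans T; apply: near_eq_cvg; apply: nearW => k /=; rewrite !sq.
by congr (_ * (_ `^ _ - _)); ring.
Qed.

(** A majorant independent of [e] for dominated convergence: the mean value bound gives
    [e t (2 (G + K))^t], and the factor [e] cancels. *)
Lemma quot_bound (t G K x e : R) : 1 < t -> 0 < e -> e <= 1 -> 0 <= G -> 0 <= K -> 0 <= x -> `|x - G| <= e * K ->
  `|e^-1 * (x `^ t - G `^ t)| <= t * (2 `^ t * 2 `^ t) * (G `^ t + K `^ t).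
Proof.
move=> t1 e0 e1 G0 K0 x0 H; have t0 : 0 < t by exact: lt_trans t1.
have b0 : 0 <= G + K by exact: addr_ge0.
have t10 : 0 <= t - 1 by rewrite subr_ge0 ltW.
have h1 := powR_dist_le t1 x0 G0.
have eK : e * K <= K by rewrite ler_piMl.
have xG : x + G <= 2 * (G + K) by have := le_trans (ler_norm _) H; lra.
have h2 : (x + G) `^ (t - 1) <= (2 * (G + K)) `^ (t - 1).
  by apply: ge0_ler_powR => //; rewrite nnegrE ?addr_ge0// mulr_ge0.
have h3 : `|x - G| <= e * (2 * (G + K)) by apply: (le_trans H); rewrite ler_pM2l//; lra.
rewrite normrM ger0_norm ?invr_ge0 ?(ltW e0)// ler_pdivrMl//.
apply: (le_trans h1); apply: (@le_trans _ _ (t * (2 * (G + K)) `^ (t - 1) * (e * (2 * (G + K))))).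
  by apply: ler_pM => //; [rewrite mulr_ge0 ?powR_ge0 ?(ltW t0)|rewrite ler_wpM2l// ltW].
have -> : t * (2 * (G + K)) `^ (t - 1) * (e * (2 * (G + K))) = e * (t * ((2 * (G + K)) `^ (t - 1) * (2 * (G + K)))) by ring.
rewrite powR_mulB1 ?mulr_ge0// powRM// ler_pM2l// -!mulrA ler_pM2l// ler_pM2l ?powR_gt0//.
exact: powRD_le (ltW t0) G0 K0.
Qed.

Lemma enorm_quot_cvg (n : nat) e (t : R) (g k : 'rV[R]_n) : 1 < t -> (forall m, 0 < e m) -> e m @[m --> \oo] --> (0 : R) ->
  (e m)^-1 * (enorm (g + e m *: k) `^ t - enorm g `^ t) @[m --> \oo] --> t * (enorm g `^ (t - 2) * dotv g k).
Proof.
move=> t1 e0 ec; have t0 : 0 < t by exact: lt_trans t1.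
have dge0 (x : 'rV[R]_n) : 0 <= dotv x x by apply: sumr_ge0 => i _; rewrite -expr2 sqr_ge0.
have sq (x : 'rV[R]_n) (b : R) : enorm x `^ b = dotv x x `^ (b / 2).
  by rewrite /enorm -powR12_sqrt// -powRrM mulrC.
(* At [g = 0] the squared norm has no nonzero base point; there the quotient is [e^(t-1)] times the
   power of the norm of [k], which tends to 0 since [t > 1]. *)
have [g0|gn] := eqVneq g 0.
  have z0 : dotv g k = 0 by rewrite g0 /dotv big1// => i _; rewrite mxE mul0r.
  rewrite z0 !mulr0 g0 enorm0 powR0 ?gt_eqF//.
  have c : e m `^ (t - 1) * enorm k `^ t @[m --> \oo] --> 0 `^ (t - 1) * enorm k `^ t.
    by apply: cvgM; [apply: cvg_powR => //; [rewrite subr_gt0|move=> m; exact: ltW]|exact: cvg_cst].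
  rewrite powR0 ?gt_eqF ?subr_gt0// mul0r in c.
  apply: cvg_trans c; apply: near_eq_cvg; apply: nearW => m /=.
  rewrite add0r enormZ gtr0_norm// subr0 powRM ?enorm_ge0 ?(ltW (e0 m))//.
  by rewrite -(powR_mulB1 (ltW (e0 m)) t0); field; rewrite gt_eqF.
have d0 : 0 < dotv g g.
  rewrite lt_neqAle dge0 andbT eq_sym; apply: contra_neq gn => E; apply: enorm_eq0.
  by rewrite /enorm E sqrtr0.
have T := @powR_quot_cvg e (t / 2) (dotv g g) (2 * dotv g k) (dotv k k) d0 e0 ec.
have -> : t * (enorm g `^ (t - 2) * dotv g k) = t / 2 * dotv g g `^ (t / 2 - 1) * (2 * dotv g k).
  by rewrite sq (_ : (t - 2) / 2 = t / 2 - 1); [field|field].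
apply: cvg_trans T; apply: near_eq_cvg; apply: nearW => m /=; rewrite !sq.
congr (_ * (_ `^ _ - _)); rewrite /dotv !mulr_sumr -!big_split /=.
by apply: eq_bigr => i _; rewrite !mxE; ring.
Qed.

End quotients.

Section quotient_integrals.
Context {R : realType} {n : nat} (Om : set 'rV[R]_n).
Notation mu := (@leb R n).
Hypothesis mOm : measurable (Om : set (lebT R n)).

Lemma Rintegral_quot_cvg (f_ : nat -> 'rV[R]_n -> R) (f0 f h : 'rV[R]_n -> R) (e : nat -> R) :
  (forall k, mu.-integrable (Om : set (lebT R n)) (EFin \o f_ k)) -> mu.-integrable (Om : set (lebT R n)) (EFin \o f0) ->
  leb_measurable_fun Om f -> mu.-integrable (Om : set (lebT R n)) (EFin \o h) ->
  ae_on Om (fun z => (e k)^-1 * (f_ k z - f0 z) @[k --> \oo] --> f z) ->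
  ae_on Om (fun z => forall k, `|(e k)^-1 * (f_ k z - f0 z)| <= h z) ->
  mu.-integrable (Om : set (lebT R n)) (EFin \o f) /\
  (e k)^-1 * (\int[mu]_(z in (Om : set (lebT R n))) f_ k z - \int[mu]_(z in (Om : set (lebT R n))) f0 z) @[k --> \oo] -->
    \int[mu]_(z in (Om : set (lebT R n))) f z.
Proof.
move=> If I0 mf Ih c b.
have m_ k : measurable_fun (Om : set (lebT R n)) (fun z : lebT R n => (e k)^-1 * (f_ k z - f0 z)).
  apply: measurable_funM; first exact: measurable_cst.
  apply: measurable_funB; [exact/measurable_EFinP/(measurable_int _ (If k))|exact/measurable_EFinP/(measurable_int _ I0)].
have b' : {ae mu, forall (z : lebT R n) k, Om z -> (`|(e k)^-1 * (f_ k z - f0 z)|%:E <= (EFin \o h) z)%E}.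
  have b1 : {ae mu, forall z : lebT R n, Om z -> forall k, `|(e k)^-1 * (f_ k z - f0 z)| <= h z} := b.
  by apply: filterS b1 => z H k Oz; rewrite lee_fin; exact: H.
have [I1 C1] := @Rdominated_cvg _ (lebT R n) R mu Om mOm (fun k z => (e k)^-1 * (f_ k z - f0 z)) f (EFin \o h) m_ mf c Ih b'.
split => //; apply: cvg_trans C1; apply: near_eq_cvg; apply: nearW => k /=.
rewrite -(@RintegralB _ (lebT R n) R mu Om _ _ mOm (If k) I0).
by rewrite -(@RintegralZl _ (lebT R n) R mu Om _ _ mOm (integrableB mOm (If k) I0)).
Qed.

Variables (w : 'rV[R]_n -> R) (t : R).
Hypotheses (mw : measurable_fun (Om : set (lebT R n)) (w : lebT R n -> R)) (w0 : forall z, Om z -> 0 <= w z) (t1 : 1 < t).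
Let t0 : 0 < t. Proof. exact: lt_trans t1. Qed.

Lemma genergy_integrable g : vmeas Om g -> (genergy Om w t g < +oo)%E ->
  mu.-integrable (Om : set (lebT R n)) (fun z => (w z * enorm (g z) `^ t)%:E).
Proof.
move=> mg fin; apply/integrableP; split; first by apply/measurable_EFinP; exact: measurable_genergy.
apply: le_lt_trans fin; rewrite le_eqVlt; apply/orP; left; apply/eqP; apply: eq_integral => z; rewrite inE => Oz.
by rewrite /= ger0_norm// mulr_ge0 ?powR_ge0 ?w0.
Qed.

Lemma measurable_pairing g k : vmeas Om g -> vmeas Om k ->
  measurable_fun (Om : set (lebT R n)) (fun z : lebT R n => w z * (enorm (g z) `^ (t - 2) * dotv (g z) (k z))).
Proof.
move=> mg mk; apply: measurable_funM; first exact: mw.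
apply: measurable_funM.
  apply: (measurableT_comp (@measurable_powR R (t - 2))).
  exact: (@measurable_comp_continuous R n _ (lebT R n) Om g enorm mg continuous_enorm).
by apply: measurable_sum => i; apply: measurable_funM; [exact: mg|exact: mk].
Qed.

Lemma genergy_quot_cvg g k (e : nat -> R) : vmeas Om g -> vmeas Om k -> (genergy Om w t g < +oo)%E -> (genergy Om w t k < +oo)%E ->
  (forall m, 0 < e m) -> (forall m, e m <= 1) -> e m @[m --> \oo] --> (0 : R) ->
  mu.-integrable (Om : set (lebT R n)) (EFin \o (fun z => w z * (enorm (g z) `^ (t - 2) * dotv (g z) (k z)))) /\
  (e m)^-1 * (fine (genergy Om w t (fun z => g z + e m *: k z)) - fine (genergy Om w t g)) @[m --> \oo] -->
    t * \int[mu]_(z in (Om : set (lebT R n))) (w z * (enorm (g z) `^ (t - 2) * dotv (g z) (k z))).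
Proof.
move=> mg mk fg fk e0 e1 ec.
have fm m : (genergy Om w t (fun z => g z + e m *: k z)%R < +oo)%E.
  have T := @genergyD_le R n Om w t mOm mw w0 t1 g (fun z => e m *: k z) mg (vmeasZ (e m) mk).
  apply: (le_lt_trans T); apply: lte_mul_pinfty; [by rewrite lee_fin powR_ge0|by []|].
  apply: lte_add_pinfty; first exact: fg.
  rewrite (@genergyZ R n Om w t mOm mw w0 (e m) k mk); apply: lte_mul_pinfty; [by rewrite lee_fin powR_ge0|by []|exact: fk].
have Im m := genergy_integrable (vmeasD mg (vmeasZ (e m) mk)) (fm m).
have Ig := genergy_integrable mg fg; have Ik := genergy_integrable mk fk.
pose c : R := t * (2 `^ t * 2 `^ t).
have Ih : mu.-integrable (Om : set (lebT R n)) (fun z => (c * (w z * enorm (g z) `^ t + w z * enorm (k z) `^ t))%:E) :=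
  integrableZl mOm c (integrableD mOm Ig Ik).
have mp := measurable_pairing mg mk.
have cv : ae_on Om (fun z => (e m)^-1 * (w z * enorm (g z + e m *: k z) `^ t - w z * enorm (g z) `^ t) @[m --> \oo] -->
    t * (w z * (enorm (g z) `^ (t - 2) * dotv (g z) (k z)))).
  apply: aeW => z Oz; have C := @enorm_quot_cvg R n e t (g z) (k z) t1 e0 ec.
  have C2 : w z * ((e m)^-1 * (enorm (g z + e m *: k z) `^ t - enorm (g z) `^ t)) @[m --> \oo] -->
      w z * (t * (enorm (g z) `^ (t - 2) * dotv (g z) (k z))) by apply: cvgM; [exact: cvg_cst|exact: C].
  rewrite mulrCA; apply: cvg_trans C2; apply: near_eq_cvg; apply: nearW => m /=.
  by rewrite -mulrBr mulrCA.
have bd : ae_on Om (fun z => forall m, `|(e m)^-1 * (w z * enorm (g z + e m *: k z) `^ t - w z * enorm (g z) `^ t)| <=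
    c * (w z * enorm (g z) `^ t + w z * enorm (k z) `^ t)).
  apply: aeW => z Oz m; rewrite -mulrBr mulrCA normrM (ger0_norm (w0 Oz)) -mulrDr mulrCA.
  apply: ler_wpM2l; first exact: w0.
  apply: (quot_bound t1 (e0 m) (e1 m)); rewrite ?enorm_ge0//.
  have D1 := enormD (g z) (e m *: k z); rewrite enormZ (gtr0_norm (e0 m)) in D1.
  have D2 := enormD (g z + e m *: k z) (- (e m *: k z)); rewrite addrK enormN enormZ (gtr0_norm (e0 m)) in D2.
  by rewrite ler_norml; apply/andP; split; lra.
have mp' : leb_measurable_fun Om (fun z => t * (w z * (enorm (g z) `^ (t - 2) * dotv (g z) (k z)))).
  by apply: measurable_funM; [exact: measurable_cst|exact: mp].
have [I1 C1] := @Rintegral_quot_cvg (fun m z => w z * enorm (g z + e m *: k z) `^ t) (fun z => w z * enorm (g z) `^ t) _ _ e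
  Im Ig mp' Ih cv bd.
have I2 : mu.-integrable (Om : set (lebT R n)) (EFin \o (fun z => w z * (enorm (g z) `^ (t - 2) * dotv (g z) (k z)))).
  have I3 := integrableZl mOm t^-1 I1; apply: eq_integrable I3; first exact: mOm.
  by move=> z _; rewrite /= -EFinM mulKf// gt_eqF.
split; first exact: I2.
by rewrite (@RintegralZl _ (lebT R n) R mu Om _ t mOm I2) in C1.
Qed.

End quotient_integrals.

(** * From one-sided stationarity to positivity and the weak equation *)

Section euler_lagrange.
Context {R : realType} {n : nat} (Om : set 'rV[R]_n) (p q r rho M : R) (eta : 'rV[R]_n -> R).
Notation mu := (@leb R n).
Notation W := (sob Om p q eta r).
Notation GA := (genergy Om (fun=> 1%R) p).
Notation GB := (genergy Om eta q).
Notation IL u := (\int[mu]_(z in (Om : set (lebT R n))) (`|u z| `^ r)%:E)%E.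
Hypotheses (oOm : open Om) (Om0 : Om !=set0) (Orho : Om `<=` cball rho)
  (p1 : 1 < p) (pq : p < q) (qr : q < r)
  (meta : leb_measurable_fun Om eta) (eta0 : forall z, Om z -> 0 <= eta z)
  (etaM : ae_on Om (fun z => eta z <= M)).
Variables (s al be N lam : R) (a y v : 'rV[R]_n -> R) (g : 'rV[R]_n -> 'rV[R]_n).
Notation SS := (singular_term Om s).
Notation CC := (coupling Om al be).
Hypotheses (s0 : 0 < s) (s1 : s < 1) (al1 : 1 < al) (be0 : 0 < be) (alb : al + be = r) (lam0 : 0 < lam)
  (ba : bounded_weight Om N a) (apos : ae_on Om (fun z => 0 < a z))
  (Wy : W y g) (y0 : forall z, 0 <= y z) (mv : leb_measurable_fun Om v) (fv : (IL v < +oo)%E).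
Implicit Types (h : 'rV[R]_n -> R) (k : 'rV[R]_n -> 'rV[R]_n) (e tau : nat -> R).

Definition stationary_path h k e tau := [/\ (forall m, 0 < e m) /\ (forall m, e m <= 1), e m @[m --> \oo] --> (0 : R),
  forall m, 0 <= tau m, tau m @[m --> \oo] --> (1 : R) &
  forall m, 0 <= tau m `^ p * (fine (GA (fun z => g z + e m *: k z)) - fine (GA g)) / p
    + tau m `^ q * (fine (GB (fun z => g z + e m *: k z)) - fine (GB g)) / q
    - tau m `^ s * (SS a (fun z => y z + e m * h z) - SS a y) / s
    - lam * tau m `^ r * (CC (fun z => y z + e m * h z) v - CC y v)].

Hypothesis stationary : forall h k, W h k -> exists e tau, stationary_path h k e tau.

Let mOm : measurable (Om : set (lebT R n)). Proof. exact: open_leb_measurable. Qed.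
Let w1 : forall z : 'rV[R]_n, Om z -> 0 <= (fun=> 1 : R) z. Proof. by []. Qed.
Let m1 : measurable_fun (Om : set (lebT R n)) ((fun=> 1) : lebT R n -> R). Proof. exact: measurable_cst. Qed.
Let p0 : 0 < p. Proof. exact: lt_trans ltr01 p1. Qed.
Let q1 : 1 < q. Proof. exact: lt_trans p1 pq. Qed.
Let q0 : 0 < q. Proof. exact: lt_trans ltr01 q1. Qed.
Let r0 : 0 < r. Proof. exact: lt_trans q0 qr. Qed.
Let r1 : 1 < r. Proof. exact: lt_trans q1 qr. Qed.
Let al0 : 0 < al. Proof. exact: lt_trans ltr01 al1. Qed.
Let my : leb_measurable_fun Om y. Proof. by case: Wy. Qed.
Let mg : vmeas Om g. Proof. by case: Wy. Qed.
Let fy : (IL y < +oo)%E. Proof. exact: (sob_IL_fin oOm Orho p1 pq qr meta eta0 etaM Wy). Qed.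
Let fW u j : W u j -> (IL u < +oo)%E. Proof. exact: (sob_IL_fin oOm Orho p1 pq qr meta eta0 etaM). Qed.
Let fA u j : W u j -> (GA j < +oo)%E. Proof. exact: (sob_GA_fin oOm Orho p1 pq qr meta eta0 etaM). Qed.
Let fB u j : W u j -> (GB j < +oo)%E. Proof. exact: (sob_GB_fin oOm Orho p1 pq qr meta eta0 etaM). Qed.
Let Wpath h k (c : R) : W h k -> W (fun z => y z + c * h z) (fun z => g z + c *: k z).
Proof. by move=> Wh; exact: (sobD oOm p1 pq qr meta eta0 Wy (sobZ oOm p1 pq qr meta eta0 c Wh)). Qed.
Let mW u j : W u j -> leb_measurable_fun Om u. Proof. by case. Qed.
Let gW u j : W u j -> vmeas Om j. Proof. by case. Qed.
Let IS b u j : bounded_weight Om N b -> W u j -> mu.-integrable (Om : set (lebT R n)) (EFin \o (fun z => b z * `|u z| `^ s)).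
Proof. by move=> bb Wu; exact: (integrable_singular oOm Orho p1 pq qr s0 s1 bb (mW Wu) (fW Wu)). Qed.
Let IC u j : W u j -> mu.-integrable (Om : set (lebT R n)) (EFin \o (fun z => `|u z| `^ al * `|v z| `^ be)).
Proof. by move=> Wu; exact: (integrable_coupling oOm al0 be0 alb (mW Wu) mv (fW Wu) fv). Qed.

Let DA k : R := \int[mu]_(z in (Om : set (lebT R n))) (1 * (enorm (g z) `^ (p - 2) * dotv (g z) (k z))).
Let DB k : R := \int[mu]_(z in (Om : set (lebT R n))) (eta z * (enorm (g z) `^ (q - 2) * dotv (g z) (k z))).

Let cancel_ident (x1 x2 : R) : x1 + x2 = 1 * (p * x1) / p + 1 * (q * x2) / q.
Proof. by rewrite !mul1r ![_ * x1]mulrC ![_ * x2]mulrC !mulfK// gt_eqF. Qed.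

Let prod_div (u1 u2 : nat -> R) (l1 l2 c : R) : u1 m @[m --> \oo] --> l1 -> u2 m @[m --> \oo] --> l2 ->
  u1 m * u2 m / c @[m --> \oo] --> l1 * l2 / c.
Proof. by move=> h1 h2; apply: cvgMl; exact: cvgM. Qed.

Let energy_part h k e tau : W h k -> stationary_path h k e tau ->
  tau m `^ p * ((e m)^-1 * (fine (GA (fun z => g z + e m *: k z)) - fine (GA g))) / p
    + tau m `^ q * ((e m)^-1 * (fine (GB (fun z => g z + e m *: k z)) - fine (GB g))) / q @[m --> \oo] --> DA k + DB k.
Proof.
move=> Wh [[e0 e1] ec t0 tc _].
have [_ cA] := genergy_quot_cvg mOm m1 w1 p1 mg (gW Wh) (fA Wy) (fA Wh) e0 e1 ec.
have [_ cB] := genergy_quot_cvg mOm meta eta0 q1 mg (gW Wh) (fB Wy) (fB Wh) e0 e1 ec.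
have tp := cvg_powR p0 t0 tc; have tq := cvg_powR q0 t0 tc; rewrite powR1 in tp tq.
rewrite cancel_ident.
exact: (cvgD (@prod_div _ _ _ _ p tp cA) (@prod_div _ _ _ _ q tq cB)).
Qed.

Let scaled_ident (i tp tq ts tr dA dB dS dC : R) : i * (tp * dA / p + tq * dB / q - ts * dS / s - lam * tr * dC) =
  tp * (i * dA) / p + tq * (i * dB) / q - ts * (i * dS) / s - lam * (tr * (i * dC)).
Proof. by ring. Qed.

Let limit_ident (x1 x2 x3 : R) : x1 - x2 - lam * x3 = x1 - 1 * (s * x2) / s - lam * (1 * x3).
Proof. by rewrite !mul1r [s * x2]mulrC mulfK// gt_eqF. Qed.

Let negate_ident (x1 x2 x3 x4 : R) : -1 * x1 + -1 * x2 - (-1 * x3) - lam * (al * (-1 * x4)) = - (x1 + x2 - x3 - lam * (al * x4)).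
Proof. by ring. Qed.

Let stationary_scaled h k e tau m : stationary_path h k e tau ->
  0 <= tau m `^ p * ((e m)^-1 * (fine (GA (fun z => g z + e m *: k z)) - fine (GA g))) / p
    + tau m `^ q * ((e m)^-1 * (fine (GB (fun z => g z + e m *: k z)) - fine (GB g))) / q
    - tau m `^ s * ((e m)^-1 * (SS a (fun z => y z + e m * h z) - SS a y)) / s
    - lam * (tau m `^ r * ((e m)^-1 * (CC (fun z => y z + e m * h z) v - CC y v))).
Proof.
move=> [[e0 _] _ _ _ /(_ m) H]; have i0 : 0 <= (e m)^-1 by rewrite invr_ge0 ltW.
by have := mulr_ge0 i0 H; rewrite scaled_ident.
Qed.

Let CC_mono h k (c : R) : W h k -> (forall z, 0 <= h z) -> 0 <= c -> CC y v <= CC (fun z => y z + c * h z) v.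
Proof.
move=> Wh h0 c0; apply: (@le_Rintegral _ (lebT R n) R mu Om _ _ mOm (IC Wy) (IC (Wpath c Wh))) => z _.
apply: ler_wpM2r; first exact: powR_ge0.
have ch : 0 <= c * h z by rewrite mulr_ge0.
apply: ge0_ler_powR; [exact: ltW al0|by rewrite nnegrE|by rewrite nnegrE|].
by rewrite !ger0_norm ?addr_ge0// lerDl.
Qed.

Let SS_mono b h k (c : R) : bounded_weight Om N b -> W h k -> (forall z, 0 <= h z) -> 0 <= c -> SS b y <= SS b (fun z => y z + c * h z).
Proof.
move=> bb Wh h0 c0; apply: (@le_Rintegral _ (lebT R n) R mu Om _ _ mOm (IS bb Wy) (IS bb (Wpath c Wh))) => z Oz.
apply: ler_wpM2l; first by have [_ /(_ z Oz)/andP[]] := bb.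
have ch : 0 <= c * h z by rewrite mulr_ge0.
apply: ge0_ler_powR; [exact: ltW s0|by rewrite nnegrE|by rewrite nnegrE|].
by rewrite !ger0_norm ?addr_ge0// lerDl.
Qed.

Let quot_le (X D E t w ss L : R) : 0 < ss -> 0 <= D -> 0 <= E -> X <= L -> 2^-1 <= t -> 0 <= w -> 0 <= X - t * D / ss - w * E ->
  D <= 2 * (ss * L).
Proof.
move=> ss0 D0 E0 XL t2 w0 H; have h1 : 0 <= w * E by exact: mulr_ge0.
have h2 : t * D / ss <= L by lra.
rewrite ler_pdivrMr// in h2; have h3 : 2^-1 * D <= t * D by exact: ler_wpM2r.
lra.
Qed.

Let singular_quot_bounded h k : W h k -> (forall z, 0 <= h z) -> exists e, exists2 K : R,
  [/\ forall m, 0 < e m, forall m, e m <= 1 & e m @[m --> \oo] --> (0 : R)] &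
  forall m, (e m)^-1 * (SS a (fun z => y z + e m * h z) - SS a y) <= K.
Proof.
move=> Wh h0; have [e [tau st]] := stationary Wh; have c := energy_part Wh st.
have [[e0 e1] ec t0 tc _] := st.
have ts := cvg_powR s0 t0 tc; rewrite powR1 in ts.
have half1 : 2^-1 < 1 :> R by rewrite invf_lt1// ltr1n.
have Lt : DA k + DB k < DA k + DB k + 1 by rewrite ltrDl.
have [N' _ HN] : \forall m \near \oo, tau m `^ p * ((e m)^-1 * (fine (GA (fun z => g z + e m *: k z)) - fine (GA g))) / p
    + tau m `^ q * ((e m)^-1 * (fine (GB (fun z => g z + e m *: k z)) - fine (GB g))) / q <= DA k + DB k + 1 /\
    2^-1 <= tau m `^ s.
  by apply: filterI; [exact: (cvgr_le _ c _ Lt)|exact: (cvgr_ge _ ts _ half1)].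
exists (fun m => e (N' + m)%N), (2 * (s * (DA k + DB k + 1))).
  by split => //; apply: (cvg_sub ec) => m; exact: leq_addl.
move=> m; have [h1 h2] := HN (N' + m)%N (leq_addr _ _).
have i0 : 0 <= (e (N' + m)%N)^-1 by rewrite invr_ge0 ltW.
have D0 := mulr_ge0 i0 (_ : 0 <= SS a (fun z => y z + e (N' + m)%N * h z) - SS a y).
have E0 := mulr_ge0 i0 (_ : 0 <= CC (fun z => y z + e (N' + m)%N * h z) v - CC y v).
rewrite subr_ge0 in D0; rewrite subr_ge0 in E0.
have T := stationary_scaled (N' + m)%N st; rewrite [lam * (_ * _)]mulrA in T.
apply: (quot_le s0 (D0 (SS_mono ba Wh h0 (ltW (e0 _)))) (E0 (CC_mono Wh h0 (ltW (e0 _)))) h1 h2 _ T).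
by rewrite mulr_ge0 ?powR_ge0 ?(ltW lam0).
Qed.

(** The weight restricted to the zero set of [y]; positivity of [y] amounts to its vanishing almost
    everywhere. *)
Let a0 z : R := a z * (y z == 0)%:R.

Let ba0 : bounded_weight Om N a0.
Proof.
have [ma Ha] := ba; split.
  apply: measurable_funM; first exact: ma.
  rewrite (_ : (fun z : lebT R n => (y z == 0)%:R : R) = (\1_[set 0 : R] : R -> R) \o (y : lebT R n -> R)); last first.
    by apply/funext => z; rewrite /= indicE (_ : (y z \in [set 0 : R]) = (y z == 0))//; apply/idP/eqP; rewrite inE.
  exact: (measurableT_comp (measurable_indic (measurable_set1 0)) my).
move=> z Oz; have /andP[h1 h2] := Ha z Oz; rewrite /a0; case: (y z == 0); rewrite ?mulr1 ?mulr0 ?h1//=.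
by rewrite lexx (le_trans h1).
Qed.

(** On the zero set of [y] the singular integrand increases by [a (e h)^s]. Boundedness of the
    quotient therefore gives [SS a0 h <= K e^(1 - s)], which tends to 0 because [s < 1]. *)
Let null_part h k : W h k -> (forall z, 0 <= h z) -> SS a0 h = 0.
Proof.
move=> Wh h0; have [e [K [e0 e1 ec] HK]] := singular_quot_bounded Wh h0.
have ineq m : SS a0 h * e m `^ s <= SS a (fun z => y z + e m * h z) - SS a y.
  have := singularZ oOm Orho p1 pq qr s0 s1 (e m) ba0 (mW Wh) (fW Wh).
  rewrite (gtr0_norm (e0 m)) => <-; rewrite lerBrDr.
  have WZ := sobZ oOm p1 pq qr meta eta0 (e m) Wh.
  rewrite -(@RintegralD _ (lebT R n) R mu Om _ _ mOm (IS ba0 WZ) (IS ba Wy)).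
  apply: (@le_Rintegral _ (lebT R n) R mu Om _ _ mOm (integrableD mOm (IS ba0 WZ) (IS ba Wy)) (IS ba (Wpath (e m) Wh))) => z Oz.
  have [_ Ha] := ba; have /andP[az0 _] := Ha z Oz.
  have eh : 0 <= e m * h z by rewrite mulr_ge0 ?(ltW (e0 m)).
  rewrite /a0; have [->|yz] := eqVneq (y z) 0; first by rewrite mulr1 add0r normr0 powR0 ?gt_eqF// mulr0 addr0.
  rewrite mulr0 mul0r add0r; apply: ler_wpM2l => //.
  apply: ge0_ler_powR; [exact: ltW s0|by rewrite nnegrE|by rewrite nnegrE|].
  by rewrite !ger0_norm ?addr_ge0// lerDl.
have le m : SS a0 h <= K * e m `^ (1 - s).
  have H1 := HK m; rewrite ler_pdivrMl// in H1.
  have H2 := le_trans (ineq m) H1.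
  have es : 0 < e m `^ s by rewrite powR_gt0.
  rewrite -(ler_pM2r es) -mulrA -powRD ?(gt_eqF (e0 m)) ?implybT// subrK powRr1 ?(ltW (e0 m))//.
  by rewrite [leRHS]mulrC.
have s10 : 0 < 1 - s by rewrite subr_gt0.
have c : K * e m `^ (1 - s) @[m --> \oo] --> (0 : R).
  have c1 := cvg_powR s10 (fun m => ltW (e0 m)) ec; rewrite powR0 ?gt_eqF// in c1.
  by rewrite -(mulr0 K); apply: cvgM; [exact: cvg_cst|exact: c1].
by apply/eqP; rewrite eq_le (cvg_ge_cst c le) (singular_ge0 s h ba0).
Qed.

(** [null_part] in the directions [|phi|] shows that [a0 phi = 0] almost everywhere for every test
    function, and the fundamental lemma concludes [a0 = 0]. *)
Lemma stationary_gt0 : ae_on Om (fun z => 0 < y z).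
Proof.
have H : ae_on Om (fun z => a0 z = 0).
  apply: (weight_test_eq0 oOm Orho ba0) => phi tphi.
  have Wp := sob_test eta p1 pq qr tphi.
  have [k [Wk _ _]] := sob_abs oOm Orho p1 pq qr meta eta0 etaM Wp.
  have E0 := null_part Wk (fun z => normr_ge0 _).
  have nn0 z : Om z -> 0 <= a0 z * `| `|phi z| | `^ s.
    by move=> Oz; have [_ /(_ z Oz)/andP[h1 _]] := ba0; rewrite mulr_ge0 ?powR_ge0.
  have ms := measurable_singular s ba0 (mW Wk).
  have ae1 : {ae mu, forall z : lebT R n, Om z -> a0 z * `| `|phi z| | `^ s = 0} := Rintegral_eq0 oOm ms nn0 (IS ba0 Wk) E0.
  apply: filterS ae1 => z H Oz; have /eqP := H Oz.
  by rewrite mulf_eq0 powR_eq0 normr_id normr_eq0 => /orP[/eqP ->|/andP[/eqP -> _]]; rewrite ?mul0r ?mulr0.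
have h1 : {ae mu, forall z : lebT R n, Om z -> a0 z = 0} := H.
have h2 : {ae mu, forall z : lebT R n, Om z -> 0 < a z} := apos.
apply: filterS2 h1 h2 => z H1 H2 Oz; rewrite lt_neqAle y0 andbT; apply/eqP => E.
by have := H1 Oz; rewrite /a0 -E eqxx mulr1 => E2; have := H2 Oz; rewrite E2 ltxx.
Qed.

Let ypos : {ae mu, forall z : lebT R n, Om z -> 0 < y z} := stationary_gt0.

Let measurable_singular_pairing h : leb_measurable_fun Om h ->
  leb_measurable_fun Om (fun z => a z * (y z `^ (s - 1) * h z)).
Proof.
move=> mh; have [ma _] := ba; apply: measurable_funM; first exact: ma.
by apply: measurable_funM; [exact: (measurableT_comp (@measurable_powR R (s - 1)) my)|exact: mh].
Qed.

(** Where [y > 0] the nonnegative quotients converge to [s a y^(s-1) h], so Fatou turns their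
    uniform bound into integrability. *)
Let integrable_singular_ge0 h k : W h k -> (forall z, 0 <= h z) ->
  mu.-integrable (Om : set (lebT R n)) (EFin \o (fun z => a z * (y z `^ (s - 1) * h z))).
Proof.
move=> Wh h0; have [e [K [e0 e1 ec] HK]] := singular_quot_bounded Wh h0.
have ap z : Om z -> 0 <= a z by move=> Oz; have [_ /(_ z Oz)/andP[]] := ba.
have I_ m : mu.-integrable (Om : set (lebT R n)) (EFin \o (fun z => (e m)^-1 * (a z * `|y z + e m * h z| `^ s - a z * `|y z| `^ s))).
  exact: (integrableZl mOm _ (integrableB mOm (IS ba (Wpath (e m) Wh)) (IS ba Wy))).
have ge m z : Om z -> 0 <= (e m)^-1 * (a z * `|y z + e m * h z| `^ s - a z * `|y z| `^ s).
  move=> Oz; rewrite mulr_ge0 ?invr_ge0 ?(ltW (e0 m))// -mulrBr mulr_ge0 ?ap// subr_ge0.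
  have eh : 0 <= e m * h z by rewrite mulr_ge0 ?(ltW (e0 m)).
  apply: ge0_ler_powR; [exact: ltW s0|by rewrite nnegrE|by rewrite nnegrE|].
  by rewrite !ger0_norm ?addr_ge0// lerDl.
have F := @fatou_ae _ (lebT R n) R mu Om mOm (fun m z => (e m)^-1 * (a z * `|y z + e m * h z| `^ s - a z * `|y z| `^ s))
  (fun z => s * (a z * (y z `^ (s - 1) * h z))) (fun=> K) K.
have fin : (\int[mu]_(z in (Om : set (lebT R n))) (s * (a z * (y z `^ (s - 1) * h z)))%:E <= K%:E)%E.
  apply: F.
  - by move=> m; apply/measurable_EFinP; exact: (measurable_int _ (I_ m)).
  - by apply: measurable_funM; [exact: measurable_cst|exact: measurable_singular_pairing (mW Wh)].
  - exact: ge.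
  - by move=> z Oz; rewrite !mulr_ge0 ?ap ?powR_ge0 ?(ltW s0).
  - apply: filterS ypos => z Hz Oz; have C := @abs_quot_cvg R e s (y z) (h z) (Hz Oz) e0 ec.
    have C2 : a z * ((e m)^-1 * (`|y z + e m * h z| `^ s - `|y z| `^ s)) @[m --> \oo] -->
      a z * (s * (y z `^ (s - 1) * h z)) by apply: cvgM; [exact: cvg_cst|exact: C].
    rewrite mulrCA; apply: cvg_trans C2; apply: near_eq_cvg; apply: nearW => m /=.
    by rewrite -mulrBr mulrCA.
  - move=> m; have := HK m.
    rewrite -(@RintegralB _ (lebT R n) R mu Om _ _ mOm (IS ba (Wpath (e m) Wh)) (IS ba Wy)).
    rewrite -(@RintegralZl _ (lebT R n) R mu Om _ _ mOm (integrableB mOm (IS ba (Wpath (e m) Wh)) (IS ba Wy))).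
    by rewrite -lee_fin /Rintegral fineK//; exact: (integrable_fin_num mOm (I_ m)).
  - exact: cvg_cst.
have I1 : mu.-integrable (Om : set (lebT R n)) (EFin \o (fun z => s * (a z * (y z `^ (s - 1) * h z)))).
  apply/integrableP; split.
    by apply/measurable_EFinP; apply: measurable_funM; [exact: measurable_cst|exact: measurable_singular_pairing (mW Wh)].
  apply: le_lt_trans (ltry K); apply: le_trans fin; rewrite le_eqVlt; apply/orP; left; apply/eqP.
  by apply: eq_integral => z; rewrite inE => Oz; rewrite /= ger0_norm// !mulr_ge0 ?ap ?powR_ge0 ?(ltW s0).
have I3 := integrableZl mOm s^-1 I1; apply: eq_integrable I3; first exact: mOm.
by move=> z _; rewrite /= -EFinM mulKf// gt_eqF.
Qed.

Lemma stationary_singular_integrable h k : W h k ->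
  mu.-integrable (Om : set (lebT R n)) (EFin \o (fun z => a z * (y z `^ (s - 1) * h z))).
Proof.
move=> Wh; have [k' [Wk _ _]] := sob_abs oOm Orho p1 pq qr meta eta0 etaM Wh.
have I1 := integrable_singular_ge0 Wk (fun z => normr_ge0 _).
apply: (le_integrable mOm _ _ I1); first by apply/measurable_EFinP; exact: measurable_singular_pairing (mW Wh).
by move=> z Oz; rewrite /= lee_fin !normrM normr_id.
Qed.

Let DC h : R := \int[mu]_(z in (Om : set (lebT R n))) (`|y z| `^ (al - 1) * `|v z| `^ be * h z).
Let DS h : R := \int[mu]_(z in (Om : set (lebT R n))) (a z * (y z `^ (s - 1) * h z)).

Let perm_factors (x1 x2 x3 x4 : R) : x1 * (x2 * x3 * x4) = x1 * (x2 * x4) * x3.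
Proof. by ring. Qed.

Let coupling_quot h k e tau : W h k -> stationary_path h k e tau ->
  mu.-integrable (Om : set (lebT R n)) (EFin \o (fun z => `|y z| `^ (al - 1) * `|v z| `^ be * h z)) /\
  (e m)^-1 * (CC (fun z => y z + e m * h z) v - CC y v) @[m --> \oo] --> al * DC h.
Proof.
move=> Wh [[e0 e1] ec _ _ _]; pose c : R := al * (2 `^ al * 2 `^ al).
have Ih : mu.-integrable (Om : set (lebT R n)) (fun z => (c * (`|y z| `^ al * `|v z| `^ be + `|h z| `^ al * `|v z| `^ be))%:E) :=
  integrableZl mOm c (integrableD mOm (IC Wy) (IC Wh)).
have mf : leb_measurable_fun Om (fun z => `|y z| `^ (al - 1) * `|v z| `^ be * h z).
  apply: measurable_funM; last exact: mW Wh.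
  by apply: measurable_funM; [exact: measurable_norm_powR my|exact: measurable_norm_powR mv].
have mf' : leb_measurable_fun Om (fun z => al * (`|y z| `^ (al - 1) * `|v z| `^ be * h z)).
  by apply: measurable_funM; [exact: measurable_cst|exact: mf].
have cv : ae_on Om (fun z => (e m)^-1 * (`|y z + e m * h z| `^ al * `|v z| `^ be - `|y z| `^ al * `|v z| `^ be) @[m --> \oo] -->
    al * (`|y z| `^ (al - 1) * `|v z| `^ be * h z)).
  apply: filterS ypos => z Hz Oz; have C := @abs_quot_cvg R e al (y z) (h z) (Hz Oz) e0 ec.
  have C2 : (e m)^-1 * (`|y z + e m * h z| `^ al - `|y z| `^ al) * `|v z| `^ be @[m --> \oo] -->
      al * (y z `^ (al - 1) * h z) * `|v z| `^ be by apply: cvgM; [exact: C|exact: cvg_cst].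
  have -> : al * (`|y z| `^ (al - 1) * `|v z| `^ be * h z) = al * (y z `^ (al - 1) * h z) * `|v z| `^ be.
    by rewrite (ger0_norm (y0 z)); exact: perm_factors.
  apply: cvg_trans C2; apply: near_eq_cvg; apply: nearW => m /=.
  by rewrite -mulrBl mulrA.
have bd : ae_on Om (fun z => forall m, `|(e m)^-1 * (`|y z + e m * h z| `^ al * `|v z| `^ be - `|y z| `^ al * `|v z| `^ be)| <=
    c * (`|y z| `^ al * `|v z| `^ be + `|h z| `^ al * `|v z| `^ be)).
  apply: aeW => z Oz m; rewrite -mulrBl mulrA normrM (ger0_norm (powR_ge0 _ be)) -mulrDl mulrA.
  apply: ler_wpM2r; first exact: powR_ge0.
  apply: (quot_bound al1 (e0 m) (e1 m)) => //.
  apply: (le_trans (ler_dist_dist _ _)); rewrite addrAC subrr add0r normrM gtr0_norm//.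
have [I1 C1] := @Rintegral_quot_cvg R n Om mOm (fun m z => `|y z + e m * h z| `^ al * `|v z| `^ be)
  (fun z => `|y z| `^ al * `|v z| `^ be) _ _ e (fun m => IC (Wpath (e m) Wh)) (IC Wy) mf' Ih cv bd.
have I2 : mu.-integrable (Om : set (lebT R n)) (EFin \o (fun z => `|y z| `^ (al - 1) * `|v z| `^ be * h z)).
  have I3 := integrableZl mOm al^-1 I1; apply: eq_integrable I3; first exact: mOm.
  by move=> z _; rewrite /= -EFinM mulKf// gt_eqF.
split; first exact: I2.
by rewrite (@RintegralZl _ (lebT R n) R mu Om _ al mOm I2) in C1.
Qed.

(** For directions of arbitrary sign: [powR_dist] dominates the quotients by [a y^(s-1) |h|],
    already known to be integrable since [|h|] is an admissible direction. *)
Let singular_quot h k e tau : W h k -> stationary_path h k e tau ->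
  (e m)^-1 * (SS a (fun z => y z + e m * h z) - SS a y) @[m --> \oo] --> s * DS h.
Proof.
move=> Wh [[e0 e1] ec _ _ _].
have [k' [Wk _ _]] := sob_abs oOm Orho p1 pq qr meta eta0 etaM Wh.
have Ih := stationary_singular_integrable Wk; have I2 := stationary_singular_integrable Wh.
have mf' : leb_measurable_fun Om (fun z => s * (a z * (y z `^ (s - 1) * h z))).
  by apply: measurable_funM; [exact: measurable_cst|exact: measurable_singular_pairing (mW Wh)].
have cv : ae_on Om (fun z => (e m)^-1 * (a z * `|y z + e m * h z| `^ s - a z * `|y z| `^ s) @[m --> \oo] -->
    s * (a z * (y z `^ (s - 1) * h z))).
  apply: filterS ypos => z Hz Oz; have C := @abs_quot_cvg R e s (y z) (h z) (Hz Oz) e0 ec.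
  have C2 : a z * ((e m)^-1 * (`|y z + e m * h z| `^ s - `|y z| `^ s)) @[m --> \oo] -->
      a z * (s * (y z `^ (s - 1) * h z)) by apply: cvgM; [exact: cvg_cst|exact: C].
    rewrite mulrCA; apply: cvg_trans C2; apply: near_eq_cvg; apply: nearW => m /=.
  by rewrite -mulrBr mulrCA.
have bd : ae_on Om (fun z => forall m, `|(e m)^-1 * (a z * `|y z + e m * h z| `^ s - a z * `|y z| `^ s)| <=
    a z * (y z `^ (s - 1) * `|h z|)).
  apply: filterS ypos => z Hz Oz m; have [_ Ha] := ba; have /andP[az0 _] := Ha z Oz.
  rewrite -mulrBr mulrCA normrM (ger0_norm az0); apply: ler_wpM2l => //.
  have D := powR_dist (e m * h z) s0 (ltW s1) (Hz Oz).
  rewrite normrM (ger0_norm (y0 z)) ger0_norm ?invr_ge0 ?(ltW (e0 m))// ler_pdivrMl//; apply: (le_trans D).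
  by rewrite normrM gtr0_norm// mulrCA.
have [I1 C1] := @Rintegral_quot_cvg R n Om mOm (fun m z => a z * `|y z + e m * h z| `^ s)
  (fun z => a z * `|y z| `^ s) _ _ e (fun m => IS ba (Wpath (e m) Wh)) (IS ba Wy) mf' Ih cv bd.
by rewrite (@RintegralZl _ (lebT R n) R mu Om _ s mOm I2) in C1.
Qed.

Let variational_ineq h k : W h k -> 0 <= DA k + DB k - DS h - lam * (al * DC h).
Proof.
move=> Wh; have [e [tau st]] := stationary Wh.
have c1 := energy_part Wh st; have c2 := singular_quot Wh st; have [_ c3] := coupling_quot Wh st.
have [_ _ t0 tc _] := st.
have ts := cvg_powR s0 t0 tc; have tr := cvg_powR r0 t0 tc; rewrite powR1 in ts tr.
rewrite limit_ident.
have c : (tau m `^ p * ((e m)^-1 * (fine (GA (fun z => g z + e m *: k z)) - fine (GA g))) / p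
    + tau m `^ q * ((e m)^-1 * (fine (GB (fun z => g z + e m *: k z)) - fine (GB g))) / q
    - tau m `^ s * ((e m)^-1 * (SS a (fun z => y z + e m * h z) - SS a y)) / s
    - lam * (tau m `^ r * ((e m)^-1 * (CC (fun z => y z + e m * h z) v - CC y v)))) @[m --> \oo] -->
    DA k + DB k - 1 * (s * DS h) / s - lam * (1 * (al * DC h)).
  apply: cvgB; first by apply: cvgB; [exact: c1|apply: cvgMl; exact: cvgM].
  by apply: cvgM; [exact: cvg_cst|exact: cvgM].
exact: cvg_ge_cst c (fun m => stationary_scaled m st).
Qed.

(** The variational inequality holds for [h] and [-h], and its expression is linear in the
    direction. *)
Lemma euler_lagrange h k : W h k -> DA k + DB k - DS h - lam * (al * DC h) = 0.
Proof.
move=> Wh; have WN := sobZ oOm p1 pq qr meta eta0 (-1) Wh.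
have [e [tau st]] := stationary Wh; have [[e0 e1] ec _ _ _] := st.
have [IA _] := genergy_quot_cvg mOm m1 w1 p1 mg (gW Wh) (fA Wy) (fA Wh) e0 e1 ec.
have [IB _] := genergy_quot_cvg mOm meta eta0 q1 mg (gW Wh) (fB Wy) (fB Wh) e0 e1 ec.
have Is := stationary_singular_integrable Wh; have [Ic _] := coupling_quot Wh st.
have H1 := variational_ineq Wh; have H2 := variational_ineq WN.
have dN (x1 x2 : 'rV[R]_n) : dotv x1 (-1 *: x2) = - dotv x1 x2.
  by rewrite /dotv -sumrN; apply: eq_bigr => i _; rewrite !mxE; ring.
have EA : DA (fun z => -1 *: k z) = -1 * DA k.
  rewrite -(@RintegralZl _ (lebT R n) R mu Om _ _ mOm IA); apply: eq_Rintegral => z _.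
  by rewrite dN !mulN1r !mulrN.
have EB : DB (fun z => -1 *: k z) = -1 * DB k.
  rewrite -(@RintegralZl _ (lebT R n) R mu Om _ _ mOm IB); apply: eq_Rintegral => z _.
  by rewrite dN !mulN1r !mulrN.
have ES : DS (fun z => -1 * h z) = -1 * DS h.
  by rewrite -(@RintegralZl _ (lebT R n) R mu Om _ _ mOm Is); apply: eq_Rintegral => z _; rewrite !mulN1r !mulrN.
have EC : DC (fun z => -1 * h z) = -1 * DC h.
  by rewrite -(@RintegralZl _ (lebT R n) R mu Om _ _ mOm Ic); apply: eq_Rintegral => z _; rewrite !mulN1r !mulrN.
rewrite EA EB ES EC negate_ident oppr_ge0 in H2.
by apply/eqP; rewrite eq_le H1 H2.
Qed.

End euler_lagrange.

(** * Both minimisers are stationary *)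

Section stationarity.
Context {R : realType} {n : nat} (Om : set 'rV[R]_n) (p q r rho M : R) (eta : 'rV[R]_n -> R).
Notation mu := (@leb R n).
Notation W := (sob Om p q eta r).
Notation GA := (genergy Om (fun=> 1%R) p).
Notation GB := (genergy Om eta q).
Notation IL u := (\int[mu]_(z in (Om : set (lebT R n))) (`|u z| `^ r)%:E)%E.
Hypotheses (oOm : open Om) (Orho : Om `<=` cball rho)
  (p1 : 1 < p) (pq : p < q) (qr : q < r)
  (meta : leb_measurable_fun Om eta) (eta0 : forall z, Om z -> 0 <= eta z)
  (etaM : ae_on Om (fun z => eta z <= M)).
Variables (s al be N lam : R) (a y v : 'rV[R]_n -> R) (g : 'rV[R]_n -> 'rV[R]_n) (A2 B2 S2 : R).
Notation SS := (singular_term Om s).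
Notation CC := (coupling Om al be).
Hypotheses (s0 : 0 < s) (s1 : s < 1) (al0 : 0 < al) (be0 : 0 < be) (alb : al + be = r) (lam0 : 0 < lam)
  (ba : bounded_weight Om N a) (Wy : W y g) (mv : leb_measurable_fun Om v) (fv : (IL v < +oo)%E)
  (A20 : 0 <= A2) (B20 : 0 <= B2) (S20 : 0 <= S2).
Implicit Types (u h : 'rV[R]_n -> R) (j k : 'rV[R]_n -> 'rV[R]_n) (e tau : nat -> R).
Let PP j := (fine (GA j) + A2) / p.
Let QQ j := (fine (GB j) + B2) / q.
Let TT u := (SS a u + S2) / s.
Let JJ u j := PP j + QQ j - TT u - lam * CC u v.

Let mOm : measurable (Om : set (lebT R n)). Proof. exact: open_leb_measurable. Qed.
Let w1 : forall z : 'rV[R]_n, Om z -> 0 <= (fun=> 1 : R) z. Proof. by []. Qed.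
Let m1 : measurable_fun (Om : set (lebT R n)) ((fun=> 1) : lebT R n -> R). Proof. exact: measurable_cst. Qed.
Let p0 : 0 < p. Proof. exact: lt_trans ltr01 p1. Qed.
Let q1 : 1 < q. Proof. exact: lt_trans p1 pq. Qed.
Let q0 : 0 < q. Proof. exact: lt_trans ltr01 q1. Qed.
Let r0 : 0 < r. Proof. exact: lt_trans q0 qr. Qed.
Let sp : s < p. Proof. exact: lt_trans s1 p1. Qed.
Let fW u j : W u j -> (IL u < +oo)%E. Proof. exact: (sob_IL_fin oOm Orho p1 pq qr meta eta0 etaM). Qed.
Let fA u j : W u j -> (GA j < +oo)%E. Proof. exact: (sob_GA_fin oOm Orho p1 pq qr meta eta0 etaM). Qed.
Let fB u j : W u j -> (GB j < +oo)%E. Proof. exact: (sob_GB_fin oOm Orho p1 pq qr meta eta0 etaM). Qed.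
Let mW u j : W u j -> leb_measurable_fun Om u. Proof. by case. Qed.
Let gW u j : W u j -> vmeas Om j. Proof. by case. Qed.
Let Wpath h k (c : R) : W h k -> W (fun z => y z + c * h z) (fun z => g z + c *: k z).
Proof. by move=> Wh; exact: (sobD oOm p1 pq qr meta eta0 Wy (sobZ oOm p1 pq qr meta eta0 c Wh)). Qed.

Let quot_cvg0 e (x_ : nat -> R) (x l : R) : (forall m, 0 < e m) -> e m @[m --> \oo] --> (0 : R) ->
  (e m)^-1 * (x_ m - x) @[m --> \oo] --> l -> x_ m @[m --> \oo] --> x.
Proof.
move=> e0 ec c; have c2 : e m * ((e m)^-1 * (x_ m - x)) + x @[m --> \oo] --> 0 * l + x.
  by apply: cvgD; [exact: cvgM|exact: cvg_cst].
rewrite mul0r add0r in c2; apply: cvg_trans c2; apply: near_eq_cvg; apply: nearW => m /=.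
by rewrite mulVKf ?subrK// gt_eqF.
Qed.

(** The steps [e m] are small enough for the perturbation to converge fast in [L^r], as the
    continuity lemmas for the singular and coupling terms require. *)
Let path h k : W h k -> exists e, [/\ (forall m, 0 < e m) /\ (forall m, e m <= 1), e m @[m --> \oo] --> (0 : R),
  fine (GA (fun z => g z + e m *: k z)) @[m --> \oo] --> fine (GA g) /\
  fine (GB (fun z => g z + e m *: k z)) @[m --> \oo] --> fine (GB g),
  SS a (fun z => y z + e m * h z) @[m --> \oo] --> SS a y &
  CC (fun z => y z + e m * h z) v @[m --> \oo] --> CC y v].
Proof.
move=> Wh; pose L := fine (IL h); have L0 : 0 <= L by apply: fine_ge0; apply: integral_ge0 => z _; rewrite lee_fin powR_ge0.
have L1 : 0 < L + 1 by rewrite ltr_wpDl.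
have EL : IL h = L%:E.
  by rewrite /L fineK// ge0_fin_numE; [exact: fW Wh|apply: integral_ge0 => z _; rewrite lee_fin powR_ge0].
(* With [e m = (c m)^(1/r)] the [L^r] mass of [e m h] is [c m L <= 4^-m]; adding 1 to [L] covers
   [h = 0] and keeps [e m <= 1]. *)
pose c m : R := 4^-1 ^+ m / (L + 1).
have c0 m : 0 < c m by rewrite divr_gt0// exprn_gt0.
have c1 m : c m <= 1.
  rewrite ler_pdivrMr// mul1r; apply: (@le_trans _ _ 1); last by rewrite lerDr.
  by apply: exprn_ile1; rewrite ?invr_ge0// invf_le1// ler1n.
have ir0 : 0 < r^-1 by rewrite invr_gt0.
pose e m := c m `^ r^-1.
have e0 m : 0 < e m by rewrite powR_gt0.
have e1 m : e m <= 1 by apply: powR_le1; rewrite ?(ltW (c0 m)) ?(ltW ir0).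
have er m : e m `^ r = c m by rewrite powR_root// ltW.
have cc : c m @[m --> \oo] --> (0 : R).
  rewrite -(mul0r (L + 1)^-1); apply: cvgMl; apply: cvg_expr.
  by rewrite ger0_norm ?invr_ge0// invf_lt1// ltr1n.
have ec : e m @[m --> \oo] --> (0 : R).
  by have := cvg_powR ir0 (fun m => ltW (c0 m)) cc; rewrite powR0 ?gt_eqF.
have [_ cA] := genergy_quot_cvg mOm m1 w1 p1 (gW Wy) (gW Wh) (fA Wy) (fA Wh) e0 e1 ec.
have [_ cB] := genergy_quot_cvg mOm meta eta0 q1 (gW Wy) (gW Wh) (fB Wy) (fB Wh) e0 e1 ec.
have H m : (IL (fun z => (y z + e m * h z) - y z)%R <= (4^-1 ^+ m)%:E)%E.
  have T := integral_powRZ r oOm (e m) (mW Wh).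
  have E : (IL (fun z => (y z + e m * h z) - y z)%R = IL (fun z => e m * h z)%R)%E.
    by apply: eq_integral => z _; rewrite addrAC subrr add0r.
  rewrite E (gtr0_norm (e0 m)) er EL in T *; rewrite T -EFinM lee_fin /c -mulrA ler_piMr ?exprn_ge0 ?invr_ge0//.
  by rewrite mulrC ler_pdivrMr// mul1r lerDl.
have mk m : leb_measurable_fun Om (fun z => y z + e m * h z) by exact: mW (Wpath (e m) Wh).
exists e; split => //.
- by split; [exact: quot_cvg0 e0 ec cA|exact: quot_cvg0 e0 ec cB].
- exact: (singular_cvg oOm Orho p1 pq qr s0 s1 ba mk (mW Wy) (fW Wy) H).
have Hv m : (IL (fun z => v z - v z)%R <= (4^-1 ^+ m)%:E)%E.
  have E0 : (IL (fun z => v z - v z)%R = 0)%E by apply: integral0_eq => z _; rewrite subrr normr0 powR0 ?gt_eqF.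
  by rewrite E0 lee_fin exprn_ge0// invr_ge0.
exact: (coupling_cvg oOm p1 pq qr al0 be0 alb mk (mW Wy) (fW Wy) H (fun=> mv) mv fv Hv).
Qed.

Let cvg_shift (u : nat -> R) (l c d : R) : u m @[m --> \oo] --> l -> (u m + c) / d @[m --> \oo] --> (l + c) / d.
Proof. by move=> ul; apply: cvgMl; apply: cvgD; [exact: ul|exact: cvg_cst]. Qed.

Let fibre_sub A A' B B' T T' C C' t : fibre p q s r ((A' + A2) / p) ((B' + B2) / q) ((T' + S2) / s) (lam * C') t -
    fibre p q s r ((A + A2) / p) ((B + B2) / q) ((T + S2) / s) (lam * C) t =
  t `^ p * (A' - A) / p + t `^ q * (B' - B) / q - t `^ s * (T' - T) / s - lam * t `^ r * (C' - C).
Proof. by rewrite /fibre; ring. Qed.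

Let energy_sub A A' B B' T T' C C' : ((A' + A2) / p + (B' + B2) / q - (T' + S2) / s - lam * C') -
    ((A + A2) / p + (B + B2) / q - (T + S2) / s - lam * C) =
  1 `^ p * (A' - A) / p + 1 `^ q * (B' - B) / q - 1 `^ s * (T' - T) / s - lam * 1 `^ r * (C' - C).
Proof. by rewrite !powR1; ring. Qed.

Let sub_ge (x1 x2 : R) : x1 <= x2 -> 0 <= x2 - x1. Proof. by rewrite subr_ge0. Qed.

(** The strict inequality keeps small perturbations inside the sublevel set, so minimality compares
    them directly with [tau = 1]. *)
Lemma local_min_stationary (b : R) : PP g + QQ g < b ->
  (forall u j, W u j -> PP j + QQ j <= b -> JJ y g <= JJ u j) ->
  forall h k, W h k -> exists e tau, stationary_path Om p q r eta s al be lam a y v g h k e tau.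
Proof.
move=> Fb H h k Wh; have [e [[e0 e1] ec [cA cB] cS cC]] := path Wh.
have cF : PP (fun z => g z + e m *: k z) + QQ (fun z => g z + e m *: k z) @[m --> \oo] --> PP g + QQ g.
  exact: (cvgD (@cvg_shift _ _ A2 p cA) (@cvg_shift _ _ B2 q cB)).
have [K _ HK] := cvgr_le _ cF _ Fb.
exists (fun m => e (K + m)%N), (fun=> 1); split.
- by split.
- by apply: (cvg_sub ec) => m; exact: leq_addl.
- by move=> m.
- exact: cvg_cst.
move=> m; set c := e (K + m)%N.
have E := energy_sub (fine (GA g)) (fine (GA (fun z => g z + c *: k z))) (fine (GB g)) (fine (GB (fun z => g z + c *: k z)))
  (SS a y) (SS a (fun z => y z + c * h z)) (CC y v) (CC (fun z => y z + c * h z) v).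
have D := H _ _ (Wpath c Wh) (HK _ (leq_addr _ _)).
exact: (eq_ind _ (fun x => 0 <= x) (sub_ge D) _ E).
Qed.

(** The coupling stays positive for small perturbations, so each perturbed fibre reaches [b] at some
    [tau m]. By [fibre_max_cvg] these tend to 1 along a subsequence. *)
Lemma ray_max_stationary (b : R) : 0 < CC y v -> 0 < b -> JJ y g = b ->
  (forall t, 0 <= t -> fibre p q s r (PP g) (QQ g) (TT y) (lam * CC y v) t <= b) ->
  (forall u j, W u j -> 0 < CC u v -> exists2 t, 0 <= t & b <= fibre p q s r (PP j) (QQ j) (TT u) (lam * CC u v) t) ->
  forall h k, W h k -> exists e tau, stationary_path Om p q r eta s al be lam a y v g h k e tau.
Proof.
move=> Cy b0 Jb fb H h k Wh; have [e [[e0 e1] ec [cA cB] cS cC]] := path Wh.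
have [K _ HK] := cvgr_gt _ cC _ Cy.
have K1 m : (m <= K + m)%N by exact: leq_addl.
have HH m : exists t, 0 <= t /\ b <= fibre p q s r (PP (fun z => g z + e (K + m)%N *: k z)) (QQ (fun z => g z + e (K + m)%N *: k z))
    (TT (fun z => y z + e (K + m)%N * h z)) (lam * CC (fun z => y z + e (K + m)%N * h z) v) t.
  by have [t t0 tb] := H _ _ (Wpath (e (K + m)%N) Wh) (HK _ (leq_addr _ _)); exists t.
have [tau Ht] := choice HH.
have t0 m : 0 <= tau m by have [] := Ht m.
have tb m := (Ht m).2.
have nA j : 0 <= PP j by apply: divr_ge0; [exact: addr_ge0 (GA_fine_ge0 _ _ _) A20|exact: ltW].
have nB j : 0 <= QQ j by apply: divr_ge0; [exact: addr_ge0 (GB_fine_ge0 q eta0 _) B20|exact: ltW].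
have nS u : 0 <= TT u by apply: divr_ge0; [exact: addr_ge0 (singular_ge0 _ _ ba) S20|exact: ltW].
have c1 : PP (fun z => g z + e (K + m)%N *: k z) @[m --> \oo] --> PP g.
  exact: (@cvg_shift _ _ A2 p (cvg_sub cA K1)).
have c2 : QQ (fun z => g z + e (K + m)%N *: k z) @[m --> \oo] --> QQ g.
  exact: (@cvg_shift _ _ B2 q (cvg_sub cB K1)).
have c3 : TT (fun z => y z + e (K + m)%N * h z) @[m --> \oo] --> TT y.
  exact: (@cvg_shift _ _ S2 s (cvg_sub cS K1)).
have c4 : lam * CC (fun z => y z + e (K + m)%N * h z) v @[m --> \oo] --> lam * CC y v.
  by apply: cvgM; [exact: cvg_cst|exact: (cvg_sub cC K1)].
have f1 : fibre p q s r (PP g) (QQ g) (TT y) (lam * CC y v) 1 = b by rewrite fibre1 -Jb.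
have [l [lk lc]] := fibre_max_cvg s0 sp pq qr (fun m => nA _) (fun m => nB _) (fun m => nS _) c1 c2 c3 c4
  (mulr_gt0 lam0 Cy) b0 fb f1 t0 tb.
exists (fun m => e (K + l m)%N), (fun m => tau (l m)); split => //.
  by apply: (cvg_sub ec) => m; exact: leq_trans (lk m) (K1 _).
move=> m; set c := e (K + l m)%N.
have E := fibre_sub (fine (GA g)) (fine (GA (fun z => g z + c *: k z))) (fine (GB g)) (fine (GB (fun z => g z + c *: k z)))
  (SS a y) (SS a (fun z => y z + c * h z)) (CC y v) (CC (fun z => y z + c * h z) v) (tau (l m)).
(* The fibre of [y] at [tau] is at most [b], and [b] is at most the perturbed fibre at the same
   [tau]. *)
have D := le_trans (fb _ (t0 (l m))) (tb (l m)).
exact: (eq_ind _ (fun x => 0 <= x) (sub_ge D) _ E).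
Qed.

End stationarity.

Lemma Rintegral_ae {R : realType} {n : nat} (Om : set 'rV[R]_n) (f g : 'rV[R]_n -> R) : measurable (Om : set (lebT R n)) ->
  leb_measurable_fun Om f -> leb_measurable_fun Om g -> ae_on Om (fun z => f z = g z) ->
  \int[@leb R n]_(z in (Om : set (lebT R n))) f z = \int[@leb R n]_(z in (Om : set (lebT R n))) g z.
Proof.
move=> mOm mf mg fg; congr fine.
have ae1 : {ae @leb R n, forall z : lebT R n, Om z -> f z = g z} := fg.
apply: (@ae_eq_integral _ (lebT R n) R (@leb R n) Om _ _ mOm); [exact/measurable_EFinP|exact/measurable_EFinP|].
by apply: filterS ae1 => z H Oz; rewrite H.
Qed.

Lemma integrable_ae {R : realType} {n : nat} (Om : set 'rV[R]_n) (f g : 'rV[R]_n -> R) : measurable (Om : set (lebT R n)) ->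
  leb_measurable_fun Om f -> ae_on Om (fun z => f z = g z) ->
  (@leb R n).-integrable (Om : set (lebT R n)) (EFin \o g) -> (@leb R n).-integrable (Om : set (lebT R n)) (EFin \o f).
Proof.
move=> mOm mf fg /integrableP[mg fin].
have ae1 : {ae @leb R n, forall z : lebT R n, Om z -> f z = g z} := fg.
have mf' : measurable_fun (Om : set (lebT R n)) (EFin \o f) by exact/measurable_EFinP.
apply/integrableP; split; first exact: mf'.
have E : (\int[@leb R n]_(z in (Om : set (lebT R n))) `|(EFin \o f) z| = \int[@leb R n]_(z in (Om : set (lebT R n))) `|(EFin \o g) z|)%E.
  apply: (@ae_eq_integral _ (lebT R n) R (@leb R n) Om _ _ mOm).
  - exact: measurableT_comp mf'.
  - exact: measurableT_comp mg.
  by apply: filterS ae1 => z H Oz; rewrite /= H.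
by rewrite E.
Qed.

(** * Translation back to [energy] and [positive_weak_solution] *)

Section weak_solutions.
Context {R : realType} {n : nat} (Om : set 'rV[R]_n) (p q rho M : R) (eta : 'rV[R]_n -> R) (nu k1 k2 N lam : R)
  (a1 a2 : 'rV[R]_n -> R).
Notation mu := (@leb R n).
Notation r := (k1 + k2 + 2).
Notation s := (1 - nu).
Notation al := (k1 + 1).
Notation be := (k2 + 1).
Notation W := (sob Om p q eta r).
Notation GA := (genergy Om (fun=> 1%R) p).
Notation GB := (genergy Om eta q).
Notation SS := (singular_term Om s).
Notation CC := (coupling Om).
Hypotheses (n0 : (0 < n)%N) (oOm : open Om) (Om0 : Om !=set0) (Orho : Om `<=` cball rho) (rho0 : 0 <= rho)
  (p1 : 1 < p) (pq : p < q) (qr : q < r) (crit : n%:R * (r - p) < p * r)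
  (meta : leb_measurable_fun Om eta) (eta0 : forall z, Om z -> 0 <= eta z)
  (etaM : ae_on Om (fun z => eta z <= M)) (nu0 : 0 < nu) (nu1 : nu < 1) (k10 : 0 < k1) (k20 : 0 < k2) (lam0 : 0 < lam)
  (ba1 : bounded_weight Om N a1) (ba2 : bounded_weight Om N a2)
  (pos1 : ae_on Om (fun z => 0 < a1 z)) (pos2 : ae_on Om (fun z => 0 < a2 z)).

Let mOm : measurable (Om : set (lebT R n)). Proof. exact: open_leb_measurable. Qed.
Let w1 : forall z : 'rV[R]_n, Om z -> 0 <= (fun=> 1 : R) z. Proof. by []. Qed.
Let m1 : measurable_fun (Om : set (lebT R n)) ((fun=> 1) : lebT R n -> R). Proof. exact: measurable_cst. Qed.
Let p0 : 0 < p. Proof. exact: lt_trans ltr01 p1. Qed.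
Let q1 : 1 < q. Proof. exact: lt_trans p1 pq. Qed.
Let q0 : 0 < q. Proof. exact: lt_trans ltr01 q1. Qed.
Let s0 : 0 < s. Proof. by rewrite subr_gt0. Qed.
Let s1 : s < 1. Proof. by rewrite ltrBlDr ltrDl. Qed.
Let al1 : 1 < al. Proof. by rewrite ltrDr. Qed.
Let be1 : 1 < be. Proof. by rewrite ltrDr. Qed.
Let al0 : 0 < al. Proof. exact: lt_trans ltr01 al1. Qed.
Let be0 : 0 < be. Proof. exact: lt_trans ltr01 be1. Qed.
Let alb : al + be = r. Proof. by rewrite addrACA. Qed.
Let bal : be + al = r. Proof. by rewrite addrC alb. Qed.
Let fA u j : W u j -> (GA j < +oo)%E. Proof. exact: (sob_GA_fin oOm Orho p1 pq qr meta eta0 etaM). Qed.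
Let fB u j : W u j -> (GB j < +oo)%E. Proof. exact: (sob_GB_fin oOm Orho p1 pq qr meta eta0 etaM). Qed.
Let fW u j : W u j -> (\int[mu]_(z in (Om : set (lebT R n))) (`|u z| `^ r)%:E < +oo)%E.
Proof. exact: (sob_IL_fin oOm Orho p1 pq qr meta eta0 etaM). Qed.
Let mW u j : W u j -> leb_measurable_fun Om u. Proof. by case. Qed.
Let gW u j : W u j -> vmeas Om j. Proof. by case. Qed.

Let to_W01H u j : W u j -> W01H Om p q eta u.
Proof. exact: (sob_W01H oOm Orho p1 pq qr meta eta0 etaM). Qed.

Let of_W01H u : W01H Om p q eta u -> W u (wgrad Om u).
Proof. exact: (W01H_sob n0 oOm Orho rho0 p1 pq qr crit meta eta0 etaM). Qed.

Let GA_wgrad u j : W u j -> GA (wgrad Om u) = GA j.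
Proof.
move=> Wu; apply: (genergy_ae oOm p m1 w1 (gW (of_W01H (to_W01H Wu))) (gW Wu)).
exact: (sob_wgrad oOm Orho p1 pq qr meta eta0 etaM Wu).
Qed.

Let GB_wgrad u j : W u j -> GB (wgrad Om u) = GB j.
Proof.
move=> Wu; apply: (genergy_ae oOm q meta eta0 (gW (of_W01H (to_W01H Wu))) (gW Wu)).
exact: (sob_wgrad oOm Orho p1 pq qr meta eta0 etaM Wu).
Qed.

Let inv_nat (m : nat) : 0 < m.+1%:R^-1 :> R. Proof. by rewrite invr_gt0. Qed.
Let inv_nat_le1 (m : nat) : m.+1%:R^-1 <= 1 :> R. Proof. by rewrite invf_le1 ?ler1n. Qed.

Let dirichlet_term (u : 'rV[R]_n -> R) : R := \int[mu]_(z in (Om : set (lebT R n)))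
  (p^-1 * enorm (wgrad Om u z) `^ p + eta z / q * enorm (wgrad Om u z) `^ q).

Let dirichletE u j : W u j -> dirichlet_term u = p^-1 * fine (GA j) + q^-1 * fine (GB j).
Proof.
move=> Wj; have Wu := of_W01H (to_W01H Wj).
have IA := genergy_integrable m1 w1 (gW Wu) (fA Wu); have IB := genergy_integrable meta eta0 (gW Wu) (fB Wu).
have e1 := @RintegralZl _ (lebT R n) R mu Om _ p^-1 mOm IA.
have e2 := @RintegralZl _ (lebT R n) R mu Om _ q^-1 mOm IB.
have e3 := @RintegralD _ (lebT R n) R mu Om _ _ mOm (integrableZl mOm p^-1 IA) (integrableZl mOm q^-1 IB).
have e1' := congr1 (fun x => p^-1 * fine x) (GA_wgrad Wj); have e2' := congr1 (fun x => q^-1 * fine x) (GB_wgrad Wj).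
apply: (eq_trans _ (eq_trans e3 (f_equal2 (fun x1 x2 => x1 + x2) (eq_trans e1 e1') (eq_trans e2 e2')))).
by apply: eq_Rintegral => z _; rewrite /= mul1r [eta z / q]mulrC mulrA.
Qed.

Let energy_ident (D1 D2 P1 P2 Q1 Q2 T T1 T2 c : R) : D1 = p^-1 * P1 + q^-1 * Q1 -> D2 = p^-1 * P2 + q^-1 * Q2 -> T = T1 + T2 ->
  D1 + D2 - s^-1 * T - lam * c = (P1 + P2) / p + (Q1 + Q2) / q - (T1 + T2) / s - lam * c.
Proof. by move=> -> -> ->; ring. Qed.

Lemma energyE y1 g1 y2 g2 : W y1 g1 -> W y2 g2 ->
  energy Om p q eta nu a1 a2 k1 k2 lam y1 y2 =
  (fine (GA g1) + fine (GA g2)) / p + (fine (GB g1) + fine (GB g2)) / q - (SS a1 y1 + SS a2 y2) / s - lam * CC al be y1 y2.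
Proof.
move=> Wy1 Wy2.
have I1 := integrable_singular oOm Orho p1 pq qr s0 s1 ba1 (mW Wy1) (fW Wy1).
have I2 := integrable_singular oOm Orho p1 pq qr s0 s1 ba2 (mW Wy2) (fW Wy2).
have e1 := @RintegralD _ (lebT R n) R mu Om _ _ mOm I1 I2.
exact: (energy_ident (CC al be y1 y2) (dirichletE Wy1) (dirichletE Wy2) e1).
Qed.

Let DA (g j : 'rV[R]_n -> 'rV[R]_n) : R := \int[mu]_(z in (Om : set (lebT R n))) (1 * (enorm (g z) `^ (p - 2) * dotv (g z) (j z))).
Let DB (g j : 'rV[R]_n -> 'rV[R]_n) : R := \int[mu]_(z in (Om : set (lebT R n))) (eta z * (enorm (g z) `^ (q - 2) * dotv (g z) (j z))).

Let double_phaseE y g h : W y g -> W h (wgrad Om h) ->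
  double_phase_form Om p q eta y h = DA g (wgrad Om h) + DB g (wgrad Om h).
Proof.
(* The steps [1/(m+1)] serve to invoke [genergy_quot_cvg] for the integrability of the two pairings,
   which lets the integral be split. *)
move=> Wg Wh; have Wy := of_W01H (to_W01H Wg); have c := @cvg_harmonic R.
have [IA _] := genergy_quot_cvg mOm m1 w1 p1 (gW Wy) (gW Wh) (fA Wy) (fA Wh) inv_nat inv_nat_le1 c.
have [IB _] := genergy_quot_cvg mOm meta eta0 q1 (gW Wy) (gW Wh) (fB Wy) (fB Wh) inv_nat inv_nat_le1 c.
have e := @RintegralD _ (lebT R n) R mu Om _ _ mOm IA IB.
have ae1 : {ae mu, forall z : lebT R n, Om z -> wgrad Om y z = g z} := sob_wgrad oOm Orho p1 pq qr meta eta0 etaM Wg.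
have EA : DA (wgrad Om y) (wgrad Om h) = DA g (wgrad Om h).
  apply: (Rintegral_ae mOm (measurable_pairing p m1 (gW Wy) (gW Wh)) (measurable_pairing p m1 (gW Wg) (gW Wh))).
  by apply: filterS ae1 => z H Oz; rewrite H.
have EB : DB (wgrad Om y) (wgrad Om h) = DB g (wgrad Om h).
  apply: (Rintegral_ae mOm (measurable_pairing q meta (gW Wy) (gW Wh)) (measurable_pairing q meta (gW Wg) (gW Wh))).
  by apply: filterS ae1 => z H Oz; rewrite H.
apply: (eq_trans _ (eq_trans e (f_equal2 (fun x1 x2 => x1 + x2) EA EB))).
by apply: eq_Rintegral => z _; rewrite /= mul1r mulrDl mulrA.
Qed.

Let coupling_comm u v : CC al be u v = CC be al v u.
Proof. by apply: eq_Rintegral => z _; exact: mulrC. Qed.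

Let assemble (D1 D2 X3 X4 Y3 Y4 x1 x2 x3 x4 y1 y2 y3 y4 : R) : D1 = x1 + x2 -> D2 = y1 + y2 -> X3 = x3 -> Y3 = y3 -> X4 = x4 -> Y4 = y4 ->
  x1 + x2 - x3 - lam * (al * x4) = 0 -> y1 + y2 - y3 - lam * (be * y4) = 0 ->
  D1 + D2 - X3 - Y3 - lam * al * X4 - lam * be * Y4 = 0.
Proof. by move=> -> -> -> -> -> -> H1 H2; rewrite -[RHS]addr0 -{1}H1 -H2; ring. Qed.

Let es : s - 1 = - nu. Proof. by rewrite addrAC subrr add0r. Qed.
Let ek1 : al - 1 = k1. Proof. by rewrite addrK. Qed.
Let ek2 : be - 1 = k2. Proof. by rewrite addrK. Qed.

(** The two components are treated by the same section with the exponents [k1 + 1] and [k2 + 1]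
    exchanged; the weak formulation is the sum of the two equations. *)
Let stationary_solution y1 g1 y2 g2 : W y1 g1 -> W y2 g2 -> (forall z, 0 <= y1 z) -> (forall z, 0 <= y2 z) ->
  (forall h k, W h k -> exists e tau, stationary_path Om p q r eta s al be lam a1 y1 y2 g1 h k e tau) ->
  (forall h k, W h k -> exists e tau, stationary_path Om p q r eta s be al lam a2 y2 y1 g2 h k e tau) ->
  positive_weak_solution Om p q eta nu a1 a2 k1 k2 lam y1 y2.
Proof.
move=> Wy1 Wy2 y10 y20 st1 st2.
have T1 := @stationary_gt0 R n Om p q r rho M eta oOm Orho p1 pq qr meta eta0 etaM s al be N lam a1 y1 y2 g1
  s0 s1 al1 be0 alb lam0 ba1 pos1 Wy1 y10 (mW Wy2) (fW Wy2) st1.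
have T2 := @stationary_gt0 R n Om p q r rho M eta oOm Orho p1 pq qr meta eta0 etaM s be al N lam a2 y2 y1 g2
  s0 s1 be1 al0 bal lam0 ba2 pos2 Wy2 y20 (mW Wy1) (fW Wy1) st2.
split; [exact: to_W01H Wy1|exact: to_W01H Wy2|exact: T1|exact: T2|].
move=> h w /of_W01H Wh /of_W01H Ww.
have I1 := @stationary_singular_integrable R n Om p q r rho M eta oOm Orho p1 pq qr meta eta0 etaM s al be N lam a1 y1 y2 g1
  s0 s1 al1 be0 alb lam0 ba1 pos1 Wy1 y10 (mW Wy2) (fW Wy2) st1 _ _ Wh.
have I2 := @stationary_singular_integrable R n Om p q r rho M eta oOm Orho p1 pq qr meta eta0 etaM s be al N lam a2 y2 y1 g2
  s0 s1 be1 al0 bal lam0 ba2 pos2 Wy2 y20 (mW Wy1) (fW Wy1) st2 _ _ Ww.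
have E1 := @euler_lagrange R n Om p q r rho M eta oOm Orho p1 pq qr meta eta0 etaM s al be N lam a1 y1 y2 g1
  s0 s1 al1 be0 alb lam0 ba1 pos1 Wy1 y10 (mW Wy2) (fW Wy2) st1 _ _ Wh.
have E2 := @euler_lagrange R n Om p q r rho M eta oOm Orho p1 pq qr meta eta0 etaM s be al N lam a2 y2 y1 g2
  s0 s1 be1 al0 bal lam0 ba2 pos2 Wy2 y20 (mW Wy1) (fW Wy1) st2 _ _ Ww.
have pt (c y x : R) : c * (y `^ (s - 1) * x) = c * y `^ (- nu) * x by rewrite es mulrA.
split.
- by apply: eq_integrable I1; [exact: mOm|move=> z _; exact: (congr1 (@EFin R) (pt (a1 z) (y1 z) (h z)))].
- by apply: eq_integrable I2; [exact: mOm|move=> z _; exact: (congr1 (@EFin R) (pt (a2 z) (y2 z) (w z)))].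
have S1 : \int[mu]_(z in (Om : set (lebT R n))) (a1 z * y1 z `^ (- nu) * h z) =
    \int[mu]_(z in (Om : set (lebT R n))) (a1 z * (y1 z `^ (s - 1) * h z)).
  by apply: eq_Rintegral => z _; rewrite pt.
have S2 : \int[mu]_(z in (Om : set (lebT R n))) (a2 z * y2 z `^ (- nu) * w z) =
    \int[mu]_(z in (Om : set (lebT R n))) (a2 z * (y2 z `^ (s - 1) * w z)).
  by apply: eq_Rintegral => z _; rewrite pt.
have C1 : \int[mu]_(z in (Om : set (lebT R n))) (`|y1 z| `^ k1 * `|y2 z| `^ be * h z) =
    \int[mu]_(z in (Om : set (lebT R n))) (`|y1 z| `^ (al - 1) * `|y2 z| `^ be * h z).
  by apply: eq_Rintegral => z _; rewrite ek1.
have C2 : \int[mu]_(z in (Om : set (lebT R n))) (`|y1 z| `^ al * `|y2 z| `^ k2 * w z) =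
    \int[mu]_(z in (Om : set (lebT R n))) (`|y2 z| `^ (be - 1) * `|y1 z| `^ al * w z).
  by apply: eq_Rintegral => z _; rewrite ek2; congr (_ * _); exact: mulrC.
exact: (assemble (double_phaseE Wy1 Wh) (double_phaseE Wy2 Ww) S1 S2 C1 C2 E1 E2).
Qed.

Let fAnn j : 0 <= fine (GA j). Proof. exact: GA_fine_ge0. Qed.
Let fBnn j : 0 <= fine (GB j). Proof. exact: (GB_fine_ge0 q eta0). Qed.

Let swap_sum (x1 x2 y1 y2 : R) : (x1 + x2) / p + (y1 + y2) / q = (x2 + x1) / p + (y2 + y1) / q.
Proof. by rewrite (addrC x1) (addrC y1). Qed.

Let swap_lt (x1 x2 y1 y2 b : R) : (x1 + x2) / p + (y1 + y2) / q < b -> (x2 + x1) / p + (y2 + y1) / q < b.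
Proof. by rewrite swap_sum. Qed.

Let swap_le (x1 x2 y1 y2 b : R) : (x1 + x2) / p + (y1 + y2) / q <= b -> (x2 + x1) / p + (y2 + y1) / q <= b.
Proof. by rewrite swap_sum. Qed.

Let swap_energy (x1 x2 y1 y2 z1 z2 c c' : R) : c = c' -> (x1 + x2) / p + (y1 + y2) / q - (z1 + z2) / s - lam * c =
  (x2 + x1) / p + (y2 + y1) / q - (z2 + z1) / s - lam * c'.
Proof. by move=> ->; rewrite swap_sum (addrC z1). Qed.

Let swap_fibre (x1 x2 y1 y2 z1 z2 c c' t : R) : c = c' ->
  fibre p q s r ((x1 + x2) / p) ((y1 + y2) / q) ((z1 + z2) / s) (lam * c) t =
  fibre p q s r ((x2 + x1) / p) ((y2 + y1) / q) ((z2 + z1) / s) (lam * c') t.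
Proof. by move=> ->; rewrite (addrC x1) (addrC y1) (addrC z1). Qed.

Let le_eq2 (x1 x2 y1 y2 : R) : x1 = y1 -> x2 = y2 -> x1 <= x2 -> y1 <= y2. Proof. by move=> -> ->. Qed.

Lemma minimiser_solution y1 g1 y2 g2 b : W y1 g1 -> W y2 g2 -> (forall z, 0 <= y1 z) -> (forall z, 0 <= y2 z) ->
  (fine (GA g1) + fine (GA g2)) / p + (fine (GB g1) + fine (GB g2)) / q < b ->
  (forall u1 j1 u2 j2, W u1 j1 -> W u2 j2 -> (fine (GA j1) + fine (GA j2)) / p + (fine (GB j1) + fine (GB j2)) / q <= b ->
    (fine (GA g1) + fine (GA g2)) / p + (fine (GB g1) + fine (GB g2)) / q - (SS a1 y1 + SS a2 y2) / s - lam * CC al be y1 y2 <=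
    (fine (GA j1) + fine (GA j2)) / p + (fine (GB j1) + fine (GB j2)) / q - (SS a1 u1 + SS a2 u2) / s - lam * CC al be u1 u2) ->
  positive_weak_solution Om p q eta nu a1 a2 k1 k2 lam y1 y2.
Proof.
move=> Wy1 Wy2 y10 y20 Fb H; apply: (stationary_solution Wy1 Wy2 y10 y20).
  apply: (@local_min_stationary R n Om p q r rho M eta oOm Orho p1 pq qr meta eta0 etaM s al be N lam a1 y1 y2 g1
    (fine (GA g2)) (fine (GB g2)) (SS a2 y2) s0 s1 al0 be0 alb ba1 Wy1 (mW Wy2) (fW Wy2) b Fb).
  by move=> u j Wu; exact: H Wu Wy2.
(* Second component: the roles are exchanged, and the [swap] lemmas reorder the sums to match the
   hypothesis. *)
apply: (@local_min_stationary R n Om p q r rho M eta oOm Orho p1 pq qr meta eta0 etaM s be al N lam a2 y2 y1 g2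
  (fine (GA g1)) (fine (GB g1)) (SS a1 y1) s0 s1 be0 al0 bal ba2 Wy2 (mW Wy1) (fW Wy1) b (swap_lt Fb)).
move=> u j Wu Hb.
exact: (le_eq2 (swap_energy _ _ _ _ _ _ (coupling_comm _ _)) (swap_energy _ _ _ _ _ _ (coupling_comm _ _)) (H _ _ _ _ Wy1 Wu (swap_le Hb))).
Qed.

Lemma ray_solution y1 g1 y2 g2 b : W y1 g1 -> W y2 g2 -> (forall z, 0 <= y1 z) -> (forall z, 0 <= y2 z) ->
  0 < CC al be y1 y2 -> 0 < b ->
  (fine (GA g1) + fine (GA g2)) / p + (fine (GB g1) + fine (GB g2)) / q - (SS a1 y1 + SS a2 y2) / s - lam * CC al be y1 y2 = b ->
  (forall t, 0 <= t -> fibre p q s r ((fine (GA g1) + fine (GA g2)) / p)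
     ((fine (GB g1) + fine (GB g2)) / q) ((SS a1 y1 + SS a2 y2) / s) (lam * CC al be y1 y2) t <= b) ->
  (forall u1 j1 u2 j2, W u1 j1 -> W u2 j2 -> 0 < CC al be u1 u2 -> exists2 t, 0 <= t & b <=
    fibre p q s r ((fine (GA j1) + fine (GA j2)) / p) ((fine (GB j1) + fine (GB j2)) / q)
      ((SS a1 u1 + SS a2 u2) / s) (lam * CC al be u1 u2) t) ->
  positive_weak_solution Om p q eta nu a1 a2 k1 k2 lam y1 y2.
Proof.
move=> Wy1 Wy2 y10 y20 Cy b0 Jb fb H; apply: (stationary_solution Wy1 Wy2 y10 y20).
  apply: (@ray_max_stationary R n Om p q r rho M eta oOm Orho p1 pq qr meta eta0 etaM s al be N lam a1 y1 y2 g1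
    (fine (GA g2)) (fine (GB g2)) (SS a2 y2) s0 s1 al0 be0 alb lam0 ba1 Wy1 (mW Wy2) (fW Wy2)
    (fAnn _) (fBnn _) (singular_ge0 _ _ ba2) b Cy b0 Jb fb).
  by move=> u j Wu; exact: H Wu Wy2.
have Cy' : 0 < CC be al y2 y1 := eq_ind _ (fun x => 0 < x) Cy _ (coupling_comm _ _).
apply: (@ray_max_stationary R n Om p q r rho M eta oOm Orho p1 pq qr meta eta0 etaM s be al N lam a2 y2 y1 g2
  (fine (GA g1)) (fine (GB g1)) (SS a1 y1) s0 s1 be0 al0 bal lam0 ba2 Wy2 (mW Wy1) (fW Wy1)
  (fAnn _) (fBnn _) (singular_ge0 _ _ ba1) b Cy' b0).
- exact: (eq_trans (esym (swap_energy _ _ _ _ _ _ (coupling_comm y1 y2))) Jb).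
- by move=> t t0; exact: (le_eq2 (swap_fibre _ _ _ _ _ _ t (coupling_comm y1 y2)) erefl (fb t t0)).
move=> u j Wu Cu; have Cu' : 0 < CC al be y1 u := eq_ind _ (fun x => 0 < x) Cu _ (esym (coupling_comm _ _)).
have [t t0 h] := H _ _ _ _ Wy1 Wu Cu'; exists t; first exact: t0.
exact: (le_eq2 erefl (swap_fibre _ _ _ _ _ _ t (coupling_comm y1 u)) h).
Qed.

End weak_solutions.

(** * Passing to truncated weights, and the final assembly *)

Section weights_ae.
Context {R : realType} {n : nat} (Om : set 'rV[R]_n) (p q nu k1 k2 lam : R) (eta a1 a2 b1 b2 : 'rV[R]_n -> R).
Notation mu := (@leb R n).
Hypotheses (mOm : measurable (Om : set (lebT R n)))
  (ma1 : leb_measurable_fun Om a1) (ma2 : leb_measurable_fun Om a2)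
  (mb1 : leb_measurable_fun Om b1) (mb2 : leb_measurable_fun Om b2)
  (ab1 : ae_on Om (fun z => a1 z = b1 z)) (ab2 : ae_on Om (fun z => a2 z = b2 z)).

Let m3 (a y h : 'rV[R]_n -> R) : leb_measurable_fun Om a -> leb_measurable_fun Om y -> leb_measurable_fun Om h ->
  leb_measurable_fun Om (fun z => a z * y z `^ (- nu) * h z).
Proof.
move=> ma my mh; apply: measurable_funM; last exact: mh.
by apply: measurable_funM; [exact: ma|exact: (measurableT_comp (@measurable_powR R (- nu)) my)].
Qed.

Let ae3 (a b y h : 'rV[R]_n -> R) : ae_on Om (fun z => a z = b z) ->
  ae_on Om (fun z => a z * y z `^ (- nu) * h z = b z * y z `^ (- nu) * h z).
Proof.
move=> ab; have ae1 : {ae mu, forall z : lebT R n, Om z -> a z = b z} := ab.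
by apply: filterS ae1 => z H Oz; rewrite H.
Qed.

Lemma positive_weak_solution_ae y1 y2 : positive_weak_solution Om p q eta nu b1 b2 k1 k2 lam y1 y2 ->
  positive_weak_solution Om p q eta nu a1 a2 k1 k2 lam y1 y2.
Proof.
move=> [w1 w2 pos1 pos2 H]; split => // h w Hh Hw; have [I1 I2 E] := H h w Hh Hw.
have my1 : leb_measurable_fun Om y1 by have [[[]]] := w1.
have my2 : leb_measurable_fun Om y2 by have [[[]]] := w2.
have mh : leb_measurable_fun Om h by have [[[]]] := Hh.
have mw : leb_measurable_fun Om w by have [[[]]] := Hw.
have E1 := Rintegral_ae mOm (m3 ma1 my1 mh) (m3 mb1 my1 mh) (ae3 y1 h ab1).
have E2 := Rintegral_ae mOm (m3 ma2 my2 mw) (m3 mb2 my2 mw) (ae3 y2 w ab2).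
split.
- exact: (integrable_ae mOm (m3 ma1 my1 mh) (ae3 y1 h ab1) I1).
- exact: (integrable_ae mOm (m3 ma2 my2 mw) (ae3 y2 w ab2) I2).
by rewrite E1 E2.
Qed.

Lemma energy_ae y1 y2 : leb_measurable_fun Om y1 -> leb_measurable_fun Om y2 ->
  energy Om p q eta nu a1 a2 k1 k2 lam y1 y2 = energy Om p q eta nu b1 b2 k1 k2 lam y1 y2.
Proof.
move=> my1 my2.
have mm (c1 c2 : 'rV[R]_n -> R) : leb_measurable_fun Om c1 -> leb_measurable_fun Om c2 ->
    leb_measurable_fun Om (fun z => c1 z * `|y1 z| `^ (1 - nu) + c2 z * `|y2 z| `^ (1 - nu)).
  move=> h1 h2; apply: measurable_funD; apply: measurable_funM; [exact: h1| |exact: h2|].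
    exact: measurable_norm_powR my1.
  exact: measurable_norm_powR my2.
have E := Rintegral_ae mOm (mm _ _ ma1 ma2) (mm _ _ mb1 mb2) (_ : ae_on Om _).
rewrite /energy E//.
have ae1 : {ae mu, forall z : lebT R n, Om z -> a1 z = b1 z} := ab1.
have ae2 : {ae mu, forall z : lebT R n, Om z -> a2 z = b2 z} := ab2.
by apply: filterS2 ae1 ae2 => z H1 H2 Oz; rewrite H1// H2.
Qed.

End weights_ae.

(** Puts [r] below the critical exponent in the division-free form used by the Sobolev estimates. *)
Lemma critical_exponent_bound (R : realType) (N p r : R) : p < N -> r < N * p / (N - p) -> N * (r - p) < p * r.
Proof. by move=> pN; rewrite ltr_pdivlMr ?subr_gt0//; lra. Qed.

(** A representative of the weight with [bounded_weight] holding at every point; it agrees almost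
    everywhere with a positive weight essentially bounded by [N]. *)
Definition truncate_weight {R : realType} {n : nat} (N : R) (a : 'rV[R]_n -> R) z := Num.max 0 (Num.min (a z) N).

Lemma truncate_weightP {R : realType} {n : nat} (Om : set 'rV[R]_n) (N N' : R) (a : 'rV[R]_n -> R) : 0 <= N -> N' <= N ->
  leb_measurable_fun Om a -> ae_on Om (fun z => `|a z| <= N') -> ae_on Om (fun z => 0 < a z) ->
  bounded_weight Om N (truncate_weight N a) /\ ae_on Om (fun z => a z = truncate_weight N a z).
Proof.
move=> N0 NN ma aN a0; split.
  split.
    have m1 : measurable_fun (Om : set (lebT R n)) ((fun=> 0) : lebT R n -> R) by exact: measurable_cst.
    have m2 : measurable_fun (Om : set (lebT R n)) ((fun=> N) : lebT R n -> R) by exact: measurable_cst.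
    exact: (measurable_maxr m1 (measurable_minr ma m2)).
  by move=> z _; rewrite /truncate_weight le_max lexx/= ge_max N0/= ge_min lexx orbT.
have h1 : {ae @leb R n, forall z : lebT R n, Om z -> `|a z| <= N'} := aN.
have h2 : {ae @leb R n, forall z : lebT R n, Om z -> 0 < a z} := a0.
apply: filterS2 h1 h2 => z H1 H2 Oz; rewrite /truncate_weight.
have aN' : a z <= N by apply: le_trans (ler_norm _) (le_trans (H1 Oz) NN).
by rewrite (min_idPl aN') (max_idPr (ltW (H2 Oz))).
Qed.

Theorem theorem3p2 (R : realType) (n : nat) (hn : (2 <= n)%N)
    (Om : set 'rV[R]_n)
    (Om_domain : is_domain Om) (Om_bounded : bounded_set Om)
    (Om_lipschitz : lipschitz_boundary Om)
    (p q nu k1 k2 : R)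
    (hp : 1 < p) (hpn : p < n%:R)
    (hnu0 : 0 < nu) (hnu1 : nu < 1) (hpq : p < q)
    (hqk1 : q < k1 + 1) (hk1 : k1 + 1 < critical_exponent n p)
    (hqk2 : q < k2 + 1) (hk2 : k2 + 1 < critical_exponent n p)
    (hk12 : k1 + k2 + 2 < critical_exponent n p)
    (eta a1 a2 : 'rV[R]_n -> R)
    (eta_ge0 : forall z, closure Om z -> 0 <= eta z)
    (eta_Linfty : Linfty Om eta)
    (a1_Linfty : Linfty Om a1) (a2_Linfty : Linfty Om a2)
    (a1_gt0 : ae_on Om (fun z => 0 < a1 z))
    (a2_gt0 : ae_on Om (fun z => 0 < a2 z)) :
  exists2 lambda_star : R, 0 < lambda_star &
    forall lam : R, 0 < lam -> lam < lambda_star ->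
    exists y1 y2 v1 v2 : 'rV[R]_n -> R,
      [/\ positive_weak_solution Om p q eta nu a1 a2 k1 k2 lam y1 y2,
          positive_weak_solution Om p q eta nu a1 a2 k1 k2 lam v1 v2,
          energy Om p q eta nu a1 a2 k1 k2 lam y1 y2 < 0 &
          0 < energy Om p q eta nu a1 a2 k1 k2 lam v1 v2].
Proof.
have [oOm _ Om0] := Om_domain; have n0 : (0 < n)%N by exact: leq_trans hn.
have [rho rho0 Orho] := bounded_sub_cball Om_bounded.
have mOm : measurable (Om : set (lebT R n)) by exact: open_leb_measurable.
have eta0 z : Om z -> 0 <= eta z by move=> Oz; apply: eta_ge0; exact: subset_closure.
have [meta [M etaA]] := eta_Linfty.
have etaM : ae_on Om (fun z => eta z <= M).
  have h1 : {ae @leb R n, forall z : lebT R n, Om z -> `|eta z| <= M} := etaA.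
  by apply: filterS h1 => z H1 Oz; exact: le_trans (ler_norm _) (H1 Oz).
have [ma1 [M1 aM1]] := a1_Linfty; have [ma2 [M2 aM2]] := a2_Linfty.
(* A common bound for both weights, made nonnegative because the constants of [Linfty] may be any
   reals. *)
pose N : R := Num.max 0 (Num.max M1 M2).
have N0 : 0 <= N by rewrite le_max lexx.
have N1 : M1 <= N by rewrite !le_max lexx orbT.
have N2 : M2 <= N by rewrite !le_max lexx !orbT.
have [B1 E1] := truncate_weightP N0 N1 ma1 aM1 a1_gt0.
have [B2 E2] := truncate_weightP N0 N2 ma2 aM2 a2_gt0.
set b1 := truncate_weight N a1 in B1 E1; set b2 := truncate_weight N a2 in B2 E2.
have pos (a b : 'rV[R]_n -> R) : ae_on Om (fun z => 0 < a z) -> ae_on Om (fun z => a z = b z) -> ae_on Om (fun z => 0 < b z).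
  move=> h1 h2; have h1' : {ae @leb R n, forall z : lebT R n, Om z -> 0 < a z} := h1.
  have h2' : {ae @leb R n, forall z : lebT R n, Om z -> a z = b z} := h2.
  by apply: filterS2 h1' h2' => z H1 H2 Oz; rewrite -H2//; exact: H1.
have pb1 := pos _ _ a1_gt0 E1; have pb2 := pos _ _ a2_gt0 E2.
have k10 : 0 < k1 by lra.
have k20 : 0 < k2 by lra.
have qr : q < k1 + k2 + 2 by lra.
have crit : n%:R * (k1 + k2 + 2 - p) < p * (k1 + k2 + 2) by exact: critical_exponent_bound hpn hk12.
have s0 : 0 < 1 - nu by lra.
have s1 : 1 - nu < 1 by lra.
have al0 : 0 < k1 + 1 by lra.
have be0 : 0 < k2 + 1 by lra.
have alb : k1 + 1 + (k2 + 1) = k1 + k2 + 2 by rewrite addrACA.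
have [ls ls0 H] := sob_pair_critical n0 oOm Om0 Orho rho0 hp hpq qr crit meta eta0 etaM s0 s1 al0 be0 alb B1 B2 pb1.
exists ls => // lam lam0 laml; have [[x [b [[nx1 nx2] Fx Jx Hx]]] [z [[nz1 nz2] Cz Jz fz Hz]]] := H lam lam0 laml.
have [Wx1 Wx2] := svalP x; have [Wz1 Wz2] := svalP z.
have meas u g : sob Om p q eta (k1 + k2 + 2) u g -> leb_measurable_fun Om u by case.
have Ex := @energyE R n Om p q rho M eta nu k1 k2 N lam b1 b2 n0 oOm Orho rho0 hp hpq qr crit meta eta0 etaM hnu0 hnu1 B1 B2 _ _ _ _ Wx1 Wx2.
have Ez := @energyE R n Om p q rho M eta nu k1 k2 N lam b1 b2 n0 oOm Orho rho0 hp hpq qr crit meta eta0 etaM hnu0 hnu1 B1 B2 _ _ _ _ Wz1 Wz2.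
have Ax := @energy_ae R n Om p q nu k1 k2 lam eta a1 a2 b1 b2 mOm ma1 ma2 B1.1 B2.1 E1 E2 _ _ (meas _ _ Wx1) (meas _ _ Wx2).
have Az := @energy_ae R n Om p q nu k1 k2 lam eta a1 a2 b1 b2 mOm ma1 ma2 B1.1 B2.1 E1 E2 _ _ (meas _ _ Wz1) (meas _ _ Wz2).
exists (sval x).1.1, (sval x).2.1, (sval z).1.1, (sval z).2.1; split.
(* Solutions are found for the truncated weights; changing the weights on a null set affects neither
   the equation nor the energy. *)
- apply: (@positive_weak_solution_ae R n Om p q nu k1 k2 lam eta a1 a2 b1 b2 mOm ma1 ma2 B1.1 B2.1 E1 E2).
  apply: (@minimiser_solution R n Om p q rho M eta nu k1 k2 N lam b1 b2 n0 oOm Orho rho0 hp hpq qr crit meta eta0 etaM hnu0 hnu1 k10 k20 lam0 B1 B2 pb1 pb2 _ _ _ _ b Wx1 Wx2 nx1 nx2 Fx).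
  by move=> u1 j1 u2 j2 W1 W2; exact: Hx (mk_pair W1 W2).
- apply: (@positive_weak_solution_ae R n Om p q nu k1 k2 lam eta a1 a2 b1 b2 mOm ma1 ma2 B1.1 B2.1 E1 E2).
  apply: (@ray_solution R n Om p q rho M eta nu k1 k2 N lam b1 b2 n0 oOm Orho rho0 hp hpq qr crit meta eta0 etaM hnu0 hnu1 k10 k20 lam0 B1 B2 pb1 pb2 _ _ _ _ _ Wz1 Wz2 nz1 nz2 Cz Jz erefl fz).
  by move=> u1 j1 u2 j2 W1 W2; exact: Hz (mk_pair W1 W2).
- by rewrite Ax Ex; exact: Jx.
by rewrite Az Ez; exact: Jz.
Qed.
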